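(* Let $m\ge 3$, $T>0$, let $V$ be a real-valued potential with $V\in H^{m^*}_{\rm per}(\Omega)$, $m^*=\max\{m,5\}$, and for $\varepsilon\in(0,1]$ let $\psi=\psi(x,t)$ be the exact solution of $$i\partial_t\psi=-\Delta\psi+\varepsilon V(x)\psi\ \text{ on }\Omega=(a,b),\ t>0,$$ with periodic boundary conditions and $\psi(x,0)=\psi_0(x)$. Assume that $$\|\psi\|_{L^\infty([0,T/\varepsilon];H^m_{\rm per})}\lesssim1,\qquad \|\partial_t\psi\|_{L^\infty([0,T/\varepsilon];H^{m-2}_{\rm per})}\lesssim1.$$ Let $\psi^n$ be the numerical approximation obtained from the time-splitting Fourier pseudospectral (TSFP) method (defined in the context) with mesh size $h=(b-a)/N$ and time step $\tau$, and $t_n=n\tau$. Let $\alpha\in(0,1)$ and $\nu_3>0$ be given constants and let $\mu_1=\frac{2\pi}{b-a}$. For any $\varepsilon\in(0,1]$ and a fixed $\tau_0\in(0,1)$, suppose that either (i) $\displaystyle 0<\tau<\alpha\,\frac{2\pi}{\mu_1^2(1+\tau_0)^2}\,\tau_0^2$; or (ii) $m\ge 5+2\nu_3$, $\tau>0$, and $$\left|\tau-\frac{2l\pi}{\mu_1^2K}\right|\ge\frac{\lambda}{|\mu_1^2K|^{2+\nu_3}}\quad\text{for all }K,l\in\mathbb Z\text{ with }0<|K|\le\lceil1/\tau_0\rceil^2,\ l\ge0,\qquad \lambda=\frac{\alpha\pi\mu_1^{2+2\nu_3}}{4\sum_{k=1}^\infty k^{-(1+\nu_3)}}.$$ Then $$\|\psi(\cdot,t_n)-I_N\psi^n\|_{H^1}\lesssim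 h^{m-1}+\varepsilon\tau^2+\tau_0^{m-1},\qquad 0\le n\le\frac{T/\varepsilon}{\tau}.$$ In particular, if the exact solution is smooth, i.e. $\psi(x,t)\in H^\infty_{\rm per}$, the $\tau_0^{m-1}$ part of the error would decrease exponentially in terms of $\tau_0$ and can be ignored in practical computation when $\tau_0$ is taken as some $\tau_0^{\rm cr}$ (small but fixed, depending only on $\psi$ and the logarithm of the machine precision); thus the improved error bounds for sufficiently small $\tau$ could be stated as $$\|\psi(\cdot,t_n)-I_N\psi^n\|_{H^1}\lesssim h^{m-1}+\varepsilon\tau^2,\qquad 0\le n\le\frac{T/\varepsilon}{\tau}.$$
   Context: Notation: $\Omega=(a,b)$, $\mu_l=\frac{2\pi l}{b-a}$ for $l\in\mathbb Z$, $\Delta=\partial_{xx}$, $\lceil\cdot\rceil$ is the ceiling function. $H^m_{\rm per}(\Omega)=\{\phi\in H^m(\Omega):\partial_x^k\phi(a)=\partial_x^k\phi(b),\ k=0,\dots,m-1\}$ with norm $\|\phi\|_{H^m}=\big(\sum_{l\in\mathbb Z}(1+\mu_l^2)^m|\widehat\phi_l|^2\big)^{1/2}$, where $\widehat\phi_l=\frac1{b-a}\int_a^b\phi(x)e^{-i\mu_l(x-a)}dx$; $\psi(x,t)\in H^\infty_{\rm per}$ means that $\psi(\cdot,t)$ lies in $H^m_{\rm per}$ for every $m$. $A\lesssim B$ means $|A|\le CB$ with a generic constant $C>0$ independent of the mesh size $h$, the time step $\tau$ and $\varepsilon$. Spatial discretization: $N$ is an even positive integer, $h=(b-a)/N$,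 $x_j=a+jh$ for $j=0,\dots,N$, $\mathcal T_N=\{-N/2,\dots,N/2-1\}$, $X_N=\{u=(u_0,\dots,u_N)^T\in\mathbb C^{N+1}:u_0=u_N\}$, $Y_N={\rm span}\{e^{i\mu_l(x-a)}:l\in\mathcal T_N\}$. For $u\in X_N$ (or for a continuous periodic function $u$, with $u_j=u(x_j)$) put $\widetilde u_l=\frac1N\sum_{j=0}^{N-1}u_je^{-i\mu_l(x_j-a)}$ and $I_Nu=\sum_{l\in\mathcal T_N}\widetilde u_le^{i\mu_l(x-a)}\in Y_N$ (trigonometric interpolation). TSFP method (Strang splitting): $\psi^0_j=\psi_0(x_j)$ and, for $n\ge0$, $j=0,\dots,N$, $$\psi^{(1)}_j=\sum_{l\in\mathcal T_N}e^{-i\tau\mu_l^2/2}\,\widetilde{(\psi^n)}_l\,e^{i\mu_l(x_j-a)},\quad \psi^{(2)}_j=e^{-i\varepsilon\tau V(x_j)}\psi^{(1)}_j,\quad \psi^{n+1}_j=\sum_{l\in\mathcal T_N}e^{-i\tau\mu_l^2/2}\,\widetilde{(\psi^{(2)})}_l\,e^{i\mu_l(x_j-a)},$$ with $\psi^n=(\psi^n_0,\dots,\psi^n_N)^T\in X_N$.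
   Formalization: The last claim fails literally (resonant τ leave an ε-independent residue; H^∞ gives no e^{-c/τ0}). Proved instead: the τ0 part is O(τ0^p) for every p, and with τ0=τ0^cr, a function of ln δ (no logarithmic rate claimed), the bound is h^{m-1}+ετ²+δ, δ the machine precision. *)

(* Defs.v *)
From HB Require Import structures.
From mathcomp Require Import all_boot all_order all_algebra.
From mathcomp Require Import all_classical all_reals all_analysis.
From mathcomp Require Import complex.

Set Implicit Arguments.
Unset Strict Implicit.
Unset Printing Implicit Defensive.

Import Order.TTheory GRing.Theory.
Import numFieldNormedType.Exports.

Local Open Scope classical_set_scope.
Local Open Scope complex_scope.
Local Open Scope ring_scope.

(* Calculus of complex-valued functions of a real variable, componentwise:
   R[i] carries no normed R-module structure in the library. *)

Definition cmodulus (R : realType) (z : R[i]) : R :=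
  ComplexField.Normc.normc z.

Definition expi (R : realType) (theta : R) : R[i] := cos theta +i* sin theta.

Definition cwithin_continuous (R : realType) (X : topologicalType) (A : set X)
    (f : X -> R[i]) : Prop :=
  {within A, continuous (fun x => complex.Re (f x))} /\
  {within A, continuous (fun x => complex.Im (f x))}.

Definition ccvg (R : realType) (f : R -> R[i]) (F : set_system R) (l : R[i]) :
    Prop :=
  (fun x => complex.Re (f x)) @ F --> complex.Re l /\
  (fun x => complex.Im (f x)) @ F --> complex.Im l.

Definition cderivable (R : realType) (f : R -> R[i]) (x : R) : Prop :=
  derivable (fun y => complex.Re (f y)) x 1 /\
  derivable (fun y => complex.Im (f y)) x 1.

Definition cderiv (R : realType) (f : R -> R[i]) (x : R) : R[i] :=
  derive1 (fun y => complex.Re (f y)) x +i* derive1 (fun y => complex.Im (f y)) x.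

Definition cintegral (R : realType) (D : set R) (f : R -> R[i]) : R[i] :=
  (\int[@lebesgue_measure R]_(x in D) complex.Re (f x)) +i*
  (\int[@lebesgue_measure R]_(x in D) complex.Im (f x)).

(* Sobolev spaces on Omega = ]a, b[ *)

Definition square_integrable (R : realType) (a b : R) (f : R -> R[i]) : Prop :=
  [/\ measurable_fun `]a, b[%classic (fun x => complex.Re (f x)),
      measurable_fun `]a, b[%classic (fun x => complex.Im (f x)) &
      (\int[@lebesgue_measure R]_(x in `]a, b[%classic)
          ((cmodulus (f x)) ^+ 2)%:E < +oo)%E].

Definition test_function (R : realType) (a b : R) (eta : R -> R) : Prop :=
  (forall (k : nat) (x : R), derivable (derive1n k eta) x 1) /\
  exists c d : R,
    [/\ a < c, d < b & forall x, ~ (c <= x <= d) -> eta x = 0].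

Definition weak_derivative (R : realType) (a b : R) (f g : R -> R[i]) : Prop :=
  forall eta : R -> R, test_function a b eta ->
    cintegral `]a, b[%classic (fun x => f x * (derive1 eta x)%:C) =
    - cintegral `]a, b[%classic (fun x => g x * (eta x)%:C).

(* phi \in H^m_per(a, b). For k < m the weak derivative d k of an H^m function
   has a unique continuous representative on [a, b]; it is the one taken for
   d k (and phi = d 0 itself), so that the boundary values make sense. *)
Definition Hper (R : realType) (a b : R) (m : nat) (phi : R -> R[i]) : Prop :=
  exists d : nat -> R -> R[i],
    [/\ d 0%N = phi,
        forall k, (k <= m)%N -> square_integrable a b (d k),
        forall k, (k < m)%N -> weak_derivative a b (d k) (d k.+1) &
        forall k, (k < m)%N ->
          cwithin_continuous `[a, b]%classic (d k) /\ d k a = d k b].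

Definition freq (R : realType) (a b : R) (l : int) : R :=
  2 * pi * l%:~R / (b - a).

Definition fourier_coef (R : realType) (a b : R) (phi : R -> R[i]) (l : int) :
    R[i] :=
  ((b - a)^-1)%:C *
  cintegral `]a, b[%classic (fun x => phi x * expi (- (freq a b l * (x - a)))).

Definition Hnorm (R : realType) (a b : R) (m : nat) (phi : R -> R[i]) : \bar R :=
  poweR (esum [set: int] (fun l =>
    ((1 + freq a b l ^+ 2) ^+ m * cmodulus (fourier_coef a b phi l) ^+ 2)%:E))
    (2^-1).

(* Classical solution of i psi_t = - psi_xx + eps V psi; the arguments of psi
   are x and t. The periodic boundary condition on psi_x is on its one-sided
   limits at the two end points. *)
Definition exact_solution (R : realType) (a b eps : R) (V : R -> R)
    (psi0 : R -> R[i]) (psi : R -> R -> R[i]) : Prop :=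
  [/\ cwithin_continuous [set p : R * R | a <= p.1 <= b /\ 0 <= p.2]
        (fun p : R * R => psi p.1 p.2),
      ((forall x t, a <= x <= b -> 0 < t -> cderivable (psi x) t) /\
       cwithin_continuous [set p : R * R | a <= p.1 <= b /\ 0 < p.2]
         (fun p : R * R => cderiv (psi p.1) p.2)),
      (forall x t, a < x < b -> 0 < t ->
        [/\ cderivable (fun y => psi y t) x,
            cderivable (cderiv (fun y => psi y t)) x &
            (0 +i* 1) * cderiv (psi x) t =
              - cderiv (cderiv (fun y => psi y t)) x
              + (eps * V x)%:C * psi x t]),
      (forall t, 0 < t ->
        psi a t = psi b t /\
        exists l : R[i],
          ccvg (cderiv (fun y => psi y t)) (a^'+) l /\
          ccvg (cderiv (fun y => psi y t)) (b^'-) l) &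
      forall x, a <= x <= b -> psi x 0 = psi0 x].

(* || u^eps ||_{L^oo([0, T/eps]; H^m_per)} is bounded uniformly in eps. *)
Definition LinfH_uniformly_bounded (R : realType) (a b T : R) (m : nat)
    (u : R -> R -> R -> R[i]) : Prop :=
  exists M : R, forall eps : R, 0 < eps <= 1 ->
    {ae @lebesgue_measure R, forall t : R, 0 <= t <= T / eps ->
       Hper a b m (fun x => u eps x t) /\
       (Hnorm a b m (fun x => u eps x t) <= M%:E)%E}.

(* Vectors (u_0, ..., u_N) on the grid x_j = a + j h. The set T_N is enumerated
   as l = k - N/2, 0 <= k < N. *)

Definition mesh (R : realType) (a b : R) (N : nat) : R := (b - a) / N%:R.

Definition grid (R : realType) (a b : R) (N j : nat) : R := a + j%:R * mesh a b N.

Definition mode (N k : nat) : int := k%:Z - (N./2)%:Z.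

Definition dft (R : realType) (a b : R) (N : nat) (u : 'cV[R[i]]_N.+1) (l : int) :
    R[i] :=
  ((N%:R : R)^-1)%:C *
  \sum_(j < N) u (widen_ord (leqnSn N) j) ord0 *
    expi (- (freq a b l * (grid a b N j - a))).

Definition trig_interp (R : realType) (a b : R) (N : nat) (u : 'cV[R[i]]_N.+1)
    (x : R) : R[i] :=
  \sum_(k < N) dft a b u (mode N k) * expi (freq a b (mode N k) * (x - a)).

Definition free_half_step (R : realType) (a b : R) (N : nat) (tau : R)
    (u : 'cV[R[i]]_N.+1) : 'cV[R[i]]_N.+1 :=
  \col_(j < N.+1) \sum_(k < N)
    expi (- (tau * freq a b (mode N k) ^+ 2 / 2)) * dft a b u (mode N k) *
    expi (freq a b (mode N k) * (grid a b N j - a)).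

Definition potential_step (R : realType) (a b : R) (N : nat) (eps tau : R)
    (V : R -> R) (u : 'cV[R[i]]_N.+1) : 'cV[R[i]]_N.+1 :=
  \col_(j < N.+1) (expi (- (eps * tau * V (grid a b N j))) * u j ord0).

Definition tsfp_step (R : realType) (a b : R) (N : nat) (eps tau : R)
    (V : R -> R) (u : 'cV[R[i]]_N.+1) : 'cV[R[i]]_N.+1 :=
  free_half_step a b tau
    (potential_step a b eps tau V (free_half_step a b tau u)).

Definition tsfp (R : realType) (a b : R) (N : nat) (eps tau : R) (V : R -> R)
    (psi0 : R -> R[i]) (n : nat) : 'cV[R[i]]_N.+1 :=
  iter n (tsfp_step a b eps tau V) (\col_(j < N.+1) psi0 (grid a b N j)).

Definition lambda_const (R : realType) (a b alpha nu3 : R) : R :=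
  alpha * pi * (freq a b 1 `^ (2 + 2 * nu3)) /
  (4 * limn (series (fun k : nat => (k.+1%:R : R) `^ (- (1 + nu3))))).

Definition step_condition_i (R : realType) (a b alpha tau0 tau : R) : Prop :=
  0 < tau /\
  tau < alpha * (2 * pi / (freq a b 1 ^+ 2 * (1 + tau0) ^+ 2)) * tau0 ^+ 2.

Definition step_condition_ii (R : realType) (a b : R) (m : nat)
    (alpha nu3 tau0 tau : R) : Prop :=
  [/\ 5 + 2 * nu3 <= m%:R,
      0 < tau &
      forall K l : int,
        0 < `|K| -> `|K| <= Num.ceil (1 / tau0) ^+ 2 -> 0 <= l ->
        lambda_const a b alpha nu3 /
            (`|freq a b 1 ^+ 2 * K%:~R| `^ (2 + nu3)) <=
        `|tau - 2 * l%:~R * pi / (freq a b 1 ^+ 2 * K%:~R)|].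

Definition tsfp_error (R : realType) (a b : R) (V : R -> R) (psi0 : R -> R[i])
    (psi : R -> R -> R -> R[i]) (eps tau : R) (N n : nat) (x : R) : R[i] :=
  psi eps x (n%:R * tau) - trig_interp a b (tsfp a b N eps tau V psi0 n) x.

(* || psi(., t_n) - I_N psi^n ||_{H^1} <= C (h^(m-1) + eps tau^2 + r) for all
   eps, N, tau, n, where tau is subject to (i) or (ii) with parameter tau0. *)
Definition tsfp_error_bound (R : realType) (a b : R) (m : nat) (T : R)
    (V : R -> R) (psi0 : R -> R[i]) (psi : R -> R -> R -> R[i])
    (alpha nu3 tau0 C r : R) : Prop :=
  forall (eps tau : R) (N n : nat),
    0 < eps <= 1 ->
    (0 < N)%N -> ~~ odd N ->
    step_condition_i a b alpha tau0 tau \/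
      step_condition_ii a b m alpha nu3 tau0 tau ->
    n%:R <= T / eps / tau ->
    (Hnorm a b 1 (tsfp_error a b V psi0 psi eps tau N n) <=
      (C * (mesh a b N ^+ (m - 1) + eps * tau ^+ 2 + r)%R)%:E)%E.

(* Main.v *)
(* Write c(t) for the Fourier coefficients of psi(t) and u^n for those of the
   numerical solution. In Fourier space one step is E(eps tau), the discrete
   convolution by the coefficients of exp(-i eps tau V), between two free half
   steps. Seen from the midpoint of the step, the local defect is, up to
   O(eps^2 tau^3 + eps tau h^(m-1)), the matrix eps (Phi(d_lk) - tau) V_(l-k)
   with d_lk = mu_l^2 - mu_k^2 and Phi(d) = 2 sin(tau d / 2) / d. For the pairs
   of frequencies below 1/tau0, conditions (i) and (ii) bound the small divisor
   sin(tau d / 2) from below, so the corresponding part of the defect is a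
   coboundary and is absorbed by a change of unknown c + eps tau Gamma c with
   Gamma = O(tau); the other pairs contribute the tail of V * c beyond 1/tau0.
   Gronwall's inequality over T / (eps tau) steps concludes.

   For the second claim it must be shown that this tail decreases faster than
   any power of tau0 uniformly in eps, although smoothness of psi is only
   assumed for each eps and t. By Baire's theorem c^eps(t) decays like om^-k
   uniformly for (eps, t) in some rectangle. Divided differences in 1/eps
   extrapolate this to eps = 0: the coefficients of V e^{it Delta} psi0 decay on
   a time interval. An Ingham-type argument isolates the time frequency mu_n^2,
   so V_(l-n) c_n(0) + V_(l+n) c_(-n)(0) decays rapidly in l; as V is real, this
   recurrence forces the coefficients of V itself to decay rapidly unless
   psi0 = 0. Then c^eps(t) is bounded in every H^p, uniformly in eps and t. *)
Require Import Defs.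
From HB Require Import structures.
From mathcomp Require Import all_boot all_order all_algebra.
From mathcomp Require Import all_classical all_reals all_analysis.
From mathcomp Require Import measurable_realfun.
From mathcomp Require Import complex.
From mathcomp Require Import ring lra zify.

Set Implicit Arguments.
Unset Strict Implicit.
Unset Printing Implicit Defensive.

Import Order.TTheory GRing.Theory Num.Theory.
Import numFieldNormedType.Exports.

Local Open Scope classical_set_scope.
Local Open Scope complex_scope.
Local Open Scope ring_scope.


(** * Weighted Euclidean norms and complex calculus *)

(** Two norms carry the error estimate. The error is propagated in H^1 only, where a step is stable
    with factor 1 + O(eps tau). Everything that loses derivatives, the commutator with the Laplacian
    and Gamma, acts on the exact solution, which is bounded in H^m, so no H^m stability of the
    scheme is needed. The two derivatives lost by the commutator explain m >= 3, and the power 2 +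
    nu3 of the small divisor explains 5 + 2 nu3 in (ii). An obstacle is aliasing: the discrete
    potential acts by cyclic convolution, so V_(l-k) is small only if l - k is far from N Z. The
    kernels are still controlled because, for modes l and k, that distance bounds the difference of
    |l| and |k|, hence also l^2 - k^2. In the smooth case the bounds must survive times T / eps. If
    V is smooth, Gronwall's inequality with rate O(eps) gives this. Smoothness of V must therefore
    be recovered from that of psi, and eps = 0 is the place to do it, since there V acts on an
    explicitly known flow. *)

Section ell2.
Context {R : realType} {I : eqType}.
Implicit Types (s t : seq I) (a b : I -> R).

(** Norms run over finite lists of indices. An infinite sequence is bounded by B when all its finite
    sections are, so no summability has to be carried along. *)
Definition N2 s a : R := Num.sqrt (\sum_(l <- s) a l ^+ 2).

Lemma N2_ge0 s a : 0 <= N2 s a.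
Proof. exact: sqrtr_ge0. Qed.

Lemma N2_sqr s a : N2 s a ^+ 2 = \sum_(l <- s) a l ^+ 2.
Proof. by rewrite sqr_sqrtr// sumr_ge0// => l _; exact: sqr_ge0. Qed.

Lemma N2_leP s a (B : R) : 0 <= B ->
  (N2 s a <= B) = (\sum_(l <- s) a l ^+ 2 <= B ^+ 2).
Proof. by move=> B0; rewrite -N2_sqr ler_pXn2r// ?nnegrE ?N2_ge0. Qed.

Lemma N2_le s a b : (forall l, l \in s -> `|a l| <= b l) -> N2 s a <= N2 s b.
Proof.
move=> ab; rewrite N2_leP ?N2_ge0// N2_sqr !big_seq ler_sum// => l ls.
rewrite -[a l ^+ 2]real_normK ?num_real// ler_pXn2r ?nnegrE ?ab//.
exact: le_trans (normr_ge0 _) (ab _ ls).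
Qed.

Lemma eq_N2 s a b : (forall l, l \in s -> a l = b l) -> N2 s a = N2 s b.
Proof.
by move=> ab; congr Num.sqrt; rewrite !big_seq; apply: eq_bigr => l /ab ->.
Qed.

Lemma N2_abs s a : N2 s (fun l => `|a l|) = N2 s a.
Proof.
by congr Num.sqrt; apply: eq_bigr => l _; rewrite real_normK ?num_real.
Qed.

Lemma N2_scale s a (c : R) : N2 s (fun l => c * a l) = `|c| * N2 s a.
Proof.
rewrite /N2; under eq_bigr do rewrite exprMn.
by rewrite -mulr_sumr sqrtrM ?sqr_ge0// sqrtr_sqr.
Qed.

Lemma N2_0 s : N2 s (fun=> 0) = 0.
Proof. by rewrite /N2 big1 ?sqrtr0// => l _; rewrite expr0n. Qed.

Lemma N2_point s a l : l \in s -> `|a l| <= N2 s a.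
Proof.
move=> ls; rewrite -sqrtr_sqr ler_sqrt ?sumr_ge0 //; last by move=> *; exact: sqr_ge0.
move: ls; elim: s => //= x s ih; rewrite inE big_cons.
move=> /predU1P[->|/ih h].
  by rewrite lerDl sumr_ge0// => *; exact: sqr_ge0.
by apply: (le_trans h); rewrite lerDr sqr_ge0.
Qed.

Lemma N2_CS s a b : \sum_(l <- s) a l * b l <= N2 s a * N2 s b.
Proof.
set A := N2 s a; set B := N2 s b.
have A0 : 0 <= A := N2_ge0 _ _.
have B0 : 0 <= B := N2_ge0 _ _.
(* This is the expansion of the sum of (A b_l - B a_l)^2. It gives the claim after division by A B,
   so vanishing norms are split off below. *)
have key : 0 <= 2 * (A * B) * (A * B - \sum_(l <- s) a l * b l).
  have : 0 <= \sum_(l <- s) (A * b l - B * a l) ^+ 2.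
    by rewrite sumr_ge0// => *; exact: sqr_ge0.
  under eq_bigr do rewrite sqrrB !exprMn.
  rewrite big_split sumrB /= -!mulr_sumr -!N2_sqr -/A -/B -mulr_natr.
  under eq_bigr => l _.
    rewrite (_ : A * b l * (B * a l) *+ 2 = 2 * (A * B) * (a l * b l)); last by ring.
    over.
  rewrite -mulr_sumr => h; apply: (le_trans h); rewrite le_eqVlt; apply/orP; left.
  by apply/eqP; ring.
have zero (x y : I -> R) : N2 s x = 0 -> \sum_(l <- s) x l * y l = 0.
  move=> x0; rewrite big_seq big1// => l /(N2_point x).
  by rewrite x0 normr_le0 => /eqP ->; rewrite mul0r.
have [/eqP A00|An0] := boolP (A == 0); first by rewrite (zero _ _ A00) A00 mul0r.
have [/eqP B00|Bn0] := boolP (B == 0).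
  by under eq_bigr do rewrite mulrC; rewrite (zero _ _ B00) B00 mulr0.
rewrite -subr_ge0; move: key; rewrite pmulr_rge0// mulr_gt0// mulr_gt0//.
  by rewrite lt_neqAle eq_sym An0.
by rewrite lt_neqAle eq_sym Bn0.
Qed.

Lemma N2_tri s a b : N2 s (fun l => a l + b l) <= N2 s a + N2 s b.
Proof.
rewrite N2_leP ?addr_ge0 ?N2_ge0// sqrrD !N2_sqr.
under eq_bigr do rewrite sqrrD.
rewrite !big_split /= lerD2r lerD2l.
by rewrite mulr2n; apply: lerD; exact: N2_CS.
Qed.

Lemma N2_triB s a b (A B : R) : N2 s a <= A -> N2 s b <= B ->
  N2 s (fun l => a l + b l) <= A + B.
Proof. by move=> hA hB; apply: (le_trans (N2_tri _ _ _)); exact: lerD. Qed.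

Lemma N2_sum {J : eqType} s (t : seq J) (F : J -> I -> R) (B : J -> R) :
  (forall k, k \in t -> N2 s (F k) <= B k) ->
  N2 s (fun l => \sum_(k <- t) F k l) <= \sum_(k <- t) B k.
Proof.
elim: t => [|k t ih] h.
  by rewrite !big_nil (@eq_N2 _ _ (fun=> 0)) ?N2_0// => l _; rewrite big_nil.
rewrite big_cons (@eq_N2 _ _ (fun l => F k l + \sum_(k <- t) F k l)).
  apply: N2_triB; first by rewrite h ?mem_head.
  by apply: ih => j jt; rewrite h// inE jt orbT.
by move=> l _; rewrite big_cons.
Qed.

(** Minkowski's inequality over the columns, the case l2 * l1 -> l2 of Young's inequality. It serves
    where the kernel has to carry all the derivatives. *)
Lemma N2_young {J : eqType} s (t : seq J) (K : I -> J -> R) (b : J -> R) (A : R) :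
  (forall k, k \in t -> N2 s (K^~ k) <= A) ->
  N2 s (fun l => \sum_(k <- t) K l k * b k) <= A * \sum_(k <- t) `|b k|.
Proof.
move=> hK; rewrite mulr_sumr; apply: N2_sum => k kt.
rewrite (@eq_N2 _ _ (fun l => b k * K l k)); last by move=> *; rewrite mulrC.
by rewrite N2_scale mulrC ler_wpM2r ?hK.
Qed.

End ell2.

(** Schur's test: K is split as sqrt K times sqrt K, Cauchy-Schwarz is applied in each row, and the
    column sums enter after the two sums are exchanged. It serves where the kernel is summable. *)
Lemma N2_schur {R : realType} {I J : eqType} (s : seq I) (t : seq J)
    (K : I -> J -> R) (b : J -> R) (A : R) :
  (forall l k, 0 <= K l k) -> 0 <= A ->
  (forall l, l \in s -> \sum_(k <- t) K l k <= A) ->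
  (forall k, k \in t -> \sum_(l <- s) K l k <= A) ->
  N2 s (fun l => \sum_(k <- t) K l k * b k) <= A * N2 t b.
Proof.
move=> K0 A0 hl hk; rewrite N2_leP ?mulr_ge0 ?N2_ge0// exprMn N2_sqr.
have step l : l \in s -> (\sum_(k <- t) K l k * b k) ^+ 2 <=
    A * \sum_(k <- t) K l k * b k ^+ 2.
  move=> ls.
  have := N2_CS t (fun k => Num.sqrt (K l k)) (fun k => Num.sqrt (K l k) * `|b k|).
  under eq_bigr do rewrite mulrA -expr2 sqr_sqrtr//.
  move=> h.
  apply: (@le_trans _ _ ((\sum_(k <- t) K l k * `|b k|) ^+ 2)).
    rewrite -[X in X <= _]real_normK ?num_real// ler_pXn2r ?nnegrE//; last first.
      by rewrite sumr_ge0// => *; rewrite mulr_ge0.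
    by apply: (le_trans (ler_norm_sum _ _ _)); apply: ler_sum => k _; rewrite normrM ger0_norm.
  apply: (@le_trans _ _ ((N2 t (fun k => Num.sqrt (K l k)) *
      N2 t (fun k => Num.sqrt (K l k) * `|b k|)) ^+ 2)).
    by rewrite ler_pXn2r ?nnegrE ?mulr_ge0 ?N2_ge0// sumr_ge0// => *; rewrite mulr_ge0.
  rewrite exprMn !N2_sqr.
  under eq_bigr do rewrite sqr_sqrtr//.
  under [X in _ * X <= _]eq_bigr do rewrite exprMn sqr_sqrtr// real_normK ?num_real//.
  rewrite ler_wpM2r ?hl// sumr_ge0// => k _; by rewrite mulr_ge0 ?sqr_ge0.
rewrite big_seq; apply: (le_trans (ler_sum _ step)); rewrite -big_seq -mulr_sumr expr2 -mulrA.
rewrite ler_wpM2l// exchange_big/= mulr_sumr big_seq [X in _ <= X]big_seq ler_sum// => k kt.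
by rewrite -mulr_suml ler_wpM2r ?sqr_ge0 ?hk.
Qed.
Section complex_numbers.
Context {R : realType}.
Implicit Types (z u : R[i]) (x y : R).

Lemma cmodE z : cmodulus z = Num.sqrt (complex.Re z ^+ 2 + complex.Im z ^+ 2).
Proof. by case: z. Qed.

Lemma cmod_sqr z : cmodulus z ^+ 2 = complex.Re z ^+ 2 + complex.Im z ^+ 2.
Proof. by rewrite cmodE sqr_sqrtr// addr_ge0 ?sqr_ge0. Qed.

Lemma cmod_ge0 z : 0 <= cmodulus z.
Proof. by rewrite cmodE sqrtr_ge0. Qed.

Lemma cmodM z u : cmodulus (z * u) = cmodulus z * cmodulus u.
Proof. exact: ComplexField.Normc.normcM. Qed.

Lemma cmodD z u : cmodulus (z + u) <= cmodulus z + cmodulus u.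
Proof. exact: le_normcD. Qed.

Lemma cmodN z : cmodulus (- z) = cmodulus z.
Proof. exact: normcN. Qed.

Lemma cmodB z u : cmodulus (z - u) <= cmodulus z + cmodulus u.
Proof. by rewrite -(cmodN u) cmodD. Qed.

Lemma cmodBC z u : cmodulus (z - u) = cmodulus (u - z).
Proof. by rewrite -cmodN opprB. Qed.

Lemma cmod0 : cmodulus (0 : R[i]) = 0.
Proof. exact: ComplexField.Normc.normc0. Qed.

Lemma cmod1 : cmodulus (1 : R[i]) = 1.
Proof. exact: ComplexField.Normc.normc1. Qed.

Lemma cmod_eq0 z : cmodulus z = 0 -> z = 0.
Proof. exact: ComplexField.Normc.eq0_normc. Qed.

Lemma cmodX z n : cmodulus (z ^+ n) = cmodulus z ^+ n.
Proof. by elim: n => [|n ih]; rewrite ?expr0 ?cmod1// !exprS cmodM ih. Qed.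

Lemma cmodR x : cmodulus x%:C = `|x|.
Proof. by rewrite cmodE /= expr0n/= addr0 sqrtr_sqr. Qed.

Lemma cmodi : cmodulus (0 +i* 1 : R[i]) = 1.
Proof. by rewrite cmodE /= expr0n/= add0r expr1n sqrtr1. Qed.

Lemma cmod_sum {I : Type} (s : seq I) (P : pred I) (F : I -> R[i]) :
  cmodulus (\sum_(k <- s | P k) F k) <= \sum_(k <- s | P k) cmodulus (F k).
Proof.
elim/big_ind2: _ => [|a b c d ab cd|//]; first by rewrite cmod0.
by apply: (le_trans (cmodD _ _)); apply: lerD.
Qed.

Lemma cmod_Re z : `|complex.Re z| <= cmodulus z.
Proof.
rewrite cmodE -sqrtr_sqr ler_sqrt ?addr_ge0 ?sqr_ge0//.
by rewrite lerDl sqr_ge0.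
Qed.

Lemma cmod_Im z : `|complex.Im z| <= cmodulus z.
Proof.
rewrite cmodE -sqrtr_sqr ler_sqrt ?addr_ge0 ?sqr_ge0//.
by rewrite lerDr sqr_ge0.
Qed.

Lemma cmod_le_ReIm z : cmodulus z <= `|complex.Re z| + `|complex.Im z|.
Proof.
rewrite cmodE -[leRHS]ger0_norm ?addr_ge0// -sqrtr_sqr ler_sqrt ?sqr_ge0//.
rewrite sqrrD !real_normK ?num_real// -addrA lerD2l -mulr_natr.
by rewrite lerDr !mulr_ge0.
Qed.

Lemma cReM z u : complex.Re (z * u) =
  complex.Re z * complex.Re u - complex.Im z * complex.Im u.
Proof. by case: z u => [? ?] [? ?]. Qed.

Lemma cImM z u : complex.Im (z * u) =
  complex.Re z * complex.Im u + complex.Im z * complex.Re u.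
Proof. by case: z u => [? ?] [? ?]. Qed.

Lemma cReD z u : complex.Re (z + u) = complex.Re z + complex.Re u.
Proof. by case: z u => [? ?] [? ?]. Qed.

Lemma cImD z u : complex.Im (z + u) = complex.Im z + complex.Im u.
Proof. by case: z u => [? ?] [? ?]. Qed.

Lemma cReN z : complex.Re (- z) = - complex.Re z.
Proof. by case: z. Qed.

Lemma cImN z : complex.Im (- z) = - complex.Im z.
Proof. by case: z. Qed.

Lemma cReB z u : complex.Re (z - u) = complex.Re z - complex.Re u.
Proof. by rewrite cReD cReN. Qed.

Lemma cImB z u : complex.Im (z - u) = complex.Im z - complex.Im u.
Proof. by rewrite cImD cImN. Qed.

Lemma cRe_sum {I : Type} (s : seq I) (P : pred I) (F : I -> R[i]) :
  complex.Re (\sum_(k <- s | P k) F k) = \sum_(k <- s | P k) complex.Re (F k).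
Proof. by elim/big_rec2: _ => // k x y _ <-; rewrite cReD. Qed.

Lemma complex_eq z u : complex.Re z = complex.Re u ->
  complex.Im z = complex.Im u -> z = u.
Proof. by case: z u => [? ?] [? ?] /= -> ->. Qed.

Lemma expiD x y : expi (x + y) = expi x * expi y :> R[i].
Proof.
by apply: complex_eq; rewrite ?cReM ?cImM /= ?cosD ?sinD // addrC.
Qed.

Lemma expi0 : expi 0 = 1 :> R[i].
Proof. by rewrite /expi cos0 sin0. Qed.

Lemma expiNK x : expi x * expi (- x) = 1 :> R[i].
Proof. by rewrite -expiD subrr expi0. Qed.

Lemma expiKN x : expi (- x) * expi x = 1 :> R[i].
Proof. by rewrite -expiD addrC subrr expi0. Qed.

Lemma cmod_expi x : cmodulus (expi x) = 1.
Proof. by rewrite cmodE /= cos2Dsin2 sqrtr1. Qed.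

Lemma expi_mulrn x n : expi (n%:R * x) = expi x ^+ n :> R[i].
Proof.
elim: n => [|n ih]; first by rewrite mul0r expi0 expr0.
by rewrite exprS -ih -expiD -nat1r mulrDl mul1r.
Qed.

Lemma conj_expi x : conjc (expi x) = expi (- x) :> R[i].
Proof. by rewrite /expi /= cosN sinN. Qed.

End complex_numbers.

Section complex_derivative.
Context {R : realType}.
Implicit Types (f g : R -> R[i]) (t : R).

(** A relation rather than an operator, so that the value of the derivative travels through the
    rules together with differentiability. *)
Definition is_cderive f t (d : R[i]) : Prop :=
  is_derive t (1 : R) (fun y => complex.Re (f y)) (complex.Re d) /\
  is_derive t (1 : R) (fun y => complex.Im (f y)) (complex.Im d).

Definition ccont f (a b : R) : Prop := cwithin_continuous `[a, b]%classic f.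

Lemma is_derive_ext (f g : R -> R) t (d d' : R) : is_derive t (1 : R) f d ->
  f =1 g -> d = d' -> is_derive t (1 : R) g d'.
Proof. by move=> h /funext <- <-. Qed.

Lemma is_cderive_ext f g t d d' : is_cderive f t d -> f =1 g -> d = d' ->
  is_cderive g t d'.
Proof. by move=> h /funext <- <-. Qed.

Lemma is_cderive_cst (c : R[i]) t : is_cderive (fun=> c) t 0.
Proof. by split; exact: is_derive_cst. Qed.

Lemma is_cderiveD f g t df dg : is_cderive f t df -> is_cderive g t dg ->
  is_cderive (fun y => f y + g y) t (df + dg).
Proof.
move=> [fr fi] [gr gi]; split.
- by apply: (is_derive_ext (is_deriveD fr gr)) => [y|]; rewrite /= cReD.
- by apply: (is_derive_ext (is_deriveD fi gi)) => [y|]; rewrite /= cImD.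
Qed.

Lemma is_cderiveM f g t df dg : is_cderive f t df -> is_cderive g t dg ->
  is_cderive (fun y => f y * g y) t (df * g t + f t * dg).
Proof.
move=> [fr fi] [gr gi]; split.
- apply: (is_derive_ext (is_deriveB (is_deriveM fr gr) (is_deriveM fi gi))) => [y|].
    by rewrite cReM.
  by rewrite /= cReD !cReM /GRing.scale /=; ring.
- apply: (is_derive_ext (is_deriveD (is_deriveM fr gi) (is_deriveM fi gr))) => [y|].
    by rewrite cImM.
  by rewrite /= cImD !cImM /GRing.scale /=; ring.
Qed.

Lemma is_cderiveMl (c : R[i]) f t df : is_cderive f t df ->
  is_cderive (fun y => c * f y) t (c * df).
Proof.
move=> h; apply: (is_cderive_ext (is_cderiveM (is_cderive_cst c t) h)) => //.
by rewrite mul0r add0r.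
Qed.

Lemma is_cderiveMr (c : R[i]) f t df : is_cderive f t df ->
  is_cderive (fun y => f y * c) t (df * c).
Proof.
move=> h; apply: (is_cderive_ext (is_cderiveMl c h)) => [y|]; exact: mulrC.
Qed.

Lemma is_cderiveN f t df : is_cderive f t df ->
  is_cderive (fun y => - f y) t (- df).
Proof.
move=> h; apply: (is_cderive_ext (is_cderiveMl (-1) h)) => [y|]; by rewrite mulN1r.
Qed.

Lemma is_cderiveB f g t df dg : is_cderive f t df -> is_cderive g t dg ->
  is_cderive (fun y => f y - g y) t (df - dg).
Proof. by move=> hf hg; apply: is_cderiveD => //; exact: is_cderiveN. Qed.

Lemma is_cderive_sum {I : eqType} (s : seq I) (F : I -> R -> R[i]) t
    (dF : I -> R[i]) : (forall k, k \in s -> is_cderive (F k) t (dF k)) ->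
  is_cderive (fun y => \sum_(k <- s) F k y) t (\sum_(k <- s) dF k).
Proof.
elim: s => [|k s ih] h.
  rewrite big_nil; apply: (is_cderive_ext (is_cderive_cst 0 t)) => // y.
  by rewrite big_nil.
rewrite big_cons; apply: (@is_cderive_ext (fun y => F k y + \sum_(j <- s) F j y)) => //.
  apply: is_cderiveD; first by apply: h; rewrite mem_head.
  by apply: ih => j js; apply: h; rewrite inE js orbT.
by move=> y; rewrite big_cons.
Qed.

Lemma is_cderive_real (g : R -> R) t (d : R) : is_derive t (1 : R) g d ->
  is_cderive (fun y => (g y)%:C) t d%:C.
Proof. by move=> h; split=> //; exact: is_derive_cst. Qed.

Lemma is_derive_affine (c d : R) t : is_derive t (1 : R) (fun y => c * y + d) c.
Proof.
have h := is_deriveD (is_deriveZ c (is_derive_id t (1 : R))) (is_derive_cst d t (1 : R)).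
by apply: (is_derive_ext h) => [y|]; rewrite /GRing.scale/= ?mulr1 ?addr0.
Qed.

Lemma is_cderive_expi (g : R -> R) t (d : R) : is_derive t (1 : R) g d ->
  is_cderive (fun y => expi (g y)) t ((0 +i* d) * expi (g t)).
Proof.
move=> h; split.
- apply: (is_derive_ext (is_derive1_comp (is_derive_cos (g t)) h)) => // /=.
  by rewrite /=; ring.
- apply: (is_derive_ext (is_derive1_comp (is_derive_sin (g t)) h)) => // /=.
  by rewrite /=; ring.
Qed.

Lemma is_cderive_shift f (r t : R) d : is_cderive f (r + t) d ->
  is_cderive (fun y => f (r + y)) t d.
Proof.
move=> [h1 h2].
have a1 : is_derive t (1 : R) (fun y => r + y) 1.
  by apply: (is_derive_ext (is_derive_affine 1 r t)) => [y|//]; rewrite mul1r addrC.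
split.
- by apply: (is_derive_ext (is_derive1_comp h1 a1)) => [y//|]; rewrite mulr1.
- by apply: (is_derive_ext (is_derive1_comp h2 a1)) => [y//|]; rewrite mulr1.
Qed.

Lemma is_cderive_scale f (r t : R) d : is_cderive f (r * t) d ->
  is_cderive (fun y => f (r * y)) t (r%:C * d).
Proof.
move=> [h1 h2].
have a1 : is_derive t (1 : R) (fun y => r * y) r.
  by apply: (is_derive_ext (is_derive_affine r 0 t)) => [y|//]; rewrite addr0.
split.
- by apply: (is_derive_ext (is_derive1_comp h1 a1)) => [y//|]; rewrite cReM /=; ring.
- by apply: (is_derive_ext (is_derive1_comp h2 a1)) => [y//|]; rewrite cImM /=; ring.
Qed.

Lemma is_derive_within_cont (f df : R -> R) (a b : R) :
  (forall t, is_derive t (1 : R) f (df t)) -> {within `[a, b], continuous f}.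
Proof.
by move=> h; apply: derivable_within_continuous => t _; have [] := h t.
Qed.

Lemma is_cderive_ccont f df (a b : R) : (forall t, is_cderive f t (df t)) ->
  ccont f a b.
Proof.
move=> h; split.
- by apply: (@is_derive_within_cont _ (fun t => complex.Re (df t))) => t; have [] := h t.
- by apply: (@is_derive_within_cont _ (fun t => complex.Im (df t))) => t; have [] := h t.
Qed.

Lemma ccont_ext f g (a b : R) : ccont f a b -> f =1 g -> ccont g a b.
Proof. by move=> h /funext <-. Qed.

Lemma ccont_cst (c : R[i]) (a b : R) : ccont (fun=> c) a b.
Proof. exact: (@is_cderive_ccont (fun=> c) (fun=> 0) a b (fun t => is_cderive_cst c t)). Qed.

Lemma ccontD f g (a b : R) : ccont f a b -> ccont g a b ->
  ccont (fun y => f y + g y) a b.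
Proof.
move=> [f1 f2] [g1 g2]; split.
- rewrite (_ : (fun _ => _) = (fun x => complex.Re (f x)) + (fun x => complex.Re (g x))).
    exact: within_continuousD.
  by apply/funext => y; rewrite cReD.
- rewrite (_ : (fun _ => _) = (fun x => complex.Im (f x)) + (fun x => complex.Im (g x))).
    exact: within_continuousD.
  by apply/funext => y; rewrite cImD.
Qed.

Lemma within_contM {T : topologicalType} (A : set T) (f g : T -> R) :
  {within A, continuous f} -> {within A, continuous g} ->
  {within A, continuous (fun x => f x * g x)}.
Proof. by move=> hf hg x; exact: (@continuousM _ (subspace A) f g x (hf x) (hg x)). Qed.

Lemma ccontM f g (a b : R) : ccont f a b -> ccont g a b ->
  ccont (fun y => f y * g y) a b.
Proof.
move=> [f1 f2] [g1 g2]; split.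
- rewrite (_ : (fun _ => _) = (fun x => complex.Re (f x) * complex.Re (g x)) -
    (fun x => complex.Im (f x) * complex.Im (g x))).
    by apply: within_continuousB; exact: within_contM.
  by apply/funext => y; rewrite cReM.
- rewrite (_ : (fun _ => _) = (fun x => complex.Re (f x) * complex.Im (g x)) +
    (fun x => complex.Im (f x) * complex.Re (g x))).
    by apply: within_continuousD; exact: within_contM.
  by apply/funext => y; rewrite cImM.
Qed.

Lemma ccont_sum {I : eqType} (s : seq I) (F : I -> R -> R[i]) (a b : R) :
  (forall k, k \in s -> ccont (F k) a b) ->
  ccont (fun y => \sum_(k <- s) F k y) a b.
Proof.
elim: s => [|k s ih] h.
  by apply: (ccont_ext (ccont_cst 0 a b)) => y; rewrite big_nil.
apply: (@ccont_ext (fun y => F k y + \sum_(j <- s) F j y)).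
  apply: ccontD; first by apply: h; rewrite mem_head.
  by apply: ih => j js; apply: h; rewrite inE js orbT.
by move=> y; rewrite big_cons.
Qed.

Lemma ccontN f (a b : R) : ccont f a b -> ccont (fun y => - f y) a b.
Proof.
move=> h; apply: (ccont_ext (ccontM (ccont_cst (-1) a b) h)) => y.
by rewrite mulN1r.
Qed.

Lemma ccontB f g (a b : R) : ccont f a b -> ccont g a b ->
  ccont (fun y => f y - g y) a b.
Proof. by move=> hf hg; apply: ccontD => //; exact: ccontN. Qed.

Lemma within_continuousP {T : pseudoMetricType R} (A : set T) (f : T -> R) :
  {within A, continuous f} <->
  forall x, A x -> forall e : R, 0 < e ->
    exists2 d : R, 0 < d & forall y, A y -> ball x d y -> `|f x - f y| < e.
Proof.
split=> [/subspace_continuousP h x Ax e e0|h].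
- have /cvgrPdist_lt /(_ e e0) := h x Ax.
  rewrite near_withinE => /nbhs_ballP[d /= d0 hd].
  by exists d => // y Ay xy; apply: hd.
- apply/subspace_continuousP => x Ax; apply/cvgrPdist_lt => e e0.
  have [d d0 hd] := h x Ax e e0.
  rewrite near_withinE; apply/nbhs_ballP; exists d => // y xy Ay; exact: hd.
Qed.

Lemma within_cont_shift (f : R -> R) (r a b : R) :
  {within `[r + a, r + b], continuous f} ->
  {within `[a, b], continuous (fun y => f (r + y))}.
Proof.
move=> /within_continuousP h; apply/within_continuousP => x /= + e e0.
rewrite in_itv/= => xab.
have [|d d0 hd] := h (r + x) _ e e0; first by rewrite /= in_itv/= !lerD2l.
exists d => // y; rewrite /= in_itv/= => yab xy.
apply: hd; first by rewrite /= in_itv/= !lerD2l.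
move: xy; rewrite /ball/= /ball/=; apply: le_lt_trans.
by rewrite (_ : r + x - (r + y) = x - y) //; ring.
Qed.

Lemma ccont_shift f (r a b : R) : ccont f (r + a) (r + b) ->
  ccont (fun y => f (r + y)) a b.
Proof. by move=> [h1 h2]; split; [exact: (within_cont_shift h1)|exact: (within_cont_shift h2)]. Qed.

(* Duality: pairing with the difference itself reduces the vector-valued mean
   value inequality to a scalar one. *)
Lemma mean_value_N2 {I : eqType} (s : seq I) (w : I -> R) (f df : I -> R -> R[i])
    (g dg : R -> R) (a b : R) : a <= b ->
  (forall l, l \in s -> ccont (f l) a b) ->
  (forall l t, l \in s -> a < t < b -> is_cderive (f l) t (df l t)) ->
  {within `[a, b], continuous g} ->
  (forall t, a < t < b -> is_derive t (1 : R) g (dg t)) ->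
  (forall t, a < t < b -> N2 s (fun l => w l * cmodulus (df l t)) <= dg t) ->
  N2 s (fun l => w l * cmodulus (f l b - f l a)) <= g b - g a.
Proof.
rewrite le_eqVlt => /predU1P[->|ab] cf hf cg hg hle.
  rewrite subrr (@eq_N2 _ _ _ _ (fun=> 0)) ?N2_0// => l _.
  by rewrite subrr cmod0 mulr0.
set X := N2 _ _.
have X0 : 0 <= X := N2_ge0 _ _.
have gm : 0 <= g b - g a.
  have hg' t : t \in `]a, b[%R -> is_derive t (1 : R) g (dg t).
    by rewrite in_itv/=; exact: hg.
  have [c + ->] := MVT ab hg' cg.
  rewrite in_itv/= => hc; apply: mulr_ge0; last by rewrite subr_ge0 ltW.
  exact: le_trans (N2_ge0 _ _) (hle _ hc).
have [->//|Xn0] := eqVneq X 0.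
have Xp : 0 < X by rewrite lt_neqAle eq_sym Xn0.
pose D l := f l b - f l a.
pose F t := \sum_(l <- s) (w l ^+ 2)%:C * conjc (D l) * f l t.
pose dF t := \sum_(l <- s) (w l ^+ 2)%:C * conjc (D l) * df l t.
have Fc : ccont F a b.
  by apply: ccont_sum => l ls; apply: ccontM; [exact: ccont_cst|exact: cf].
have Fd t : a < t < b -> is_cderive F t (dF t).
  by move=> ht; apply: is_cderive_sum => l ls; apply: is_cderiveMl; exact: hf.
pose h t := complex.Re (F t) - X * g t.
have hc : {within `[a, b], continuous h}.
  rewrite /h (_ : (fun _ => _) = (fun t => complex.Re (F t)) - (fun t => X * g t)) //.
  apply: within_continuousB; first by case: Fc.
  by apply: within_contM => // t; exact: cvg_cst.
have hd t : t \in `]a, b[%R -> is_derive t (1 : R) h (complex.Re (dF t) - X * dg t).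
  rewrite in_itv/= => ht; have [h1 _] := Fd _ ht.
  have h2 := is_deriveZ X (hg _ ht).
  by apply: (is_derive_ext (is_deriveB h1 h2)).
have [c + hE] := MVT ab hd hc.
rewrite in_itv/= => hcab.
have FX : complex.Re (F b) - complex.Re (F a) = X ^+ 2.
  rewrite -cReB /F -sumrB cRe_sum /X N2_sqr; apply: eq_bigr => l _.
  rewrite -mulrBr -/(D l) cReM [RHS]exprMn cmod_sqr; case: (D l) => x y /=.
  by ring.
have le0 : complex.Re (dF c) - X * dg c <= 0.
  rewrite subr_le0 /dF cRe_sum.
  apply: (@le_trans _ _ (\sum_(l <- s) (w l * cmodulus (D l)) * (w l * cmodulus (df l c)))).
    apply: ler_sum => l _; apply: (le_trans (ler_norm _)); apply: (le_trans (cmod_Re _)).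
    rewrite !cmodM cmodR ger0_norm ?sqr_ge0// (_ : cmodulus (D l)^*%C = cmodulus (D l)).
      by rewrite le_eqVlt; apply/orP; left; apply/eqP; ring.
    by case: (D l) => x y; rewrite !cmodE /= sqrrN.
  apply: (le_trans (N2_CS _ _ _)); rewrite ler_wpM2l//.
  exact: hle.
have : h b - h a <= 0.
  by rewrite hE pmulr_lle0 // subr_gt0.
have -> : h b - h a = X ^+ 2 - X * (g b - g a) by rewrite -FX /h; ring.
by rewrite subr_le0 expr2 ler_pM2l.
Qed.

Lemma mean_value_N2_lin {I : eqType} (s : seq I) (w : I -> R)
    (f df : I -> R -> R[i]) (B : R) (a b : R) : a <= b ->
  (forall l, l \in s -> ccont (f l) a b) ->
  (forall l t, l \in s -> a < t < b -> is_cderive (f l) t (df l t)) ->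
  (forall t, a < t < b -> N2 s (fun l => w l * cmodulus (df l t)) <= B) ->
  N2 s (fun l => w l * cmodulus (f l b - f l a)) <= B * (b - a).
Proof.
move=> ab cf hf hle; rewrite mulrBr.
have hB t : is_derive t (1 : R) (fun t : R => B * t) B.
  by apply: (is_derive_ext (is_derive_affine B 0 t)) => // y; rewrite addr0.
apply: (mean_value_N2 (g := fun t => B * t) (dg := fun=> B) ab cf hf) => //.
exact: (is_derive_within_cont (fun t => hB t)).
Qed.

End complex_derivative.

(** * Weighted norms of complex sequences and a Gronwall inequality *)

Section weighted_norm.
Context {R : realType} {I : eqType}.
Implicit Types (s : seq I) (w : I -> R) (u : I -> R[i]).

Definition nrm s w u : R := N2 s (fun l => w l * cmodulus (u l)).

Lemma nrm_ge0 s w u : 0 <= nrm s w u.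
Proof. exact: N2_ge0. Qed.

Lemma eq_nrm s w u u' : (forall l, l \in s -> u l = u' l) -> nrm s w u = nrm s w u'.
Proof. by move=> h; apply: eq_N2 => l /h ->. Qed.

Lemma eq_nrm_cmod s w u u' : (forall l, l \in s -> cmodulus (u l) = cmodulus (u' l)) ->
  nrm s w u = nrm s w u'.
Proof. by move=> h; apply: eq_N2 => l /h ->. Qed.

Lemma nrm_le s w w' u u' : (forall l, l \in s -> 0 <= w l) ->
  (forall l, l \in s -> w l * cmodulus (u l) <= w' l * cmodulus (u' l)) ->
  nrm s w u <= nrm s w' u'.
Proof.
move=> w0 h; apply: N2_le => l ls; rewrite ger0_norm ?mulr_ge0 ?cmod_ge0 ?w0//.
exact: h.
Qed.

Lemma nrm0 s w : nrm s w (fun=> 0) = 0.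
Proof.
by rewrite /nrm (@eq_N2 _ _ _ _ (fun=> 0)) ?N2_0// => l _; rewrite cmod0 mulr0.
Qed.

Lemma nrmN s w u : nrm s w (fun l => - u l) = nrm s w u.
Proof. by apply: eq_nrm_cmod => l _; rewrite cmodN. Qed.

Lemma nrmZ s w (c : R[i]) u : nrm s w (fun l => c * u l) = cmodulus c * nrm s w u.
Proof.
rewrite /nrm -[cmodulus c]ger0_norm ?cmod_ge0// -N2_scale; apply: eq_N2 => l _.
by rewrite cmodM mulrCA.
Qed.

Lemma nrm_expi s w (a : I -> R) u : nrm s w (fun l => expi (a l) * u l) = nrm s w u.
Proof. by apply: eq_nrm_cmod => l _; rewrite cmodM cmod_expi mul1r. Qed.

Lemma nrmD s w u u' : (forall l, l \in s -> 0 <= w l) ->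
  nrm s w (fun l => u l + u' l) <= nrm s w u + nrm s w u'.
Proof.
move=> w0; apply: le_trans (N2_tri _ _ _); apply: N2_le => l ls.
rewrite ger0_norm ?mulr_ge0 ?cmod_ge0 ?w0// -mulrDr ler_wpM2l ?w0//.
exact: cmodD.
Qed.

Lemma nrmDle s w u u' (A B : R) : (forall l, l \in s -> 0 <= w l) ->
  nrm s w u <= A -> nrm s w u' <= B -> nrm s w (fun l => u l + u' l) <= A + B.
Proof. by move=> w0 hA hB; apply: (le_trans (nrmD _ _ w0)); exact: lerD. Qed.

Lemma nrmBle s w u u' (A B : R) : (forall l, l \in s -> 0 <= w l) ->
  nrm s w u <= A -> nrm s w u' <= B -> nrm s w (fun l => u l - u' l) <= A + B.
Proof. by move=> w0 hA hB; apply: nrmDle => //; rewrite nrmN. Qed.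

Lemma nrm_kernel s (t : seq I) w (M : I -> I -> R[i]) (K : I -> I -> R) u :
  (forall l, l \in s -> 0 <= w l) ->
  (forall l k, l \in s -> k \in t -> cmodulus (M l k) <= K l k) ->
  nrm s w (fun l => \sum_(k <- t) M l k * u k) <=
  N2 s (fun l => w l * \sum_(k <- t) K l k * cmodulus (u k)).
Proof.
move=> w0 MK; apply: N2_le => l ls.
rewrite ger0_norm ?mulr_ge0 ?cmod_ge0 ?w0// ler_wpM2l ?w0//.
apply: (le_trans (cmod_sum _ _ _)); rewrite !big_seq; apply: ler_sum => k kt.
by rewrite cmodM ler_wpM2r ?cmod_ge0 ?MK.
Qed.

(** The family [S] of lists is there because a convolution couples all frequencies: the derivative
    on one list is controlled only when all lists are. Starting from the a priori bound [K0], a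
    bound A e^(2Lt) is inserted into the hypothesis again and again. Integrating L A e^(2Lt) yields
    only A / 2 times e^(2Lt) - 1, so the excess of A over 2B is halved each time. *)
Lemma gronwall_nrm (S : seq I -> Prop) w (f df : I -> R -> R[i])
    (L K K0 B0 th : R) : 0 <= L -> 0 <= K -> 0 <= K0 -> 0 <= B0 ->
  (forall s l, S s -> l \in s -> 0 <= w l) ->
  (forall s l, S s -> l \in s -> ccont (f l) 0 th) ->
  (forall s l (t : R), S s -> l \in s -> 0 < t < th -> is_cderive (f l) t (df l t)) ->
  (forall s (t : R), S s -> 0 <= t <= th -> nrm s w (f^~ t) <= K0) ->
  (forall s (t B : R), S s -> 0 < t < th -> (forall s', S s' -> nrm s' w (f^~ t) <= B) ->
     nrm s w (df^~ t) <= L * B + K) ->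
  (forall s, S s -> nrm s w (f^~ 0) <= B0) ->
  forall s (t : R), S s -> 0 <= t <= th ->
    nrm s w (f^~ t) <= 2 * (B0 + K * th) * expR (2 * L * t).
Proof.
move=> L0 Kp K00 B00 w0 cf hf hK hL hB s0 t0 Ss0 t0th.
set B := B0 + K * th.
have key n : forall s (t : R), S s -> 0 <= t <= th ->
    nrm s w (f^~ t) <= (2 * B + K0 / 2 ^+ n) * expR (2 * L * t).
  elim: n => [|n ih] s t Ss tth.
    rewrite expr0 divr1; apply: (le_trans (hK _ _ Ss tth)).
    have th0 : 0 <= th by case/andP: tth => *; lra.
    have e1 : 1 <= expR (2 * L * t).
      rewrite -expR0 ler_expR; case/andP: tth => h1 h2.
      by rewrite !mulr_ge0.
    have BB : 0 <= B by rewrite addr_ge0// mulr_ge0.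
    apply: (@le_trans _ _ ((2 * B + K0) * 1)); first by rewrite mulr1; lra.
    by rewrite ler_wpM2l// addr_ge0// mulr_ge0.
  set A := 2 * B + K0 / 2 ^+ n.
  case/andP: (tth) => tt0 tth'.
  have de (r : R) : is_derive r (1 : R)
      (fun r => K * r + (A / 2) * expR (2 * L * r)) (K + L * (A * expR (2 * L * r))).
    have h1 := is_derive_affine K 0 r.
    have h2 := @is_derive1_comp _ expR (fun y => 2 * L * y + 0) r _ _ (is_derive_expR _)
      (is_derive_affine (2 * L) 0 r).
    have h3 := is_deriveD h1 (is_deriveZ (A / 2) h2).
    apply: (is_derive_ext h3) => [y|]; first by rewrite !fctE /GRing.scale /= !addr0.
    by rewrite /GRing.scale /= addr0; field.
  have sub0t y : 0 < y < t -> 0 < y < th.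
    by case/andP=> y1 y2; rewrite y1 (lt_le_trans y2).
  have h := @mean_value_N2 _ _ s w f df _ _ 0 t tt0 _ _
     (is_derive_within_cont de) (fun r _ => de r) _.
  have {}h : nrm s w (fun l => f l t - f l 0) <=
      (K * t + (A / 2) * expR (2 * L * t)) - (K * 0 + (A / 2) * expR (2 * L * 0)).
    apply: h.
    - move=> l ls; have [c1 c2] := cf _ _ Ss ls.
      split; [apply: continuous_subspaceW c1|apply: continuous_subspaceW c2];
      by apply: subset_itvl; rewrite bnd_simp.
    - by move=> l r ls /sub0t; exact: hf Ss ls.
    - move=> r rt; rewrite addrC; apply: hL => //; first exact: sub0t.
      move=> s' Ss'; apply: ih => //; case/andP: rt => r1 r2.
      by rewrite ltW//= ltW// (lt_le_trans r2).
  rewrite (@eq_nrm s w _ (fun l => (f l t - f l 0) + f l 0)); last by move=> *; rewrite subrK.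
  have w0s : forall l, l \in s -> 0 <= w l by move=> l; exact: w0 Ss.
  apply: (le_trans (nrmDle w0s h (hB _ Ss))).
  rewrite !mulr0 expR0 exprS.
  have e1 : 1 <= expR (2 * L * t) by rewrite -expR0 ler_expR !mulr_ge0.
  have A0 : 0 <= A.
    rewrite addr_ge0 ?mulr_ge0 ?invr_ge0 ?exprn_ge0// addr_ge0// mulr_ge0//.
    exact: le_trans tth'.
  have -> : 2 * B + K0 / (2 * 2 ^+ n) = B + A / 2.
    by rewrite /A; field; rewrite expf_neq0.
  have KB : B0 + K * t <= B by rewrite lerD2l ler_wpM2l.
  have BB : 0 <= B by rewrite addr_ge0// mulr_ge0// (le_trans tt0).
  have : B * 1 <= B * expR (2 * L * t) by rewrite ler_wpM2l.
  rewrite [(B + A / 2) * _]mulrDl; move: (expR _) KB A0 => E.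
  clearbody A; clearbody B => KB A0 BE; lra.
apply/ler_addgt0Pr => e e0.
pose c := K0 * expR (2 * L * t0).
have c0 : 0 <= c by rewrite mulr_ge0 ?expR_ge0.
have [n hn] : exists n : nat, c / e < n%:R.
  by exists (Num.Def.archi_bound (c / e)); apply: archi_boundP; rewrite divr_ge0// ltW.
apply: (le_trans (key n _ _ Ss0 t0th)); rewrite mulrDl lerD2l.
rewrite mulrAC -/c ler_pdivrMr ?exprn_gt0//.
apply: ltW; rewrite mulrC -ltr_pdivrMr//; apply: (lt_trans hn).
by rewrite -natrX ltr_nat ltn_expl.
Qed.

End weighted_norm.


(** * The splitting error in Fourier coordinates *)

Section core.
Context {R : realType} {I : eqType}.
Local Notation ci := ((0 +i* 1)%C : R[i]).

Lemma imE (d : R) : (0 +i* d)%C = ci * d%:C.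
Proof. by apply: complex_eq; rewrite ?cReM ?cImM /=; ring. Qed.

Lemma cisqr : ci * ci = -1.
Proof. by apply: complex_eq; rewrite ?cReM ?cImM ?cReN ?cImN/=; ring. Qed.

Lemma cmod_expi_sub (x y : R) : cmodulus (expi x - expi y) <= `|x - y|.
Proof.
wlog yx : x y / y <= x.
  by case: (leP y x) => [h|/ltW h] H; [exact: H|rewrite cmodBC distrC; exact: H].
have h := @mean_value_N2_lin R nat [:: 0%N] (fun=> 1) (fun _ t => expi t)
  (fun _ t => ci * expi t) 1 y x yx.
have hd (t : R) : is_cderive (fun t => expi t) t (ci * expi t).
  apply: (is_cderive_ext (is_cderive_expi (is_derive_id t 1))) => //.
have {h} : N2 [:: 0%N] (fun=> 1 * cmodulus (expi x - expi y)) <= 1 * (x - y).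
  apply: h => [l _|l t _ _|t _].
  - exact: (@is_cderive_ccont R _ (fun t => ci * expi t) y x hd).
  - exact: hd.
  - by rewrite /N2 big_seq1 cmodM cmodi cmod_expi !mul1r expr1n sqrtr1.
rewrite /N2 big_seq1 !mul1r sqrtr_sqr ger0_norm ?cmod_ge0// => h.
by rewrite ger0_norm// subr_ge0.
Qed.

(** The scheme in abstract form. Errors are measured with the weight [w], while the stronger [wm] is
    applied to exact quantities. [A] stands for the eigenvalues of - Delta, [v] for the matrix of
    the potential, [E th] for the exponential of - i th v. [HV] is the boundedness of
    multiplication; [HC] says that the commutator with [A] loses derivatives. *)
Context (s : seq I) (w wm A : I -> R) (v : I -> I -> R[i]) (E : R -> I -> I -> R[i]).
Context (Cv Cc Bc Bf T : R).
Context (Cv0 : 0 <= Cv) (Cc0 : 0 <= Cc) (Bc0 : 0 <= Bc) (Bf0 : 0 <= Bf) (T0 : 0 <= T).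
Context (w_ge0 : forall l, l \in s -> 0 <= w l)
  (w_le : forall l, l \in s -> w l <= wm l).
Context (HV : forall u : I -> R[i],
  N2 s (fun l => w l * \sum_(k <- s) cmodulus (v l k) * cmodulus (u k)) <=
  Cv * nrm s w u).
Context (HC : forall u : I -> R[i],
  N2 s (fun l => w l * \sum_(k <- s) `|A l - A k| * cmodulus (v l k) * cmodulus (u k)) <=
  Cc * nrm s wm u).

Definition mv (M : I -> I -> R[i]) (u : I -> R[i]) (l : I) : R[i] :=
  \sum_(k <- s) M l k * u k.

Context (HE0 : forall u l, l \in s -> mv (E 0) u l = u l).
Context (HEd : forall th l k, l \in s -> k \in s ->
  is_cderive (fun th => E th l k) th (- ci * \sum_(j <- s) v l j * E th j k)).
Context (HEb : forall th l k, cmodulus (E th l k) <= 1).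

Lemma nrm_w_wm u : nrm s w u <= nrm s wm u.
Proof. by apply: nrm_le => // l ls; rewrite ler_wpM2r ?cmod_ge0 ?w_le. Qed.

Lemma mvB M u u' l : mv M (fun k => u k - u' k) l = mv M u l - mv M u' l.
Proof. by rewrite /mv -sumrB; apply: eq_bigr => k _; rewrite mulrBr. Qed.

Lemma mv_le (ph : I -> I -> R[i]) u :
  (forall l k, l \in s -> k \in s -> cmodulus (ph l k) <= 1) ->
  nrm s w (mv (fun l k => ph l k * v l k) u) <= Cv * nrm s w u.
Proof.
move=> hph; apply: le_trans (HV u).
apply: nrm_kernel => // l k ls ks.
by rewrite cmodM ler_piMl ?cmod_ge0 ?hph.
Qed.

Lemma mv_v_le u : nrm s w (mv v u) <= Cv * nrm s w u.
Proof.
have := @mv_le (fun _ _ => 1) u; rewrite /mv => h.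
rewrite (@eq_nrm _ _ _ _ _ (mv (fun l k => 1 * v l k) u)).
  by apply: h => *; rewrite cmod1.
by move=> l _; apply: eq_bigr => k _; rewrite mul1r.
Qed.

Lemma mv_comm_le (th : I -> I -> R[i]) (r : R) u : 0 <= r ->
  (forall l k, l \in s -> k \in s -> cmodulus (th l k) <= r * `|A l - A k|) ->
  nrm s w (mv (fun l k => th l k * v l k) u) <= r * (Cc * nrm s wm u).
Proof.
move=> r0 hth.
apply: (@le_trans _ _ (N2 s (fun l => w l *
   \sum_(k <- s) (r * (`|A l - A k| * cmodulus (v l k))) * cmodulus (u k)))).
  apply: nrm_kernel => // l k ls ks.
  by rewrite cmodM mulrA ler_wpM2r ?cmod_ge0 ?hth.
rewrite (@eq_N2 _ _ _ _ (fun l => r * (w l * \sum_(k <- s) `|A l - A k| *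
   cmodulus (v l k) * cmodulus (u k)))).
  by rewrite N2_scale ger0_norm// ler_wpM2l.
move=> l _; rewrite mulrCA; congr (_ * _); rewrite mulr_sumr.
by apply: eq_bigr => k _; rewrite !mulrA.
Qed.

Lemma E_flow u th l : l \in s ->
  is_cderive (fun th => mv (E th) u l) th (- ci * mv v (mv (E th) u) l).
Proof.
move=> ls.
apply: (is_cderive_ext (f := fun th => \sum_(k <- s) E th l k * u k)
   (d := \sum_(k <- s) (- ci * \sum_(j <- s) v l j * E th j k) * u k)) => //.
  by apply: is_cderive_sum => k ks; apply: is_cderiveMr; exact: HEd.
rewrite /mv mulr_sumr.
under eq_bigr do rewrite -mulrA mulr_suml mulr_sumr.
rewrite exchange_big /=; apply: eq_bigr => j _; rewrite mulr_sumr mulr_sumr.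
by apply: eq_bigr => k _; rewrite !mulrA.
Qed.

(** In a weighted norm the propagator need not be an isometry, so Gronwall's inequality is used; the
    entrywise bound [HEb] supplies the a priori bound that it asks for. *)
Lemma E_bound u th : 0 <= th <= T ->
  nrm s w (mv (E th) u) <= 2 * nrm s w u * expR (2 * Cv * T).
Proof.
move=> /andP[th0 thT].
have := @gronwall_nrm R I (eq s) w (fun l th => mv (E th) u l)
  (fun l th => - ci * mv v (mv (E th) u) l) Cv 0
  (N2 s (fun l => w l * \sum_(k <- s) 1 * cmodulus (u k))) (nrm s w u) T
  Cv0 (lexx _) (N2_ge0 _ _) (nrm_ge0 _ _ _).
move=> /(_ _ _ _ _ _ _ s th erefl) h.
have {h} : nrm s w (mv (E th) u) <= 2 * (nrm s w u + 0 * T) * expR (2 * Cv * th).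
  apply: h => //.
  - by move=> ? l <-; exact: w_ge0.
  - move=> ? l <- ls.
    exact: (@is_cderive_ccont R _ _ 0 T (fun th => E_flow u th ls)).
  - by move=> ? l t <- ls _; exact: E_flow.
  - by move=> ? t <- _; apply: nrm_kernel.
  - move=> ? t B <- _ /(_ _ erefl) h.
    rewrite nrmZ cmodN cmodi mul1r addr0; apply: (le_trans (mv_v_le _)).
    by rewrite ler_wpM2l.
  - move=> ? <-; rewrite le_eqVlt; apply/orP; left; apply/eqP.
    by apply: eq_nrm => l ls; exact: HE0.
  - by rewrite th0.
rewrite mul0r addr0 => h; apply: (le_trans h).
by rewrite ler_wpM2l ?mulr_ge0 ?nrm_ge0// ler_expR ler_wpM2l// mulr_ge0.
Qed.

Definition CE : R := Cv * (2 * expR (2 * Cv * T)).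

Lemma CE_ge0 : 0 <= CE.
Proof. by rewrite !mulr_ge0 ?expR_ge0. Qed.

Lemma E_lip u th : 0 <= th <= T ->
  nrm s w (fun l => mv (E th) u l - u l) <= CE * th * nrm s w u.
Proof.
move=> /andP[th0 thT].
have h := @mean_value_N2_lin R I s w (fun l th => mv (E th) u l)
  (fun l th => - ci * mv v (mv (E th) u) l) (CE * nrm s w u) 0 th th0.
rewrite (@eq_nrm _ _ _ _ _ (fun l => mv (E th) u l - mv (E 0) u l)); last first.
  by move=> l ls; rewrite HE0.
rewrite mulrAC -[X in _ * X]subr0; apply: h.
- move=> l ls; exact: (@is_cderive_ccont R _ _ 0 th (fun th => E_flow u th ls)).
- by move=> l t ls _; exact: E_flow.
- move=> t /andP[t0 tth]; rewrite -/(nrm _ _ _) nrmZ cmodN cmodi mul1r.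
  apply: (le_trans (mv_v_le _)); rewrite /CE -mulrA ler_wpM2l// mulrAC.
  by apply: E_bound; rewrite ltW//= (le_trans (ltW tth)).
Qed.

(** The summands of [C2] bound, in this order, the four pieces of the derivative in [ZPlip]. Those
    of [C3] bound the pieces in [local_defect]; the one with [T] absorbs eta eps tau <= eta T. *)
Definition C2 : R := 1 + Cc * Bc + Cv * Bf + Cv * (CE * Bc).
Definition C3 : R := 1 + Cv * C2 * T + Cc * Bf + Cv * C2.

Lemma C2_ge0 : 0 <= C2.
Proof. by rewrite /C2 !addr_ge0 ?mulr_ge0 ?CE_ge0. Qed.

Lemma C3_ge0 : 0 <= C3.
Proof. by rewrite /C3 !addr_ge0 ?mulr_ge0 ?C2_ge0. Qed.

Section one_step.
(** [c] and [f] hold the Fourier coefficients of psi and of V psi, and [eta] bounds the distance of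
    f from the discrete convolution v c, the aliasing error. [Phi l k] is the primitive, from the
    start of the step, of the phase which the midpoint frame puts on the pair l, k. *)
Context (eps tau t0 eta : R) (c f : I -> R -> R[i]) (Phi : I -> I -> R -> R[i]).
Context (eps0 : 0 < eps) (eps1 : eps <= 1) (tau0 : 0 < tau) (etT : eps * tau <= T)
  (eta0 : 0 <= eta).
Context (cc : forall l, l \in s -> ccont (c l) t0 (t0 + tau)).
Context (cd : forall l t, l \in s -> t0 < t < t0 + tau ->
  is_cderive (c l) t (- ci * (A l)%:C * c l t - ci * eps%:C * f l t)).
Context (cB : forall t, t0 <= t <= t0 + tau -> nrm s wm (c^~ t) <= Bc).
Context (fB : forall t, t0 <= t <= t0 + tau -> nrm s wm (f^~ t) <= Bf).
Context (fE : forall t, t0 <= t <= t0 + tau ->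
  nrm s w (fun l => f l t - mv v (c^~ t) l) <= eta).
Context (Phid : forall l k r, is_cderive (Phi l k) r (expi ((r - tau / 2) * (A l - A k))))
  (Phi0 : forall l k, Phi l k 0 = 0).

(* The solution seen from the midpoint of the step, where the free half steps of the splitting cancel. *)
Definition mid_frame (l : I) (r : R) : R[i] := expi ((r - tau / 2) * A l) * c l (t0 + r).
Local Notation Z := mid_frame.
Local Notation z0 := (fun k => mid_frame k 0).
Let F (l : I) (r : R) : R[i] := expi ((r - tau / 2) * A l) * f l (t0 + r).
Let P (l : I) (r : R) : R[i] := mv (E (eps * r)) z0 l.
Let ph (r : R) (l k : I) : R[i] := expi ((r - tau / 2) * (A l - A k)).

Let shift_in r : 0 < r < tau -> t0 < t0 + r < t0 + tau.
Proof. by rewrite ltrDl ltrD2l. Qed.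

Let shift_in' r : 0 < r < tau -> t0 <= t0 + r <= t0 + tau.
Proof. by move=> /shift_in /andP[h1 h2]; rewrite !ltW. Qed.

Let Zc l : l \in s -> ccont (Z l) 0 tau.
Proof.
move=> ls; apply: ccontM; last by apply: ccont_shift; rewrite addr0; exact: cc.
apply: (@is_cderive_ccont R _ (fun r => (0 +i* (A l))%C * expi ((r - tau / 2) * A l))) => r.
apply: is_cderive_expi; apply: (is_derive_ext (is_derive_affine (A l) (- (tau / 2 * A l)) r)) => // y.
by ring.
Qed.

Let Zd l r : l \in s -> 0 < r < tau -> is_cderive (Z l) r (- ci * eps%:C * F l r).
Proof.
move=> ls hr.
have h1 : is_derive r (1 : R) (fun r => (r - tau / 2) * A l) (A l).
  apply: (is_derive_ext (is_derive_affine (A l) (- (tau / 2 * A l)) r)) => // y.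
  by ring.
apply: (is_cderive_ext (is_cderiveM (is_cderive_expi h1)
  (is_cderive_shift (cd ls (shift_in hr))))) => //.
rewrite /F /mid_frame imE; ring.
Qed.

Let nrm_eps (u : I -> R[i]) (B : R) : nrm s w u <= B ->
  nrm s w (fun l => - ci * eps%:C * u l) <= eps * B.
Proof.
move=> h; rewrite nrmZ cmodM cmodN cmodi mul1r cmodR gtr0_norm//.
by rewrite ler_wpM2l// ltW.
Qed.

Let z0B : nrm s wm z0 <= Bc.
Proof.
rewrite /mid_frame nrm_expi addr0; apply: cB.
by rewrite lexx lerDl ltW.
Qed.

Lemma mid_frame_lip r : 0 <= r <= tau ->
  nrm s wm (fun l => Z l r - z0 l) <= Bf * (eps * r).
Proof.
move=> /andP[r0 rt].
have h := @mean_value_N2_lin R I s wm Z (fun l r => - ci * eps%:C * F l r) (Bf * eps) 0 r r0.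
rewrite mulrA -[X in _ * X]subr0; apply: h.
- move=> l ls; have [c1 c2] := Zc ls.
  by split; [apply: continuous_subspaceW c1|apply: continuous_subspaceW c2];
    apply: subset_itvl; rewrite bnd_simp.
- by move=> l t ls /andP[t1 t2]; apply: Zd => //; rewrite t1 (lt_le_trans t2).
- move=> t /andP[t1 t2]; rewrite -/(nrm _ _ _) nrmZ cmodM cmodN cmodi mul1r cmodR gtr0_norm//.
  rewrite [leRHS]mulrC ler_wpM2l ?(ltW eps0)// nrm_expi; apply: fB; apply: shift_in'.
  by rewrite t1 (lt_le_trans t2).
Qed.

Let Pd l r : l \in s -> is_cderive (P l) r (- ci * eps%:C * mv v (P^~ r) l).
Proof.
move=> ls; apply: (is_cderive_ext (is_cderive_scale (E_flow z0 (eps * r) ls))) => //.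
by rewrite /P; ring.
Qed.

Let Plip r : 0 <= r <= tau -> nrm s w (fun l => P l r - z0 l) <= CE * Bc * (eps * r).
Proof.
move=> /andP[r0 rt]; apply: (@le_trans _ _ (CE * (eps * r) * nrm s w z0)).
  apply: E_lip; apply/andP; split; first by rewrite mulr_ge0// ltW.
  by apply: le_trans etT; rewrite ler_wpM2l// ltW.
rewrite mulrAC ler_wpM2r ?mulr_ge0 ?(ltW eps0)// ler_wpM2l ?CE_ge0//.
exact: le_trans (nrm_w_wm _) z0B.
Qed.

Let phB r l k : cmodulus (ph r l k) <= 1.
Proof. by rewrite cmod_expi. Qed.

Let ph1 r l k : 0 < r < tau -> cmodulus (ph r l k - 1) <= tau * `|A l - A k|.
Proof.
move=> /andP[r0 rt]; rewrite -[X in _ - X](@expi0 R); apply: (le_trans (cmod_expi_sub _ _)).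
rewrite subr0 normrM ler_wpM2r// ler_norml; apply/andP; split; lra.
Qed.

(** [W r] is the potential conjugated by the free flow over the time elapsed since the midpoint;
    [W1 r] is its deviation from [v], which costs tau times a commutator. *)
Let W1 r u := mv (fun l k => (ph r l k - 1) * v l k) u.
Let W r u := mv (fun l k => ph r l k * v l k) u.

Let FE r l : F l r = expi ((r - tau / 2) * A l) * (f l (t0 + r) - mv v (c^~ (t0 + r)) l)
   + W r (Z^~ r) l.
Proof.
rewrite mulrBr -/(F l r) -addrA -[LHS]addr0; congr (_ + _); apply/esym/eqP.
rewrite addrC subr_eq0 /W /mv mulr_sumr; apply/eqP; apply: eq_bigr => k _.
rewrite /mid_frame /ph [_ * (A l - A k)]mulrBr expiD.
have := expiKN ((r - tau / 2) * A k); move: (expi _) (expi _) => e1 e2 e.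
transitivity (expi ((r - tau / 2) * A l) * (v l k * c k (t0 + r)) * (e1 * e2)).
  by ring.
by rewrite [e1 * e2]mulrC e mulr1.
Qed.

Let W1E r u l : W1 r u l = W r u l - mv v u l.
Proof. by rewrite /W1 /W /mv -sumrB; apply: eq_bigr => k _; ring. Qed.

Let defB r : 0 < r < tau -> nrm s w (fun l => expi ((r - tau / 2) * A l) *
   (f l (t0 + r) - mv v (c^~ (t0 + r)) l)) <= eta.
Proof. by move=> hr; rewrite nrm_expi; apply: fE; exact: shift_in'. Qed.

(** A first pass: the derivative of Z - P is eps times terms of size eta + tau. This alone is of too
    low an order, but [local_defect] inserts it into the equation again and thereby gains a factor
    eps tau. *)
Let ZPlip r : 0 <= r <= tau -> nrm s w (fun l => Z l r - P l r) <=
   (C2 * eps * (eta + tau)) * r.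
Proof.
move=> /andP[r0 rt].
have h := @mean_value_N2_lin R I s w (fun l r => Z l r - P l r)
  (fun l r => - ci * eps%:C * (F l r - mv v (P^~ r) l)) (C2 * eps * (eta + tau)) 0 r r0.
rewrite (@eq_nrm _ _ _ _ _ (fun l => (Z l r - P l r) - (Z l 0 - P l 0))); last first.
  by move=> l ls; rewrite /P mulr0 HE0// subrr subr0.
rewrite -[X in _ * X]subr0; apply: h.
- move=> l ls; apply: ccontB; last exact: (@is_cderive_ccont R _ _ 0 r (fun t => Pd t ls)).
  have [c1 c2] := Zc ls.
  by split; [apply: continuous_subspaceW c1|apply: continuous_subspaceW c2];
    apply: subset_itvl; rewrite bnd_simp.
- move=> l t ls /andP[t1 t2]; rewrite mulrBr; apply: is_cderiveB; last exact: Pd.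
  by apply: Zd => //; rewrite t1 (lt_le_trans t2).
- move=> t /andP[t1 t2].
  have tt : 0 < t < tau by rewrite t1 (lt_le_trans t2).
  have tt' : 0 <= t <= tau by case/andP: tt => *; rewrite !ltW.
  rewrite -/(nrm _ _ _) -mulrA [eps * _ in leRHS]mulrC mulrA [leRHS]mulrC; apply: nrm_eps.
  rewrite (@eq_nrm _ _ _ _ _ (fun l => ((expi ((t - tau / 2) * A l) *
   (f l (t0 + t) - mv v (c^~ (t0 + t)) l) + W1 t z0 l) +
   W t (fun k => Z k t - z0 k) l) - mv v (fun k => P k t - z0 k) l)); last first.
    move=> l ls; rewrite FE W1E /W !mvB; ring.
  have et : eps * t <= tau.
    apply: (@le_trans _ _ (1 * t)); first by rewrite ler_wpM2r// ltW.
    by rewrite mul1r; case/andP: tt'.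
  have b1 : nrm s w (W1 t z0) <= tau * (Cc * Bc).
    apply: (le_trans (mv_comm_le (r := tau) _ _ _)); [exact: ltW|by move=> *; exact: ph1|].
    by rewrite ler_wpM2l ?(ltW tau0)// ler_wpM2l.
  have b2 : nrm s w (W t (fun k => Z k t - z0 k)) <= Cv * (Bf * tau).
    apply: (le_trans (mv_le _ _)); first by move=> *; exact: phB.
    rewrite ler_wpM2l//; apply: (le_trans (nrm_w_wm _)).
    by apply: (le_trans (mid_frame_lip tt')); rewrite ler_wpM2l.
  have b3 : nrm s w (mv v (fun k => P k t - z0 k)) <= Cv * (CE * Bc * tau).
    apply: (le_trans (mv_v_le _)); rewrite ler_wpM2l//; apply: (le_trans (Plip tt')).
    by rewrite ler_wpM2l// mulr_ge0 ?CE_ge0.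
  apply: (le_trans (nrmBle w_ge0 (nrmDle w_ge0 (nrmDle w_ge0 (defB tt) b1) b2) b3)).
  have k1 : 0 <= Cc * Bc * eta by rewrite !mulr_ge0.
  have k2 : 0 <= Cv * Bf * eta by rewrite !mulr_ge0.
  have k3 : 0 <= Cv * (CE * Bc) * eta by rewrite !mulr_ge0 ?CE_ge0.
  rewrite /C2; have := ltW tau0; lra.
Qed.

(** The sum with [Phi] is chosen so that its derivative cancels [W1 r z0], the one term of the
    derivative of Z - P that is of first order in tau, apart from aliasing. What remains is [W1]
    applied to Z - z0 and v applied to Z - P, and both differences carry a further eps tau. *)
Lemma local_defect :
  nrm s w (fun l => Z l tau - mv (E (eps * tau)) z0 l +
     ci * eps%:C * \sum_(k <- s) v l k * (Phi l k tau - tau%:C) * z0 k) <=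
  C3 * (eps * tau * eta + eps ^+ 2 * tau ^+ 3).
Proof.
pose Y l r := Z l r - P l r + ci * eps%:C * \sum_(k <- s) v l k * (Phi l k r - r%:C) * z0 k.
have t00 := ltW tau0; have e00 := ltW eps0.
have h := @mean_value_N2_lin R I s w Y
  (fun l r => - ci * eps%:C * (F l r - mv v (P^~ r) l) +
      ci * eps%:C * \sum_(k <- s) v l k * (ph r l k - 1) * z0 k)
  (C3 * (eps * eta + eps ^+ 2 * tau ^+ 2)) 0 tau t00.
rewrite -/(nrm _ _ _) in h *.
rewrite (@eq_nrm _ _ _ _ _ (fun l => Y l tau - Y l 0)); last first.
  move=> l ls; rewrite /Y -/(P l tau) /P mulr0 HE0// subrr add0r.
  have -> : \sum_(k <- s) v l k * (Phi l k 0 - 0%:C) * Z k 0 = 0.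
    by rewrite big1// => k _; rewrite Phi0 subrr mulr0 mul0r.
  by rewrite mulr0 subr0.
have -> : eps * tau * eta + eps ^+ 2 * tau ^+ 3 =
  (eps * eta + eps ^+ 2 * tau ^+ 2) * (tau - 0) by ring.
rewrite mulrA; apply: h.
- move=> l ls; apply: ccontD; first apply: ccontB => //; first exact: Zc.
    exact: (@is_cderive_ccont R _ _ 0 tau (fun t => Pd t ls)).
  apply: ccontM; first exact: ccont_cst.
  apply: ccont_sum => k ks; apply: ccontM; last exact: ccont_cst.
  apply: ccontM; first exact: ccont_cst.
  apply: ccontB; first exact: (@is_cderive_ccont R _ _ 0 tau (fun t => Phid l k t)).
  apply: (@is_cderive_ccont R _ (fun=> 1%:C) 0 tau) => t.
  exact: is_cderive_real (is_derive_id t (1 : R)).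
- move=> l t ls tt; apply: is_cderiveD.
    by rewrite mulrBr; apply: is_cderiveB; [exact: Zd|exact: Pd].
  apply: is_cderiveMl; apply: is_cderive_sum => k ks.
  apply: is_cderiveMr; apply: is_cderiveMl; apply: is_cderiveB; first exact: Phid.
  exact: is_cderive_real (is_derive_id t (1 : R)).
- move=> t tt; rewrite -/(nrm _ _ _).
  have tt' : 0 <= t <= tau by case/andP: tt => *; rewrite !ltW.
  rewrite (@eq_nrm _ _ _ _ _ (fun l => - ci * eps%:C * ((expi ((t - tau / 2) * A l) *
   (f l (t0 + t) - mv v (c^~ (t0 + t)) l) + W1 t (fun k => Z k t - z0 k) l) +
   mv v (fun k => Z k t - P k t) l))); last first.
    move=> l ls; have -> : \sum_(k <- s) v l k * (ph t l k - 1) * z0 k = W1 t z0 l.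
      by apply: eq_bigr => k _; rewrite [v _ _ * _]mulrC.
    by rewrite FE !W1E /W !mvB; ring.
  have -> : C3 * (eps * eta + eps ^+ 2 * tau ^+ 2) =
    eps * (C3 * (eta + eps * tau ^+ 2)) by ring.
  apply: nrm_eps.
  have et : eps * t <= eps * tau by rewrite ler_wpM2l//; case/andP: tt'.
  have b1 : nrm s w (W1 t (fun k => Z k t - z0 k)) <= tau * (Cc * (Bf * (eps * tau))).
    apply: (le_trans (mv_comm_le (r := tau) _ _ _)); [exact: ltW|by move=> *; exact: ph1|].
    rewrite ler_wpM2l// ler_wpM2l//; apply: (le_trans (mid_frame_lip tt')).
    by rewrite ler_wpM2l.
  have b2 : nrm s w (mv v (fun k => Z k t - P k t)) <= Cv * ((C2 * (eta + tau)) * (eps * tau)).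
    apply: (le_trans (mv_v_le _)); rewrite ler_wpM2l//; apply: (le_trans (ZPlip tt')).
    have -> : C2 * eps * (eta + tau) * t = C2 * (eta + tau) * (eps * t) by ring.
    by rewrite ler_wpM2l// mulr_ge0 ?C2_ge0// addr_ge0.
  apply: (le_trans (nrmDle w_ge0 (nrmDle w_ge0 (defB tt) b1) b2)).
  have C20 := C2_ge0.
  have k1 : (Cv * C2 * eta) * (eps * tau) <= (Cv * C2 * eta) * T by rewrite ler_wpM2l ?mulr_ge0.
  have k2 : 0 <= (Cc * Bf) * eta by rewrite !mulr_ge0.
  have k3 : 0 <= (Cv * C2) * eta by rewrite !mulr_ge0.
  have et2 : 0 <= eps * tau ^+ 2 by rewrite mulr_ge0 ?sqr_ge0.
  have k4 : 0 <= Cv * C2 * T * (eps * tau ^+ 2) by rewrite !mulr_ge0 ?sqr_ge0.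
  rewrite /C3; lra.
Qed.

End one_step.

Section many_steps.
Context (eps tau eta rho Cg : R) (c f : I -> R -> R[i]) (gam : I -> I -> R)
  (hp : I -> I -> bool) (N : nat) (u : nat -> I -> R[i]).
Context (eps0 : 0 < eps) (eps1 : eps <= 1) (tau0 : 0 < tau)
  (NT : eps * (N%:R * tau) <= T) (eta0 : 0 <= eta) (rho0 : 0 <= rho) (Cg0 : 0 <= Cg).
Context (cc : forall l, l \in s -> ccont (c l) 0 (N%:R * tau)).
Context (cd : forall l t, l \in s -> 0 < t < N%:R * tau ->
  is_cderive (c l) t (- ci * (A l)%:C * c l t - ci * eps%:C * f l t)).
Context (cB : forall t, 0 <= t <= N%:R * tau -> nrm s wm (c^~ t) <= Bc).
Context (fB : forall t, 0 <= t <= N%:R * tau -> nrm s wm (f^~ t) <= Bf).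
Context (fE : forall t, 0 <= t <= N%:R * tau ->
  nrm s w (fun l => f l t - mv v (c^~ t) l) <= eta).

(* The integral of e^{i s d} over the step, centred at 0. *)
Definition phi_step (d : R) : R := if d == 0 then tau else 2 * sin (tau * d / 2) / d.

Context (HG : forall x : I -> R[i],
  N2 s (fun l => w l * \sum_(k <- s) `|gam l k| * cmodulus (v l k) * cmodulus (x k)) <=
  Cg * tau * nrm s wm x).
Context (gam_hp : forall l k, l \in s -> k \in s -> hp l k -> gam l k = 0).
Context (gam_cancel : forall l k, l \in s -> k \in s -> ~~ hp l k ->
  phi_step (A l - A k) - tau = 2 * tau * sin (tau * (A l - A k) / 2) * gam l k).
Context (hpB : forall t, 0 <= t <= N%:R * tau ->
  N2 s (fun l => w l * \sum_(k <- s) (hp l k)%:R * cmodulus (v l k) * cmodulus (c k t)) <= rho).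
Context (uS : forall n l, l \in s -> u n.+1 l =
  expi ((0 - tau / 2) * A l) *
    mv (E (eps * tau)) (fun k => expi ((0 - tau / 2) * A k) * u n k) l).

Let Gam (x : I -> R[i]) : I -> R[i] := mv (fun l k => (gam l k)%:C * v l k) x.

(* Normal form: the correction [eps * tau * Gam] absorbs the first-order defect of the low frequency pairs. *)
Let ct n l : R[i] := c l (n%:R * tau) + (eps * tau)%:C * Gam (c^~ (n%:R * tau)) l.

Let Gam_le (ph : I -> I -> R[i]) x :
  (forall l k, l \in s -> k \in s -> cmodulus (ph l k) <= 1) ->
  nrm s w (mv (fun l k => ph l k * ((gam l k)%:C * v l k)) x) <= Cg * tau * nrm s wm x.
Proof.
move=> hph; apply: le_trans (HG x); apply: nrm_kernel => // l k ls ks.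
by rewrite !cmodM cmodR ler_piMl ?mulr_ge0 ?cmod_ge0 ?hph.
Qed.

Let Gam_le1 x : nrm s w (Gam x) <= Cg * tau * nrm s wm x.
Proof.
rewrite (@eq_nrm _ _ _ _ _ (mv (fun l k => 1 * ((gam l k)%:C * v l k)) x)).
  by apply: Gam_le => *; rewrite cmod1.
by move=> l _; apply: eq_bigr => k _; rewrite mul1r.
Qed.

Let Phi (l k : I) (r : R) : R[i] :=
  if A l - A k == 0 then r%:C else
  (expi ((r - tau / 2) * (A l - A k)) - expi ((0 - tau / 2) * (A l - A k))) /
  (ci * (A l - A k)%:C).

Let cineq0 (d : R) : d != 0 -> ci * d%:C != 0.
Proof.
move=> d0; apply/eqP => /(congr1 (fun z => cmodulus z)).
by rewrite cmodM cmodi cmod0 cmodR mul1r => /eqP; rewrite normr_eq0 (negbTE d0).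
Qed.

Let Phid l k r : is_cderive (Phi l k) r (expi ((r - tau / 2) * (A l - A k))).
Proof.
rewrite /Phi; have [->|d0] := eqVneq (A l - A k) 0.
  rewrite mulr0 expi0; exact: is_cderive_real (is_derive_id r (1 : R)).
set d := A l - A k in d0 *.
have h1 : is_derive r (1 : R) (fun r => (r - tau / 2) * d) d.
  apply: (is_derive_ext (is_derive_affine d (- (tau / 2 * d)) r)) => // y.
  by ring.
apply: (is_cderive_ext (is_cderiveMr ((ci * d%:C)^-1) (is_cderiveB (is_cderive_expi h1)
   (is_cderive_cst (expi ((0 - tau / 2) * d)) r)))) => //.
by rewrite subr0 imE mulrAC mulfV ?cineq0// mul1r.
Qed.

Let sinE (x : R) : expi x - expi (- x) = ci * (2 * sin x)%:C :> R[i].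
Proof.
by apply: complex_eq; rewrite ?cReB ?cImB ?cReM ?cImM /= ?cosN ?sinN; ring.
Qed.

Let Phitau l k : Phi l k tau = (phi_step (A l - A k))%:C.
Proof.
rewrite /Phi /phi_step; have [//|d0] := eqVneq (A l - A k) 0.
rewrite (_ : (tau - tau / 2) * _ = tau * (A l - A k) / 2); last by field.
rewrite (_ : (0 - tau / 2) * _ = - (tau * (A l - A k) / 2)); last by field.
rewrite sinE; apply: (mulIf (cineq0 d0)); rewrite mulfVK ?cineq0//.
rewrite mulrCA; congr (_ * _); rewrite -rmorphM /=; congr (_%:C); by field.
Qed.

Let abs_sin (x : R) : `|sin x| <= `|x|.
Proof.
have := cmod_expi_sub x 0; rewrite subr0; apply: le_trans.
by apply: le_trans (cmod_Im _); rewrite cImB /= sin0 subr0.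
Qed.

Let phiB d : `|phi_step d - tau| <= 2 * tau.
Proof.
rewrite /phi_step; have [_|d0] := eqVneq d 0.
  by rewrite subrr normr0 mulr_ge0// ltW.
apply: (le_trans (ler_normB _ _)).
have -> : 2 * tau = tau + tau by ring.
rewrite (gtr0_norm tau0) lerD2r.
rewrite normrM normfV ler_pdivrMr ?normr_gt0// normrM ger0_norm//.
apply: (le_trans (ler_wpM2l _ (abs_sin _))) => //.
rewrite !normrM normfV !(ger0_norm (ler0n _ _)) (gtr0_norm tau0).
by rewrite le_eqVlt; apply/orP; left; apply/eqP; field.
Qed.

Definition C4 : R := C3 + Cg * Bf + CE * Cg * Bc + 2.

Let etT : (0 < N)%N -> eps * tau <= T.
Proof.
move=> N0; apply: le_trans NT; rewrite ler_wpM2l ?(ltW eps0)//.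
by rewrite ler_peMl ?(ltW tau0)// ler1n.
Qed.

Let S (x : I -> R[i]) l := expi ((0 - tau / 2) * A l) *
    mv (E (eps * tau)) (fun k => expi ((0 - tau / 2) * A k) * x k) l.

Let C40 : 0 <= C4.
Proof.
have h1 := C3_ge0; have h2 : 0 <= Cg * Bf by rewrite mulr_ge0.
have h3 : 0 <= CE * Cg * Bc by rewrite !mulr_ge0 ?CE_ge0.
by rewrite /C4; lra.
Qed.

(** In the midpoint frame the correction carries the phases [ht l * hm k] at the end of the step and
    [hm l * ht k] at its start. Their difference is i times 2 sin (tau d / 2), the factor that
    [gam_cancel] pairs with [gam]; this is how the first-order defect of the low pairs
    disappears. *)
Let step n : (n < N)%N -> nrm s w (fun l => ct n.+1 l - S (ct n) l) <=
  C4 * (eps * tau * (eta + eps * tau ^+ 2 + rho)).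
Proof.
move=> nN; have N0 : (0 < N)%N by exact: leq_ltn_trans nN.
have t00 := ltW tau0; have e00 := ltW eps0.
pose t0 := n%:R * tau.
have t0n : 0 <= t0 by rewrite mulr_ge0.
have tS : t0 + tau = n.+1%:R * tau by rewrite /t0 -natr1; ring.
have tN : t0 + tau <= N%:R * tau by rewrite tS ler_wpM2r// ler_nat.
have sub t : t0 <= t <= t0 + tau -> 0 <= t <= N%:R * tau.
  by move=> /andP[h1 h2]; rewrite (le_trans t0n h1) (le_trans h2 tN).
have cc1 l : l \in s -> ccont (c l) t0 (t0 + tau).
  move=> ls; have [c1 c2] := cc ls.
  by split; [apply: continuous_subspaceW c1|apply: continuous_subspaceW c2];
     move=> x /=; rewrite !in_itv/=; exact: sub.
have cd1 l t : l \in s -> t0 < t < t0 + tau ->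
    is_cderive (c l) t (- ci * (A l)%:C * c l t - ci * eps%:C * f l t).
  move=> ls /andP[h1 h2]; apply: cd => //.
  by rewrite (le_lt_trans t0n h1) (lt_le_trans h2 tN).
have cB1 t : t0 <= t <= t0 + tau -> nrm s wm (c^~ t) <= Bc by move/sub; exact: cB.
have fB1 t : t0 <= t <= t0 + tau -> nrm s wm (f^~ t) <= Bf by move/sub; exact: fB.
have fE1 t : t0 <= t <= t0 + tau -> nrm s w (fun l => f l t - mv v (c^~ t) l) <= eta.
  by move/sub; exact: fE.
have Phi0 l k : Phi l k 0 = 0.
  by rewrite /Phi; case: ifP => // _; rewrite subrr mul0r.
have ld := local_defect eps0 eps1 tau0 (etT N0) eta0 cc1 cd1 cB1 fB1 fE1 Phid Phi0.
have lip := mid_frame_lip eps0 cc1 cd1 fB1 (r := tau).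
pose Z := mid_frame tau t0 c; pose z0 k := Z k 0.
pose ht l : R[i] := expi ((tau - tau / 2) * A l).
pose hm l : R[i] := expi ((0 - tau / 2) * A l).
have hthm l : ht l * hm l = 1.
  rewrite -expiD -mulrDl (_ : tau - tau / 2 + (0 - tau / 2) = 0) ?mul0r ?expi0//.
  by field.
have Ztau l : Z l tau = ht l * c l (t0 + tau) by [].
have Z0 l : z0 l = hm l * c l t0 by rewrite /z0 /Z /mid_frame addr0.
have hsin l k : ht l * hm k - hm l * ht k = ci * (2 * sin (tau * (A l - A k) / 2))%:C.
  rewrite -sinE -!expiD; congr (expi _ - expi _); by field.
pose q l := hm l * Gam (c^~ t0) l.
have qB : nrm s w q <= Cg * tau * Bc.
  rewrite nrm_expi; apply: (le_trans (Gam_le1 _)); rewrite ler_wpM2l ?mulr_ge0//.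
  by apply: cB1; rewrite lexx lerDl.
(* Multiplication by the unimodular [ht l] moves the defect to the midpoint frame. *)
rewrite (@eq_nrm_cmod _ _ _ _ _ (fun l => ht l * (ct n.+1 l - S (ct n) l))); last first.
  by move=> l _; rewrite cmodM cmod_expi mul1r.
(* Four parts: the remainder of [local_defect], the untreated pairs, the drift of the solution
   inside the correction, and E - 1 acting on the correction. The last two are of order eps^2 tau^3
   because [gam] contributes a factor tau. *)
rewrite (@eq_nrm _ _ _ _ _ (fun l => (((Z l tau - mv (E (eps * tau)) z0 l +
     ci * eps%:C * \sum_(k <- s) v l k * (Phi l k tau - tau%:C) * z0 k) +
   (- ci * eps%:C) * mv (fun l k => ((hp l k)%:R * (phi_step (A l - A k) - tau))%:C * v l k) z0 l) +
   (eps * tau)%:C * mv (fun l k => (ht l * hm k) * ((gam l k)%:C * v l k)) (fun k => Z k tau - z0 k) l) -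
   (eps * tau)%:C * (mv (E (eps * tau)) q l - q l))); last first.
  move=> l ls; rewrite mulrBr /S mulrA hthm mul1r.
  have -> : mv (E (eps * tau)) (fun k => expi ((0 - tau / 2) * A k) * ct n k) l =
     mv (E (eps * tau)) z0 l + (eps * tau)%:C * mv (E (eps * tau)) q l.
    rewrite /mv [in RHS]mulr_sumr -big_split /=; apply: eq_bigr => k _.
    by rewrite Z0 /q /ct -/t0 -/(hm k); ring.
  have -> : ht l * ct n.+1 l = Z l tau +
     (eps * tau)%:C * mv (fun l k => (ht l * hm k) * ((gam l k)%:C * v l k)) (Z^~ tau) l.
    rewrite /ct -tS Ztau mulrDr; congr (_ + _); rewrite mulrCA; congr (_ * _).
    rewrite /Gam /mv mulr_sumr; apply: eq_bigr => k _; rewrite Ztau.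
    transitivity (ht l * ((gam l k)%:C * v l k * c k (t0 + tau)) * (ht k * hm k)).
      by rewrite hthm mulr1.
    by ring.
  have qE : q l = mv (fun l k => (hm l * ht k) * ((gam l k)%:C * v l k)) z0 l.
    rewrite /q /Gam /mv mulr_sumr; apply: eq_bigr => k _; rewrite Z0.
    transitivity (hm l * ((gam l k)%:C * v l k * c k t0) * (ht k * hm k)).
      by rewrite hthm mulr1.
    by ring.
  (* The first-order defect, without the untreated pairs, equals the change of the correction over
     the step with the solution frozen at z0. *)
  have key : ci * eps%:C * (\sum_(k <- s) v l k * (Phi l k tau - tau%:C) * z0 k) -
     ci * eps%:C * mv (fun l k => ((hp l k)%:R * (phi_step (A l - A k) - tau))%:C * v l k) z0 l =
     (eps * tau)%:C * (mv (fun l k => (ht l * hm k) * ((gam l k)%:C * v l k)) z0 l - q l).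
    rewrite qE /mv -mulrBr -!sumrB !mulr_sumr.
    rewrite big_seq [RHS]big_seq; apply: eq_bigr => k ks.
    rewrite -mulrBl -!mulrBl hsin Phitau.
    have [h|h] := boolP (hp l k).
      by rewrite (gam_hp ls ks h) mul1r rmorphB /=; ring.
    have gc := gam_cancel ls ks h.
    rewrite mul0r [in LHS]mul0r subr0 -[_%:C - _%:C]rmorphB gc !rmorphM /=; ring.
  rewrite (mvB _ (Z^~ tau) z0); move: key; rewrite /mv.
  set X1 := \sum_(k <- s) v l k * _ * _; set X2 := \sum_(k <- s) _ * v l k * _.
  set X3 := \sum_(k <- s) _ * _ * z0 k.
  set X4 := \sum_(k <- s) _ * _ * Z k tau => key.
  have -> : - ci * eps%:C * X2 = (eps * tau)%:C * (X3 - q l) - ci * eps%:C * X1.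
    by rewrite -key; ring.
  by ring.
have b2 : nrm s w (fun l => (- ci * eps%:C) *
    mv (fun l k => ((hp l k)%:R * (phi_step (A l - A k) - tau))%:C * v l k) z0 l) <=
    eps * (2 * tau * rho).
  rewrite nrmZ cmodM cmodN cmodi mul1r cmodR gtr0_norm// ler_wpM2l//.
  apply: (@le_trans _ _ (N2 s (fun l => w l * \sum_(k <- s)
      (2 * tau * ((hp l k)%:R * cmodulus (v l k))) * cmodulus (z0 k)))).
    apply: nrm_kernel => // l k ls ks.
    rewrite cmodM cmodR normrM ger0_norm ?ler0n// mulrA ler_wpM2r ?cmod_ge0//.
    by rewrite [leRHS]mulrC ler_wpM2l.
  rewrite (@eq_N2 _ _ _ _ (fun l => (2 * tau) * (w l * \sum_(k <- s)
      (hp l k)%:R * cmodulus (v l k) * cmodulus (c k t0)))); last first.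
    move=> l _; rewrite mulrCA; congr (_ * _); rewrite mulr_sumr; apply: eq_bigr => k _.
    by rewrite Z0 [cmodulus (hm k * _)]cmodM cmod_expi mul1r !mulrA.
  rewrite N2_scale ger0_norm ?mulr_ge0// ler_wpM2l ?mulr_ge0//.
  by apply: hpB; apply: sub; rewrite lexx lerDl.
have b3 : nrm s w (fun l => (eps * tau)%:C *
    mv (fun l k => (ht l * hm k) * ((gam l k)%:C * v l k)) (fun k => Z k tau - z0 k) l) <=
    eps * tau * (Cg * tau * (Bf * (eps * tau))).
  rewrite nrmZ cmodR ger0_norm ?mulr_ge0// ler_wpM2l ?mulr_ge0//.
  apply: (le_trans (Gam_le _ _)); first by move=> *; rewrite cmodM !cmod_expi mulr1.
  by rewrite ler_wpM2l ?mulr_ge0//; apply: lip; rewrite t00 lexx.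
have b4 : nrm s w (fun l => (eps * tau)%:C * (mv (E (eps * tau)) q l - q l)) <=
    eps * tau * (CE * (eps * tau) * (Cg * tau * Bc)).
  rewrite nrmZ cmodR ger0_norm ?mulr_ge0// ler_wpM2l ?mulr_ge0//.
  apply: (le_trans (E_lip _ _)); first by rewrite etT// mulr_ge0.
  by rewrite ler_wpM2l ?mulr_ge0 ?CE_ge0.
apply: (le_trans (nrmBle w_ge0 (nrmDle w_ge0 (nrmDle w_ge0 ld b2) b3) b4)).
have [x0 x1 x2 x3] : [/\ 0 <= C3, 0 <= Cg * Bf, 0 <= CE * Cg * Bc & 0 <= eps * tau].
  by rewrite !mulr_ge0 ?C3_ge0 ?CE_ge0.
have y1 : 0 <= (eps * tau) * eta by rewrite mulr_ge0.
have y2 : 0 <= (eps * tau) * rho by rewrite mulr_ge0.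
have y3 : 0 <= (eps * tau) * (eps * tau ^+ 2) by rewrite !mulr_ge0 ?sqr_ge0.
set a1 := (eps * tau) * eta in y1; set a2 := (eps * tau) * rho in y2.
set a3 := (eps * tau) * (eps * tau ^+ 2) in y3.
have z1 : 0 <= C3 * a2 by rewrite mulr_ge0.
have z2 : 0 <= Cg * Bf * a1 by rewrite mulr_ge0.
have z3 : 0 <= Cg * Bf * a2 by rewrite mulr_ge0.
have z4 : 0 <= CE * Cg * Bc * a1 by rewrite mulr_ge0.
have z5 : 0 <= CE * Cg * Bc * a2 by rewrite mulr_ge0.
have -> : C4 * (eps * tau * (eta + eps * tau ^+ 2 + rho)) = C4 * (a1 + a3 + a2).
  by rewrite /a1 /a2 /a3; ring.
have -> : eps * tau * eta + eps ^+ 2 * tau ^+ 3 = a1 + a3 by rewrite /a1 /a3; ring.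
have -> : eps * (2 * tau * rho) = 2 * a2 by rewrite /a2; ring.
have -> : eps * tau * (Cg * tau * (Bf * (eps * tau))) = Cg * Bf * a3 by rewrite /a3; ring.
have -> : eps * tau * (CE * (eps * tau) * (Cg * tau * Bc)) = CE * Cg * Bc * a3.
  by rewrite /a3; ring.
by rewrite /C4; clearbody a1 a2 a3; lra.
Qed.

(** The free half steps are isometries for every weight, so only E - 1 = O(eps tau) enters. *)
Let Sstab x : (0 < N)%N -> nrm s w (S x) <= (1 + CE * (eps * tau)) * nrm s w x.
Proof.
move=> N0; rewrite /S nrm_expi; set y := (fun k => _ * x k).
have -> : nrm s w x = nrm s w y by rewrite nrm_expi.
rewrite (@eq_nrm _ _ _ _ _ (fun l => (mv (E (eps * tau)) y l - y l) + y l)); last first.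
  by move=> l _; rewrite subrK.
rewrite mulrDl mul1r addrC; apply: nrmDle => //; first apply: E_lip.
by rewrite etT// mulr_ge0 ?ltW.
Qed.

Let SB x y l : S x l - S y l = S (fun k => x k - y k) l.
Proof.
rewrite /S -mulrBr -mvB; congr (_ * _); apply: eq_bigr => k _; congr (_ * _); ring.
Qed.

(** The scheme is compared with the corrected solution [ct]. The correction is inserted at time 0
    and removed at time n tau, each at the cost Cg Bc eps tau^2. The amplification r^n stays below
    e^(CE T) since n eps tau <= T. *)
Lemma nrm_splitting_error n : (n <= N)%N ->
  nrm s w (fun l => c l (n%:R * tau) - u n l) <=
  expR (CE * T) * (nrm s w (fun l => c l 0 - u 0%N l) + Cg * Bc * (eps * tau ^+ 2)
     + C4 * T * (eta + eps * tau ^+ 2 + rho)) + Cg * Bc * (eps * tau ^+ 2).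
Proof.
have t00 := ltW tau0; have e00 := ltW eps0.
set D := eta + eps * tau ^+ 2 + rho.
have D0 : 0 <= D by rewrite !addr_ge0 ?mulr_ge0 ?sqr_ge0.
set X0 := nrm s w (fun l => c l 0 - u 0%N l).
have ctc k : (k <= N)%N -> nrm s w (fun l => ct k l - c l (k%:R * tau)) <= Cg * Bc * (eps * tau ^+ 2).
  move=> kN; rewrite (@eq_nrm _ _ _ _ _ (fun l => (eps * tau)%:C * Gam (c^~ (k%:R * tau)) l)); last first.
    by move=> l _; rewrite /ct [c _ _ + _]addrC addrK.
  rewrite nrmZ cmodR ger0_norm ?mulr_ge0//.
  have -> : Cg * Bc * (eps * tau ^+ 2) = eps * tau * (Cg * tau * Bc) by ring.
  rewrite ler_wpM2l ?mulr_ge0//; apply: (le_trans (Gam_le1 _)).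
  rewrite ler_wpM2l ?mulr_ge0//; apply: cB.
  by rewrite mulr_ge0//= ler_wpM2r// ler_nat.
set r := 1 + CE * (eps * tau).
have r1 : 1 <= r by rewrite lerDl mulr_ge0 ?CE_ge0// mulr_ge0.
have key k : (k <= N)%N -> nrm s w (fun l => ct k l - u k l) <=
    r ^+ k * (X0 + Cg * Bc * (eps * tau ^+ 2) + k%:R * (C4 * (eps * tau * D))).
  elim: k => [|k ih] kN.
    rewrite expr0 mul1r mul0r addr0 addrC.
    rewrite (@eq_nrm _ _ _ _ _ (fun l => (ct 0 l - c l (0%:R * tau)) + (c l 0 - u 0%N l))); last first.
      by move=> l _; rewrite mul0r addrA subrK.
    by apply: nrmDle => //; exact: ctc.
  rewrite (@eq_nrm _ _ _ _ _ (fun l => (ct k.+1 l - S (ct k) l) +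
     S (fun j => ct k j - u k j) l)); last first.
    by move=> l ls; rewrite -SB (uS _ ls) addrA subrK.
  have N0 : (0 < N)%N by exact: leq_trans kN.
  apply: (le_trans (nrmDle w_ge0 (step kN) (Sstab _ N0))).
  rewrite -/r -/D.
  have {}ih := ih (ltnW kN).
  have r0 : 0 <= r by exact: le_trans r1.
  have := ler_wpM2l r0 ih; rewrite [r * (r ^+ k * _)]mulrA -exprS => h.
  rewrite -[k.+1%:R]natr1; set d := C4 * (eps * tau * D).
  have d0 : 0 <= d by rewrite mulr_ge0// mulr_ge0// mulr_ge0.
  apply: (le_trans (lerD (lexx d) h)); rewrite -/d.
  have : 1 * d <= r ^+ k.+1 * d by rewrite ler_wpM2r// exprn_ege1.
  by move: (r ^+ k.+1) => rk; clearbody d; move=> h'; lra.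
move=> nN.
rewrite (@eq_nrm _ _ _ _ _ (fun l => (ct n l - u n l) - (ct n l - c l (n%:R * tau)))); last first.
  by move=> l _; ring.
apply: nrmBle => //; last exact: ctc.
apply: (le_trans (key _ nN)).
have XB : 0 <= X0 + Cg * Bc * (eps * tau ^+ 2).
  by rewrite addr_ge0 ?nrm_ge0// !mulr_ge0 ?sqr_ge0.
have ntT : n%:R * (eps * tau) <= T.
  apply: le_trans NT; rewrite mulrCA ler_wpM2l// ler_wpM2r// ler_nat//.
apply: ler_pM.
- by rewrite exprn_ge0// (le_trans _ r1).
- by rewrite addr_ge0// !mulr_ge0.
- apply: (@le_trans _ _ (expR (CE * (eps * tau)) ^+ n)).
    rewrite lerXn2r ?nnegrE ?expR_ge0// ?(le_trans _ r1)//.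
    exact: expR_ge1Dx.
  rewrite -expRM_natl ler_expR; apply: (@le_trans _ _ (CE * (n%:R * (eps * tau)))).
    by rewrite -mulr_natl; lra.
  by rewrite ler_wpM2l ?CE_ge0.
- rewrite lerD2l (_ : n%:R * (C4 * (eps * tau * D)) = (C4 * D) * (n%:R * (eps * tau))); last by ring.
  by rewrite (_ : C4 * T * D = (C4 * D) * T) ?ler_wpM2l ?mulr_ge0//; ring.
Qed.

End many_steps.
End core.

(** * Frequency windows and weights *)

Section lattice.
Context {R : realType}.
Implicit Types (l k : int).

Definition win (M : nat) : seq int := [seq (j%:Z - M%:Z)%R | j <- iota 0 (M.*2).+1].

Lemma mem_win M l : (l \in win M) = (`|l| <= M%:Z).
Proof.
apply/mapP/idP => [[j]|lM].
  by rewrite mem_iota add0n => /andP[_ h] ->; move: h; lia.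
exists (absz (l + M%:Z)); first by rewrite mem_iota; lia.
by lia.
Qed.

Lemma uniq_win M : uniq (win M).
Proof. by rewrite map_inj_uniq ?iota_uniq// => i j h; lia. Qed.

Definition modes (N : nat) : seq int := [seq mode N j | j <- iota 0 N].

Lemma uniq_modes N : uniq (modes N).
Proof. by rewrite map_inj_uniq ?iota_uniq// => i j; rewrite /mode => h; lia. Qed.

Lemma mem_modes N l : ~~ odd N -> (l \in modes N) = (- N%:Z <= 2 * l < N%:Z).
Proof.
move=> oN; have NE : N = (N./2).*2 by rewrite -[LHS]odd_double_half (negbTE oN).
apply/mapP/idP => [[j]|lN].
  by rewrite mem_iota add0n => /andP[_ h] ->; rewrite /mode; lia.
exists (absz (l + (N./2)%:Z)); first by rewrite mem_iota; lia.
by rewrite /mode; lia.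
Qed.

Lemma big_modesC N (F : int -> R[i]) : \sum_(k < N) F (mode N k) = \sum_(k <- modes N) F k.
Proof. by rewrite big_map -(big_mkord xpredT (fun j : nat => F (mode N j))) /index_iota subn0. Qed.

(* The representative of [l] modulo [N] in the window of modes; it has minimal modulus in its class. *)
Definition rep (N : nat) l : int := ((l + (N./2)%:Z) %% N%:Z)%Z - (N./2)%:Z.

Lemma rep_eq N l : exists p : int, rep N l = l + p * N%:Z.
Proof.
exists (- ((l + (N./2)%:Z) %/ N%:Z)%Z); rewrite /rep.
have := divz_eq (l + (N./2)%:Z) N%:Z; lia.
Qed.

Lemma rep_modes N l : (0 < N)%N -> ~~ odd N -> rep N l \in modes N.
Proof.
move=> N0 oN; rewrite mem_modes//.
have NE : N = (N./2).*2 by rewrite -[LHS]odd_double_half (negbTE oN).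
have h1 : (0 <= (l + (N./2)%:Z) %% N%:Z)%Z by rewrite modz_ge0; lia.
have h2 : ((l + (N./2)%:Z) %% N%:Z < N%:Z)%Z by rewrite ltz_pmod; lia.
by rewrite /rep; lia.
Qed.

Lemma modes_eq N l k p : ~~ odd N -> l \in modes N -> k \in modes N ->
  l = k + p * N%:Z -> l = k.
Proof. by move=> oN; rewrite !mem_modes// => h1 h2 h; have [p0|] := eqVneq p 0; nia. Qed.

Lemma rep_id N l : (0 < N)%N -> ~~ odd N -> l \in modes N -> rep N l = l.
Proof.
move=> N0 oN lN; have [p hp] := rep_eq N l.
exact: (modes_eq oN (rep_modes l N0 oN) lN hp).
Qed.

Lemma rep_addM N l p : (0 < N)%N -> ~~ odd N -> rep N (l + p * N%:Z) = rep N l.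
Proof.
move=> N0 oN; have [q hq] := rep_eq N l; have [q' hq'] := rep_eq N (l + p * N%:Z).
apply: (@modes_eq N _ _ (q' + p - q) oN (rep_modes _ N0 oN) (rep_modes _ N0 oN)).
by rewrite hq hq'; ring.
Qed.

Lemma rep_min N l p : (0 < N)%N -> ~~ odd N -> `|rep N l| <= `|l + p * N%:Z|.
Proof.
move=> N0 oN; have [q hq] := rep_eq N l.
have := rep_modes l N0 oN; rewrite mem_modes//.
have -> : l + p * N%:Z = rep N l + (p - q) * N%:Z by rewrite hq; ring.
move: (rep N l) (p - q) => r t h; have [->|] := eqVneq t 0; first by rewrite mul0r addr0.
by nia.
Qed.

Lemma rep_add_le N l k : (0 < N)%N -> ~~ odd N ->
  `|rep N (l + k)| <= `|rep N l| + `|rep N k|.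
Proof.
move=> N0 oN; have [q hq] := rep_eq N l; have [q' hq'] := rep_eq N k.
apply: le_trans (ler_normD _ _); have := rep_min (l + k) (q + q') N0 oN.
by rewrite hq hq' (_ : l + q * _ + (k + _) = l + k + (q + q') * N%:Z) //; ring.
Qed.

Lemma rep_opp_le N l : (0 < N)%N -> ~~ odd N -> `|rep N (- l)| <= `|rep N l|.
Proof.
move=> N0 oN; have [q hq] := rep_eq N l.
have := rep_min (- l) (- q) N0 oN.
by rewrite hq (_ : - l + - q * _ = - (l + q * N%:Z)) ?normrN//; ring.
Qed.

(** The modulus of the representative is subadditive and even, like a norm on Z / N, and this is its
    reverse triangle inequality. It makes l^2 - k^2 controllable by the aliased index l - k. *)
Lemma rep_dist N l k : (0 < N)%N -> ~~ odd N -> l \in modes N -> k \in modes N ->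
  `| `|l| - `|k| | <= `|rep N (l - k)|.
Proof.
move=> N0 oN lN kN.
have h1 := rep_add_le (l - k) k N0 oN.
have h2 := rep_add_le (k - l) l N0 oN.
have h3 := rep_opp_le (l - k) N0 oN.
rewrite subrK (rep_id N0 oN lN) (rep_id N0 oN kN) in h1.
rewrite subrK (rep_id N0 oN lN) (rep_id N0 oN kN) in h2.
rewrite opprB in h3; move: h1 h2 h3.
move: `|rep N (l - k)| `|rep N (k - l)| `|l| `|k| => x y z t h1 h2 h3.
rewrite ler_norml; apply/andP; split; lia.
Qed.

Lemma perm_rep_sub N k : (0 < N)%N -> ~~ odd N ->
  perm_eq [seq rep N (l - k) | l <- modes N] (modes N).
Proof.
move=> N0 oN; apply: uniq_perm; [|exact: uniq_modes|].
  rewrite map_inj_in_uniq ?uniq_modes// => l l' lN l'N h.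
  have [q hq] := rep_eq N (l - k); have [q' hq'] := rep_eq N (l' - k).
  by apply: (@modes_eq N _ _ (q' - q) oN lN l'N); move: h; rewrite hq hq'; lia.
move=> j; apply/mapP/idP => [[l _ ->]|jN]; first exact: rep_modes.
exists (rep N (j + k)); first exact: rep_modes.
have [q hq] := rep_eq N (j + k).
rewrite hq (_ : j + k + q * N%:Z - k = j + q * N%:Z); last by ring.
by rewrite rep_addM// rep_id.
Qed.

Lemma perm_rep_subl N l : (0 < N)%N -> ~~ odd N ->
  perm_eq [seq rep N (l - k) | k <- modes N] (modes N).
Proof.
move=> N0 oN; apply: uniq_perm; [|exact: uniq_modes|].
  rewrite map_inj_in_uniq ?uniq_modes// => k k' lN l'N h.
  have [q hq] := rep_eq N (l - k); have [q' hq'] := rep_eq N (l - k').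
  by apply: (@modes_eq N _ _ (q - q') oN lN l'N); move: h; rewrite hq hq'; lia.
move=> j; apply/mapP/idP => [[k _ ->]|jN]; first exact: rep_modes.
exists (rep N (l - j)); first exact: rep_modes.
have [q hq] := rep_eq N (l - j).
rewrite hq (_ : l - (l - j + q * N%:Z) = j + (- q) * N%:Z); last by ring.
by rewrite rep_addM// rep_id.
Qed.

Lemma sum_rep_sub N k (F : int -> R) : (0 < N)%N -> ~~ odd N ->
  (forall l, F (rep N l) = F l) ->
  \sum_(l <- modes N) F (l - k) = \sum_(l <- modes N) F l.
Proof.
move=> N0 oN hF; transitivity (\sum_(l <- [seq rep N (l - k) | l <- modes N]) F l).
  by rewrite [RHS]big_map; apply: eq_bigr => l _; rewrite hF.
exact: perm_big (perm_rep_sub k N0 oN).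
Qed.

Lemma sum_rep_subl N l (F : int -> R) : (0 < N)%N -> ~~ odd N ->
  (forall l, F (rep N l) = F l) ->
  \sum_(k <- modes N) F (l - k) = \sum_(k <- modes N) F k.
Proof.
move=> N0 oN hF; transitivity (\sum_(k <- [seq rep N (l - k) | k <- modes N]) F k).
  by rewrite [RHS]big_map; apply: eq_bigr => k _; rewrite hF.
exact: perm_big (perm_rep_subl l N0 oN).
Qed.

Lemma ler_sum_subset {T : eqType} (s t : seq T) (F : T -> R) : uniq s ->
  {subset s <= t} -> (forall z, z \in t -> 0 <= F z) ->
  \sum_(z <- s) F z <= \sum_(z <- t) F z.
Proof.
elim: s t => [|x s ih] t /=.
  by move=> _ _ h; rewrite big_nil big_seq sumr_ge0.
move=> /andP[xs us] st F0.
have xt : x \in t by apply: st; rewrite mem_head.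
rewrite big_cons (perm_big _ (perm_to_rem xt)) big_cons lerD2l; apply: ih => //.
  move=> y ys; have yx : y != x by apply: contraNneq xs => <-.
  have := st y; rewrite inE ys orbT => /(_ isT); rewrite (perm_mem (perm_to_rem xt)) inE.
  by rewrite (negbTE yx).
by move=> y /mem_rem; exact: F0.
Qed.

(* Equivalent to (1 + mu_l^2)^(1/2) for mu = mu_1, and submultiplicative. *)
Definition om (mu : R) l : R := 1 + mu * `|l%:~R|.

Section weights.
Context (mu : R) (mu0 : 0 < mu).
Local Notation om := (om mu).

Lemma om_ge1 l : 1 <= om l.
Proof. by rewrite lerDl mulr_ge0// ltW. Qed.

Lemma om_gt0 l : 0 < om l.
Proof. exact: lt_le_trans (om_ge1 l). Qed.

Lemma om_ge0 l : 0 <= om l.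
Proof. exact: ltW (om_gt0 l). Qed.

Lemma omX_ge0 l p : 0 <= om l ^+ p.
Proof. by rewrite exprn_ge0// om_ge0. Qed.

Lemma om_absE l k : `|l| = `|k| -> om l = om k.
Proof. by move=> h; rewrite /om -!intr_norm h. Qed.

Lemma om_le l k : `|l| <= `|k| -> om l <= om k.
Proof. by move=> h; rewrite lerD2l ler_pM2l// -!intr_norm ler_int. Qed.

Lemma omD l k : om (l + k) <= om l * om k.
Proof.
rewrite /om intrD; have := ler_normD (l%:~R : R) k%:~R => h.
have : 0 <= mu ^+ 2 * `|l%:~R| * `|k%:~R| :> R by rewrite !mulr_ge0 ?exprn_ge0 ?(ltW mu0).
have : mu * `|l%:~R + k%:~R| <= mu * (`|l%:~R| + `|k%:~R|) by rewrite ler_pM2l.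
rewrite mulrDl mul1r; move: (`|l%:~R + _|) (`|l%:~R|) (`|k%:~R|) => x y z; nra.
Qed.

Lemma omD_le l k j : `|l| <= `|j| + `|k| -> om l <= om j * om k.
Proof.
move=> h; apply: (@le_trans _ _ (om (`|j| + `|k|))).
  by apply: om_le; rewrite [leRHS]ger0_norm// addr_ge0.
by apply: (le_trans (omD _ _)); rewrite (@om_absE `|j| j) ?(@om_absE `|k| k) ?normr_id.
Qed.

Lemma omX_le_max l k j p : `|l| <= `|j| + `|k| -> om l ^+ p <= 2 ^+ p * (om j ^+ p + om k ^+ p).
Proof.
move=> h.
have ho : om l <= om j + om k.
  rewrite /om; move: h; rewrite -(ler_int R) intrD !intr_norm => h.
  have : mu * `|l%:~R| <= mu * (`|j%:~R| + `|k%:~R|) by rewrite ler_pM2l.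
  by rewrite mulrDr; lra.
have [jk|/ltW kj] := leP (om j) (om k).
- apply: (@le_trans _ _ ((2 * om k) ^+ p)).
    by apply: lerXn2r; rewrite ?nnegrE ?mulr_ge0 ?om_ge0//; apply: (le_trans ho); lra.
  by rewrite exprMn ler_wpM2l ?exprn_ge0// lerDr omX_ge0.
- apply: (@le_trans _ _ ((2 * om j) ^+ p)).
    by apply: lerXn2r; rewrite ?nnegrE ?mulr_ge0 ?om_ge0//; apply: (le_trans ho); lra.
  by rewrite exprMn ler_wpM2l ?exprn_ge0// lerDl omX_ge0.
Qed.

Lemma omX_mono l p q : (p <= q)%N -> om l ^+ p <= om l ^+ q.
Proof. by move=> pq; rewrite ler_weXn2l// om_ge1. Qed.

(** Telescoping: with x = 1 + mu n one has (x + mu)^-2 <= 1 / (x (x + mu)), which is the difference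
    of 1 / (mu x) and 1 / (mu (x + mu)). *)
Lemma sum_om_nat (M n : nat) :
  \sum_(M <= j < M + n) (1 + mu * j.+1%:R) ^- 2 <=
  (mu * (1 + mu * M%:R))^-1 - (mu * (1 + mu * (M + n)%:R))^-1.
Proof.
have p (j : nat) : 0 < 1 + mu * j%:R by rewrite ltr_pwDl// mulr_ge0// ltW.
elim: n => [|n ih]; first by rewrite addn0 big_geq// subrr.
rewrite addnS big_nat_recr ?leq_addr//=; apply: (le_trans (lerD ih (lexx _))).
have p1 := p (M + n)%N; have p2 := p (M + n).+1.
have e : 1 + mu * (M + n).+1%:R = 1 + mu * (M + n)%:R + mu by rewrite -natr1; ring.
rewrite e in p2 *; move: (1 + mu * (M + n)%:R) p1 p2 => x x0 xm0.
suff : (x + mu) ^- 2 <= (mu * x)^-1 - (mu * (x + mu))^-1 by lra.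
have -> : (mu * x)^-1 - (mu * (x + mu))^-1 = (x * (x + mu))^-1.
  by field; rewrite !gt_eqF.
rewrite lef_pV2 ?posrE ?exprn_gt0 ?mulr_gt0// expr2 ler_pM2r//.
by rewrite lerDl ltW.
Qed.

Lemma sum_om_tail_nat (M : nat) (s : seq nat) : uniq s -> (forall n, n \in s -> (M < n)%N) ->
  \sum_(n <- s) (1 + mu * n%:R) ^- 2 <= (mu * (1 + mu * M%:R))^-1.
Proof.
move=> us hs; pose m := \max_(n <- s) n.
have p (j : nat) : 0 < 1 + mu * j%:R by rewrite ltr_pwDl// mulr_ge0// ltW.
apply: (@le_trans _ _ (\sum_(n <- [seq j.+1 | j <- index_iota M (M + m)]) (1 + mu * n%:R) ^- 2)).
  apply: ler_sum_subset => //; last by move=> *; rewrite invr_ge0 exprn_ge0// ltW.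
  move=> n ns; apply/mapP; exists n.-1.
    rewrite mem_index_iota; have := hs n ns; have : (n <= m)%N by exact: leq_bigmax_seq.
    by move=> *; lia.
  by have := hs n ns; lia.
rewrite big_map; apply: (le_trans (sum_om_nat M m)).
by rewrite gerBl invr_ge0 mulr_ge0 ?ltW.
Qed.

Lemma sum_om_tail (M : nat) (s : seq int) : uniq s -> (forall l, l \in s -> M%:Z < `|l|) ->
  \sum_(l <- s) om l ^- 2 <= 2 * (mu * (1 + mu * M%:R))^-1.
Proof.
move=> us hs; rewrite (bigID (fun l : int => 0 <= l))/= mulr2n mulrDl mul1r.
(* On either half-line the absolute value is injective, so the sum reduces to natural numbers; the
   two half-lines give the factor 2. *)
have aux (P : pred int) : (forall l k, P l -> P k -> absz l = absz k -> l = k) ->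
    \sum_(l <- s | P l) om l ^- 2 <= (mu * (1 + mu * M%:R))^-1.
  move=> Pinj; rewrite -big_filter.
  rewrite (eq_bigr (fun l => (1 + mu * (absz l)%:R) ^- 2)); last first.
    by move=> l _; rewrite /om -intr_norm pmulrn.
  rewrite -(big_map absz xpredT (fun n => (1 + mu * n%:R) ^- 2)).
  apply: sum_om_tail_nat.
    rewrite map_inj_in_uniq ?filter_uniq// => l k.
    by rewrite !mem_filter => /andP[Pl _] /andP[Pk _]; exact: Pinj.
  by move=> n /mapP[l]; rewrite mem_filter => /andP[_ /hs h] ->; lia.
apply: lerD; apply: aux => l k; lia.
Qed.

Lemma sum_om (s : seq int) : uniq s -> \sum_(l <- s) om l ^- 2 <= 1 + 2 / mu.
Proof.
move=> us; rewrite (bigID (pred1 0))/=; apply: lerD.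
  rewrite -big_filter; apply: (@le_trans _ _ (\sum_(l <- [:: 0]) om l ^- 2)).
    apply: ler_sum_subset; first exact: filter_uniq.
      by move=> l; rewrite mem_filter => /andP[/eqP -> _]; rewrite mem_head.
    by move=> *; rewrite invr_ge0 omX_ge0.
  by rewrite big_seq1 /om normr0 mulr0 addr0 expr1n invr1.
rewrite -big_filter; apply: (le_trans (@sum_om_tail 0 _ _ _)).
- exact: filter_uniq.
- by move=> l; rewrite mem_filter => /andP[h _]; lia.
- by rewrite mulr0 addr0 mulr1.
Qed.

(** It bounds the sum of om^-2 and, being at least 1, also the square root of that sum; it is used
    for both. *)
Definition C0 : R := 1 + 2 / mu.

Lemma C0_ge1 : 1 <= C0.
Proof. by rewrite lerDl divr_ge0// ltW. Qed.

Lemma C0_ge0 : 0 <= C0.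
Proof. exact: le_trans C0_ge1. Qed.

Lemma l1_le_N2 (s : seq int) (x : int -> R) : uniq s ->
  \sum_(l <- s) `|x l| <= C0 * N2 s (fun l => om l * x l).
Proof.
move=> us; have := N2_CS s (fun l => (om l)^-1) (fun l => om l * `|x l|).
rewrite (eq_bigr (fun l => `|x l|)); last first.
  by move=> l _; rewrite mulrA mulVf ?mul1r// gt_eqF// om_gt0.
move=> h; apply: (le_trans h); apply: ler_pM; rewrite ?N2_ge0//; last first.
  rewrite -[leRHS]N2_abs; apply: N2_le => l _.
  by rewrite !normrM normr_id.
rewrite N2_leP ?C0_ge0//; under eq_bigr do rewrite exprVn.
apply: (le_trans (sum_om us)); rewrite expr2 ler_peMl ?C0_ge1// C0_ge0//.
Qed.

Lemma l1X_le_N2 (s : seq int) (x : int -> R) (p q : nat) : uniq s -> (p < q)%N ->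
  \sum_(l <- s) om l ^+ p * `|x l| <= C0 * N2 s (fun l => om l ^+ q * x l).
Proof.
move=> us pq; have := l1_le_N2 (fun l => om l ^+ p * x l) us.
rewrite (eq_bigr (fun l => om l ^+ p * `|x l|)); last first.
  by move=> l _; rewrite normrM ger0_norm// omX_ge0.
move=> h; apply: (le_trans h); rewrite ler_wpM2l ?C0_ge0//.
rewrite -[leRHS]N2_abs; apply: N2_le => l _.
rewrite !normrM (ger0_norm (om_ge0 l)) !(ger0_norm (omX_ge0 l _)) mulrA -exprS ler_wpM2r//.
exact: omX_mono.
Qed.

End weights.
End lattice.

(** * Sequences of Sobolev regularity and their convolution *)

Section limits.
Context {R : realType}.

Definition clim (F : nat -> R[i]) (z : R[i]) : Prop :=
  forall e : R, 0 < e -> exists M0 : nat, forall M, (M0 <= M)%N -> cmodulus (F M - z) < e.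

Lemma clim_cst (z : R[i]) : clim (fun=> z) z.
Proof. by move=> e e0; exists 0%N => M _; rewrite subrr cmod0. Qed.

Lemma clim_near F G (z : R[i]) (M1 : nat) : clim F z ->
  (forall M, (M1 <= M)%N -> F M = G M) -> clim G z.
Proof.
move=> h FG e /h[M0 hM]; exists (maxn M0 M1) => M; rewrite geq_max => /andP[h1 h2].
by rewrite -FG// hM.
Qed.

Lemma climD F G (z u : R[i]) : clim F z -> clim G u -> clim (fun M => F M + G M) (z + u).
Proof.
move=> hF hG e e0; have e2 : 0 < e / 2 by rewrite divr_gt0.
have [M1 h1] := hF _ e2; have [M2 h2] := hG _ e2.
exists (maxn M1 M2) => M; rewrite geq_max => /andP[/h1 a1 /h2 a2].
rewrite (_ : _ - _ = (F M - z) + (G M - u)); last by ring.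
by apply: le_lt_trans (cmodD _ _) _; lra.
Qed.

Lemma climMl (c : R[i]) F z : clim F z -> clim (fun M => c * F M) (c * z).
Proof.
move=> hF e e0; have c1 : 0 < cmodulus c + 1 by rewrite ltr_wpDl ?cmod_ge0.
have [M0 h] := hF (e / (cmodulus c + 1)) (divr_gt0 e0 c1).
exists M0 => M /h {}h; rewrite -mulrBr cmodM.
move: h; rewrite ltr_pdivlMr// mulrDr mulr1; have := cmod_ge0 (F M - z); lra.
Qed.

Lemma climN F z : clim F z -> clim (fun M => - F M) (- z).
Proof.
move=> hF e /hF[M0 h]; exists M0 => M /h.
by rewrite -opprD cmodN.
Qed.

Lemma climB F G (z u : R[i]) : clim F z -> clim G u -> clim (fun M => F M - G M) (z - u).
Proof. by move=> hF hG; apply: climD => //; exact: climN. Qed.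

Lemma clim_sum {I : eqType} (s : seq I) (F : I -> nat -> R[i]) (z : I -> R[i]) :
  (forall k, k \in s -> clim (F k) (z k)) ->
  clim (fun M => \sum_(k <- s) F k M) (\sum_(k <- s) z k).
Proof.
elim: s => [|k s ih] h.
  apply: (@clim_near (fun=> 0) _ _ 0%N); first by rewrite big_nil; exact: clim_cst.
  by move=> M _; rewrite big_nil.
rewrite big_cons; apply: (@clim_near (fun M => F k M + \sum_(j <- s) F j M) _ _ 0%N).
  apply: climD; first by apply: h; rewrite mem_head.
  by apply: ih => j js; apply: h; rewrite inE js orbT.
by move=> M _; rewrite big_cons.
Qed.

Lemma clim_le F z (B : R) : clim F z -> (forall M, cmodulus (F M) <= B) -> cmodulus z <= B.
Proof.
move=> hF hB; apply/ler_addgt0Pr => e e0; have [M0 /(_ M0 (leqnn _)) h] := hF _ e0.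
rewrite (_ : z = F M0 - (F M0 - z)); last by ring.
by apply: (le_trans (cmodB _ _)); apply: lerD => //; exact: ltW.
Qed.

Lemma clim_unique F z u : clim F z -> clim F u -> z = u.
Proof.
move=> h1 h2; apply/eqP; rewrite -subr_eq0; apply/eqP/cmod_eq0/eqP.
rewrite eq_le cmod_ge0 andbT.
by apply: (clim_le (climB h1 h2)) => M; rewrite subrr cmod0.
Qed.

Lemma N2_clim {I : eqType} (s : seq I) (w : I -> R) (F : I -> nat -> R[i]) (z : I -> R[i]) (B : R) :
  (forall l, l \in s -> 0 <= w l) ->
  (forall l, l \in s -> clim (F l) (z l)) -> (forall M, nrm s w (F^~ M) <= B) ->
  nrm s w z <= B.
Proof.
move=> w0 hF hB; apply/ler_addgt0Pr => e e0.
pose K := N2 s w + 1.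
have K0 : 0 < K by rewrite ltr_wpDl ?N2_ge0.
have [M hM] : exists M, forall l, l \in s -> cmodulus (F l M - z l) < e / K.
  have : exists M0, forall M, (M0 <= M)%N -> forall l, l \in s -> cmodulus (F l M - z l) < e / K.
    have eK : 0 < e / K by rewrite divr_gt0.
    elim: (s) (fun l => hF l) => [|x t ih] h; first by exists 0%N.
    have [l lt|M1 h1] := ih; first by apply: h; rewrite inE lt orbT.
    have [M2 h2] := h x (mem_head _ _) _ eK.
    exists (maxn M1 M2) => M; rewrite geq_max => /andP[m1 m2] l.
    by rewrite inE => /predU1P[->|lt]; [exact: h2|exact: h1].
  by move=> [M0 h]; exists M0; exact: h.
rewrite (@eq_nrm _ _ _ _ _ (fun l => F l M - (F l M - z l))); last first.
  by move=> l _; ring.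
apply: (nrmBle w0 (hB M)); apply: (@le_trans _ _ (e / K * N2 s w)).
  rewrite -[X in X * _]gtr0_norm ?divr_gt0// -N2_scale -[leRHS]N2_abs.
  apply: N2_le => l ls; rewrite [X in _ <= X]normrM (gtr0_norm (divr_gt0 e0 K0)).
  rewrite !normrM (ger0_norm (cmod_ge0 _)) (ger0_norm (w0 _ ls)) mulrC.
  by rewrite ler_wpM2r ?w0// ltW// hM.
rewrite mulrAC ler_pdivrMr// ler_wpM2l ?(ltW e0)// /K lerDl//.
Qed.

End limits.

(** * Convolution in Sobolev spaces, cyclic convolution on the modes, aliasing *)

Section lattice_bounds.
Context {R : realType} (mu : R) (mu0 : 0 < mu).
Local Notation om_1 := (@om R 1).
Local Notation om := (om mu).
Local Notation C0 := (C0 mu).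
Local Notation wp p := (fun l => om l ^+ p).

(* The H^m norm of the sequence u is at most B. *)
Definition Hbound (m : nat) (u : int -> R[i]) (B : R) : Prop :=
  forall s, uniq s -> nrm s (wp m) u <= B.

Lemma Hbound_ge0 m u B : Hbound m u B -> 0 <= B.
Proof. by move=> /(_ [::] isT); apply: le_trans; exact: nrm_ge0. Qed.

Lemma Hbound_mono m p u B : (p <= m)%N -> Hbound m u B -> Hbound p u B.
Proof.
move=> pm h s us; apply: le_trans (h s us); apply: nrm_le => l _; first exact: omX_ge0.
by rewrite ler_wpM2r ?cmod_ge0// omX_mono.
Qed.

Lemma Hbound_point m u B l : Hbound m u B -> om l ^+ m * cmodulus (u l) <= B.
Proof.
move=> /(_ [:: l] isT); apply: le_trans; rewrite /nrm /N2 big_seq1 sqrtr_sqr.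
exact: ler_norm.
Qed.

Lemma Hbound_l1 m p u B s : (p < m)%N -> Hbound m u B -> uniq s ->
  \sum_(l <- s) om l ^+ p * cmodulus (u l) <= C0 * B.
Proof.
move=> pm h us; rewrite (eq_bigr (fun l => om l ^+ p * `|cmodulus (u l)|)); last first.
  by move=> l _; rewrite (ger0_norm (cmod_ge0 _)).
apply: (le_trans (l1X_le_N2 mu0 _ us pm)); rewrite ler_wpM2l ?C0_ge0//.
exact: h.
Qed.

(* f is the convolution v * c, summed symmetrically. *)
Definition fconv (v c f : int -> R[i]) : Prop :=
  forall l, clim (fun M => \sum_(k <- win M) v (l - k) * c k) (f l).

(** H^m is an algebra: om_l^m is distributed on the two factors. The part with all derivatives on v
    is treated by Young's inequality, the part with all derivatives on c by Schur's test. *)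
Lemma conv_bound m v c (Bv Bc : R) (t s : seq int) : (0 < m)%N -> uniq t -> uniq s ->
  Hbound m v Bv -> Hbound m c Bc ->
  nrm s (wp m) (fun l => \sum_(k <- t) v (l - k) * c k) <= 2 ^+ m.+1 * C0 * Bv * Bc.
Proof.
move=> m0 ut us hv hc.
have Bv0 := Hbound_ge0 hv; have Bc0 := Hbound_ge0 hc; have C00 := C0_ge0 mu0.
apply: (@le_trans _ _ (N2 s (fun l => 2 ^+ m * \sum_(k <- t) (om (l - k) ^+ m * cmodulus (v (l - k))) * cmodulus (c k) +
   2 ^+ m * \sum_(k <- t) cmodulus (v (l - k)) * (om k ^+ m * cmodulus (c k))))).
  apply: N2_le => l _; rewrite ger0_norm ?mulr_ge0 ?cmod_ge0 ?omX_ge0//.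
  apply: (le_trans (ler_wpM2l _ (cmod_sum _ _ _))); first exact: omX_ge0.
  rewrite -mulrDr -big_split /= !mulr_sumr; apply: ler_sum => k _.
  rewrite cmodM; have : om l ^+ m <= 2 ^+ m * (om (l - k) ^+ m + om k ^+ m).
    apply: omX_le_max => //; rewrite -{1}(subrK k l); exact: ler_normD.
  move=> h; have vc : 0 <= cmodulus (v (l - k)) * cmodulus (c k) by rewrite mulr_ge0 ?cmod_ge0.
  by apply: (le_trans (ler_wpM2r vc h)); rewrite le_eqVlt; apply/orP; left; apply/eqP; ring.
have -> : 2 ^+ m.+1 * C0 * Bv * Bc = 2 ^+ m * (Bv * (C0 * Bc)) + 2 ^+ m * (C0 * Bv * Bc).
  by rewrite exprS; ring.
apply: N2_triB.
- rewrite N2_scale ger0_norm ?exprn_ge0// ler_wpM2l ?exprn_ge0//.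
  apply: (@le_trans _ _ (Bv * \sum_(k <- t) `|cmodulus (c k)|)).
    apply: N2_young => k _.
    have := hv [seq l - k | l <- s]; rewrite /nrm /N2 big_map; apply.
    by rewrite map_inj_uniq// => x y /(congr1 (fun z => z + k)); rewrite !subrK.
  rewrite ler_wpM2l//.
  have := @Hbound_l1 m 0 c Bc t m0 hc ut; apply: le_trans; apply: ler_sum => k _.
  by rewrite expr0 mul1r (ger0_norm (cmod_ge0 _)).
- rewrite N2_scale ger0_norm ?exprn_ge0// ler_wpM2l ?exprn_ge0//.
  apply: (@le_trans _ _ (C0 * Bv * N2 t (fun k => om k ^+ m * cmodulus (c k)))).
    apply: N2_schur; [by move=> *; exact: cmod_ge0|exact: mulr_ge0| |].
    + move=> l _; have := @Hbound_l1 m 0 v Bv [seq l - k | k <- t] m0 hv; rewrite big_map.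
      under eq_bigr do rewrite expr0 mul1r.
      apply; rewrite map_inj_uniq// => x y h; lia.
    + move=> k _; have := @Hbound_l1 m 0 v Bv [seq l - k | l <- s] m0 hv; rewrite big_map.
      under eq_bigr do rewrite expr0 mul1r.
      apply; rewrite map_inj_uniq// => x y h; lia.
  by rewrite ler_wpM2l ?mulr_ge0//; exact: hc.
Qed.

Lemma fconv_bound m v c f (Bv Bc : R) : (0 < m)%N ->
  Hbound m v Bv -> Hbound m c Bc -> fconv v c f ->
  Hbound m f (2 ^+ m.+1 * C0 * Bv * Bc).
Proof.
move=> m0 hv hc hf s us; apply: (N2_clim (F := fun l M => \sum_(k <- win M) v (l - k) * c k)).
- by move=> l _; exact: omX_ge0.
- by move=> l _; exact: hf.
- by move=> M; apply: conv_bound => //; exact: uniq_win.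
Qed.

Section modes_bounds.
Context (N : nat) (N0 : (0 < N)%N) (oN : ~~ odd N).
Local Notation T := (modes N).
Local Notation W := (fun l => om (rep N l)).

Lemma rep_rep l : rep N (rep N l) = rep N l.
Proof. by apply: rep_id => //; exact: rep_modes. Qed.

Lemma om_rep l : l \in T -> om (rep N l) = om l.
Proof. by move=> lT; rewrite rep_id. Qed.

(** By [vrep] the sequence has period N, and its norm is given on one period. As l - k may leave the
    window of modes, the weight of v at l - k is read at the representative. *)
Context (v : int -> R[i]) (vrep : forall l, v (rep N l) = v l) (m : nat) (Bv : R).
Context (vB : nrm T (wp m) v <= Bv).

Let Bv0 : 0 <= Bv.
Proof. exact: le_trans (nrm_ge0 _ _ _) vB. Qed.

Lemma N2_shift_modes k : N2 T (fun l => W (l - k) ^+ m * cmodulus (v (l - k))) <= Bv.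
Proof.
apply: le_trans vB; rewrite le_eqVlt; apply/orP; left; apply/eqP.
congr Num.sqrt.
rewrite (sum_rep_sub (F := fun l => (om (rep N l) ^+ m * cmodulus (v l)) ^+ 2) k N0 oN); last first.
  by move=> l; rewrite rep_rep vrep.
by rewrite !big_seq; apply: eq_bigr => l lT; rewrite om_rep.
Qed.

Lemma sum_modes_l1 p : (p < m)%N -> \sum_(l <- T) W l ^+ p * cmodulus (v l) <= C0 * Bv.
Proof.
move=> pm; rewrite big_seq (eq_bigr (fun l => om l ^+ p * `|cmodulus (v l)|)); last first.
  by move=> l lT; rewrite om_rep// (ger0_norm (cmod_ge0 _)).
rewrite -big_seq; apply: (le_trans (l1X_le_N2 mu0 _ (uniq_modes N) pm)).
by rewrite ler_wpM2l ?C0_ge0.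
Qed.

Lemma young_modes (b : int -> R) :
  N2 T (fun l => \sum_(k <- T) (W (l - k) ^+ m * cmodulus (v (l - k))) * b k) <=
  Bv * \sum_(k <- T) `|b k|.
Proof. by apply: N2_young => k _; exact: N2_shift_modes. Qed.

Lemma schur_modes p (b : int -> R) : (p < m)%N ->
  N2 T (fun l => \sum_(k <- T) (W (l - k) ^+ p * cmodulus (v (l - k))) * b k) <=
  C0 * Bv * N2 T b.
Proof.
move=> pm; have Frep l : W (rep N l) ^+ p * cmodulus (v (rep N l)) = W l ^+ p * cmodulus (v l).
  by rewrite rep_rep vrep.
apply: N2_schur.
- by move=> *; rewrite mulr_ge0 ?cmod_ge0 ?omX_ge0.
- by rewrite mulr_ge0 ?C0_ge0.
- move=> l _; rewrite (sum_rep_subl (F := fun l => W l ^+ p * cmodulus (v l)) l N0 oN)//.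
  exact: sum_modes_l1.
- move=> k _; rewrite (sum_rep_sub (F := fun l => W l ^+ p * cmodulus (v l)) k N0 oN)//.
  exact: sum_modes_l1.
Qed.

Lemma om_conv_le l k : l \in T -> k \in T -> om l <= W (l - k) * om k.
Proof.
move=> lT kT; apply: omD_le => //; have := rep_add_le (l - k) k N0 oN.
by rewrite subrK (rep_id N0 oN lT) (rep_id N0 oN kT).
Qed.

Lemma modes_H1_bound (u : int -> R[i]) : (1 < m)%N ->
  N2 T (fun l => om l * \sum_(k <- T) cmodulus (v (l - k)) * cmodulus (u k)) <=
  C0 * Bv * nrm T om u.
Proof.
move=> m1; apply: le_trans (schur_modes _ m1); apply: N2_le => l lT.
rewrite ger0_norm; last first.
  by rewrite mulr_ge0 ?om_ge0// sumr_ge0// => *; rewrite mulr_ge0 ?cmod_ge0.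
rewrite mulr_sumr big_seq [leRHS]big_seq; apply: ler_sum => k kT.
have vc : 0 <= cmodulus (v (l - k)) * cmodulus (u k) by rewrite mulr_ge0 ?cmod_ge0.
apply: (le_trans (ler_wpM2r vc (om_conv_le lT kT))).
by rewrite expr1 le_eqVlt; apply/orP; left; apply/eqP; ring.
Qed.

(** The kernel puts the whole weight W^m on v, which is then merely square summable. By Young's
    inequality om^(m-1) u must be summable, and one more power makes this the H^m norm of u. *)
Lemma modes_kernel_bound (K : int -> int -> R) (c : R) (u : int -> R[i]) : (0 < m)%N -> 0 <= c ->
  (forall l k, l \in T -> k \in T -> 0 <= K l k) ->
  (forall l k, l \in T -> k \in T -> om l * K l k <= c * W (l - k) ^+ m * om k ^+ m.-1) ->
  N2 T (fun l => om l * \sum_(k <- T) K l k * cmodulus (v (l - k)) * cmodulus (u k)) <=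
  c * (Bv * C0) * nrm T (wp m) u.
Proof.
move=> m0 c0 K0 hK.
apply: (@le_trans _ _ (N2 T (fun l => c * \sum_(k <- T) (W (l - k) ^+ m * cmodulus (v (l - k))) *
   (om k ^+ m.-1 * cmodulus (u k))))).
  apply: N2_le => l lT; rewrite ger0_norm; last first.
    rewrite mulr_ge0 ?om_ge0// big_seq sumr_ge0// => k kT.
    by rewrite !mulr_ge0 ?cmod_ge0 ?K0.
  rewrite !mulr_sumr big_seq [leRHS]big_seq; apply: ler_sum => k kT.
  have vc : 0 <= cmodulus (v (l - k)) * cmodulus (u k) by rewrite mulr_ge0 ?cmod_ge0.
  have := ler_wpM2r vc (hK l k lT kT) => h.
  rewrite (_ : om l * (_ * _) = om l * K l k * (cmodulus (v (l - k)) * cmodulus (u k))); last by ring.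
  by apply: (le_trans h); rewrite le_eqVlt; apply/orP; left; apply/eqP; ring.
rewrite N2_scale (ger0_norm c0) -!mulrA ler_wpM2l//.
apply: (le_trans (young_modes _)); rewrite ler_wpM2l//.
rewrite (eq_bigr (fun k => om k ^+ m.-1 * `|cmodulus (u k)|)); last first.
  by move=> k _; rewrite normrM (ger0_norm (omX_ge0 mu0 _ _)).
by apply: l1X_le_N2 => //; [exact: uniq_modes|rewrite prednK].
Qed.

(** l^2 - k^2 is the product of |l| - |k| and |l| + |k|. The first factor is at most the aliased
    distance by [rep_dist], the second at most that distance plus 2 |k|. *)
Lemma delta_le l k : l \in T -> k \in T ->
  `|(mu * l%:~R) ^+ 2 - (mu * k%:~R) ^+ 2| <= 2 * W (l - k) ^+ 2 * om k.
Proof.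
move=> lT kT; have h1 := rep_dist N0 oN lT kT.
have -> : `|(mu * l%:~R) ^+ 2 - (mu * k%:~R) ^+ 2| =
   mu ^+ 2 * (`| `|l| - `|k| |%:~R * (`|l| + `|k|)%:~R).
  rewrite !exprMn -mulrBr normrM (ger0_norm (sqr_ge0 mu)); congr (_ * _).
  rewrite intr_norm intrB intrD !intr_norm.
  rewrite -[(l%:~R) ^+ 2]real_normK ?num_real// -[(k%:~R) ^+ 2]real_normK ?num_real//.
  by rewrite subr_sqr normrM [X in _ * X]ger0_norm// addr_ge0.
have h4 : (`| `|l| - `|k| |%:~R : R) <= `|(rep N (l - k))%:~R| by rewrite -intr_norm ler_int.
have h5 : ((`|l| + `|k|)%:~R : R) <= `|(rep N (l - k))%:~R| + 2 * `|k%:~R|.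
  have : `|l| + `|k| <= `|rep N (l - k)| + 2 * `|k|.
    by move: h1; move: `|l| `|k| `|rep N (l - k)| => x y z; lia.
  move=> H; apply: (@le_trans _ _ ((`|rep N (l - k)| + 2 * `|k|)%:~R)).
    by rewrite ler_int.
  by rewrite intrD intrM !intr_norm.
have k0 : 0 <= (`| `|l| - `|k| |%:~R : R) by rewrite ler0z.
have k1 : 0 <= ((`|l| + `|k|)%:~R : R) by rewrite ler0z addr_ge0.
apply: (@le_trans _ _ (mu ^+ 2 * (`|(rep N (l - k))%:~R| * (`|(rep N (l - k))%:~R| + 2 * `|k%:~R|)))).
  by rewrite ler_wpM2l ?sqr_ge0// ler_pM.
rewrite /om; move: (normr_ge0 ((rep N (l - k))%:~R : R)) (normr_ge0 (k%:~R : R)).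
move: `|(rep N (l - k))%:~R| `|k%:~R| => x y x0 y0.
have a0 : 0 <= mu * x by rewrite mulr_ge0// ltW.
have b0 : 0 <= mu * y by rewrite mulr_ge0// ltW.
have -> : mu ^+ 2 * (x * (x + 2 * y)) = (mu * x) * ((mu * x) + 2 * (mu * y)) by ring.
move: (mu * x) (mu * y) a0 b0 => p q p0 q0.
have pq : 0 <= p * q by rewrite mulr_ge0.
have ppq : 0 <= p ^+ 2 * q by rewrite mulr_ge0 ?sqr_ge0.
have pp : 0 <= p ^+ 2 by exact: sqr_ge0.
by rewrite (_ : 2 * (1 + p) ^+ 2 * (1 + q) = 2 + 4 * p + 2 * p ^+ 2 + 2 * q + 4 * (p * q) + 2 * (p ^+ 2 * q)); [rewrite (_ : p * (p + 2 * q) = p ^+ 2 + 2 * (p * q)); [lra|ring]|ring].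
Qed.

Lemma om_delta_le l k : l \in T -> k \in T ->
  om l * `|(mu * l%:~R) ^+ 2 - (mu * k%:~R) ^+ 2| <= 2 * W (l - k) ^+ 3 * om k ^+ 2.
Proof.
move=> lT kT; have h2 := om_conv_le lT kT; have h3 := delta_le lT kT.
apply: (@le_trans _ _ ((W (l - k) * om k) * (2 * W (l - k) ^+ 2 * om k))).
  by apply: ler_pM; rewrite ?om_ge0.
by rewrite le_eqVlt; apply/orP; left; apply/eqP; ring.
Qed.

(** The commutator uses W^3 om^2, so W^m om^(m-1) suffices as soon as m >= 3; this is where the
    hypothesis on m enters. *)
Lemma om_delta_leX l k : (2 < m)%N -> l \in T -> k \in T ->
  om l * `|(mu * l%:~R) ^+ 2 - (mu * k%:~R) ^+ 2| <= 2 * W (l - k) ^+ m * om k ^+ m.-1.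
Proof.
move=> m2 lT kT; apply: (le_trans (om_delta_le lT kT)).
apply: ler_pM; rewrite ?omX_ge0//.
- by apply: mulr_ge0 => //; exact: omX_ge0.
- by rewrite ler_wpM2l//; exact: omX_mono.
- by apply: omX_mono => //; lia.
Qed.

(** A high index satisfies om <= Y^-(m-1) om^m. If it is k, the power om_k^m goes directly to u; if
    it is l, om_l^m is first distributed on l - k and k. *)
Lemma high_pairs_bound (Y : R) (hp1 : pred int) (u : int -> R[i]) (Bu : R) : (1 < m)%N -> 0 < Y ->
  (forall l, hp1 l -> Y <= om l) -> nrm T (wp m) u <= Bu ->
  N2 T (fun l => om l * \sum_(k <- T) (hp1 l || hp1 k)%:R * cmodulus (v (l - k)) * cmodulus (u k)) <=
  (2 ^+ m.+2 * C0 * Bv * Bu) * Y ^- m.-1.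
Proof.
move=> m1 Y0 hY uB; have C00 := C0_ge0 mu0.
have Bu0 : 0 <= Bu by exact: le_trans (nrm_ge0 _ _ _) uB.
have m0 : (0 < m)%N by exact: ltnW.
have hi l : hp1 l -> om l <= Y ^- m.-1 * om l ^+ m.
  move=> /hY Yl; rewrite -[X in om l ^+ X](prednK m0) exprS mulrCA ler_peMr ?om_ge0//.
  rewrite mulrC ler_pdivlMr ?exprn_gt0// mul1r lerXn2r// ?nnegrE ?om_ge0// ltW//.
apply: (@le_trans _ _ (N2 T (fun l => Y ^- m.-1 * (2 ^+ m * \sum_(k <- T) (W (l - k) ^+ m * cmodulus (v (l - k))) * cmodulus (u k)
   + (2 ^+ m + 1) * \sum_(k <- T) (W (l - k) ^+ 1 * cmodulus (v (l - k))) * (om k ^+ m * cmodulus (u k)))))).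
  apply: N2_le => l lT; rewrite ger0_norm; last first.
    rewrite mulr_ge0 ?om_ge0// sumr_ge0// => k _.
    by rewrite !mulr_ge0 ?cmod_ge0.
  rewrite !mulr_sumr -big_split /= mulr_sumr big_seq [leRHS]big_seq; apply: ler_sum => k kT.
  have vc : 0 <= cmodulus (v (l - k)) * cmodulus (u k) by rewrite mulr_ge0 ?cmod_ge0.
  have [h|] := boolP (hp1 l || hp1 k); last first.
    move=> _; rewrite !mul0r mulr0 mulr_ge0 ?invr_ge0 ?exprn_ge0 ?(ltW Y0)//.
    by rewrite addr_ge0// mulr_ge0 ?addr_ge0 ?exprn_ge0// ?mulr_ge0 ?cmod_ge0 ?omX_ge0.
  rewrite mul1r.
  have -> : Y ^- m.-1 * (2 ^+ m * (W (l - k) ^+ m * cmodulus (v (l - k)) * cmodulus (u k)) +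
      (2 ^+ m + 1) * (W (l - k) ^+ 1 * cmodulus (v (l - k)) * (om k ^+ m * cmodulus (u k)))) =
      Y ^- m.-1 * (2 ^+ m * W (l - k) ^+ m + (2 ^+ m + 1) * W (l - k) * om k ^+ m) *
      (cmodulus (v (l - k)) * cmodulus (u k)) by ring.
  rewrite ler_wpM2r//.
  have W1 : 1 <= W (l - k) by exact: om_ge1.
  have Y1 : 0 <= Y ^- m.-1 by rewrite invr_ge0 exprn_ge0// ltW.
  have A : 2 ^+ m * om k ^+ m <= 2 ^+ m * W (l - k) * om k ^+ m.
    by rewrite ler_wpM2r ?omX_ge0// ler_peMr ?exprn_ge0.
  have B : 0 <= 2 ^+ m * W (l - k) * om k ^+ m.
    by rewrite !mulr_ge0 ?exprn_ge0 ?om_ge0.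
  have D : 0 <= 2 ^+ m * W (l - k) ^+ m by rewrite !mulr_ge0 ?exprn_ge0 ?om_ge0.
  have E : 0 <= W (l - k) * om k ^+ m by rewrite mulr_ge0 ?omX_ge0 ?om_ge0.
  case/orP: h => h.
    apply: (le_trans (hi _ h)); rewrite ler_wpM2l//.
    apply: (@le_trans _ _ (2 ^+ m * (W (l - k) ^+ m + om k ^+ m))).
      apply: omX_le_max => //; have := rep_add_le (l - k) k N0 oN.
      by rewrite subrK (rep_id N0 oN lT) (rep_id N0 oN kT).
    by rewrite mulrDr; lra.
  apply: (le_trans (om_conv_le lT kT)).
  apply: (@le_trans _ _ (W (l - k) * (Y ^- m.-1 * om k ^+ m))).
    by rewrite ler_wpM2l ?om_ge0// hi.
  rewrite mulrCA ler_wpM2l//.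
  by lra.
rewrite N2_scale ger0_norm ?invr_ge0 ?exprn_ge0 ?(ltW Y0)// mulrC ler_wpM2r ?invr_ge0 ?exprn_ge0 ?(ltW Y0)//.
apply: (@le_trans _ _ (2 ^+ m * (Bv * (C0 * Bu)) + (2 ^+ m + 1) * (C0 * Bv * Bu))).
  apply: N2_triB.
    rewrite N2_scale ger0_norm ?exprn_ge0// ler_wpM2l ?exprn_ge0//.
    apply: (le_trans (young_modes _)); rewrite ler_wpM2l//.
    rewrite (eq_bigr (fun k => om k ^+ 0 * `|cmodulus (u k)|)); last first.
      by move=> k _; rewrite expr0 mul1r.
    apply: (le_trans (l1X_le_N2 mu0 _ (uniq_modes N) m0)).
    by rewrite ler_wpM2l.
  rewrite N2_scale ger0_norm ?addr_ge0 ?exprn_ge0// ler_wpM2l ?addr_ge0 ?exprn_ge0//.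
  by apply: (le_trans (schur_modes _ m1)); rewrite ler_wpM2l ?mulr_ge0.
have P : 0 <= C0 * Bv * Bu by rewrite !mulr_ge0.
have Q : 1 <= 2 ^+ m :> R by rewrite exprn_ege1// ler1n.
have : C0 * Bv * Bu * 1 <= C0 * Bv * Bu * 2 ^+ m by rewrite ler_wpM2l.
rewrite !exprS (_ : 2 ^+ m * (Bv * (C0 * Bu)) = 2 ^+ m * (C0 * Bv * Bu)); last by ring.
rewrite (_ : 2 * (2 * 2 ^+ m) * C0 * Bv * Bu = 4 * (2 ^+ m * (C0 * Bv * Bu))); last by ring.
have : 0 <= 2 ^+ m * (C0 * Bv * Bu) by rewrite mulr_ge0// exprn_ge0.
by move: (C0 * Bv * Bu) (2 ^+ m) => X0 Y1; lra.
Qed.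

End modes_bounds.

(** The aliases of a mode l have size at least of order N / 2 times their distance in periods, so
    Cauchy-Schwarz against om^-m gives the gain x^-m with x = mu N / 2, while om_l^p costs at most
    x^p up to a constant. *)
Lemma aliasing_fin (N m p : nat) (a : int -> R[i]) (s : seq int) : (1 < N)%N -> ~~ odd N ->
  (0 < m)%N -> uniq s ->
  nrm (modes N) (wp p) (fun l => \sum_(k <- s | (rep N k == l) && (k != l)) a k) <=
  3 * (1 + mu^-1) ^+ p * ((mu * N%:R / 2) ^+ p / (mu * N%:R / 2) ^+ m) * nrm s (wp m) a.
Proof.
move=> N1 oN m0 us; have N0 : (0 < N)%N by exact: ltnW.
set x := mu * N%:R / 2.
have x0 : 0 < x by rewrite !mulr_gt0 ?invr_gt0// ltr0n.
have mux : mu <= x.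
  by rewrite /x -mulrA ler_peMr ?(ltW mu0)// ler_pdivlMr// mul1r ler_nat.
pose sl l := [seq k <- s | (rep N k == l) && (k != l)].
pose h l := N2 (sl l) (fun k => om k ^+ m * cmodulus (a k)).
have omlx l : l \in modes N -> om l <= (1 + mu^-1) * x.
  rewrite mem_modes// => lN; rewrite mulrDl mul1r addrC /om; apply: lerD.
    by rewrite mulrC ler_pdivlMr// mul1r.
  rewrite /x -mulrA ler_pM2l// ler_pdivlMr// mulrC -intr_norm.
  have : 2 * `|l| <= N%:Z by lia.
  by rewrite -(ler_int R) intrM.
pose P l k : int := ((k - l) %/ N%:Z)%Z.
have PE l k : l \in modes N -> k \in sl l -> k - l = P l k * N%:Z /\ P l k != 0.
  rewrite mem_filter => lT /andP[/andP[/eqP rk kl] _].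
  have [q hq] := rep_eq N k.
  have kE : k - l = - q * N%:Z by rewrite -rk hq; ring.
  rewrite /P kE mulzK; last by lia.
  by split => //; apply: contraNneq kl => q0; rewrite -subr_eq0 kE q0 mul0r.
(* An alias is k = l + q N with q nonzero, and 2 |k| >= |q| N, whence om k >= x |q|. Comparing |q|
   >= 1 with 1 + |q| costs 4, the sum over q at most 2, and 8 <= 3^2. *)
have inv l : l \in modes N -> N2 (sl l) (fun k => (om k ^+ m)^-1) <= 3 / x ^+ m.
  move=> lT; rewrite N2_leP ?divr_ge0 ?exprn_ge0 ?(ltW x0)//.
  apply: (@le_trans _ _ (\sum_(k <- sl l) (4 * x ^- (2 * m)) * (om_1 (P l k)) ^- 2)).
    rewrite !big_seq; apply: ler_sum => k ksl; have [kE p0] := PE _ _ lT ksl.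
    move: (P l k) kE p0 => q kE q0.
    have q1 : 1 <= `|q%:~R| :> R by rewrite -intr_norm (ler_int R 1); lia.
    have omk : x * `|q%:~R| <= om k.
      apply: (@le_trans _ _ (mu * `|k%:~R|)); last by rewrite lerDr.
      have -> : x * `|q%:~R| = mu * ((N%:R * `|q%:~R|) / 2) by rewrite /x; ring.
      rewrite ler_pM2l// ler_pdivrMr//.
      have : N%:Z * `|q| <= 2 * `|k|.
        by move: lT; rewrite mem_modes// => ?; nia.
      by rewrite -(ler_int R) !intrM !intr_norm [X in _ <= X]mulrC.
    rewrite exprVn -exprM [(m * 2)%N]mulnC.
    have xq : (x * `|q%:~R|) ^+ (2 * m) <= om k ^+ (2 * m).
      by apply: lerXn2r; rewrite ?nnegrE ?om_ge0// mulr_ge0// ltW.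
    apply: (@le_trans _ _ ((x * `|q%:~R|) ^- (2 * m))).
      by rewrite lef_pV2 ?posrE ?exprn_gt0 ?om_gt0// mulr_gt0// (lt_le_trans ltr01).
    rewrite exprMn invfM -[X in _ <= X]mulrA mulrCA ler_pM2l ?invr_gt0 ?exprn_gt0//.
    rewrite -[4]invrK -invfM lef_pV2 ?posrE; last 2 first.
    - by rewrite exprn_gt0// (lt_le_trans ltr01).
    - by rewrite mulr_gt0 ?invr_gt0// exprn_gt0// om_gt0.
    apply: (@le_trans _ _ (`|q%:~R| ^+ 2)); last first.
      by rewrite ler_weXn2l// leq_pmulr.
    rewrite mulrC ler_pdivrMr// (_ : om_1 q = 1 + `|q%:~R|); last by rewrite -[om_1 q]/(1 + 1 * `|q%:~R|) mul1r.
    rewrite (_ : 4 = 2 ^+ 2); last by ring.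
    rewrite -exprMn lerXn2r// ?nnegrE ?addr_ge0 ?mulr_ge0//; lra.
  rewrite -mulr_sumr -(big_map (P l) xpredT (fun q => om_1 q ^- 2)).
  have tl := @sum_om_tail R 1 ltr01 0 [seq P l k | k <- sl l].
  have {}tl : \sum_(q <- [seq P l k | k <- sl l]) om_1 q ^- 2 <= 2.
    rewrite mulr0 addr0 !mul1r invr1 mulr1 in tl; apply: tl.
      rewrite map_inj_in_uniq ?filter_uniq// => k k' h1 h2 e.
      have [e1 _] := PE _ _ lT h1; have [e2 _] := PE _ _ lT h2.
      by apply/(addIr (- l)); rewrite e1 e2 e.
    by move=> q /mapP[k ksl ->]; have [_] := PE _ _ lT ksl; lia.
  apply: (@le_trans _ _ (4 * x ^- (2 * m) * 2)).
    by rewrite ler_wpM2l// mulr_ge0 ?invr_ge0 ?exprn_ge0// ltW.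
  rewrite mul2n -addnn exprD; have y0 : 0 < x ^+ m by rewrite exprn_gt0.
  move: (x ^+ m) y0 => y y0; have -> : (3 / y) ^+ 2 = 9 / (y * y) by field; rewrite gt_eqF.
  by rewrite mulrAC ler_wpM2r ?invr_ge0 ?mulr_ge0 ?(ltW y0)//; lra.
apply: (@le_trans _ _ (N2 (modes N) (fun l => (3 * (1 + mu^-1) ^+ p * (x ^+ p / x ^+ m)) * h l))).
  apply: N2_le => l lT; rewrite ger0_norm ?mulr_ge0 ?omX_ge0 ?cmod_ge0//.
  rewrite -big_filter -/(sl l).
  have cs : cmodulus (\sum_(k <- sl l) a k) <= 3 / x ^+ m * h l.
    apply: (le_trans (cmod_sum _ _ _)).
    rewrite (eq_bigr (fun k => (om k ^+ m)^-1 * (om k ^+ m * cmodulus (a k)))); last first.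
      by move=> k _; rewrite mulrA mulVf ?mul1r// gt_eqF// exprn_gt0// om_gt0.
    apply: (le_trans (N2_CS _ _ _)); rewrite ler_wpM2r ?N2_ge0//; exact: inv.
  have omp : om l ^+ p <= (1 + mu^-1) ^+ p * x ^+ p.
    by rewrite -exprMn; apply: lerXn2r; rewrite ?nnegrE ?om_ge0 ?omlx// mulr_ge0 ?addr_ge0 ?invr_ge0 ?(ltW mu0) ?(ltW x0).
  have := ler_pM (omX_ge0 mu0 l p) (cmod_ge0 _) omp cs.
  move=> e; apply: (le_trans e); rewrite le_eqVlt; apply/orP; left; apply/eqP; ring.
rewrite N2_scale ger0_norm; last first.
  by rewrite !mulr_ge0 ?invr_ge0 ?exprn_ge0 ?addr_ge0 ?invr_ge0 ?(ltW mu0) ?(ltW x0)//.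
rewrite ler_wpM2l//.
  by rewrite !mulr_ge0 ?invr_ge0 ?exprn_ge0 ?addr_ge0 ?invr_ge0 ?(ltW mu0) ?(ltW x0)//.
rewrite N2_leP ?nrm_ge0// N2_sqr.
under eq_bigr do rewrite /h N2_sqr big_filter big_mkcond /=.
(* Each k lies in a single residue class, so the squared local norms add up to at most the full
   one. *)
rewrite exchange_big /= ; apply: ler_sum => k _.
rewrite (bigD1_seq (rep N k)) ?uniq_modes//=; last exact: rep_modes.
rewrite big1 ?addr0; last first.
  by move=> l lk; rewrite eq_sym (negbTE lk).
by case: ifP => // _; exact: sqr_ge0.
Qed.

Lemma aliasing (N m p : nat) (a d : int -> R[i]) (B : R) : (1 < N)%N -> ~~ odd N ->
  (0 < m)%N -> Hbound m a B ->
  (forall l, l \in modes N -> clim (fun M => \sum_(k <- win M | rep N k == l) a k) (d l)) ->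
  nrm (modes N) (wp p) (fun l => d l - a l) <=
  3 * (1 + mu^-1) ^+ p * ((mu * N%:R / 2) ^+ p / (mu * N%:R / 2) ^+ m) * B.
Proof.
move=> N1 oN m0 aB hd; have N0 : (0 < N)%N by exact: ltnW.
have x0 : 0 < mu * N%:R / 2 by rewrite !mulr_gt0 ?invr_gt0// ltr0n.
apply: (N2_clim (F := fun l M => \sum_(k <- win M | (rep N k == l) && (k != l)) a k)).
- by move=> l _; exact: omX_ge0.
- move=> l lT; apply: (@clim_near _ (fun M => \sum_(k <- win M | rep N k == l) a k - a l) _ _ (absz l)).
    by apply: climB; [exact: hd|exact: clim_cst].
  move=> M lM; rewrite big_mkcond (bigD1_seq l) ?uniq_win//=; last by rewrite mem_win; lia.
  rewrite rep_id// eqxx addrAC subrr add0r big_mkcond [RHS]big_mkcond /=.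
  by apply: eq_bigr => k _; case: (rep N k == l); case: (k != l).
- move=> M; apply: (le_trans (aliasing_fin p a N1 oN m0 (uniq_win M))).
  rewrite ler_wpM2l//; last exact: aB (uniq_win M).
  by rewrite !mulr_ge0 ?invr_ge0 ?exprn_ge0 ?addr_ge0 ?invr_ge0 ?(ltW mu0) ?(ltW x0).
Qed.

End lattice_bounds.

(** * Small divisors *)

Section small_divisors.
Context {R : realType}.


Lemma cos_ge (x : R) : 1 - x ^+ 2 / 2 <= cos x.
Proof.
have e : cos x = 1 - 2 * sin (x / 2) ^+ 2.
  have := cos2Dsin2 (x / 2) => h.
  have -> : cos x = cos (x / 2) ^+ 2 - sin (x / 2) ^+ 2.
    by rewrite [in LHS](_ : x = x / 2 + x / 2) ?cosD -?expr2//; field.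
  by move: h; move: (cos _ ^+ 2) (sin _ ^+ 2) => p q; lra.
rewrite e lerD2l lerN2; have : `|sin (x / 2)| <= `|x / 2|.
  have := cmod_expi_sub (x / 2) 0; rewrite subr0; apply: le_trans.
  by apply: le_trans (cmod_Im _); rewrite cImB /= sin0 subr0.
move=> h; rewrite (_ : x ^+ 2 / 2 = 2 * (x / 2) ^+ 2); last by field.
rewrite ler_wpM2l// -[leLHS]real_normK ?num_real// -[leRHS]real_normK ?num_real//.
by rewrite lerXn2r// ?nnegrE.
Qed.

Lemma ge0_mono (f df : R -> R) (x : R) : 0 <= x -> (forall t, is_derive t (1 : R) f (df t)) ->
  (forall t : R, 0 <= t -> 0 <= df t) -> f 0 <= f x.
Proof.
move=> x0 hf h; have [|c hc e] := @MVT_segment R f df 0 x x0 (fun t _ => hf t).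
  exact: (is_derive_within_cont hf).
move: hc; rewrite in_itv/= => /andP[c0 _].
by rewrite -subr_ge0 e mulr_ge0 ?h// subr0.
Qed.

Lemma sin_cubic (x : R) : `|sin x - x| <= `|x| ^+ 3 / 6.
Proof.
wlog x0 : x / 0 <= x.
  move=> H; have [/H//|/ltW xle] := leP 0 x.
  have := H (- x); rewrite oppr_ge0 => /(_ xle).
  by rewrite sinN -opprD !normrN.
have hle : sin x <= x.
  have := @ge0_mono (fun t => t - sin t) (fun t => 1 - cos t) x x0.
  rewrite sin0 subr0 subr_ge0; apply => t.
  by move=> _; rewrite subr_ge0 cos_le1.
have hge : x - x ^+ 3 / 6 <= sin x.
  have hd (t : R) : is_derive t (1 : R) (fun t => sin t - t + 6^-1 * (t * (t * t))) (cos t - 1 + t ^+ 2 / 2).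
    have id1 := is_derive_id t (1 : R).
    have h3 := is_deriveZ (6^-1) (is_deriveM id1 (is_deriveM id1 id1)).
    have h4 := is_deriveD (is_deriveB (is_derive_sin t) id1) h3.
    apply: (is_derive_ext h4) => //.
    transitivity (cos t - 1 + 6^-1 * (t * (t * 1 + t * 1) + (t * t) * 1)) => //.
    by field.
  have := @ge0_mono _ _ x x0 hd; rewrite sin0 subr0 !mul0r mulr0 addr0.
  have aux (t : R) : 0 <= t -> 0 <= cos t - 1 + t ^+ 2 / 2 by move=> _; have := cos_ge t; lra.
  move=> /(_ aux); rewrite (_ : x * (x * x) = x ^+ 3); [lra|ring].
rewrite ler0_norm ?subr_le0// ger0_norm//; lra.
Qed.

(** For 0 <= x <= 2 the cubic term x^3 / 6 is at most 2 x / 3. The interval includes pi / 2, which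
    is what [sin_abs_ge] uses. *)
Lemma sin_ge3 (x : R) : 0 <= x <= 2 -> x / 3 <= sin x.
Proof.
move=> /andP[x0 x2]; have := sin_cubic x; rewrite (ger0_norm x0) ler_norml => /andP[h _].
have : x ^+ 3 <= 4 * x.
  rewrite (_ : x ^+ 3 = x ^+ 2 * x); last by ring.
  by rewrite ler_wpM2r// (_ : 4 = 2 ^+ 2); [rewrite ler_pXn2r ?nnegrE|ring].
lra.
Qed.

Lemma sin_abs_ge (x : R) : `|x| <= pi / 2 -> `|x| / 3 <= `|sin x|.
Proof.
move=> h; have h2 : `|x| <= 2 by apply: (le_trans h); exact: ltW (pihalf_lt2 R).
have h3 : `|x| / 3 <= sin `|x| by apply: sin_ge3; rewrite normr_ge0.
apply: (le_trans h3); have [x0|x0] := leP 0 x.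
  by rewrite ger0_norm// ler_norm.
by rewrite ltr0_norm// sinN -normrN ler_norm.
Qed.

Lemma sin_abs_shift (x : R) (n : nat) : `|sin (x + n%:R * pi)| = `|sin x|.
Proof.
elim: n => [|n ih]; first by rewrite mul0r addr0.
rewrite (_ : x + n.+1%:R * pi = (x + n%:R * pi) + pi); last by rewrite -natr1; ring.
by rewrite sinDpi normrN.
Qed.

Lemma sin_dist (x : R) : 0 <= x -> exists n : nat, `|x - n%:R * pi| / 3 <= `|sin x|.
Proof.
move=> x0; have p0 : 0 < pi :> R := pi_gt0 R.
(* The floor of x / pi + 1/2 is the integer nearest to x / pi, so the reduced argument lies within
   pi / 2 of 0. *)
pose y := x / pi + 2^-1.
have y0 : 0 <= y by rewrite addr_ge0 ?divr_ge0 ?pi_ge0.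
have /andP[f1 f2] := floor_itv y.
have fl0 : 0 <= Num.floor y by rewrite floor_ge0.
exists (absz (Num.floor y)).
have -> : (absz (Num.floor y))%:R = (Num.floor y)%:~R :> R.
  by rewrite -[in RHS](gez0_abs fl0) -pmulrn.
set q := (Num.floor y)%:~R : R.
have xE : x = (y - 2^-1) * pi by rewrite /y addrK divfK// gt_eqF.
have h : `|x - q * pi| <= pi / 2.
  rewrite xE -mulrBl normrM (gtr0_norm p0) [leRHS]mulrC ler_wpM2r ?pi_ge0//.
  rewrite ler_norml; apply/andP; split; first by rewrite -/q in f1; lra.
  by move: f2; rewrite intrD -/q; lra.
apply: (le_trans (sin_abs_ge h)).
rewrite -(sin_abs_shift _ (absz (Num.floor y))).
have -> : (absz (Num.floor y))%:R = q :> R.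
  by rewrite /q -[in RHS](gez0_abs fl0) -pmulrn.
by rewrite subrK.
Qed.

(** Beyond pi / 2 the sine is reflected at pi: the distance to pi is at least (1 - alpha) pi, hence
    at least (1 - alpha) |x|. *)
Lemma sin_ge_alpha (alpha x : R) : 0 < alpha < 1 -> `|x| <= alpha * pi ->
  (1 - alpha) / 3 * `|x| <= `|sin x|.
Proof.
move=> /andP[a0 a1] hx; have p0 := pi_gt0 R.
have [h|h] := leP `|x| (pi / 2).
  apply: le_trans (sin_abs_ge h); have := normr_ge0 x => nx.
  rewrite mulrAC ler_wpM2r ?invr_ge0//; have : 0 <= alpha * `|x| by rewrite mulr_ge0// ltW.
  by lra.
have sE : `|sin x| = `|sin (pi - `|x|)|.
  have -> : sin (pi - `|x|) = - sin (- `|x|) by rewrite addrC sinDpi.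
  rewrite normrN sinN normrN.
  have [x0|x0] := leP 0 x; first by rewrite (ger0_norm x0).
  by rewrite (ltr0_norm x0) sinN normrN.
have h1 : 0 <= pi - `|x|.
  by rewrite subr_ge0; apply: (le_trans hx); rewrite ger_pMl// ltW.
have h2 : `|pi - `|x| | <= pi / 2 by rewrite ger0_norm//; lra.
rewrite sE; apply: le_trans (sin_abs_ge h2); rewrite (ger0_norm h1).
rewrite mulrAC ler_wpM2r ?invr_ge0//.
have : (1 - alpha) * `|x| <= (1 - alpha) * (alpha * pi) by rewrite ler_wpM2l//; lra.
have : (1 - alpha) * (alpha * pi) <= (1 - alpha) * pi.
  rewrite ler_wpM2l ?subr_ge0 ?(ltW a1)// ger_pMl// ltW//.
lra.
Qed.

(* The solution of tau * (2 sin (tau d / 2)) * gamma = phi_step d - tau. *)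
Definition gamma_step (tau d : R) : R := (tau * d)^-1 - (2 * sin (tau * d / 2))^-1.

Lemma gamma_step_cancel (tau d : R) : 0 < tau -> d != 0 -> sin (tau * d / 2) != 0 ->
  phi_step tau d - tau = 2 * tau * sin (tau * d / 2) * gamma_step tau d.
Proof.
move=> t0 d0 s0; rewrite /phi_step (negbTE d0) /gamma_step.
by field; rewrite d0 s0 gt_eqF.
Qed.

(** The two singular terms of gamma cancel: over a common denominator the numerator is sin x - x,
    cubic in x = tau d / 2, while the denominator is quadratic from below. So gamma is O(tau d),
    which provides the factor tau of the correction. *)
Lemma gamma_step_le (tau d c : R) : 0 < tau -> d != 0 -> 0 < c ->
  c * `|tau * d / 2| <= `|sin (tau * d / 2)| ->
  `|gamma_step tau d| <= `|tau * d| / (24 * c).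
Proof.
move=> t0 d0 c0; rewrite /gamma_step; set th := tau * d => hs.
have th0 : th != 0 by rewrite mulf_neq0// gt_eqF.
have nth0 : 0 < `|th| by rewrite normr_gt0.
have h2 : `|th / 2| = `|th| / 2 by rewrite normrM [`|2^-1|]ger0_norm.
rewrite h2 in hs; clearbody th.
have sp : 0 < `|sin (th / 2)| by apply: lt_le_trans hs; rewrite !mulr_gt0.
have s0 : sin (th / 2) != 0 by rewrite -normr_gt0.
have -> : th^-1 - (2 * sin (th / 2))^-1 = 2 * (sin (th / 2) - th / 2) / (th * (2 * sin (th / 2))).
  by field; rewrite th0 s0.
rewrite !normrM normfV !normrM !(ger0_norm (ler0n _ _)).
have sc := sin_cubic (th / 2); rewrite h2 in sc.
rewrite ler_pdivrMr ?mulr_gt0//.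
apply: (@le_trans _ _ (2 * ((`|th| / 2) ^+ 3 / 6))); first by rewrite ler_wpM2l.
apply: (@le_trans _ _ (`|th| / (24 * c) * (`|th| * (2 * (c * (`|th| / 2)))))).
  rewrite le_eqVlt; apply/orP; left; apply/eqP; field; by rewrite gt_eqF.
by rewrite ler_wpM2l ?divr_ge0 ?mulr_ge0 ?(ltW c0)// ler_wpM2l// ler_wpM2l.
Qed.

(** Comparison with the integral of x^-(1 + nu), in the form of the mean value theorem for x^-nu on
    each unit interval. *)
Lemma sum_powR_bound (nu : R) (n : nat) : 0 < nu ->
  series (fun k : nat => (k.+1%:R : R) `^ (- (1 + nu))) n.+1 <= 1 + nu^-1 * (1 - (n.+1%:R : R) `^ (- nu)).
Proof.
move=> nu0; elim: n => [|n ih].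
  by rewrite seriesEnat/= big_nat1 !powR1 subrr mulr0 addr0.
rewrite seriesEnat/= big_nat_recr//=; rewrite seriesEnat/= in ih.
apply: (le_trans (lerD ih (lexx _))).
have xp : 0 < (n.+1%:R : R) by rewrite ltr0n.
have xy : (n.+1%:R : R) < n.+2%:R by rewrite ltr_nat.
have hd x : x \in `](n.+1%:R : R), n.+2%:R[%R ->
    is_derive x (1 : R) (fun x => x `^ (- nu)) (- nu * x `^ (- nu - 1)).
  rewrite in_itv/= => /andP[h _]; apply: is_derive1_powR.
  exact: lt_trans h.
have hc : {within `[(n.+1%:R : R), n.+2%:R], continuous (fun x : R => x `^ (- nu))}.
  apply: derivable_within_continuous => x; rewrite in_itv/= => /andP[h _].
  by have [] := is_derive1_powR (- nu) (lt_le_trans xp h).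
have [c] := MVT xy hd hc.
rewrite in_itv/= => /andP[c1 c2]; rewrite -natrB//.
rewrite (_ : (n.+2 - n.+1)%N = 1%N) ?mulr1; last by lia.
move=> e; have cp : 0 < c by exact: lt_trans c1.
have : (n.+2%:R : R) `^ (- (1 + nu)) <= c `^ (- nu - 1).
  rewrite (_ : - nu - 1 = - (1 + nu)) ?powRN; last by ring.
  rewrite lef_pV2 ?posrE ?powR_gt0//.
  by apply: ge0_ler_powR; rewrite ?nnegrE ?ltW// addr_gt0.
move=> h; rewrite -addrA lerD2l; move: e.
move: h; set u := n.+2%:R `^ _; set v := c `^ _.
set p := n.+2%:R `^ _; set q := n.+1%:R `^ _ => h e.
have -> : 1 - p = 1 - q + nu * v by lra.
by rewrite [leRHS]mulrDr [nu^-1 * (nu * v)]mulrA mulVf ?gt_eqF// mul1r lerD2l.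
Qed.

(** Convergence has to be proved first: of a divergent series [limn] would be a default value, and
    [lambda_const], in which it is a divisor, would carry no information. *)
Lemma lim_sum_powR_gt0 (nu : R) : 0 < nu ->
  0 < limn (series (fun k : nat => (k.+1%:R : R) `^ (- (1 + nu)))).
Proof.
move=> nu0; set u := (fun k : nat => _).
have u0 k : 0 <= u k by rewrite powR_ge0.
have nd : nondecreasing_seq (series u).
  by apply: nondecreasing_series => k _ _; exact: u0.
have cv : cvgn (series u).
  apply: nondecreasing_is_cvgn => //.
  exists (1 + nu^-1) => _ [n _ <-].
  apply: (@le_trans _ _ (series u n.+1)); first exact: nd.
  by apply: (le_trans (sum_powR_bound n nu0)); rewrite lerD2l ger_pMr ?invr_gt0//.
apply: (@lt_le_trans _ _ (series u 1)); last exact: nondecreasing_cvgn_le.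
by rewrite seriesEnat /= big_nat1 /u powR1.
Qed.

Lemma lambda_const_gt0 (a b alpha nu : R) : a < b -> 0 < alpha -> 0 < nu ->
  0 < lambda_const a b alpha nu.
Proof.
move=> ab a0 nu0; rewrite /lambda_const divr_gt0//; last first.
  by rewrite mulr_gt0// lim_sum_powR_gt0.
rewrite !mulr_gt0 ?pi_gt0// powR_gt0// /freq !mulr_gt0 ?pi_gt0// ?invr_gt0 ?subr_gt0//.
Qed.


Lemma mu_gt0 (a b : R) : a < b -> 0 < freq a b 1.
Proof. by move=> ab; rewrite /freq !mulr_gt0 ?pi_gt0 ?invr_gt0 ?subr_gt0. Qed.

Lemma freqE (a b : R) l : freq a b l = freq a b 1 * l%:~R.
Proof. by rewrite /freq; ring. Qed.

Lemma exponent_aux (nu M : R) : 0 < nu -> 5 + 2 * nu <= M -> 1 + (2 + nu) <= M - 1.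
Proof. by move=> h1 h2; lra. Qed.

Section step_conditions.
Context (a b alpha nu tau0 tau : R) (m : nat) (ab : a < b) (alpha01 : 0 < alpha < 1)
  (nu0 : 0 < nu) (tau001 : 0 < tau0 < 1) (m3 : (2 < m)%N).
Context (mu : R) (muE : freq a b 1 = mu) (mu0 : 0 < mu).

Definition Ncut : int := Num.ceil (1 / tau0).

Lemma Ncut_ge : 1 / tau0 <= Ncut%:~R.
Proof. exact: ceil_ge. Qed.

Lemma Ncut_le : Ncut%:~R <= (1 + tau0) / tau0.
Proof.
case/andP: tau001 => t0 t1; have /andP[h _] := ceil_itv (1 / tau0).
by move: h; rewrite intrD -/Ncut mulrDl divff ?gt_eqF// => h; lra.
Qed.

Lemma Ncut_ge0 : 0 <= Ncut.
Proof.
case/andP: tau001 => t0 t1; rewrite -(ler_int R); apply: le_trans Ncut_ge.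
by rewrite divr_ge0// ltW.
Qed.

(** The nonzero values of l^2 - k^2 with |l| and |k| at most [Ncut] satisfy this. It is the range in
    which condition (ii) is imposed. *)
Definition lowK (K : int) : Prop := 0 < `|K| /\ `|K| <= Ncut ^+ 2.

Local Notation dK K := (mu ^+ 2 * K%:~R).

Let dK0 K : lowK K -> 0 < `|dK K|.
Proof.
move=> [K0 _]; rewrite normr_gt0; apply: mulf_neq0; first by rewrite expf_neq0// gt_eqF.
by rewrite intr_eq0 -normr_gt0.
Qed.

(** Since |K| <= ((1 + tau0) / tau0)^2, condition (i) says that tau |d| / 2 stays below alpha pi:
    before the first nonzero resonance. *)
Lemma sin_step_i K : step_condition_i a b alpha tau0 tau -> lowK K ->
  (1 - alpha) / 3 * `|tau * dK K / 2| <= `|sin (tau * dK K / 2)|.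
Proof.
rewrite /step_condition_i muE => -[t0 tlt] [K0 KN].
case/andP: tau001 => tt0 tt1; case/andP: alpha01 => a0 a1.
apply: sin_ge_alpha => //.
rewrite normrM [`|tau * _|]normrM [`|mu ^+ 2 * _|]normrM (gtr0_norm t0) (ger0_norm (sqr_ge0 mu)) [`|2^-1|]ger0_norm//.
rewrite ler_pdivrMr//.
have KR : `|K%:~R| <= ((1 + tau0) / tau0) ^+ 2.
  apply: (@le_trans _ _ ((Ncut ^+ 2)%:~R)); first by rewrite -intr_norm ler_int.
  rewrite rmorphXn /=; apply: lerXn2r; rewrite ?nnegrE ?ler0z ?Ncut_ge0 ?Ncut_le//.
  by rewrite divr_ge0 ?addr_ge0 ?(ltW tt0).
apply: (@le_trans _ _ (tau * (mu ^+ 2 * ((1 + tau0) / tau0) ^+ 2))).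
  by rewrite ler_wpM2l ?(ltW t0)// ler_wpM2l ?sqr_ge0.
have P : 0 < mu ^+ 2 * ((1 + tau0) / tau0) ^+ 2.
  by rewrite mulr_gt0 ?exprn_gt0 ?divr_gt0 ?addr_gt0.
rewrite -ler_pdivlMr//; apply: (le_trans (ltW tlt)).
rewrite le_eqVlt; apply/orP; left; apply/eqP.
by field; rewrite (gt_eqF mu0) (gt_eqF tt0) gt_eqF// addr_gt0.
Qed.

(** With n pi the multiple of pi nearest to tau |d| / 2, the distance between them is |d| / 2 times
    that of tau to 2 n pi / |d|, which is the quantity bounded below in condition (ii), with l =
    n. *)
Lemma sin_step_ii K : step_condition_ii a b m alpha nu tau0 tau -> lowK K ->
  lambda_const a b alpha nu / 6 * (`|dK K| `^ (1 + nu))^-1 <= `|sin (tau * dK K / 2)|.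
Proof.
rewrite /step_condition_ii muE => -[_ t0 h] lK; have [K0 KN] := lK.
have d0 := dK0 lK.
pose x := tau * `|dK K| / 2.
have sE : `|sin (tau * dK K / 2)| = `|sin x|.
  rewrite /x; have [k0|k0] := leP 0 (dK K); first by rewrite (ger0_norm k0).
  by rewrite (ltr0_norm k0) mulrN mulNr sinN normrN.
have x0 : 0 <= x by rewrite !mulr_ge0 ?(ltW t0).
have [n hn] := sin_dist x0; rewrite sE; apply: le_trans hn.
have lK' : `|(`|K| : int)| <= Ncut ^+ 2 by rewrite normr_id.
have := h `|K| n; rewrite normr_id => /(_ K0 KN (le0z_nat n)).
have dE : mu ^+ 2 * `|K|%:~R = `|dK K|.
  by rewrite normrM intr_norm (ger0_norm (sqr_ge0 _)).
rewrite dE normr_id -pmulrn; move: d0; rewrite /x.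
move: `|dK K| => d d0 hh.
have -> : `|tau * d / 2 - n%:R * pi| / 3 = d / 6 * `|tau - 2 * n%:R * pi / d|.
  rewrite (_ : tau * d / 2 - n%:R * pi = d / 2 * (tau - 2 * n%:R * pi / d)); last first.
    by field; rewrite gt_eqF.
  rewrite normrM [`|d / 2|]ger0_norm ?divr_ge0 ?(ltW d0)//; by field.
have d6 : 0 <= d / 6 by rewrite divr_ge0// ltW.
apply: le_trans (ler_wpM2l d6 hh).
have -> : d `^ (2 + nu) = d * d `^ (1 + nu).
  rewrite -[X in X * _](powRr1 (ltW d0)) -powRD; first by congr powR; ring.
  by rewrite (gt_eqF d0) implybT.
have p0 : 0 < d `^ (1 + nu) by rewrite powR_gt0.
by rewrite le_eqVlt; apply/orP; left; apply/eqP; field; rewrite !gt_eqF.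
Qed.

(** The first summand serves condition (i), the second condition (ii); adding them avoids a constant
    that depends on the case. *)
Definition Cgam : R := 4 / (12 * (1 - alpha)) + (2 + 3 / lambda_const a b alpha nu * 2 `^ (2 + nu)).

Lemma Cgam_ge0 : 0 <= Cgam.
Proof.
case/andP: alpha01 => a0 a1; have l0 := lambda_const_gt0 ab a0 nu0.
rewrite /Cgam !addr_ge0 ?divr_ge0 ?mulr_ge0 ?powR_ge0 ?subr_ge0 ?(ltW a1)// invr_ge0 ltW//.
Qed.

(** [o], [W] and [w] stand for om at l, l - k and k, so that only the inequalities between them
    matter. *)
Lemma gamma_bound K (o W w : R) :
  step_condition_i a b alpha tau0 tau \/ step_condition_ii a b m alpha nu tau0 tau ->
  lowK K -> 1 <= W -> 1 <= w -> 0 <= o -> o <= W * w -> `|dK K| <= 2 * W ^+ 2 * w ->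
  sin (tau * dK K / 2) != 0 /\
  o * `|gamma_step tau (dK K)| <= Cgam * tau * W ^+ m * w ^+ m.-1.
Proof.
move=> cond lK W1 w1 o0 oWw dWw.
have d0 := dK0 lK.
have dn0 : dK K != 0 by rewrite -normr_gt0.
case/andP: alpha01 => a0 a1; have l0 := lambda_const_gt0 ab a0 nu0.
have t0 : 0 < tau by case: cond => [[]|[]].
have W0 : 0 <= W by exact: le_trans W1.
have w0 : 0 <= w by exact: le_trans w1.
have Wm p : (p <= m)%N -> W ^+ p <= W ^+ m by move=> ?; rewrite ler_weXn2l.
have wm p : (p <= m.-1)%N -> w ^+ p <= w ^+ m.-1 by move=> ?; rewrite ler_weXn2l.
have WW : 0 <= W ^+ m * w ^+ m.-1 by rewrite mulr_ge0 ?exprn_ge0.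
have od : o * `|dK K| <= 2 * (W ^+ m * w ^+ m.-1).
  apply: (@le_trans _ _ ((W * w) * (2 * W ^+ 2 * w))); first by rewrite ler_pM.
  rewrite (_ : W * w * (2 * W ^+ 2 * w) = 2 * (W ^+ 3 * w ^+ 2)); last by ring.
  rewrite ler_wpM2l//; apply: ler_pM; rewrite ?exprn_ge0//; [exact: Wm|apply: wm].
  by rewrite -ltnS prednK// (ltn_trans _ m3).
have base c : 0 < c -> c * `|tau * dK K / 2| <= `|sin (tau * dK K / 2)| ->
   o * `|gamma_step tau (dK K)| <= (2 / (24 * c)) * tau * (W ^+ m * w ^+ m.-1).
  move=> c0 hs; apply: (le_trans (ler_wpM2l o0 (gamma_step_le t0 dn0 c0 hs))).
  rewrite normrM (gtr0_norm t0).
  rewrite (_ : o * (tau * `|dK K| / (24 * c)) = (tau / (24 * c)) * (o * `|dK K|)); last by ring.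
  rewrite (_ : 2 / (24 * c) * tau * _ = (tau / (24 * c)) * (2 * (W ^+ m * w ^+ m.-1))); last by ring.
  by rewrite ler_wpM2l// divr_ge0 ?(ltW t0)// mulr_ge0// ltW.
have sneq c : 0 < c -> c * `|tau * dK K / 2| <= `|sin (tau * dK K / 2)| -> sin (tau * dK K / 2) != 0.
  move=> c0 hs; rewrite -normr_gt0; apply: lt_le_trans hs; rewrite mulr_gt0// normr_gt0.
  by apply: mulf_neq0; [apply: mulf_neq0 => //; rewrite gt_eqF|rewrite invr_eq0 gt_eqF].
have part2 : 0 <= 2 + 3 / lambda_const a b alpha nu * 2 `^ (2 + nu).
  by rewrite addr_ge0// mulr_ge0 ?powR_ge0// divr_ge0// ltW.
have part1 : 0 <= 4 / (12 * (1 - alpha)).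
  by rewrite divr_ge0// mulr_ge0// subr_ge0 ltW.
have mono X : 0 <= X -> X <= Cgam -> forall z, z <= X * tau * (W ^+ m * w ^+ m.-1) ->
    z <= Cgam * tau * W ^+ m * w ^+ m.-1.
  move=> X0 XC z hz; apply: (le_trans hz); rewrite -[leRHS]mulrA ler_wpM2r//.
  by rewrite ler_wpM2r// ltW.
case: cond => [ci|cii].
  have hs := sin_step_i ci lK; have c0 : 0 < (1 - alpha) / 3 by rewrite divr_gt0 ?subr_gt0.
  split; first exact: sneq hs.
  apply: (mono (2 / (24 * ((1 - alpha) / 3)))); last exact: base.
    by rewrite divr_ge0// mulr_ge0// ltW.
  rewrite /Cgam; apply: (@le_trans _ _ (4 / (12 * (1 - alpha)))); last by rewrite lerDl.
  rewrite (_ : 2 / (24 * ((1 - alpha) / 3)) = 3 / (12 * (1 - alpha))); last first.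
    by field; rewrite subr_eq0 gt_eqF.
  rewrite ler_wpM2r ?ler_nat// invr_ge0; apply: mulr_ge0 => //.
  by rewrite subr_ge0 ltW.
have hs := sin_step_ii cii lK; have [m5 _ _] := cii.
have pd : 0 < `|dK K| `^ (1 + nu) by rewrite powR_gt0.
have sp : 0 < `|sin (tau * dK K / 2)|.
  by apply: lt_le_trans hs; rewrite mulr_gt0 ?invr_gt0// divr_gt0.
split; first by rewrite -normr_gt0.
apply: (mono _ part2); first by rewrite /Cgam lerDr.
(* If |tau d / 2| <= 1 there is no resonance and the sine is linear from below, as under (i).
   Otherwise |tau d| >= 1 may be inserted as a factor, which produces the tau that the bound
   needs. *)
have [small|big] := leP `|tau * dK K / 2| 1.
  have hb : 1 / 3 * `|tau * dK K / 2| <= `|sin (tau * dK K / 2)|.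
    rewrite mulrC mul1r; apply: sin_abs_ge; apply: (le_trans small).
    exact: pihalf_ge1.
  apply: (le_trans (base _ _ hb)); first by [].
  rewrite ler_wpM2r// ler_wpM2r ?(ltW t0)//.
  apply: (@le_trans _ _ 2); last by rewrite lerDl mulr_ge0 ?powR_ge0// divr_ge0// ltW.
  by rewrite ler_pdivrMr//; lra.
have th : 1 <= `|tau * dK K|.
  by move: big; rewrite normrM [`|2^-1|]ger0_norm// => /ltW; rewrite ler_pdivlMr//; lra.
have g1 : `|gamma_step tau (dK K)| <= `|tau * dK K| * (1 + 3 / lambda_const a b alpha nu * `|dK K| `^ (1 + nu)).
  rewrite /gamma_step; apply: (le_trans (ler_normB _ _)); rewrite !normfV normrM mulrDr mulr1.
  apply: lerD.
    apply: (@le_trans _ _ 1); last by rewrite -normrM.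
    by rewrite -normrM invf_le1// (lt_le_trans ltr01).
  rewrite -normrM.
  apply: (@le_trans _ _ (1 * (3 / lambda_const a b alpha nu * `|dK K| `^ (1 + nu)))).
    rewrite mul1r -[leRHS]invrK lef_pV2 ?posrE ?normr_gt0; last 2 first.
    - by rewrite mulf_neq0// -normr_gt0.
    - by rewrite invr_gt0 mulr_gt0// divr_gt0.
    have n2 (z : R) : `|2 * z| = 2 * `|z| by rewrite normrM ger0_norm.
    rewrite n2.
    have : 2 * (lambda_const a b alpha nu / 6 * (`|dK K| `^ (1 + nu))^-1) <= 2 * `|sin (tau * dK K / 2)|.
      by rewrite ler_wpM2l.
    apply: le_trans; rewrite le_eqVlt; apply/orP; left; apply/eqP; field.
    by rewrite !gt_eqF.
  apply: ler_wpM2r => //; apply: mulr_ge0; last exact: powR_ge0.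
  by rewrite divr_ge0// ltW.
apply: (le_trans (ler_wpM2l o0 g1)).
rewrite normrM (gtr0_norm t0).
set L := 3 / lambda_const a b alpha nu.
have L0 : 0 <= L by rewrite divr_ge0// ltW.
(* With |d| <= 2 W^2 w and o <= W w, the power of W is 1 + 2 (2 + nu) = 5 + 2 nu, the threshold for
   m in (ii); the power 3 + nu of w then fits below m - 1. *)
have key : o * (`|dK K| * `|dK K| `^ (1 + nu)) <= 2 `^ (2 + nu) * (W ^+ m * w ^+ m.-1).
  have -> : `|dK K| * `|dK K| `^ (1 + nu) = `|dK K| `^ (2 + nu).
    rewrite -[X in X * _](powRr1 (ltW d0)) -powRD; first by congr powR; ring.
    by rewrite (gt_eqF d0) implybT.
  have n2 : 0 <= 2 + nu by rewrite addr_ge0// ltW.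
  apply: (@le_trans _ _ ((W * w) * (2 * W ^+ 2 * w) `^ (2 + nu))).
    apply: ler_pM; rewrite ?powR_ge0//.
    by apply: ge0_ler_powR; rewrite ?nnegrE// !mulr_ge0 ?exprn_ge0.
  rewrite powRM ?mulr_ge0 ?exprn_ge0// powRM ?exprn_ge0//.
  have Wp : 0 < W by exact: lt_le_trans W1.
  have wp : 0 < w by exact: lt_le_trans w1.
  have -> : (W ^+ 2) `^ (2 + nu) = W `^ (4 + 2 * nu).
    by rewrite -powR_mulrn// -powRrM; congr powR; ring.
  have -> : W * w * (2 `^ (2 + nu) * W `^ (4 + 2 * nu) * w `^ (2 + nu)) =
     2 `^ (2 + nu) * ((W `^ 1 * W `^ (4 + 2 * nu)) * (w `^ 1 * w `^ (2 + nu))).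
    by rewrite !powRr1//; ring.
  rewrite -!powRD ?(gt_eqF Wp) ?(gt_eqF wp) ?implybT//.
  rewrite ler_wpM2l ?powR_ge0//; apply: ler_pM; rewrite ?powR_ge0//.
    by rewrite -powR_mulrn//; apply: ler_powR => //; lra.
  rewrite -powR_mulrn//; apply: ler_powR => //.
  have -> : m.-1%:R = m%:R - 1 :> R by rewrite -[in RHS](prednK (n := m)) -?natr1 ?addrK// (ltn_trans _ m3).
  exact: exponent_aux.
rewrite (_ : o * (tau * `|dK K| * (1 + L * `|dK K| `^ (1 + nu))) =
  tau * (o * `|dK K| + L * (o * (`|dK K| * `|dK K| `^ (1 + nu))))); last by ring.
rewrite (_ : (2 + L * 2 `^ (2 + nu)) * tau * _ =
  tau * (2 * (W ^+ m * w ^+ m.-1) + L * (2 `^ (2 + nu) * (W ^+ m * w ^+ m.-1)))); last by ring.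
by rewrite ler_wpM2l ?(ltW t0)// lerD// ler_wpM2l.
Qed.

End step_conditions.
End small_divisors.

(** * Fourier coefficients *)

Section interval_integrals.
Context {R : realType}.
Implicit Types (a b : R).
Local Notation mu := (@lebesgue_measure R).

Definition rintegrable a b (f : R -> R) : Prop :=
  mu.-integrable `]a, b[%classic (EFin \o f).

Definition cintegrable a b (f : R -> R[i]) : Prop :=
  rintegrable a b (fun x => complex.Re (f x)) /\
  rintegrable a b (fun x => complex.Im (f x)).

Lemma within_cont_compact_bounded a b (f : R -> R) : a <= b ->
  {within `[a, b], continuous f} -> exists2 M : R, 0 <= M & forall x, a <= x <= b -> `|f x| <= M.
Proof.
move=> ab cf; have [c _ hc] := EVT_max ab cf; have [d _ hd] := EVT_min ab cf.
exists (`|f c| + `|f d|); first by rewrite addr_ge0.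
move=> x xab; have xi : x \in `[a, b] by rewrite in_itv/=.
have h1 := hc _ xi; have h2 := hd _ xi; rewrite ler_norml.
have := ler_norm (f c); have := ler_norm (- f d); rewrite normrN.
have := normr_ge0 (f c); have := normr_ge0 (f d).
by move=> *; apply/andP; split; lra.
Qed.

Lemma ccont_bounded a b (f : R -> R[i]) : a <= b -> ccont f a b ->
  exists2 M : R, 0 <= M & forall x, a <= x <= b -> cmodulus (f x) <= M.
Proof.
move=> ab [c1 c2]; have [M M0 hM] := within_cont_compact_bounded ab c1.
have [N N0 hN] := within_cont_compact_bounded ab c2.
exists (M + N); first by rewrite addr_ge0.
by move=> x h; apply: (le_trans (cmod_le_ReIm _)); apply: lerD; auto.
Qed.

Lemma rintegrable_cont a b (f : R -> R) : {within `[a, b], continuous f} -> rintegrable a b f.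
Proof.
move=> cf; apply: (@integrableS _ _ _ mu `[a, b]%classic) => //.
  by apply: subset_itv_oo_cc.
by apply: continuous_compact_integrable => //; exact: segment_compact.
Qed.

Lemma cintegrable_cont a b (f : R -> R[i]) : ccont f a b -> cintegrable a b f.
Proof. by move=> [c1 c2]; split; exact: rintegrable_cont. Qed.

Lemma rintegrableD a b f g : rintegrable a b f -> rintegrable a b g ->
  rintegrable a b (fun x => f x + g x).
Proof. by move=> hf hg; exact: (@integrableD _ _ _ mu _ (measurable_itv _) _ _ hf hg). Qed.

Lemma rintegrableZ a b c f : rintegrable a b f -> rintegrable a b (fun x => c * f x).
Proof. by move=> hf; exact: (@integrableZl _ _ _ mu _ (measurable_itv _) c _ hf). Qed.

Lemma rintegrable_ext a b f g : rintegrable a b f -> (forall x, a < x < b -> f x = g x) ->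
  rintegrable a b g.
Proof.
move=> hf e; apply: eq_integrable hf => // x; rewrite inE /= in_itv/= => h.
by rewrite e.
Qed.

Lemma rintegrableB a b f g : rintegrable a b f -> rintegrable a b g ->
  rintegrable a b (fun x => f x - g x).
Proof.
move=> hf hg; apply: (rintegrable_ext (rintegrableD hf (rintegrableZ (-1) hg))) => x _.
by rewrite mulN1r.
Qed.

Lemma rintegrableMc a b f g : a <= b -> rintegrable a b f -> {within `[a, b], continuous g} ->
  rintegrable a b (fun x => f x * g x).
Proof.
move=> ab hf cg; have [M M0 hM] := within_cont_compact_bounded ab cg.
have mg : measurable_fun `]a, b[%classic g.
  by apply/measurable_EFinP; have := rintegrable_cont cg => /measurable_int.
have bg : [bounded g x | x in `]a, b[%classic].
  exists M; split; first exact: num_real.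
  move=> y My x /=; rewrite in_itv/= => /andP[h1 h2].
  by apply: le_trans (ltW My); apply: hM; rewrite !ltW.
exact: (@integrableMl _ _ _ mu _ (measurable_itv _) _ _ hf mg bg).
Qed.

Lemma cintegrableD a b f g : cintegrable a b f -> cintegrable a b g ->
  cintegrable a b (fun x => f x + g x).
Proof.
move=> [f1 f2] [g1 g2]; split.
  by apply: (rintegrable_ext (rintegrableD f1 g1)) => x _; rewrite cReD.
by apply: (rintegrable_ext (rintegrableD f2 g2)) => x _; rewrite cImD.
Qed.

Lemma cintegrableMl a b (c : R[i]) f : cintegrable a b f -> cintegrable a b (fun x => c * f x).
Proof.
move=> [f1 f2]; split.
  apply: (rintegrable_ext (rintegrableB (rintegrableZ (complex.Re c) f1) (rintegrableZ (complex.Im c) f2))) => x _.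
  by rewrite cReM.
apply: (rintegrable_ext (rintegrableD (rintegrableZ (complex.Re c) f2) (rintegrableZ (complex.Im c) f1))) => x _.
by rewrite cImM.
Qed.

Lemma cintegrable_ext a b f g : cintegrable a b f -> (forall x, a < x < b -> f x = g x) ->
  cintegrable a b g.
Proof.
move=> [f1 f2] e; split; [apply: (rintegrable_ext f1)|apply: (rintegrable_ext f2)] => x h;
by rewrite e.
Qed.

Lemma cintegrableN a b f : cintegrable a b f -> cintegrable a b (fun x => - f x).
Proof. by move=> h; apply: (cintegrable_ext (cintegrableMl (-1) h)) => x _; rewrite mulN1r. Qed.

Lemma cintegrableB a b f g : cintegrable a b f -> cintegrable a b g ->
  cintegrable a b (fun x => f x - g x).
Proof. by move=> hf hg; exact: (cintegrableD hf (cintegrableN hg)). Qed.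

Lemma cintegrableMc a b f g : a <= b -> cintegrable a b f -> ccont g a b ->
  cintegrable a b (fun x => f x * g x).
Proof.
move=> ab [f1 f2] [g1 g2]; split.
  apply: (rintegrable_ext (rintegrableB (rintegrableMc ab f1 g1) (rintegrableMc ab f2 g2))) => x _.
  by rewrite cReM.
apply: (rintegrable_ext (rintegrableD (rintegrableMc ab f1 g2) (rintegrableMc ab f2 g1))) => x _.
by rewrite cImM.
Qed.

Lemma cintegrable_sum {I : eqType} a b (s : seq I) (F : I -> R -> R[i]) : 
  (forall i, i \in s -> cintegrable a b (F i)) -> cintegrable a b (fun x => \sum_(i <- s) F i x).
Proof.
elim: s => [_|i s ih h].
  apply: (cintegrable_ext (f := fun=> 0)); last by move=> x _; rewrite big_nil.
  by apply: cintegrable_cont; exact: ccont_cst.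
apply: (cintegrable_ext (f := fun x => F i x + \sum_(j <- s) F j x)); last first.
  by move=> x _; rewrite big_cons.
apply: cintegrableD; first by apply: h; rewrite mem_head.
by apply: ih => j js; apply: h; rewrite inE js orbT.
Qed.

Local Notation rint a b f := (\int[mu]_(x in `]a, b[%classic) f x)%R.
Local Notation cint a b f := (cintegral `]a, b[%classic f).

Lemma cint_eq a b f g : (forall x, a < x < b -> f x = g x) -> cint a b f = cint a b g.
Proof.
move=> e; rewrite /cintegral; congr (_ +i* _); apply: eq_Rintegral => x; rewrite inE /= in_itv/= => h;
by rewrite e.
Qed.

Lemma cintD a b f g : cintegrable a b f -> cintegrable a b g ->
  cint a b (fun x => f x + g x) = cint a b f + cint a b g.
Proof.
move=> [f1 f2] [g1 g2]; apply: complex_eq; rewrite ?cReD ?cImD /=.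
  by under eq_Rintegral do rewrite cReD; apply: RintegralD.
by under eq_Rintegral do rewrite cImD; apply: RintegralD.
Qed.

Lemma cintMl a b (c : R[i]) f : cintegrable a b f ->
  cint a b (fun x => c * f x) = c * cint a b f.
Proof.
move=> [f1 f2]; apply: complex_eq; rewrite ?cReM ?cImM /=.
  under eq_Rintegral do rewrite cReM.
  by rewrite RintegralB ?RintegralZl//; exact: rintegrableZ.
under eq_Rintegral do rewrite cImM.
by rewrite RintegralD ?RintegralZl//; exact: rintegrableZ.
Qed.

Lemma cintN a b f : cintegrable a b f -> cint a b (fun x => - f x) = - cint a b f.
Proof.
move=> h; rewrite -mulN1r -cintMl//; apply: cint_eq => x _; by rewrite mulN1r.
Qed.

Lemma cintB a b f g : cintegrable a b f -> cintegrable a b g ->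
  cint a b (fun x => f x - g x) = cint a b f - cint a b g.
Proof. by move=> hf hg; rewrite cintD ?cintN//; exact: cintegrableN. Qed.

Lemma cint_sum {I : eqType} a b (s : seq I) (F : I -> R -> R[i]) :
  (forall i, i \in s -> cintegrable a b (F i)) ->
  cint a b (fun x => \sum_(i <- s) F i x) = \sum_(i <- s) cint a b (F i).
Proof.
elim: s => [_|i s ih h].
  rewrite big_nil (@cint_eq _ _ _ (fun=> 0)); last by move=> x _; rewrite big_nil.
  by apply: complex_eq; rewrite /= Rintegral_cst// mul0r.
have hs : forall j, j \in s -> cintegrable a b (F j) by move=> j js; apply: h; rewrite inE js orbT.
rewrite big_cons -ih// -cintD; last 2 first.
- by apply: h; rewrite mem_head.
- exact: cintegrable_sum.
by apply: cint_eq => x _; rewrite big_cons.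
Qed.

Lemma rint_cst a b (c : R) : a <= b -> rint a b (fun=> c) = c * (b - a).
Proof.
move=> ab; rewrite Rintegral_cst//; congr (_ * _).
transitivity (fine (@lebesgue_measure R `]a, b[%classic)) => //.
rewrite lebesgue_measure_itv/= lte_fin; case: ltP => //= h.
by apply/eqP; rewrite eq_sym subr_eq0 eq_le ab h.
Qed.

Lemma rintegrable_cst a b (c : R) : rintegrable a b (fun=> c).
Proof. by apply: rintegrable_cont => x; exact: cvg_cst. Qed.

Lemma rint_le a b f g : rintegrable a b f -> rintegrable a b g ->
  (forall x, a < x < b -> f x <= g x) -> rint a b f <= rint a b g.
Proof.
move=> hf hg h; apply: le_Rintegral => // x /=; rewrite in_itv/=; exact: h.
Qed.

Lemma rintegrable_abs a b f : rintegrable a b f -> rintegrable a b (fun x => `|f x|).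
Proof. by move=> hf; have := integrable_abse hf. Qed.

Lemma rint_norm_le a b f g : rintegrable a b f -> rintegrable a b g ->
  (forall x, a < x < b -> `|f x| <= g x) -> `|rint a b f| <= rint a b g.
Proof.
move=> hf hg h; apply: (le_trans (le_normr_Rintegral _ _)) => //.
by apply: rint_le => //; exact: rintegrable_abs.
Qed.

Lemma cint_bound a b f g : cintegrable a b f -> rintegrable a b g ->
  (forall x, a < x < b -> cmodulus (f x) <= g x) -> cmodulus (cint a b f) <= 2 * rint a b g.
Proof.
move=> [f1 f2] hg h; apply: (le_trans (cmod_le_ReIm _)); rewrite /=.
have h1 : `|rint a b (fun x => complex.Re (f x))| <= rint a b g.
  by apply: rint_norm_le => // x hx; apply: (le_trans (cmod_Re _)); exact: h.
have h2 : `|rint a b (fun x => complex.Im (f x))| <= rint a b g.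
  by apply: rint_norm_le => // x hx; apply: (le_trans (cmod_Im _)); exact: h.
lra.
Qed.

Lemma rint_FTC a b (f F : R -> R) : a < b -> {within `[a, b], continuous f} ->
  {within `[a, b], continuous F} -> (forall x, a < x < b -> is_derive x (1 : R) F (f x)) ->
  rint a b f = F b - F a.
Proof.
move=> ab cf cF dF.
rewrite Rintegral_itv_bndo_bndc; last exact: rintegrable_cont.
rewrite Rintegral_itv_obnd_cbnd; last first.
  apply: (@integrableS _ _ _ mu `[a, b]%classic) => //; first exact: subset_itv_oc_cc.
  by apply: continuous_compact_integrable => //; exact: segment_compact.
rewrite /Rintegral (@continuous_FTC2 _ f F)//.
  move/(continuous_within_itvP _ ab) : cF => [_ h1 h2]; split => // x.
  by rewrite in_itv/= => /dF[].
by move=> x; rewrite in_itv/= => /dF h; rewrite derive1E derive_val.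
Qed.

Lemma cint_FTC a b (f F : R -> R[i]) : a < b -> ccont f a b -> ccont F a b ->
  (forall x, a < x < b -> is_cderive F x (f x)) -> cint a b f = F b - F a.
Proof.
move=> ab [f1 f2] [F1 F2] dF; apply: complex_eq; rewrite ?cReB ?cImB /=.
  by apply: (@rint_FTC _ _ _ (fun x => complex.Re (F x))) => // x /dF[].
by apply: (@rint_FTC _ _ _ (fun x => complex.Im (F x))) => // x /dF[].
Qed.

End interval_integrals.

(** * Peak kernels for the uniqueness of Fourier coefficients *)

Section uniqueness.
Context {R : realType}.
Implicit Types (a b : R).
Local Notation mu := (@lebesgue_measure R).
Local Notation rint a b f := (\int[mu]_(x in `]a, b[%classic) f x)%R.

Lemma bernoulli_ineq (s : R) n : 0 <= s -> 1 + n%:R * s <= (1 + s) ^+ n.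
Proof.
move=> s0; elim: n => [|n ih]; first by rewrite mul0r addr0 expr0.
rewrite exprS; apply: (@le_trans _ _ ((1 + s) * (1 + n%:R * s))); last first.
  by rewrite ler_wpM2l// addr_ge0.
rewrite -natr1; have : 0 <= n%:R * (s * s) by rewrite !mulr_ge0.
by move: (n%:R) => k h; lra.
Qed.

Lemma geometric_absurd (A B q1 q2 : R) : 0 < A -> 0 < q2 < q1 ->
  (forall n, A * q1 ^+ n <= B * q2 ^+ n) -> False.
Proof.
move=> A0 /andP[q20 q12] h; pose s := q1 / q2 - 1.
have s0 : 0 < s by rewrite subr_gt0 ltr_pdivlMr// mul1r.
have key n : A * (n%:R * s) <= B.
  have := h n; rewrite -ler_pdivrMr ?exprn_gt0// -mulrA -expr_div_n => hn.
  apply: le_trans hn; rewrite ler_wpM2l ?(ltW A0)//.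
  apply: le_trans (_ : _ <= (1 + s) ^+ n) _; last by rewrite /s addrC subrK.
  by apply: le_trans (bernoulli_ineq _ (ltW s0)); rewrite lerDr.
have := archi_boundP (normr_ge0 (B / (A * s))).
set n := Num.bound _ => hn; have := key n; rewrite leNgt => /negP; apply.
have : B / (A * s) < n%:R by apply: le_lt_trans hn; exact: ler_norm.
rewrite ltr_pdivrMr ?mulr_gt0// => hh; apply: (lt_le_trans hh).
by rewrite le_eqVlt; apply/orP; left; apply/eqP; ring.
Qed.

Lemma rint_subset a b c d (f : R -> R) : a <= c -> d <= b -> rintegrable a b f ->
  (forall x, a < x < b -> 0 <= f x) -> rint c d f <= rint a b f.
Proof.
move=> ac db hf f0.
have sub : `]c, d[%classic `<=` `]a, b[%classic.
  move=> x /=; rewrite !in_itv/= => /andP[h1 h2]; apply/andP; split.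
    exact: le_lt_trans ac h1.
  exact: lt_le_trans h2 db.
have hf2 : rintegrable c d f by apply: (@integrableS _ _ _ mu `]a, b[%classic).
rewrite /Rintegral fine_le//.
- exact: integrable_fin_num.
- exact: integrable_fin_num.
by apply: ge0_subset_integral => //; exact: (measurable_int mu).
Qed.

Lemma cos_even_2pi (y : R) : cos (2 * pi - y) = cos y.
Proof.
have := cosD2pi (- y); rewrite cosN => <-; congr cos.
by rewrite mulr_natl addrC.
Qed.

(** The kernels ((1 + cos) / 2)^n are trigonometric polynomials that concentrate at x0. Near x0 the
    integrand contributes at least a multiple of q1^n, elsewhere at most a multiple of q2^n in
    modulus, and q2 < q1 contradicts vanishing integrals. *)
Lemma peak_positive a b (u : R -> R) (x0 mu1 : R) : mu1 * (b - a) = 2 * pi ->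
  a < x0 < b -> {within `[a, b], continuous u} -> 0 < u x0 ->
  (forall n, rint a b (fun x => u x * ((1 + cos (mu1 * (x - x0))) / 2) ^+ n) = 0) -> False.
Proof.
move=> muE /andP[ax xb] cu u0 hint; have ab := lt_trans ax xb.
have p0 := pi_gt0 R.
have ba0 : 0 < b - a by rewrite subr_gt0.
have mu0 : 0 < mu1.
  by rewrite -(pmulr_lgt0 _ ba0) muE mulr_gt0.
have [M M0 hM] := within_cont_compact_bounded (ltW ab) cu.
have eta0 : 0 < u x0 / 2 by rewrite divr_gt0.
have xin : (`[a, b]%classic : set R) x0 by rewrite /= in_itv/= !ltW.
have [d1 d10 hd1] := (within_continuousP _ _).1 cu x0 xin _ eta0.
(* Half of the minimum: u stays above u(x0) / 2 on the distance d, and a margin 2d remains to both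
   end points. *)
pose d := Num.min d1 (Num.min (x0 - a) (b - x0)) / 2.
have m0 : 0 < Num.min d1 (Num.min (x0 - a) (b - x0)).
  by rewrite !lt_min d10 !subr_gt0 ax xb.
have d0 : 0 < d by rewrite divr_gt0.
have [dd1 dxa dxb] : [/\ d < d1, 2 * d <= x0 - a & 2 * d <= b - x0].
  rewrite /d mulrCA divff// mulr1; split; last 2 first.
  - by rewrite !ge_min lexx orbT.
  - by rewrite !ge_min lexx !orbT.
  by apply: (@lt_le_trans _ _ (Num.min d1 (Num.min (x0 - a) (b - x0)))); [lra|rewrite ge_min lexx].
pose K x := (1 + cos (mu1 * (x - x0))) / 2.
have K0 x : 0 <= K x by rewrite /K divr_ge0//; have := cos_geN1 (mu1 * (x - x0)); lra.
pose q1 := (1 + cos (mu1 * (d / 2))) / 2; pose q2 := (1 + cos (mu1 * d)) / 2.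
have mud : mu1 * d < pi.
  have : mu1 * (4 * d) <= 2 * pi by rewrite -muE ler_wpM2l ?(ltW mu0)//; lra.
  lra.
have mudp : 0 < mu1 * d by rewrite mulr_gt0.
have cosK x : cos (mu1 * (x - x0)) = cos (mu1 * `|x - x0|).
  by rewrite -cos_norm normrM (gtr0_norm mu0).
have cosmono (s t : R) : 0 <= s -> s <= t -> t <= pi -> cos t <= cos s.
  move=> h1 h2 h3; rewrite leNgt ltr_cos ?in_itv/= ?h3 ?h1 ?(le_trans h2 h3) ?(le_trans h1 h2)//.
  by rewrite -leNgt.
have q21 : q2 < q1.
  rewrite /q1 /q2 ltr_pM2r ?invr_gt0// ltrD2l ltr_cos.
  - by rewrite ltr_pM2l// ltr_pdivrMr// mulr_natr mulr2n ltrDl.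
  - by rewrite in_itv/=; apply/andP; split; lra.
  - by rewrite in_itv/=; apply/andP; split; lra.
have q20 : 0 < q2.
  rewrite /q2 divr_gt0//; have : cos pi < cos (mu1 * d).
    by rewrite ltr_cos ?in_itv/= ?lexx ?(ltW p0) ?(ltW mud) ?(ltW mudp).
  by rewrite cospi; lra.
have Kin x : `|x - x0| <= d / 2 -> q1 <= K x.
  move=> h; rewrite /q1 /K ler_pM2r ?invr_gt0// lerD2l cosK; apply: cosmono.
  - by rewrite mulr_ge0// ltW.
  - by rewrite ler_pM2l.
  - by lra.
(* The cosine peaks again at distance b - a from x0, outside the interval; the margin keeps x at
   least d away from these copies too. *)
have Kout x : a < x < b -> d <= `|x - x0| -> K x <= q2.
  move=> /andP[h1 h2] h; rewrite /q2 /K ler_pM2r ?invr_gt0// lerD2l cosK.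
  have hle : `|x - x0| <= b - a - d by rewrite ler_norml; apply/andP; split; lra.
  have [le|gt] := leP (mu1 * `|x - x0|) pi.
    by apply: cosmono => //; [exact: ltW|rewrite ler_pM2l].
  rewrite -(cos_even_2pi (mu1 * `|x - x0|)).
  have hle2 : mu1 * `|x - x0| <= mu1 * (b - a - d) by rewrite ler_pM2l.
  have e : mu1 * (b - a - d) = 2 * pi - mu1 * d by rewrite -muE; ring.
  by apply: cosmono; lra.
have cK n : {within `[a, b], continuous (fun x => K x ^+ n)}.
  have h1 t : is_derive t (1 : R) K (mu1 * (- sin (mu1 * (t - x0))) / 2).
    have h2 : is_derive t (1 : R) (fun y => mu1 * (y - x0)) mu1.
      by apply: (is_derive_ext (is_derive_affine mu1 (- (mu1 * x0)) t)) => // y; ring.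
    have h3 := is_derive1_comp (f := cos) (g := fun y => mu1 * (y - x0)).
    have h4 : is_derive t (1 : R) (cos \o (fun y => mu1 * (y - x0))) (- sin (mu1 * (t - x0)) * mu1).
      apply: is_derive1_comp.
    have h5 := is_deriveZ (2^-1) (is_deriveD (is_derive_cst (1 : R) t (1 : R)) h4).
    apply: (is_derive_ext h5) => [y|]; last by rewrite /GRing.scale /=; ring.
    by rewrite /K; transitivity (2^-1 * (1 + cos (mu1 * (y - x0)))) => //; rewrite mulrC.
  elim: n => [|n ih]; first by move=> x; exact: cvg_cst.
  rewrite (_ : (fun x => K x ^+ n.+1) = (fun x => K x * K x ^+ n)); last first.
    by apply/funext => x; rewrite exprS.
  by apply: within_contM => //; exact: (is_derive_within_cont h1).
apply: (@geometric_absurd (u x0 / 2 * d) (M * (b - a)) q1 q2).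
- by rewrite mulr_gt0.
- by rewrite q20.
(* Adding M q2^n makes the integrand nonnegative on the whole interval, so its integral can be
   bounded below by that over the inner interval. *)
move=> n; pose h x := u x * K x ^+ n + M * q2 ^+ n.
have ih : rintegrable a b h.
  apply: rintegrableD; last exact: rintegrable_cst.
  by apply: rintegrable_cont; apply: within_contM.
have iu : rintegrable a b (fun x => u x * K x ^+ n).
  by apply: rintegrable_cont; apply: within_contM.
have unear x : a < x < b -> `|x - x0| < d -> u x0 / 2 <= u x.
  move=> /andP[h1 h2] hx.
  have : `|u x0 - u x| < u x0 / 2.
    apply: hd1; first by rewrite /= in_itv/= !ltW.
    by rewrite /ball /= distrC; apply: lt_trans dd1.
  by rewrite ltr_norml => /andP[_]; lra.
have hge0 x : a < x < b -> 0 <= h x.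
  move=> xab; have [lt|ge] := ltP `|x - x0| d.
    by rewrite addr_ge0 ?mulr_ge0 ?exprn_ge0 ?(ltW q20)//; apply: le_trans (unear _ xab lt); exact: ltW.
  have : `|u x * K x ^+ n| <= M * q2 ^+ n.
    rewrite normrM [`|K x ^+ n|]ger0_norm ?exprn_ge0//; apply: ler_pM; rewrite ?exprn_ge0//.
      by case/andP: xab => h1 h2; apply: hM; rewrite !ltW.
    by apply: lerXn2r; rewrite ?nnegrE ?(ltW q20)//; apply: Kout.
  by rewrite ler_norml => /andP[]; rewrite /h; lra.
have : rint (x0 - d / 2) (x0 + d / 2) h <= rint a b h.
  by apply: rint_subset => //; lra.
have -> : rint a b h = M * (b - a) * q2 ^+ n.
  rewrite RintegralD ?rint_cst ?(ltW ab)//; last exact: rintegrable_cst.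
  by rewrite (hint n) add0r mulrAC.
apply: le_trans; have -> : u x0 / 2 * d * q1 ^+ n = rint (x0 - d / 2) (x0 + d / 2) (fun=> u x0 / 2 * q1 ^+ n).
  by rewrite rint_cst; [field|lra].
apply: rint_le; first exact: rintegrable_cst.
  apply: (@integrableS _ _ _ mu `]a, b[%classic) => //.
  move=> x /=; rewrite !in_itv/= => /andP[h1 h2]; apply/andP; split; lra.
move=> x /andP[h1 h2]; have xab : a < x < b by apply/andP; split; lra.
have xd : `|x - x0| <= d / 2 by rewrite ler_norml; apply/andP; split; lra.
apply: (@le_trans _ _ (u x * K x ^+ n)).
  apply: ler_pM; rewrite ?(ltW eta0) ?exprn_ge0 ?(le_trans (ltW q20) (ltW q21))//.
    by apply: unear => //; apply: le_lt_trans xd _; lra.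
  by apply: lerXn2r; rewrite ?nnegrE ?(le_trans (ltW q20) (ltW q21))//; apply: Kin.
by rewrite lerDl mulr_ge0// exprn_ge0// ltW.
Qed.

End uniqueness.

(** * Fourier coefficients, inversion with a rate, and products *)

Section fourier.
Context {R : realType} (a b : R) (ab : a < b).
Local Notation mu1 := (freq a b 1).
Local Notation fc := (fourier_coef a b).
Local Notation cint f := (cintegral `]a, b[%classic f).
Local Notation rint a b f := (\int[@lebesgue_measure R]_(x in `]a, b[%classic) f x)%R.

Let ba0 : 0 < b - a. Proof. by rewrite subr_gt0. Qed.
Let m0 : 0 < mu1. Proof. exact: mu_gt0. Qed.

Definition ech (l : int) (x : R) : R[i] := expi (freq a b l * (x - a)).

Lemma freqD l k : freq a b (l + k) = freq a b l + freq a b k.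
Proof. by rewrite freqE [freq a b l]freqE [freq a b k]freqE intrD mulrDr. Qed.

Lemma freqN l : freq a b (- l) = - freq a b l.
Proof. by rewrite freqE [freq a b l]freqE intrN mulrN. Qed.

Lemma freq_period l : freq a b l * (b - a) = 2 * pi * l%:~R.
Proof. by rewrite /freq divfK// gt_eqF. Qed.

Lemma echD l k x : ech (l + k) x = ech l x * ech k x.
Proof. by rewrite /ech freqD mulrDl expiD. Qed.

Lemma ech0 x : ech 0 x = 1.
Proof. by rewrite /ech freqE mulr0 mul0r expi0. Qed.

Lemma cmod_ech l x : cmodulus (ech l x) = 1.
Proof. exact: cmod_expi. Qed.

Lemma expi_2pi (n : nat) : expi (2 * pi * n%:R) = 1 :> R[i].
Proof.
rewrite mulrC expi_mulrn (_ : expi (2 * pi) = 1) ?expr1n//.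
by apply: complex_eq; rewrite /= mulr_natl ?cos2pi ?sin2pi.
Qed.

Lemma expi_2piz (l : int) : expi (2 * pi * l%:~R) = 1 :> R[i].
Proof.
case: l => n; first exact: expi_2pi.
rewrite NegzE intrN mulrN -conj_expi expi_2pi.
by apply: complex_eq; rewrite /= ?oppr0.
Qed.

Lemma ech_a l : ech l a = 1.
Proof. by rewrite /ech subrr mulr0 expi0. Qed.

Lemma ech_b l : ech l b = 1.
Proof. by rewrite /ech freq_period expi_2piz. Qed.

Lemma is_cderive_ech l x : is_cderive (ech l) x ((0 +i* freq a b l) * ech l x).
Proof.
have h : is_derive x (1 : R) (fun y => freq a b l * (y - a)) (freq a b l).
  by apply: (is_derive_ext (is_derive_affine (freq a b l) (- (freq a b l * a)) x)) => // y; ring.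
exact: (is_cderive_expi h).
Qed.

Lemma ccont_ech l : ccont (ech l) a b.
Proof. exact: (@is_cderive_ccont R (ech l) _ a b (is_cderive_ech l)). Qed.

Lemma fcE phi l : fc phi l = ((b - a)^-1)%:C * cint (fun x => phi x * ech (- l) x).
Proof.
rewrite /fourier_coef; congr (_ * _); apply: cint_eq => x _.
by rewrite /ech freqN mulNr.
Qed.

Lemma fc_eq phi phi' l : (forall x, a < x < b -> phi x = phi' x) -> fc phi l = fc phi' l.
Proof. by move=> h; rewrite !fcE; congr (_ * _); apply: cint_eq => x hx; rewrite h. Qed.

Lemma cintegrable_ech phi l : cintegrable a b phi -> cintegrable a b (fun x => phi x * ech l x).
Proof. by move=> h; apply: cintegrableMc => //; [exact: ltW|exact: ccont_ech]. Qed.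

Lemma fcD phi phi' l : cintegrable a b phi -> cintegrable a b phi' ->
  fc (fun x => phi x + phi' x) l = fc phi l + fc phi' l.
Proof.
move=> h h'; rewrite !fcE -mulrDr -cintD; last 2 first.
- exact: cintegrable_ech.
- exact: cintegrable_ech.
by congr (_ * _); apply: cint_eq => x _; rewrite mulrDl.
Qed.

Lemma fcMl c phi l : cintegrable a b phi -> fc (fun x => c * phi x) l = c * fc phi l.
Proof.
move=> h; rewrite !fcE [RHS]mulrCA -[c * cintegral _ _]cintMl; last exact: cintegrable_ech.
by congr (_ * _); apply: cint_eq => x _; rewrite mulrA.
Qed.

Lemma fcB phi phi' l : cintegrable a b phi -> cintegrable a b phi' ->
  fc (fun x => phi x - phi' x) l = fc phi l - fc phi' l.
Proof.
move=> h h'; rewrite -mulN1r -fcMl// -fcD//; last exact: cintegrableMl.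
by apply: fc_eq => x _; rewrite mulN1r.
Qed.

Lemma fc_sum {I : eqType} (s : seq I) (F : I -> R -> R[i]) l :
  (forall i, i \in s -> cintegrable a b (F i)) ->
  fc (fun x => \sum_(i <- s) F i x) l = \sum_(i <- s) fc (F i) l.
Proof.
move=> h; under eq_bigr => i _ do rewrite fcE; rewrite -mulr_sumr fcE -cint_sum.
  by congr (_ * _); apply: cint_eq => x _; rewrite mulr_suml.
by move=> i /h ?; exact: cintegrable_ech.
Qed.

Lemma fc_bound phi l (g : R -> R) : cintegrable a b phi -> rintegrable a b g ->
  (forall x, a < x < b -> cmodulus (phi x) <= g x) -> 
  cmodulus (fc phi l) <= 2 / (b - a) * rint a b g.
Proof.
move=> h hg hM; rewrite fcE cmodM cmodR ger0_norm ?invr_ge0 ?(ltW ba0)//.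
rewrite [2 / _]mulrC -mulrA ler_wpM2l ?invr_ge0 ?(ltW ba0)//.
apply: cint_bound => //; first exact: cintegrable_ech.
by move=> x hx; rewrite cmodM cmod_ech mulr1 hM.
Qed.

Lemma fc_bound_cst phi l (M : R) : cintegrable a b phi ->
  (forall x, a < x < b -> cmodulus (phi x) <= M) -> cmodulus (fc phi l) <= 2 * M.
Proof.
move=> h hM; apply: (le_trans (fc_bound l h (rintegrable_cst a b M) hM)).
by rewrite rint_cst ?(ltW ab)// mulrCA [X in _ * X]divfK ?gt_eqF// mulrC.
Qed.

Lemma fc_shift phi l k : fc (fun x => ech k x * phi x) l = fc phi (l - k).
Proof.
rewrite !fcE; congr (_ * _); apply: cint_eq => x _.
by rewrite opprB addrC [LHS]mulrC mulrA [ech _ x * _]mulrC -echD mulrC addrC.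
Qed.

Lemma cint_ech l : cint (ech l) = (if l == 0 then b - a else 0)%:C.
Proof.
have [->|l0] := eqVneq l 0.
  rewrite (@cint_eq _ _ _ _ (fun=> 1)); last by move=> x _; rewrite ech0.
  by apply: complex_eq; rewrite /= rint_cst ?(ltW ab)// ?mul1r ?mul0r.
have f0 : freq a b l != 0 by rewrite freqE; apply: mulf_neq0; rewrite ?intr_eq0// gt_eqF.
pose z : R[i] := 0 +i* freq a b l.
have z0 : z != 0 by rewrite /z eq_complex /= negb_and f0 orbT.
have -> : cint (ech l) = ech l b * z^-1 - ech l a * z^-1.
  apply: (@cint_FTC R a b _ (fun x => ech l x * z^-1)) => //.
  - exact: ccont_ech.
  - by apply: ccontM; [exact: ccont_ech|exact: ccont_cst].
  move=> x _; have := is_cderiveMr z^-1 (is_cderive_ech l x) => h.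
  by apply: (is_cderive_ext h) => //; rewrite mulrAC divff// mul1r.
by rewrite ech_a ech_b subrr.
Qed.

Lemma fc_ech k l : fc (ech k) l = (k == l)%:R.
Proof.
rewrite fcE (@cint_eq _ _ _ _ (ech (k - l))); last by move=> x _; rewrite -echD.
rewrite cint_ech subr_eq0; case: eqP => _; last by rewrite mulr0.
by rewrite -rmorphM /= mulVf ?gt_eqF.
Qed.

Lemma fc_trig (s : seq int) (c : int -> R[i]) l : uniq s ->
  fc (fun x => \sum_(k <- s) c k * ech k x) l = if l \in s then c l else 0.
Proof.
move=> us; have hk k : cintegrable a b (ech k) by apply: cintegrable_cont; exact: ccont_ech.
rewrite fc_sum; last by move=> k _; exact: cintegrableMl.
under eq_bigr => k _ do rewrite fcMl// fc_ech.
case: ifPn => ls.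
  rewrite (bigD1_seq l)//= eqxx mulr1 big1 ?addr0// => k /negbTE ->.
  by rewrite mulr0.
rewrite big_seq big1// => k ks; case: eqP => [e|_]; last by rewrite mulr0.
by rewrite -e ks in ls.
Qed.

(** (1 + cos) / 2 equals 1/2 plus one quarter of each of two characters of frequency 1 and -1. The
    induction on the exponent therefore has to range over all frequencies l. *)
Lemma fc_cos_power (g : R -> R[i]) (x0 : R) n l : cintegrable a b g ->
  (forall k, fc g k = 0) ->
  cint (fun x => g x * (((1 + cos (mu1 * (x - x0))) / 2) ^+ n)%:C * ech l x) = 0.
Proof.
move=> ig hg; pose z : R[i] := expi (- (mu1 * (x0 - a))).
pose zc : R[i] := expi (mu1 * (x0 - a)).
have KE x : ((1 + cos (mu1 * (x - x0))) / 2)%:C =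
    2^-1 + 4^-1 * z * ech 1 x + 4^-1 * zc * ech (-1) x.
  have -> : 4^-1 * z * ech 1 x = 4^-1 * expi (mu1 * (x - x0)).
    by rewrite -mulrA /z /ech -expiD; congr (_ * expi _); ring.
  have -> : 4^-1 * zc * ech (-1) x = 4^-1 * conjc (expi (mu1 * (x - x0))).
    by rewrite conj_expi -mulrA /zc /ech freqN -expiD; congr (_ * expi _); ring.
  rewrite -[2^-1 : R[i]](_ : (2^-1)%:C = _); last by rewrite fmorphV rmorph_nat.
  rewrite -[4^-1 : R[i]](_ : (4^-1)%:C = _); last by rewrite fmorphV rmorph_nat.
  apply: complex_eq; rewrite ?cReD ?cImD ?cReM ?cImM /=; first by field.
  by ring.
have iK m k : cintegrable a b (fun x => g x * (((1 + cos (mu1 * (x - x0))) / 2) ^+ m)%:C * ech k x).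
  elim: m k => [|m ih] k.
    by apply: cintegrable_ext (cintegrable_ech k ig) _ => x _; rewrite expr0 mulr1.
  apply: (cintegrable_ext (cintegrableD (cintegrableMl 2^-1 (ih k))
     (cintegrableD (cintegrableMl (4^-1 * z) (ih (1 + k))) (cintegrableMl (4^-1 * zc) (ih (-1 + k)))))) => x _.
  by rewrite exprS rmorphM /= KE !echD; ring.
elim: n l => [|n ih] l.
  rewrite (@cint_eq _ _ _ _ (fun x => g x * ech l x)); last by move=> x _; rewrite expr0 mulr1.
  have := hg (- l); rewrite fcE opprK => /eqP; rewrite mulf_eq0 => /orP[|/eqP//].
  by move=> /eqP/(congr1 (@complex.Re R)) /= /eqP; rewrite invr_eq0 gt_eqF.
rewrite (@cint_eq _ _ _ _ (fun x => 2^-1 * (g x * (((1 + cos (mu1 * (x - x0))) / 2) ^+ n)%:C * ech l x) +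
   (4^-1 * z * (g x * (((1 + cos (mu1 * (x - x0))) / 2) ^+ n)%:C * ech (1 + l) x) +
    4^-1 * zc * (g x * (((1 + cos (mu1 * (x - x0))) / 2) ^+ n)%:C * ech (-1 + l) x)))); last first.
  by move=> x _; rewrite exprS rmorphM /= KE !echD; ring.
rewrite cintD; last 2 first.
- exact: cintegrableMl.
- by apply: cintegrableD; exact: cintegrableMl.
rewrite cintD; last 2 first.
- exact: cintegrableMl.
- exact: cintegrableMl.
by rewrite !cintMl// !ih !mulr0 !addr0.
Qed.

Lemma within_cont_zero (u : R -> R) : {within `[a, b], continuous u} ->
  (forall x, a < x < b -> u x = 0) -> forall x, a <= x <= b -> u x = 0.
Proof.
move=> cu h x /andP[ax xb].
have [xi|xi] := boolP (a < x < b); first exact: h.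
apply/eqP/negPn/negP => ux.
have e0 : 0 < `|u x| by rewrite normr_gt0.
have xin : (`[a, b]%classic : set R) x by rewrite /= in_itv/= ax.
have [d d0 hd] := (within_continuousP _ _).1 cu x xin _ e0.
have [y [ya yb yd]] : exists y : R, [/\ a < y, y < b & `|x - y| < d].
  pose e := Num.min d (b - a) / 2.
  have mm : 0 < Num.min d (b - a) by rewrite lt_min d0.
  have [l1 l2] : e < d /\ e < b - a.
    have h1 : Num.min d (b - a) <= d by rewrite ge_min lexx.
    have h2 : Num.min d (b - a) <= b - a by rewrite ge_min lexx orbT.
    by rewrite /e; split; lra.
  have e00 : 0 < e by rewrite divr_gt0.
  move: xi; rewrite negb_and -!leNgt => /orP[] hx.
    exists (x + e); split; [lra|lra|]; by rewrite opprD addrA subrr sub0r normrN gtr0_norm.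
  exists (x - e); split; [lra|lra|]; by rewrite opprB addrCA subrr addr0 gtr0_norm.
have := hd y; rewrite (h y) ?ya// subr0 ltxx => hh; suff : false by [].
by apply: hh; rewrite /= ?in_itv/= ?ltW.
Qed.

Lemma fc_uniqueness (g : R -> R[i]) : ccont g a b -> (forall k, fc g k = 0) ->
  forall x, a <= x <= b -> g x = 0.
Proof.
move=> cg hg; have [g1 g2] := cg.
have mE : mu1 * (b - a) = 2 * pi by rewrite freq_period mulr1.
have nonpos (f : R -> R[i]) : ccont f a b -> (forall k, fc f k = 0) ->
    forall x, a < x < b -> complex.Re (f x) <= 0 /\ complex.Im (f x) <= 0.
  move=> cf hf x xab; have [f1 f2] := cf; have jf := cintegrable_cont cf.
  split; rewrite leNgt; apply/negP => ux.
    apply: (peak_positive mE xab f1 ux) => n.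
    have := fc_cos_power x n 0 jf hf => /(congr1 (@complex.Re R)) /= <-.
    by apply: eq_Rintegral => y _; rewrite ech0 mulr1 cReM /= mulr0 subr0.
  apply: (peak_positive mE xab f2 ux) => n.
  have := fc_cos_power x n 0 jf hf => /(congr1 (@complex.Im R)) /= <-.
  by apply: eq_Rintegral => y _; rewrite ech0 mulr1 cImM /= mulr0 add0r.
have hN k : fc (fun x => - g x) k = 0.
  rewrite (@fc_eq _ (fun x => -1 * g x)); last by move=> x _; rewrite mulN1r.
  by rewrite fcMl ?hg ?mulr0//; exact: cintegrable_cont.
have zero x : a < x < b -> complex.Re (g x) = 0 /\ complex.Im (g x) = 0.
  move=> xab; have [h1 h2] := nonpos g cg hg x xab.
  have [h3 h4] := nonpos _ (ccontN cg) hN x xab.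
  rewrite cReN oppr_le0 in h3; rewrite cImN oppr_le0 in h4.
  by split; apply/eqP; rewrite eq_le ?h1 ?h2 ?h3 ?h4.
move=> x xab; apply: complex_eq.
  by apply: (within_cont_zero g1 _ xab) => y /zero[].
by apply: (within_cont_zero g2 _ xab) => y /zero[].
Qed.

(** The sum over |l| > M of B om^-2, estimated as in [sum_om_tail]. An explicit rate makes the
    convergence of Fourier series uniform in x. *)
Definition tail_bd (B : R) (M : nat) : R := 2 * B / (mu1 * (1 + mu1 * M%:R)).

Lemma big_win_sub (M M' : nat) (F : int -> R[i]) : (M <= M')%N ->
  \sum_(l <- win M') F l = \sum_(l <- win M) F l + \sum_(l <- win M' | l \notin win M) F l.
Proof.
move=> MM; rewrite (bigID (fun l => l \in win M))/=; congr (_ + _).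
rewrite -big_filter; apply: perm_big; apply: uniq_perm.
- by rewrite filter_uniq// uniq_win.
- exact: uniq_win.
move=> l; rewrite mem_filter !mem_win; case: (leP `|l| M%:Z) => //= h.
by apply: le_trans h _; rewrite lez_nat.
Qed.

Lemma tail_win (c : int -> R[i]) (B : R) (z : int -> R[i]) (M M' : nat) : (M <= M')%N ->
  (forall l, om mu1 l ^+ 2 * cmodulus (c l) <= B) -> (forall l, cmodulus (z l) = 1) ->
  cmodulus (\sum_(l <- win M') c l * z l - \sum_(l <- win M) c l * z l) <= tail_bd B M.
Proof.
move=> MM hc hz; rewrite (big_win_sub _ MM) addrC addKr.
have B0 : 0 <= B by apply: le_trans (hc 0); rewrite mulr_ge0 ?cmod_ge0 ?omX_ge0.
apply: (le_trans (cmod_sum _ _ _)).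
apply: (@le_trans _ _ (\sum_(l <- win M' | l \notin win M) B * om mu1 l ^- 2)).
  apply: ler_sum => l _; rewrite cmodM hz mulr1 ler_pdivlMr ?exprn_gt0 ?om_gt0// mulrC.
  exact: hc.
rewrite -mulr_sumr -big_filter.
apply: (@le_trans _ _ (B * (2 * (mu1 * (1 + mu1 * M%:R))^-1))).
  apply: ler_wpM2l => //; apply: sum_om_tail => //.
    by rewrite filter_uniq// uniq_win.
  by move=> l; rewrite mem_filter mem_win -ltNge => /andP[].
by rewrite /tail_bd mulrCA mulrA.
Qed.

Lemma tail_bd_ge0 (B : R) M : 0 <= B -> 0 <= tail_bd B M.
Proof.
move=> B0; apply: (divr_ge0 (mulr_ge0 (ler0n R 2) B0)).
exact: (mulr_ge0 (ltW m0) (addr_ge0 ler01 (mulr_ge0 (ltW m0) (ler0n _ _)))).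
Qed.

Lemma tail_bd_small (B e : R) : 0 <= B -> 0 < e -> exists M0 : nat, forall M, (M0 <= M)%N -> tail_bd B M < e.
Proof.
move=> B0 e0; pose K := 2 * B / (mu1 * mu1 * e).
have K0 : 0 <= K.
  apply: (divr_ge0 (mulr_ge0 (ler0n R 2) B0)).
  exact: (mulr_ge0 (mulr_ge0 (ltW m0) (ltW m0)) (ltW e0)).
have := archi_boundP K0; set n := Num.bound _ => hn.
exists n => M nM; rewrite /tail_bd ltr_pdivrMr; last first.
  by rewrite mulr_gt0// ltr_pwDl// mulr_ge0// ltW.
have : K < M%:R by apply: lt_le_trans hn _; rewrite ler_nat.
rewrite /K ltr_pdivrMr; last exact: (mulr_gt0 (mulr_gt0 m0 m0) e0).
move=> h; apply: (lt_le_trans h).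
rewrite [leRHS](_ : _ = e * mu1 + M%:R * (mu1 * mu1 * e)); last by ring.
by rewrite lerDr mulr_ge0 ?(ltW e0)// ltW.
Qed.

Lemma clim_rate (F : nat -> R[i]) z (B : R) : 0 <= B ->
  (forall M, cmodulus (F M - z) <= 2 * tail_bd B M) -> clim F z.
Proof.
move=> B0 h e e0; have [M0 hM] := tail_bd_small B0 (divr_gt0 e0 (ltr0n R 2)).
by exists M0 => M /hM h1; apply: le_lt_trans (h M) _; lra.
Qed.

(** The limit is the supremum of x_n - t_n: the hypothesis says that every x_m + t_m is an upper
    bound of these numbers. This keeps the rate t_n. *)
Lemma real_lim (x t : nat -> R) : (forall n m, `|x n - x m| <= t n + t m) ->
  exists y, forall n, `|x n - y| <= t n.
Proof.
move=> h; pose S := range (fun n => x n - t n).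
have hub n : ubound S (x n + t n).
  move=> _ [m _ <-]; have := h n m; rewrite ler_norml => /andP[h1 h2]; lra.
have hs : has_sup S.
  by split; [exists (x 0%N - t 0%N), 0%N|exists (x 0%N + t 0%N); exact: hub].
exists (sup S) => n.
have h1 : sup S <= x n + t n by apply: ge_sup; [case: hs|exact: hub].
have h2 : x n - t n <= sup S by apply: ub_le_sup; [case: hs|exists n].
by rewrite ler_norml; apply/andP; split; lra.
Qed.

Lemma sum_exists (c z : int -> R[i]) (B : R) :
  (forall l, om mu1 l ^+ 2 * cmodulus (c l) <= B) -> (forall l, cmodulus (z l) = 1) ->
  exists S, forall M, cmodulus (\sum_(l <- win M) c l * z l - S) <= 2 * tail_bd B M.
Proof.
move=> hc hz; pose F M := \sum_(l <- win M) c l * z l.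
have B0 : 0 <= B by apply: le_trans (hc 0); rewrite mulr_ge0 ?cmod_ge0 ?omX_ge0.
have hF n m : cmodulus (F n - F m) <= tail_bd B n + tail_bd B m.
  have [nm|/ltnW mn] := leqP n m.
    rewrite cmodBC; apply: (le_trans (tail_win nm hc hz)); rewrite lerDl.
    exact: tail_bd_ge0.
  by apply: (le_trans (tail_win mn hc hz)); rewrite lerDr; exact: tail_bd_ge0.
have [x hx] := @real_lim (fun n => complex.Re (F n)) (tail_bd B)
  (fun n m => ltac:(rewrite -cReB; exact: le_trans (cmod_Re _) (hF n m))).
have [y hy] := @real_lim (fun n => complex.Im (F n)) (tail_bd B)
  (fun n m => ltac:(rewrite -cImB; exact: le_trans (cmod_Im _) (hF n m))).
exists (x +i* y) => M; apply: (le_trans (cmod_le_ReIm _)); rewrite cReB cImB /=.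
by have := hx M; have := hy M; rewrite /F; lra.
Qed.

(** The series converges uniformly, so its sum is continuous and has the coefficients of phi;
    uniqueness identifies the two. *)
Lemma fourier_inversion (phi : R -> R[i]) (B : R) : ccont phi a b ->
  (forall l, om mu1 l ^+ 2 * cmodulus (fc phi l) <= B) ->
  forall x M, a <= x <= b ->
    cmodulus (\sum_(l <- win M) fc phi l * ech l x - phi x) <= 2 * tail_bd B M.
Proof.
move=> cphi hc.
have B0 : 0 <= B by apply: le_trans (hc 0); rewrite mulr_ge0 ?cmod_ge0 ?omX_ge0.
have /choice[S hS] : forall x, exists S, forall M,
    cmodulus (\sum_(l <- win M) fc phi l * ech l x - S) <= 2 * tail_bd B M.
  by move=> x; apply: sum_exists => // l; exact: cmod_ech.
have cF M : ccont (fun x => \sum_(l <- win M) fc phi l * ech l x) a b.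
  by apply: ccont_sum => l _; apply: ccontM; [exact: ccont_cst|exact: ccont_ech].
have unif (p : R[i] -> R) : (forall z u, p (z - u) = p z - p u) -> (forall z, `|p z| <= cmodulus z) ->
   (forall M, {within `[a, b], continuous (fun x => p (\sum_(l <- win M) fc phi l * ech l x))}) ->
   {within `[a, b], continuous (fun x => p (S x))}.
  move=> pB pc cp; apply/within_continuousP => x xab e e0.
  have [M hM] := tail_bd_small B0 (divr_gt0 e0 (ltr0n R 8)).
  have e2 : 0 < e / 2 by rewrite divr_gt0.
  have [d d0 hd] := (within_continuousP _ _).1 (cp M) x xab _ e2.
  exists d => // y yab yd; have := hd y yab yd.
  have h1 := hS x M; have h2 := hS y M; have h3 := hM M (leqnn M).
  have := le_trans (pc _) h1; have := le_trans (pc _) h2; rewrite !pB.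
  set u := p (\sum_(_ <- _) _); set v := p (\sum_(_ <- _) _).
  rewrite !ler_norml !ltr_norml => /andP[? ?] /andP[? ?] /andP[? ?].
  by apply/andP; split; lra.
have cS : ccont S a b.
  split; apply: unif => //; [exact: cReB|exact: cmod_Re| |exact: cImB|exact: cmod_Im|].
    by move=> M; have [] := cF M.
  by move=> M; have [] := cF M.
have fcS l : fc S l = fc phi l.
  apply: (@clim_unique R (fun M => fc (fun x => \sum_(k <- win M) fc phi k * ech k x) l)).
    move=> e e0; have [M0 hM] := tail_bd_small B0 (divr_gt0 e0 (ltr0n R 8)).
    exists M0 => M /hM h; rewrite -fcB; [|exact: cintegrable_cont|exact: cintegrable_cont].
    apply: le_lt_trans (_ : _ <= 2 * (2 * tail_bd B M)) _; last by lra.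
    apply: fc_bound_cst; last by move=> x _; exact: hS.
    by apply: cintegrableB; exact: cintegrable_cont.
  apply: (@clim_near _ (fun=> fc phi l) _ _ (absz l)); first exact: clim_cst.
  by move=> M lM; rewrite fc_trig ?uniq_win// mem_win ifT.
have eS : forall x, a <= x <= b -> phi x = S x.
  move=> x xab; apply/eqP; rewrite -subr_eq0; apply/eqP; move: x xab.
  apply: fc_uniqueness; first exact: ccontB.
  by move=> k; rewrite fcB ?fcS ?subrr//; exact: cintegrable_cont.
by move=> x M xab; rewrite eS//; exact: hS.
Qed.

(** Only g is expanded, uniformly on the interval; phi has to be bounded and integrable.
    Multiplication by a character shifts the coefficients of phi. *)
Lemma fc_product (g phi : R -> R[i]) (B : R) l : ccont g a b -> cintegrable a b phi ->
  (exists2 K : R, 0 <= K & forall x, a < x < b -> cmodulus (phi x) <= K) ->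
  (forall l, om mu1 l ^+ 2 * cmodulus (fc g l) <= B) ->
  clim (fun M => \sum_(k <- win M) fc g k * fc phi (l - k)) (fc (fun x => g x * phi x) l).
Proof.
move=> cg iphi [K K0 hK] hc.
have B0 : 0 <= B by apply: le_trans (hc 0); rewrite mulr_ge0 ?cmod_ge0 ?omX_ge0.
have mulc f : ccont f a b -> cintegrable a b (fun x => f x * phi x).
  move=> cf; apply: (cintegrable_ext (cintegrableMc (ltW ab) iphi cf)) => x _; exact: mulrC.
have cF M : ccont (fun x => \sum_(l <- win M) fc g l * ech l x) a b.
  by apply: ccont_sum => k _; apply: ccontM; [exact: ccont_cst|exact: ccont_ech].
apply: (@clim_near _ (fun M => fc (fun x => (\sum_(k <- win M) fc g k * ech k x) * phi x) l) _ _ 0%N).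
  move=> e e0; have e1 : 0 < e / (8 * (K + 1)) by rewrite divr_gt0// mulr_gt0// ltr_wpDl.
  have [M0 hM] := tail_bd_small B0 e1.
  exists M0 => M /hM h; rewrite -fcB; [|exact: mulc|exact: mulc].
  apply: le_lt_trans (_ : _ <= 2 * (2 * tail_bd B M * K)) _; last first.
    have : tail_bd B M * (8 * (K + 1)) < e by rewrite -ltr_pdivlMr// mulr_gt0// ltr_wpDl.
    have := mulr_ge0 (tail_bd_ge0 M B0) K0; have := tail_bd_ge0 M B0.
    by set t := tail_bd B M; rewrite mulrDr mulr1 [8 * K]mulrC; move=> h1 h2 h3; nra.
  apply: fc_bound_cst; first by apply: cintegrableB; exact: mulc.
  move=> x /andP[h1 h2]; rewrite -mulrBl cmodM; apply: ler_pM; rewrite ?cmod_ge0//.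
    by apply: fourier_inversion => //; rewrite !ltW.
  by apply: hK; rewrite h1.
move=> M _; rewrite (@fc_eq _ (fun x => \sum_(k <- win M) fc g k * (ech k x * phi x))); last first.
  by move=> x _; rewrite mulr_suml; apply: eq_bigr => k _; rewrite mulrA.
have ie k : cintegrable a b (fun x => ech k x * phi x) by apply: mulc; exact: ccont_ech.
rewrite fc_sum; last by move=> k _; exact: cintegrableMl.
by apply: eq_bigr => k _; rewrite fcMl// fc_shift.
Qed.

End fourier.

(** * Weak derivatives *)

Section smooth_functions.
Context {R : realType}.
Implicit Types (f g : R -> R) (A : (R -> R) -> Prop).

Definition derivation_closed A : Prop := forall f, A f ->
  exists2 f', A f' & forall x, is_derive x (1 : R) f (f' x).

(** Membership in some class that is stable under differentiation. Such a class is easy to exhibit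
    for a concrete function, whereas the n-th derivatives demanded by [test_function] would need
    closed formulas. *)
Definition smooth f : Prop := exists2 A, derivation_closed A & A f.

Lemma smooth_derive f : smooth f -> exists2 f', smooth f' & forall x, is_derive x (1 : R) f (f' x).
Proof. by move=> [A cA Af]; have [f' Af' h] := cA f Af; exists f' => //; exists A. Qed.

Lemma smooth_derivable f : smooth f -> forall k x, derivable (derive1n k f) x 1.
Proof.
move=> [A cA Af] k; suff : A (derive1n k f) by move=> /cA[f' _ h] x; have [] := h x.
elim: k => [//|k ih]; rewrite derive1nS; have [f' Af' h] := cA _ ih.
suff -> : derive1 (derive1n k f) = f' by [].
by apply/funext => x; rewrite derive1E derive_val.
Qed.

(** The Leibniz rule turns a product into a sum of products, so this is the class that witnesses
    smoothness of a product. *)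
Inductive sum_of_products A B : (R -> R) -> Prop :=
| sop_mul f g : A f -> B g -> sum_of_products A B (fun x => f x * g x)
| sop_add f g : sum_of_products A B f -> sum_of_products A B g ->
    sum_of_products A B (fun x => f x + g x).

Lemma smoothM f g : smooth f -> smooth g -> smooth (fun x => f x * g x).
Proof.
move=> [A cA Af] [B cB Bg]; exists (sum_of_products A B); last exact: sop_mul.
move=> h; elim=> {h} [u v Au Bv|u v _ [u' hu du] _ [v' hv dv]].
  have [u' Au' du] := cA u Au; have [v' Bv' dv] := cB v Bv.
  exists (fun x => u x * v' x + u' x * v x); first by apply: sop_add; exact: sop_mul.
  move=> x; have [// du1 dv1] := (du x, dv x).
  apply: (is_derive_ext (is_deriveM du1 dv1)) => //.
  by rewrite /GRing.scale /=; ring.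
exists (fun x => u' x + v' x); first exact: sop_add.
by move=> x; have du1 := du x; have dv1 := dv x; exact: (is_derive_ext (is_deriveD du1 dv1)).
Qed.

Lemma smooth_affine f (c d : R) : smooth f -> smooth (fun x => f (c * x + d)).
Proof.
move=> [A cA Af]; exists (fun g => exists2 f, A f & exists k : R, g = (fun x => k * f (c * x + d))).
  move=> _ [h Ah [k ->]]; have [h' Ah' dh] := cA h Ah.
  exists (fun x => (k * c) * h' (c * x + d)); first by exists h' => //; exists (k * c).
  move=> x; have h1 := is_derive_affine c d x.
  have h2 := dh (c * x + d).
  have h3 : is_derive x (1 : R) (h \o (fun y => c * y + d)) (h' (c * x + d) * c).
    exact: is_derive1_comp.
  apply: (is_derive_ext (is_deriveZ k h3)) => //.
  by rewrite /GRing.scale /=; ring.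
by exists f => //; exists 1; apply/funext => x; rewrite mul1r.
Qed.

Lemma smooth_cos : smooth cos.
Proof.
exists (fun g => exists c d : R, g = (fun x => c * cos (x + d))); last first.
  by exists 1, 0; apply/funext => x; rewrite mul1r addr0.
move=> _ [c [d ->]]; exists (fun x => c * cos (x + (d + pi / 2))).
  by exists c, (d + pi / 2).
move=> x; have h1 : is_derive x (1 : R) (fun y => y + d) 1.
  by apply: (is_derive_ext (is_derive_affine 1 d x)) => // y; rewrite mul1r.
have h3 : is_derive x (1 : R) (cos \o (fun y => y + d)) (- sin (x + d) * 1).
  exact: is_derive1_comp.
apply: (is_derive_ext (is_deriveZ c h3)) => //.
by rewrite /GRing.scale /= addrA cosDpihalf mulr1.
Qed.

Lemma smooth_sin : smooth sin.
Proof.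
rewrite (_ : sin = (fun x => cos (1 * x + (- (pi / 2))))).
  exact: smooth_affine smooth_cos.
by apply/funext => x; rewrite mul1r cosBpihalf.
Qed.

(** The polynomial factor in 1 / x makes the family stable under differentiation: the derivative of
    P(1/x) e^(-1/x) is of the same form, with the polynomial [flat_deriv P]. *)
Definition flat (P : {poly R}) (x : R) : R :=
  if 0 < x then P.[x^-1] * expR (- x^-1) else 0.

Lemma horner_growth (P : {poly R}) : exists2 K : R, 0 <= K &
  forall y : R, 1 <= y -> `|P.[y]| <= K * y ^+ size P.
Proof.
exists (\sum_(i < size P) `|P`_i|); first by rewrite sumr_ge0.
move=> y y1; have y0 : 0 <= y by exact: le_trans y1.
rewrite horner_coef mulr_suml; apply: (le_trans (ler_norm_sum _ _ _)).
apply: ler_sum => i _; rewrite normrM ler_wpM2l// normrX (ger0_norm y0).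
by rewrite ler_weXn2l// ltnW.
Qed.

(** The exponential beats every power of 1 / x. Quadratic smallness at 0 is what differentiability
    there, with derivative 0, requires. *)
Lemma flat_small (P : {poly R}) : exists2 K : R, 0 <= K &
  forall x : R, `|x| <= 1 -> `|flat P x| <= K * x ^+ 2.
Proof.
have [K K0 hK] := horner_growth P; set n := size P in hK.
exists (K * (n.+2)`!%:R); first by rewrite mulr_ge0.
move=> x x1; rewrite /flat; case: ltP => x0; last first.
  by rewrite normr0 mulr_ge0 ?sqr_ge0// mulr_ge0.
rewrite (gtr0_norm x0) in x1.
have y1 : 1 <= x^-1 by rewrite invf_ge1.
have y0 : 0 <= x^-1 by rewrite invr_ge0 ltW.
rewrite normrM (ger0_norm (expR_ge0 _)) expRN ler_pdivrMr ?expR_gt0//.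
apply: (le_trans (hK _ y1)).
have h := expR_ge1Dxn n.+1 y0.
have {}h : x^-1 ^+ n.+2 / (n.+2)`!%:R <= expR x^-1 by apply: le_trans h; rewrite lerDr.
have f0 : 0 < (n.+2)`!%:R :> R by rewrite ltr0n fact_gt0.
rewrite ler_pdivrMr// in h.
rewrite -!mulrA ler_wpM2l//.
have -> : x^-1 ^+ n = x ^+ 2 * x^-1 ^+ n.+2.
  by rewrite -[n.+2]addn2 exprD mulrCA -exprMn mulfV ?gt_eqF// expr1n mulr1.
rewrite [leRHS](_ : _ = x ^+ 2 * (expR x^-1 * (n.+2)`!%:R)) ?ler_wpM2l ?sqr_ge0//.
by ring.
Qed.

Lemma is_derive_quad f (x d K : R) : 0 <= K ->
  (forall h : R, `|h| <= 1 -> `|f (x + h) - f x - d * h| <= K * h ^+ 2) ->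
  is_derive x (1 : R) f d.
Proof.
move=> K0 hf.
have cv : (fun h : R => h^-1 *: (f (h *: (1 : R) + x) - f x)) @ 0^' --> d.
  apply/cvgrPdist_lt => e e0.
  have K1 : 0 < K + 1 by rewrite ltr_wpDl.
  pose r := Num.min 1 (e / (K + 1)).
  have r0 : 0 < r by rewrite lt_min ltr01 divr_gt0.
  exists r => //= h; rewrite /= sub0r normrN => hr h0.
  have h1 : `|h| <= 1 by apply: (le_trans (ltW hr)); rewrite ge_min lexx.
  have h2 : `|h| < e / (K + 1) by apply: (lt_le_trans hr); rewrite ge_min lexx orbT.
  have nh0 : 0 < `|h| by rewrite normr_gt0.
  have -> : d - h^-1 *: (f (h *: (1 : R) + x) - f x) = - (h^-1 * (f (x + h) - f x - d * h)).
    rewrite /GRing.scale /= mulr1 [h + x]addrC; field.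
    by [].
  rewrite normrN normrM normfV mulrC ltr_pdivrMr//.
  apply: (le_lt_trans (hf h h1)).
  rewrite -[h ^+ 2]real_normK ?num_real// expr2 mulrA ltr_pM2r//.
  rewrite ltr_pdivlMr// in h2; apply: le_lt_trans h2; rewrite mulrC ler_wpM2l//.
  by rewrite lerDl.
apply: DeriveDef; first by apply/cvg_ex; exists d.
by apply: cvg_lim.
Qed.

Definition flat_deriv (P : {poly R}) : {poly R} := 'X^2 * (P - P^`()).

Lemma is_derive_flat (P : {poly R}) (x : R) :
  is_derive x (1 : R) (flat P) (flat (flat_deriv P) x).
Proof.
have [x0|x0|x0] := ltgtP x 0.
- have -> : flat (flat_deriv P) x = 0 by rewrite /flat ltNge (ltW x0).
  have hc : is_derive x (1 : R) (fun=> (0 : R)) 0 by exact: is_derive_cst.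
  apply: (near_eq_is_derive _ hc).
  near=> y; rewrite /flat ltNge.
  suff -> : y <= 0 by [].
  by apply: ltW; near: y; exact: lt_nbhsl.
- have xn : x != 0 by rewrite gt_eqF.
  have h1 : is_derive x (1 : R) (fun y : R => y^-1) (- x^-1 ^+ 2).
    have h := is_deriveV xn (is_derive_id x (1 : R)).
    by apply: (is_derive_ext h) => //; rewrite /GRing.scale /= mulr1 exprVn.
  have h2 : is_derive x (1 : R) ((fun z => P.[z]) \o (fun y : R => y^-1)) (P^`().[x^-1] * (- x^-1 ^+ 2)).
    by apply: is_derive1_comp; exact: is_derive_poly.
  have h1N := is_deriveN h1.
  have h3 : is_derive x (1 : R) (expR \o (fun y : R => - y^-1)) (expR (- x^-1) * - - x^-1 ^+ 2).
    by apply: is_derive1_comp.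
  suff hd : is_derive x (1 : R) (fun y => P.[y^-1] * expR (- y^-1)) (flat (flat_deriv P) x).
    apply: (near_eq_is_derive _ hd); near=> y; rewrite /flat.
    suff -> : 0 < y by [].
    by near: y; exact: lt_nbhsr.
  apply: (is_derive_ext (is_deriveM h2 h3)) => //.
  rewrite /flat x0 /flat_deriv /GRing.scale /= !hornerE /=.
  by rewrite opprK; ring.
- have -> : flat (flat_deriv P) x = 0 by rewrite /flat x0 ltxx.
  have [K K0 hK] := flat_small P.
  apply: (is_derive_quad K0) => h h1; rewrite x0 add0r mul0r subr0.
  by rewrite {2}/flat ltxx subr0; exact: hK.
Unshelve. all: by end_near.
Qed.

Lemma smooth_flat (P : {poly R}) : smooth (flat P).
Proof.
exists (fun g => exists Q, g = flat Q); last by exists P.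
by move=> _ [Q ->]; exists (flat (flat_deriv Q)); [exists (flat_deriv Q)|exact: is_derive_flat].
Qed.

Definition flat1 : R -> R := flat 1.

Lemma flat1_ge0 x : 0 <= flat1 x.
Proof. by rewrite /flat1 /flat; case: ifP => // _; rewrite hornerE mul1r expR_ge0. Qed.

Lemma flat1_le1 x : flat1 x <= 1.
Proof.
rewrite /flat1 /flat; case: ifP => // x0; rewrite hornerE mul1r expR_le1 oppr_le0 invr_ge0 ltW//.
Qed.

Lemma flat1_zero x : x <= 0 -> flat1 x = 0.
Proof. by move=> x0; rewrite /flat1 /flat ltNge x0. Qed.

Lemma flat1_ge x : 0 < x -> 1 - x^-1 <= flat1 x.
Proof.
move=> x0; rewrite /flat1 /flat x0 hornerE mul1r.
by have := expR_ge1Dx (- x^-1).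
Qed.

Lemma flat1_deriv : exists2 f', smooth f' &
  (forall x, 0 <= f' x) /\ forall x, is_derive x (1 : R) flat1 (f' x).
Proof.
exists (flat (flat_deriv 1)); first exact: smooth_flat.
split; last by move=> x; exact: is_derive_flat.
move=> x; rewrite /flat; case: ifP => // x0; rewrite mulr_ge0 ?expR_ge0//.
by rewrite /flat_deriv derivC subr0 mulr1 hornerE sqr_ge0.
Qed.

End smooth_functions.

Section weak_derivatives.
Context {R : realType} (a b : R) (ab : a < b).
Local Notation mu := (@lebesgue_measure R).
Local Notation rint f := (\int[mu]_(x in `]a, b[%classic) f x)%R.
Local Notation cint f := (cintegral `]a, b[%classic f).
Local Notation fc := (fourier_coef a b).

Lemma smoothZ (c : R) f : smooth f -> smooth (fun x => c * f x).
Proof.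
move=> [A cA Af]; exists (fun g => exists2 h, A h & g = (fun x => c * h x)); last by exists f.
move=> _ [h /cA[h' Ah' dh] ->]; exists (fun x => c * h' x); first by exists h'.
by move=> x; have dx := dh x; exact: (is_derive_ext (is_deriveZ c dx)).
Qed.

Lemma rint_dct (k : R -> R) (u : nat -> R -> R) : rintegrable a b k ->
  (forall n, {within `[a, b], continuous (u n)}) ->
  (forall n x, a < x < b -> `|u n x| <= 1) ->
  (forall x, a < x < b -> forall e : R, 0 < e ->
     exists n0 : nat, forall n, (n0 <= n)%N -> `|1 - u n x| < e) ->
  forall e : R, 0 < e -> exists n0 : nat, forall n, (n0 <= n)%N ->
    `|rint k - rint (fun x => k x * u n x)| < e.
Proof.
move=> ik cu u1 ucv e e0.
have iku n : rintegrable a b (fun x => k x * u n x) by apply: rintegrableMc => //; exact: ltW.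
have cvx x : a < x < b -> (fun n => (k x * u n x)%:E) @ \oo --> (k x)%:E.
  move=> xab; apply: cvg_EFin; first exact: nearW.
  rewrite -[X in _ --> X]mulr1; apply: cvgMl_tmp; apply/cvgrPdist_lt => e1 e10.
  by have [n0 hn0] := ucv x xab e1 e10; exists n0 => // n; exact: hn0.
have dom x n : a < x < b -> (`|(k x * u n x)%:E| <= `|k x|%:E)%E.
  by move=> xab; rewrite lee_fin normrM ler_piMr//; exact: u1.
have [_ _ cv] := @dominated_convergence _ _ R mu `]a, b[%classic (measurable_itv _)
  (fun n x => (k x * u n x)%:E) (fun x => (k x)%:E) (fun x => `|k x|%:E)
  (fun n => measurable_int mu (iku n)) (measurable_int mu ik)
  (ltac:(by apply: aeW => x /=; rewrite in_itv/=; exact: cvx))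
  (rintegrable_abs ik)
  (ltac:(by apply: aeW => x n /=; rewrite in_itv/=; exact: dom)).
have fk : (\int[mu]_(x in `]a, b[%classic) (k x)%:E)%E \is a fin_num.
  exact: integrable_fin_num.
have cv2 : (fun n => rint (fun x => k x * u n x)) @ \oo --> rint k.
  by apply: fine_cvg; rewrite fineK.
move/cvgrPdist_lt : cv2 => /(_ e e0)[n0 _ hn0].
by exists n0 => n nn; exact: hn0.
Qed.

Lemma expr1D_le (x : R) m : 0 <= x -> (1 + x) ^+ m <= 2 ^+ m * (1 + x ^+ m).
Proof.
move=> x0; have [le1|gt1] := leP x 1.
  apply: (@le_trans _ _ (2 ^+ m)).
    by apply: lerXn2r; rewrite ?nnegrE ?addr_ge0//; lra.
  by rewrite ler_peMr ?exprn_ge0// lerDl exprn_ge0.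
apply: (@le_trans _ _ ((2 * x) ^+ m)).
  by apply: lerXn2r; rewrite ?nnegrE ?addr_ge0 ?mulr_ge0//; lra.
by rewrite exprMn ler_wpM2l ?exprn_ge0// lerDr.
Qed.

Lemma abs_three (p1 p2 p3 p4 p5 e : R) : `|p1| < e / 3 -> `|p2 - p3| < e / 3 ->
  `|p4 - p5| < e / 3 -> p1 + p3 = - p5 -> `|p2 + p4| <= e.
Proof.
rewrite !ltr_norml => /andP[? ?] /andP[? ?] /andP[? ?] ?.
by rewrite ler_norml; apply/andP; split; lra.
Qed.

Lemma concentration_arith (e K D Lb Ra rl rr rg : R) : 0 < e -> 0 <= K -> 0 <= D ->
  Lb <= 1 -> Ra <= 1 -> D - rl < e / (8 * (K + 1)) -> D - rr < e / (8 * (K + 1)) ->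
  rg + (K * rl + K * rr) = (e / 4 + K * D) * Lb + (e / 4 + K * D) * Ra -> rg < e.
Proof.
move=> e0 K0 D0 Lb1 Ra1 h1 h2 rgE.
have K1 : 0 < K + 1 by rewrite ltr_wpDl.
have k0 : K * (e / (8 * (K + 1))) <= e / 8.
  have -> : K * (e / (8 * (K + 1))) = (e / 8) * (K / (K + 1)).
    by field; rewrite gt_eqF.
  by rewrite ler_piMr ?divr_ge0 ?(ltW e0)// ler_pdivrMr// mul1r lerDl.
have k1 : K * (D - rl) <= e / 8 by apply: le_trans k0; rewrite ler_wpM2l// ltW.
have k2 : K * (D - rr) <= e / 8 by apply: le_trans k0; rewrite ler_wpM2l// ltW.
have pos : 0 <= e / 4 + K * D by rewrite addr_ge0 ?divr_ge0 ?(ltW e0)// mulr_ge0.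
have m1 : (e / 4 + K * D) * Lb <= e / 4 + K * D by rewrite ler_piMr.
have m2 : (e / 4 + K * D) * Ra <= e / 4 + K * D by rewrite ler_piMr.
move: k1 k2; rewrite !mulrBr => k1 k2; lra.
Qed.

(** The derivative of the cutoff L Q has mass near the end points, where P is small. The lines e/4 +
    K (x - a) and e/4 + K (b - x) dominate |P|, and the products of the lines with L' and with [dQ]
    are integrated by parts: the boundary terms are at most e/2 + 2 K (b - a), and since L and Q are
    close to 1 their integrals remove almost all of 2 K (b - a). *)
Lemma concentration (P L Q dL dQ : R -> R) (e K : R) : 0 < e -> 0 <= K ->
  {within `[a, b], continuous P} -> {within `[a, b], continuous L} ->
  {within `[a, b], continuous Q} -> {within `[a, b], continuous dL} ->
  {within `[a, b], continuous dQ} ->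
  (forall x, is_derive x (1 : R) L (dL x)) -> (forall x, is_derive x (1 : R) Q (- dQ x)) ->
  (forall x, 0 <= dL x) -> (forall x, 0 <= dQ x) ->
  (forall x, 0 <= L x <= 1) -> (forall x, 0 <= Q x <= 1) -> L a = 0 -> Q b = 0 ->
  (forall x, a < x < b -> `|P x| <= e / 4 + K * (x - a) /\ `|P x| <= e / 4 + K * (b - x)) ->
  b - a - rint L < e / (8 * (K + 1)) -> b - a - rint Q < e / (8 * (K + 1)) ->
  `|rint (fun x => P x * (dL x * Q x - L x * dQ x))| < e.
Proof.
move=> e0 K0 cP cL cR cLd cRd hL hQ Ld0 Rd0 L01 Q01 La Qb hK rL rQ.
pose al x : R := K * x + (e / 4 - K * a); pose be x : R := - K * x + (e / 4 + K * b).
have dal x : is_derive x (1 : R) al K by exact: is_derive_affine.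
have dbe x : is_derive x (1 : R) be (- K) by exact: is_derive_affine.
have cal : {within `[a, b], continuous al} by exact: (is_derive_within_cont dal).
have cbe : {within `[a, b], continuous be} by exact: (is_derive_within_cont dbe).
have alE x : al x = e / 4 + K * (x - a) by rewrite /al; ring.
have beE x : be x = e / 4 + K * (b - x) by rewrite /be; ring.
clearbody al be.
pose G x := al x * dL x + be x * dQ x; pose H x := K * L x + K * Q x.
have cG : {within `[a, b], continuous G}.
  have q1 := within_contM cal cLd; have q2 := within_contM cbe cRd.
  by move=> x; apply: cvgD; [exact: q1|exact: q2].
have iL := rintegrable_cont cL; have iR := rintegrable_cont cR.
have iG := rintegrable_cont cG.
have iH : rintegrable a b H by apply: rintegrableD; exact: rintegrableZ.
have cGH : {within `[a, b], continuous (fun x => G x + H x)}.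
  move=> x; apply: cvgD; first exact: cG.
  by apply: cvgD; apply: cvgM; [exact: cvg_cst|exact: cL|exact: cvg_cst|exact: cR].
have GE : rint (fun x => G x + H x) = (al b * L b - be b * Q b) - (al a * L a - be a * Q a).
  have cF : {within `[a, b], continuous (fun x => al x * L x - be x * Q x)}.
    have q1 := within_contM cal cL; have q2 := within_contM cbe cR.
    by move=> x; apply: cvgB; [exact: q1|exact: q2].
  have dF x : a < x < b -> is_derive x (1 : R) (fun x => al x * L x - be x * Q x) (G x + H x).
    move=> _; have d1 := hL x; have d2 := hQ x; have da := dal x; have db := dbe x.
    apply: (is_derive_ext (is_deriveB (is_deriveM da d1) (is_deriveM db d2))) => //.
    by rewrite /G /H /GRing.scale /=; ring.
  by have := rint_FTC ab cGH cF dF; exact.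
rewrite La Qb !mulr0 subr0 sub0r opprK RintegralD// in GE.
have HE : rint H = K * rint L + K * rint Q.
  by rewrite RintegralD ?RintegralZl//; exact: rintegrableZ.
rewrite HE alE beE in GE.
have Gle : `|rint (fun x => P x * (dL x * Q x - L x * dQ x))| <= rint G.
  have cI : {within `[a, b], continuous (fun x => P x * (dL x * Q x - L x * dQ x))}.
    apply: within_contM => //.
    have q1 := within_contM cLd cR; have q2 := within_contM cL cRd.
    by move=> x; apply: cvgB; [exact: q1|exact: q2].
  apply: (rint_norm_le (rintegrable_cont cI) iG) => x xab; have [p1 p2] := hK x xab.
  have /andP[l0 l1] := L01 x; have /andP[r0 r1] := Q01 x.
  rewrite normrM; apply: (@le_trans _ _ (`|P x| * (dL x + dQ x))).
    rewrite ler_wpM2l//; apply: (le_trans (ler_normB _ _)); rewrite !normrM.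
    rewrite (ger0_norm (Ld0 x)) (ger0_norm (Rd0 x)) (ger0_norm l0) (ger0_norm r0).
    by apply: lerD; [apply: ler_piMr|apply: ler_piMl].
  by rewrite mulrDr /G alE beE; apply: lerD; apply: ler_wpM2r.
apply: (le_lt_trans Gle).
have /andP[_ lb1] := L01 b; have /andP[_ qa1] := Q01 a.
have ba0 : 0 <= b - a by rewrite subr_ge0 ltW.
exact: (concentration_arith e0 K0 ba0 lb1 qa1 rL rQ GE).
Qed.

(** With these offsets [Lc n] vanishes up to a + 1/n and [Rc n] from b - 1/n on; both increase to 1
    inside as n grows, and their product has compact support in the open interval. *)
Let ca (n : nat) : R := - (n%:R * a) - 1.
Let cb (n : nat) : R := n%:R * b - 1.
Let Lc (n : nat) (x : R) : R := flat1 (n%:R * x + ca n).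
Let Rc (n : nat) (x : R) : R := flat1 (- n%:R * x + cb n).

Let flat1_lim (z : R) (f : nat -> R) : 0 < z -> (forall n, f n = n%:R * z - 1) ->
  forall e : R, 0 < e -> exists n0 : nat, forall n, (n0 <= n)%N -> `|1 - flat1 (f n)| < e.
Proof.
move=> z0 fE e e0.
have K0 : 0 <= (2 + e^-1) / z by rewrite divr_ge0 ?addr_ge0 ?invr_ge0 ?(ltW e0) ?(ltW z0).
have := archi_boundP K0; set n0 := Num.bound _ => hn0.
exists n0 => n nn; have : (2 + e^-1) / z < n%:R by apply: lt_le_trans hn0 _; rewrite ler_nat.
rewrite ltr_pdivrMr// => h; have h2 : 1 + e^-1 < f n by rewrite fE; lra.
have f0 : 0 < f n by apply: lt_trans h2; rewrite addr_gt0 ?invr_gt0.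
rewrite ger0_norm ?subr_ge0 ?flat1_le1//.
apply: (@le_lt_trans _ _ (f n)^-1); first by have := flat1_ge f0; lra.
rewrite -[e]invrK ltf_pV2 ?posrE ?invr_gt0//; apply: lt_trans h2; rewrite ltrDr//.
Qed.

Let smooth_within (f : R -> R) : smooth f -> {within `[a, b], continuous f}.
Proof. by move=> /smooth_derive[f' _ h]; exact: (is_derive_within_cont h). Qed.

Let sL n : smooth (Lc n). Proof. by apply: smooth_affine; exact: smooth_flat. Qed.
Let sR n : smooth (Rc n). Proof. by apply: smooth_affine; exact: smooth_flat. Qed.

Let L_int (k : R -> R) : rintegrable a b k -> forall e : R, 0 < e ->
  exists n0 : nat, forall n, (n0 <= n)%N -> `|rint k - rint (fun x => k x * Lc n x)| < e.
Proof.
move=> ik; apply: rint_dct => //.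
- by move=> n; exact: smooth_within.
- by move=> n x _; rewrite ger0_norm ?flat1_ge0 ?flat1_le1.
- move=> x /andP[ax _]; apply: (@flat1_lim (x - a)); first by rewrite subr_gt0.
  by move=> n; rewrite /ca; ring.
Qed.

Let R_int (k : R -> R) : rintegrable a b k -> forall e : R, 0 < e ->
  exists n0 : nat, forall n, (n0 <= n)%N -> `|rint k - rint (fun x => k x * Rc n x)| < e.
Proof.
move=> ik; apply: rint_dct => //.
- by move=> n; exact: smooth_within.
- by move=> n x _; rewrite ger0_norm ?flat1_ge0 ?flat1_le1.
- move=> x /andP[_ xb]; apply: (@flat1_lim (b - x)); first by rewrite subr_gt0.
  by move=> n; rewrite /cb; ring.
Qed.

Let L_int1 (e : R) : 0 < e -> exists n0 : nat, forall n, (n0 <= n)%N -> b - a - rint (Lc n) < e.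
Proof.
move=> e0; have [n0 h0] := L_int (rintegrable_cst a b 1) e0; exists n0 => n /h0.
rewrite rint_cst ?(ltW ab)// mul1r.
have -> : rint (fun x => 1 * Lc n x) = rint (Lc n) by apply: eq_Rintegral => x _; rewrite mul1r.
by apply: le_lt_trans; exact: ler_norm.
Qed.

Let R_int1 (e : R) : 0 < e -> exists n0 : nat, forall n, (n0 <= n)%N -> b - a - rint (Rc n) < e.
Proof.
move=> e0; have [n0 h0] := R_int (rintegrable_cst a b 1) e0; exists n0 => n /h0.
rewrite rint_cst ?(ltW ab)// mul1r.
have -> : rint (fun x => 1 * Rc n x) = rint (Rc n) by apply: eq_Rintegral => x _; rewrite mul1r.
by apply: le_lt_trans; exact: ler_norm.
Qed.

Let LR_int (k : R -> R) : rintegrable a b k -> forall e : R, 0 < e ->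
  exists n0 : nat, forall n, (n0 <= n)%N -> `|rint k - rint (fun x => k x * (Lc n x * Rc n x))| < e.
Proof.
move=> ik; apply: rint_dct => //.
- by move=> n; apply: smooth_within; exact: smoothM.
- move=> n x _; rewrite ger0_norm ?mulr_ge0 ?flat1_ge0// -[leRHS]mulr1.
  by apply: ler_pM; rewrite ?flat1_ge0 ?flat1_le1.
- move=> x /andP[ax xb] e e0; have e2 : 0 < e / 2 by rewrite divr_gt0.
  have xa0 : 0 < x - a by rewrite subr_gt0.
  have bx0 : 0 < b - x by rewrite subr_gt0.
  have [n1 h1] := @flat1_lim (x - a) (fun n => n%:R * x + ca n) xa0 (fun n => ltac:(rewrite /ca; ring)) _ e2.
  have [n2 h2] := @flat1_lim (b - x) (fun n => - n%:R * x + cb n) bx0 (fun n => ltac:(rewrite /cb; ring)) _ e2.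
  exists (maxn n1 n2) => n; rewrite geq_max => /andP[/h1 {}h1 /h2 {}h2].
  rewrite /Lc /Rc; move: h1 h2 (flat1_ge0 (n%:R * x + ca n)) (flat1_le1 (n%:R * x + ca n)).
  move: (flat1 _) (flat1 _) => p q.
  rewrite (_ : 1 - q * p = (1 - q) + q * (1 - p)); last by ring.
  move=> h1 h2 p0 p1; apply: (le_lt_trans (ler_normD _ _)); rewrite normrM.
  have : `|q| * `|1 - p| <= 1 * `|1 - p| by rewrite ler_wpM2r// ger0_norm.
  lra.
Qed.

(** A continuous function vanishing at an end point lies below e plus a line through that point.
    Unlike a modulus of continuity, a line can be integrated by parts in [concentration]. *)
Let sloped (P : R -> R) : {within `[a, b], continuous P} -> P a = 0 -> P b = 0 ->
  forall e : R, 0 < e -> exists2 K : R, 0 <= K &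
    forall x, a < x < b -> `|P x| <= e + K * (x - a) /\ `|P x| <= e + K * (b - x).
Proof.
move=> cP Pa Pb e e0; have [M M0 hM] := within_cont_compact_bounded (ltW ab) cP.
have ain : (`[a, b]%classic : set R) a by rewrite /= in_itv/= lexx ltW.
have bin : (`[a, b]%classic : set R) b by rewrite /= in_itv/= lexx ltW.
have [d1 d10 h1] := (within_continuousP _ _).1 cP a ain _ e0.
have [d2 d20 h2] := (within_continuousP _ _).1 cP b bin _ e0.
have gen (d t p : R) : 0 < d -> 0 <= t -> p <= M -> (t < d -> p < e) -> 
    p <= e + (M / d1 + M / d2) * t -> p <= e + (M / d1 + M / d2) * t by [].
exists (M / d1 + M / d2); first by rewrite addr_ge0 ?divr_ge0 ?(ltW d10) ?(ltW d20).
move=> x /andP[ax xb]; have xin : (`[a, b]%classic : set R) x by rewrite /= in_itv/= !ltW.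
have Mx : `|P x| <= M by apply: hM; rewrite !ltW.
have q1 : 0 <= M / d1 by rewrite divr_ge0// ltW.
have q2 : 0 <= M / d2 by rewrite divr_ge0// ltW.
have xa0 : 0 <= x - a by rewrite subr_ge0 ltW.
have bx0 : 0 <= b - x by rewrite subr_ge0 ltW.
split.
  have [lt|ge] := ltP (x - a) d1.
    apply: le_trans (_ : _ <= e) _; last by rewrite lerDl mulr_ge0// addr_ge0.
    have := h1 x xin; rewrite Pa sub0r normrN => /(_ _) /ltW; apply.
    by rewrite /ball /= distrC ger0_norm.
  apply: (le_trans Mx); apply: le_trans (_ : _ <= M / d1 * (x - a)) _.
    by rewrite mulrAC ler_pdivlMr// ler_wpM2l.
  rewrite mulrDl; have := mulr_ge0 q2 xa0; lra.
have [lt|ge] := ltP (b - x) d2.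
  apply: le_trans (_ : _ <= e) _; last by rewrite lerDl mulr_ge0// addr_ge0.
  have := h2 x xin; rewrite Pb sub0r normrN => /(_ _) /ltW; apply.
  by rewrite /ball /= ger0_norm.
apply: (le_trans Mx); apply: le_trans (_ : _ <= M / d2 * (b - x)) _.
  by rewrite mulrAC ler_pdivlMr// ler_wpM2l.
rewrite mulrDl; have := mulr_ge0 q1 bx0; lra.
Qed.

Let cutoff_derivative : exists Ld Rd : nat -> R -> R,
  [/\ forall n, smooth (Ld n), forall n, smooth (Rd n),
      forall n x, 0 <= Ld n x, forall n x, 0 <= Rd n x &
      forall n x, is_derive x (1 : R) (Lc n) (Ld n x) /\ is_derive x (1 : R) (Rc n) (- Rd n x)].
Proof.
have [f' sf' [f0 hf]] := @flat1_deriv R.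
exists (fun n x => n%:R * f' (n%:R * x + ca n)), (fun n x => n%:R * f' (- n%:R * x + cb n)).
have dc (c d x : R) : is_derive x (1 : R) (fun y => flat1 (c * y + d)) (c * f' (c * x + d)).
  have h1 := is_derive_affine c d x; have h2 := hf (c * x + d).
  have h3 : is_derive x (1 : R) (flat1 \o (fun y => c * y + d)) (f' (c * x + d) * c).
    exact: is_derive1_comp.
  by apply: (is_derive_ext h3) => //; rewrite mulrC.
split.
- by move=> n; apply: smoothZ; exact: smooth_affine.
- by move=> n; apply: smoothZ; exact: smooth_affine.
- by move=> n x; rewrite mulr_ge0.
- by move=> n x; rewrite mulr_ge0.
by move=> n x; split; [exact: dc|rewrite -mulNr; exact: dc].
Qed.

(** The weak derivative is tested with functions of compact support, whereas the characters are
    merely periodic. The test function is E times a cutoff chi, and the extra term, the integral of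
    g E chi', must be shown to vanish in the limit. *)
Lemma weak_ibp (g h E E' : R -> R) : {within `[a, b], continuous g} -> g a = g b ->
  rintegrable a b h ->
  (forall eta, test_function a b eta ->
    rint (fun x => g x * derive1 eta x) = - rint (fun x => h x * eta x)) ->
  smooth E -> (forall x, is_derive x (1 : R) E (E' x)) -> E a = E b ->
  rint (fun x => g x * E' x) = - rint (fun x => h x * E x).
Proof.
move=> cg gab ih weak sE dE Eab.
have [E1 sE1 dE1] := smooth_derive sE.
have EE : E' = E1.
  apply/funext => x; have h1 := dE x; have h2 := dE1 x.
  by rewrite -(@derive_val _ _ _ _ _ _ _ h1) derive_val.
have sE' : smooth E' by rewrite EE.
have cE := smooth_within sE; have cE' := smooth_within sE'.
have [Ld [Rd [sLd sRd Ld0 Rd0 dLR]]] := cutoff_derivative.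
have cLd n := smooth_within (sLd n); have cRd n := smooth_within (sRd n).
have cL n := smooth_within (sL n); have cR n := smooth_within (sR n).
pose dchi n x := Ld n x * Rc n x - Lc n x * Rd n x.
have cdchi n : {within `[a, b], continuous (dchi n)}.
  have h1 := within_contM (cLd n) (cR n); have h2 := within_contM (cL n) (cRd n).
  by move=> x; apply: cvgB; [exact: h1|exact: h2].
(* Periodicity gives g E the value [gam] at both ends. As chi' has integral 0, this constant may be
   subtracted, and the difference P vanishes at both ends as [concentration] needs. *)
pose gam := g a * E a; pose P x := g x * E x - gam.
have cP : {within `[a, b], continuous P}.
  have h1 := within_contM cg cE.
  by move=> x; apply: cvgB; [exact: h1|exact: cvg_cst].
have Lca n : Lc n a = 0 by rewrite /Lc flat1_zero// /ca; lra.
have Rcb n : Rc n b = 0 by rewrite /Rc flat1_zero// /cb; lra.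
have dchi0 n : rint (dchi n) = 0.
  transitivity (Lc n b * Rc n b - Lc n a * Rc n a); last by rewrite Lca Rcb mul0r mulr0 subr0.
  apply: (@rint_FTC _ a b _ (fun x => Lc n x * Rc n x)) => //; first exact: within_contM.
  move=> x _; have [d1 d2] := dLR n x.
  apply: (is_derive_ext (is_deriveM d1 d2)) => //.
  by rewrite /dchi /GRing.scale /=; ring.
have iP n : rintegrable a b (fun x => P x * dchi n x).
  by apply: rintegrable_cont; exact: within_contM.
have conc (e : R) : 0 < e -> exists n0 : nat, forall n, (n0 <= n)%N -> `|rint (fun x => P x * dchi n x)| < e.
  move=> e0; have e4 : 0 < e / 4 by rewrite divr_gt0.
  have Pa : P a = 0 by rewrite /P /gam subrr.
  have Pb : P b = 0 by rewrite /P /gam gab Eab subrr.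
  have [K K0 hK] := sloped cP Pa Pb e4.
  have eK : 0 < e / (8 * (K + 1)) by rewrite divr_gt0// mulr_gt0// ltr_wpDl.
  have [n1 h1] := L_int1 eK; have [n2 h2] := R_int1 eK.
  exists (maxn n1 n2) => n; rewrite geq_max => /andP[/h1 {}h1 /h2 {}h2].
  apply: (concentration e0 K0 cP (cL n) (cR n) (cLd n) (cRd n) _ _ (Ld0 n) (Rd0 n) _ _ (Lca n) (Rcb n) hK h1 h2).
  - by move=> x; have [] := dLR n x.
  - by move=> x; have [] := dLR n x.
  - by move=> x; rewrite flat1_ge0 flat1_le1.
  - by move=> x; rewrite flat1_ge0 flat1_le1.
suff zero : rint (fun x => g x * E' x) + rint (fun x => h x * E x) = 0.
  by apply/eqP; rewrite -addr_eq0 zero.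
have igE' : rintegrable a b (fun x => g x * E' x).
  by apply: rintegrable_cont; exact: within_contM.
have ihE : rintegrable a b (fun x => h x * E x) by apply: rintegrableMc => //; exact: ltW.
apply/eqP; rewrite -normr_le0; apply/ler_addgt0Pr => e e0; rewrite add0r.
have e3 : 0 < e / 3 by rewrite divr_gt0.
have [n1 h1] := conc _ e3; have [n2 h2] := LR_int igE' e3; have [n3 h3] := LR_int ihE e3.
pose n := (maxn 1 (maxn n1 (maxn n2 n3))).
have n0 : (0 < n)%N by rewrite leq_max.
have {}h1 := h1 n (ltac:(by rewrite !leq_max leqnn !orbT)).
have {}h2 := h2 n (ltac:(by rewrite !leq_max leqnn !orbT)).
have {}h3 := h3 n (ltac:(by rewrite !leq_max leqnn !orbT)).
have dEta x : is_derive x (1 : R) (fun x => Lc n x * Rc n x * E x) (dchi n x * E x + Lc n x * Rc n x * E' x).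
  have [d1 d2] := dLR n x; have d3 := dE x.
  apply: (is_derive_ext (is_deriveM (is_deriveM d1 d2) d3)) => //.
  transitivity (Lc n x * Rc n x * E' x + E x * (Lc n x * - Rd n x + Rc n x * Ld n x)) => //.
  by rewrite /dchi; ring.
have test : test_function a b (fun x => Lc n x * Rc n x * E x).
  split.
    by move=> k x; apply: smooth_derivable; apply: smoothM => //; exact: smoothM.
  have nR : 0 < (n%:R : R) by rewrite ltr0n.
  exists (a + n%:R^-1), (b - n%:R^-1); split.
  - by rewrite ltrDl invr_gt0.
  - by rewrite ltrBlDr ltrDl invr_gt0.
  move=> x /negP; rewrite negb_and -!ltNge => /orP[] hx.
    rewrite /Lc flat1_zero ?mul0r// /ca.
    have : n%:R * x <= n%:R * (a + n%:R^-1) by rewrite ler_pM2l// ltW.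
    by rewrite mulrDr mulfV ?gt_eqF//; lra.
  rewrite /Rc flat1_zero ?mulr0 ?mul0r// /cb.
  have : n%:R * (b - n%:R^-1) <= n%:R * x by rewrite ler_pM2l// ltW.
  by rewrite mulrBr mulfV ?gt_eqF//; lra.
have := weak _ test.
have -> : rint (fun x => g x * derive1 (fun x => Lc n x * Rc n x * E x) x) =
    rint (fun x => P x * dchi n x) + rint (fun x => g x * E' x * (Lc n x * Rc n x)).
  have iA : rintegrable a b (fun x => g x * E' x * (Lc n x * Rc n x)).
    by apply: rintegrable_cont; do 2! apply: within_contM => //.
  have iD : rintegrable a b (fun x => gam * dchi n x) by apply: rintegrableZ; exact: rintegrable_cont.
  transitivity (rint (fun x => (P x * dchi n x + gam * dchi n x) + g x * E' x * (Lc n x * Rc n x))).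
    apply: eq_Rintegral => x _; have dx := dEta x; rewrite derive1E derive_val /P.
    by ring.
  rewrite RintegralD//; last exact: rintegrableD.
  rewrite (RintegralD _ (iP n) iD)// [X in _ + X + _ = _](RintegralZl _ _ (rintegrable_cont (cdchi n)))//.
  by rewrite dchi0 mulr0 addr0.
have -> : rint (fun x => h x * (Lc n x * Rc n x * E x)) = rint (fun x => h x * E x * (Lc n x * Rc n x)).
  by apply: eq_Rintegral => x _; ring.
move: h1 h2 h3.
exact: abs_three.
Qed.

Lemma fc_weak_derivative (f g : R -> R[i]) l : ccont f a b -> f a = f b ->
  cintegrable a b g -> weak_derivative a b f g ->
  fc g l = (0 +i* freq a b l) * fc f l.
Proof.
move=> cf fab [g1 g2] wd; have [f1 f2] := cf.
pose th := freq a b (- l).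
have dcos x : is_derive x (1 : R) (fun x => cos (th * x + - (th * a))) (th * - sin (th * x + - (th * a))).
  have h1 := is_derive_affine th (- (th * a)) x.
  have h3 : is_derive x (1 : R) (cos \o (fun y => th * y + - (th * a))) (- sin (th * x + - (th * a)) * th).
    exact: is_derive1_comp.
  by apply: (is_derive_ext h3) => //; rewrite mulrC.
have dsin x : is_derive x (1 : R) (fun x => sin (th * x + - (th * a))) (th * cos (th * x + - (th * a))).
  have h1 := is_derive_affine th (- (th * a)) x.
  have h3 : is_derive x (1 : R) (sin \o (fun y => th * y + - (th * a))) (cos (th * x + - (th * a)) * th).
    exact: is_derive1_comp.
  by apply: (is_derive_ext h3) => //; rewrite mulrC.
have echE x : ech a b (- l) x = cos (th * x + - (th * a)) +i* sin (th * x + - (th * a)).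
  by rewrite /ech /expi -/th mulrBr.
have eab : ech a b (- l) a = ech a b (- l) b by rewrite ech_a ech_b.
rewrite !echE in eab; have [cab sab] := (congr1 (@complex.Re R) eab, congr1 (@complex.Im R) eab).
rewrite /= in cab sab.
have w1 eta : test_function a b eta ->
    rint (fun x => complex.Re (f x) * derive1 eta x) = - rint (fun x => complex.Re (g x) * eta x).
  move=> /wd /(congr1 (@complex.Re R)); rewrite cReN /=.
  by under eq_Rintegral do rewrite cReM /= mulr0 subr0; under [in X in _ = - X]eq_Rintegral do rewrite cReM /= mulr0 subr0.
have w2 eta : test_function a b eta ->
    rint (fun x => complex.Im (f x) * derive1 eta x) = - rint (fun x => complex.Im (g x) * eta x).
  move=> /wd /(congr1 (@complex.Im R)); rewrite cImN /=.
  by under eq_Rintegral do rewrite cImM /= mulr0 add0r; under [in X in _ = - X]eq_Rintegral do rewrite cImM /= mulr0 add0r.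
have [fab1 fab2] := (congr1 (@complex.Re R) fab, congr1 (@complex.Im R) fab).
have scos := smooth_affine th (- (th * a)) (@smooth_cos R).
have ssin := smooth_affine th (- (th * a)) (@smooth_sin R).
have r1 := weak_ibp f1 fab1 g1 w1 scos dcos cab.
have r2 := weak_ibp f1 fab1 g1 w1 ssin dsin sab.
have r3 := weak_ibp f2 fab2 g2 w2 scos dcos cab.
have r4 := weak_ibp f2 fab2 g2 w2 ssin dsin sab.
have ccos : {within `[a, b], continuous (fun x => cos (th * x + - (th * a)))} := smooth_within scos.
have csin : {within `[a, b], continuous (fun x => sin (th * x + - (th * a)))} := smooth_within ssin.
rewrite !fcE [RHS]mulrCA; congr (_ * _).
have leab := ltW ab.
have pull (u v : R -> R) (c : R) : {within `[a, b], continuous u} -> {within `[a, b], continuous v} ->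
    rint (fun x => u x * (c * v x)) = c * rint (fun x => u x * v x).
  move=> cu cv; rewrite -RintegralZl//; last by apply: rintegrable_cont; exact: within_contM.
  by apply: eq_Rintegral => x _; rewrite mulrCA.
rewrite (pull _ _ _ f1 ccos) in r2; rewrite (pull _ _ _ f2 ccos) in r4.
have pullN (u : R -> R) : {within `[a, b], continuous u} ->
   rint (fun x => u x * (th * - sin (th * x + - (th * a)))) = - th * rint (fun x => u x * sin (th * x + - (th * a))).
  move=> cu; rewrite -(pull _ _ _ cu csin); apply: eq_Rintegral => x _; by rewrite mulrN mulNr.
rewrite (pullN _ f1) in r1; rewrite (pullN _ f2) in r3.
have splitRe (u : R -> R[i]) : cintegrable a b u -> complex.Re (cint (fun x => u x * ech a b (- l) x)) =
    rint (fun x => complex.Re (u x) * cos (th * x + - (th * a))) -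
    rint (fun x => complex.Im (u x) * sin (th * x + - (th * a))).
  move=> [u1 u2] /=; under eq_Rintegral do rewrite echE cReM /=.
  by rewrite RintegralB//; exact: rintegrableMc.
have splitIm (u : R -> R[i]) : cintegrable a b u -> complex.Im (cint (fun x => u x * ech a b (- l) x)) =
    rint (fun x => complex.Re (u x) * sin (th * x + - (th * a))) +
    rint (fun x => complex.Im (u x) * cos (th * x + - (th * a))).
  move=> [u1 u2] /=; under eq_Rintegral do rewrite echE cImM /=.
  by rewrite RintegralD//; exact: rintegrableMc.
have icf := cintegrable_cont cf.
have thE : th = - freq a b l by rewrite /th freqN.
rewrite thE in r1 r2 r3 r4.
apply: complex_eq; rewrite ?cReM ?cImM !splitRe ?splitIm//= ?mul0r ?sub0r ?add0r.
  rewrite !mulrDr; move: r1 r4; rewrite thE; lra.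
rewrite !mulrBr; move: r2 r3; rewrite thE; lra.
Qed.

Lemma square_integrable_cintegrable (f : R -> R[i]) : square_integrable a b f ->
  cintegrable a b f /\ rintegrable a b (fun x => cmodulus (f x) ^+ 2).
Proof.
move=> [m1 m2 fin].
have i2 : rintegrable a b (fun x => cmodulus (f x) ^+ 2).
  apply/integrableP; split.
    apply/measurable_EFinP; rewrite (_ : (fun x => _) = (fun x => complex.Re (f x) ^+ 2 + complex.Im (f x) ^+ 2)).
      by apply: measurable_funD; apply: measurable_funX.
    by apply/funext => x; rewrite cmod_sqr.
  apply: le_lt_trans fin; rewrite le_eqVlt; apply/orP; left; apply/eqP.
  by apply: eq_integral => x _; rewrite /= ger0_norm ?sqr_ge0.
split=> //.
(* On a bounded interval |f| <= 1 + |f|^2 turns square integrability into integrability. *)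
have i3 : rintegrable a b (fun x => 1 + cmodulus (f x) ^+ 2).
  by apply: rintegrableD => //; exact: rintegrable_cst.
have bnd (p : R[i] -> R) : (forall z, `|p z| <= cmodulus z) -> measurable_fun `]a, b[%classic (fun x => p (f x)) ->
    rintegrable a b (fun x => p (f x)).
  move=> pc mp; apply: (@le_integrable _ _ _ mu _ (measurable_itv _) _ (fun x => (1 + cmodulus (f x) ^+ 2)%:E)) => //.
    exact/measurable_EFinP.
  move=> x _; rewrite /= lee_fin [leRHS]ger0_norm ?addr_ge0 ?sqr_ge0//.
  apply: (le_trans (pc _)); have := sqr_ge0 (cmodulus (f x) - 1); have := cmod_ge0 (f x).
  rewrite sqrrB mulr1 expr1n; set c := cmodulus (f x); rewrite -mulr_natl; lra.
split; [apply: (bnd (@complex.Re R)) => //; exact: cmod_Re|apply: (bnd (@complex.Im R)) => //; exact: cmod_Im].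
Qed.

(** The mean square distance of f to its partial sum S is nonnegative. The integrals of f conj(S)
    and of S conj(S) agree, because f and S have the same coefficients on the list. *)
Lemma bessel (f : R -> R[i]) : square_integrable a b f -> exists2 B : R, 0 <= B &
  forall s, uniq s -> \sum_(l <- s) cmodulus (fc f l) ^+ 2 <= B ^+ 2.
Proof.
move=> sf; have [icf i2] := square_integrable_cintegrable sf.
have ba0 : 0 < b - a by rewrite subr_gt0.
pose Q := rint (fun x => cmodulus (f x) ^+ 2) / (b - a).
have Q0 : 0 <= Q by apply: divr_ge0; [apply: Rintegral_ge0 => x _; exact: sqr_ge0|exact: ltW].
exists (Num.sqrt Q); first exact: sqrtr_ge0.
move=> s us; rewrite sqr_sqrtr// ler_pdivlMr//.
pose c l := fc f l; pose S x := \sum_(l <- s) c l * ech a b l x.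
have cS : ccont S a b.
  by apply: ccont_sum => l _; apply: ccontM; [exact: ccont_cst|exact: ccont_ech].
have icS := cintegrable_cont cS.
pose Sc x := \sum_(l <- s) conjc (c l) * ech a b (- l) x.
have cSc : ccont Sc a b.
  by apply: ccont_sum => l _; apply: ccontM; [exact: ccont_cst|exact: ccont_ech].
have ScE x : Sc x = conjc (S x).
  rewrite /Sc /S rmorph_sum; apply: eq_bigr => l _.
  transitivity (conjc (c l) * conjc (ech a b l x)); last by rewrite -rmorphM.
  by rewrite /ech conj_expi freqN mulNr.
have intSc (u : R -> R[i]) : cintegrable a b u -> (forall l, l \in s -> fc u l = c l) ->
    cint (fun x => u x * Sc x) = ((b - a) * \sum_(l <- s) cmodulus (c l) ^+ 2)%:C.
  move=> iu hu; rewrite (@cint_eq _ _ _ _ (fun x => \sum_(l <- s) conjc (c l) * (u x * ech a b (- l) x))).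
    rewrite cint_sum; last by move=> l _; apply: cintegrableMl; exact: cintegrable_ech.
    rewrite rmorphM rmorph_sum mulr_sumr; apply: eq_big_seq => l ls.
    rewrite cintMl; last exact: cintegrable_ech.
    have := hu l ls; rewrite fcE => hl.
    have -> : cint (fun x => u x * ech a b (- l) x) = (b - a)%:C * c l.
      by rewrite -hl mulrA -rmorphM /= mulfV ?gt_eqF// mul1r.
    rewrite mulrCA; congr (_ * _); rewrite cmod_sqr; case: (c l) => p q.
    by apply: complex_eq; rewrite ?cReM ?cImM /=; ring.
  by move=> x _; rewrite /Sc mulr_sumr; apply: eq_bigr => l _; rewrite mulrCA.
have h1 := intSc f icf (fun l _ => erefl).
have h2 := intSc S icS (fun l ls => ltac:(by rewrite /S fc_trig// ls)).
have iu u : cintegrable a b u -> cintegrable a b (fun x => u x * Sc x).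
  by move=> h; apply: cintegrableMc => //; exact: ltW.
have [if1 _] := iu f icf; have [iS1 _] := iu S icS.
have e1 : rint (fun x => complex.Re (f x * Sc x)) = (b - a) * \sum_(l <- s) cmodulus (c l) ^+ 2.
  by have := congr1 (@complex.Re R) h1.
have e2 : rint (fun x => complex.Re (S x * Sc x)) = (b - a) * \sum_(l <- s) cmodulus (c l) ^+ 2.
  by have := congr1 (@complex.Re R) h2.
have : 0 <= rint (fun x => cmodulus (f x - S x) ^+ 2).
  by apply: Rintegral_ge0 => x _; exact: sqr_ge0.
have -> : rint (fun x => cmodulus (f x - S x) ^+ 2) =
    rint (fun x => cmodulus (f x) ^+ 2 - 2 * complex.Re (f x * Sc x) + complex.Re (S x * Sc x)).
  apply: eq_Rintegral => x _; rewrite ScE; case: (f x) (S x) => p q [p' q'].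
  by rewrite !cmod_sqr !cReM /=; ring.
rewrite RintegralD//; last by apply: rintegrableB => //; exact: rintegrableZ.
rewrite RintegralB//; last exact: rintegrableZ.
rewrite RintegralZl// e1 e2.
have aux (X Y : R) : 0 <= X - 2 * Y + Y -> Y <= X by move=> ?; lra.
by move/aux; rewrite mulrC.
Qed.

Lemma Hper_cont m phi : (0 < m)%N -> Hper a b m phi -> ccont phi a b /\ phi a = phi b.
Proof. by move=> m0 [d [<- _ _ h]]; exact: h. Qed.

Lemma fc_Hper_derivative (d : nat -> R -> R[i]) (m : nat) :
  (forall k, (k <= m)%N -> square_integrable a b (d k)) ->
  (forall k, (k < m)%N -> weak_derivative a b (d k) (d k.+1)) ->
  (forall k, (k < m)%N -> cwithin_continuous `[a, b]%classic (d k) /\ d k a = d k b) ->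
  forall k l, (k <= m)%N -> fc (d k) l = (0 +i* freq a b l) ^+ k * fc (d 0%N) l.
Proof.
move=> sq wd cont k l; elim: k => [|k ih] km; first by rewrite mul1r.
have [cd dab] := cont k km.
have [id _] := square_integrable_cintegrable (sq k.+1 km).
rewrite (fc_weak_derivative l cd dab id (wd k km)) ih; last exact: ltnW.
by rewrite exprS mulrA.
Qed.

(** Bessel's inequality for the function and for its m-th derivative suffices, since (1 + x)^m <=
    2^m (1 + x^m). *)
Lemma Hper_Hbound m phi : Hper a b m phi -> exists B : R, Hbound (freq a b 1) m (fc phi) B.
Proof.
move=> [d [d0 sq wd cont]].
have m0 := mu_gt0 ab.
have [B0 B00 h0] := bessel (sq 0%N (leq0n m)); have [B1 B10 h1] := bessel (sq m (leqnn m)).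
rewrite d0 in h0.
exists (2 ^+ m * (B0 + B1)) => s us.
have n0 : nrm s (fun=> 1) (fc phi) <= B0.
  rewrite /nrm N2_leP//; apply: le_trans (h0 s us); apply: ler_sum => l _.
  by rewrite mul1r.
have n1 : nrm s (fun l => `|freq a b l| ^+ m) (fc phi) <= B1.
  rewrite /nrm N2_leP//; apply: le_trans (h1 s us); apply: ler_sum => l _.
  rewrite (fc_Hper_derivative sq wd cont l (leqnn m)) d0 cmodM cmodX.
  by rewrite cmodE /= expr0n /= add0r sqrtr_sqr.
apply: (@le_trans _ _ (N2 s (fun l => 2 ^+ m * (1 * cmodulus (fc phi l) + `|freq a b l| ^+ m * cmodulus (fc phi l))))).
  apply: N2_le => l _; rewrite ger0_norm ?mulr_ge0 ?cmod_ge0 ?omX_ge0//.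
  rewrite -mulrDl mulrA ler_wpM2r ?cmod_ge0//.
  rewrite [freq a b l]freqE normrM (gtr0_norm m0) /om.
  by apply: expr1D_le; rewrite mulr_ge0// ltW.
rewrite N2_scale ger0_norm ?exprn_ge0// ler_wpM2l ?exprn_ge0//.
by apply: (le_trans (N2_tri _ _ _)); apply: lerD.
Qed.

End weak_derivatives.

(** * The exact solution in Fourier coordinates *)

Section hnorm.
Context {R : realType} (a b : R) (ab : a < b).
Local Notation mu1 := (freq a b 1).
Local Notation fc := (fourier_coef a b).

Let m0 : 0 < mu1. Proof. exact: mu_gt0. Qed.

Lemma Hnorm_le m (phi : R -> R[i]) (C : R) : 0 <= C ->
  (forall s, uniq s -> \sum_(l <- s) (1 + freq a b l ^+ 2) ^+ m * cmodulus (fc phi l) ^+ 2 <= C ^+ 2) ->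
  (Hnorm a b m phi <= C%:E)%E.
Proof.
move=> C0 h; rewrite /Hnorm.
set F := (fun l : int => _%:E); set e := esum _ _.
have F0 l : (0 <= F l)%E by rewrite lee_fin mulr_ge0 ?sqr_ge0// exprn_ge0// addr_ge0 ?sqr_ge0.
have e0 : (0 <= e)%E by apply: esum_ge0 => l _; exact: F0.
have eC : (e <= (C ^+ 2)%:E)%E.
  apply: ge_ereal_sup => _ [A [finA _] <-].
  rewrite fsbig_finite//= sumEFin lee_fin; apply: h; exact: finmap.fset_uniq.
rewrite poweR12_sqrt//; move: e0 eC; case: e => [r| |]//=.
rewrite !lee_fin => r0 rC; rewrite -(ger0_norm C0) -sqrtr_sqr ler_sqrt//.
by rewrite (le_trans r0).
Qed.

Lemma Hnorm_ge m (phi : R -> R[i]) (M : R) : (Hnorm a b m phi <= M%:E)%E ->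
  0 <= M /\ forall s, uniq s ->
    \sum_(l <- s) (1 + freq a b l ^+ 2) ^+ m * cmodulus (fc phi l) ^+ 2 <= M ^+ 2.
Proof.
rewrite /Hnorm; set F := (fun l : int => _%:E); set e := esum _ _ => he.
have F0 l : (0 <= F l)%E by rewrite lee_fin mulr_ge0 ?sqr_ge0// exprn_ge0// addr_ge0 ?sqr_ge0.
have e0 : (0 <= e)%E by apply: esum_ge0 => l _; exact: F0.
have M0 : 0 <= M by rewrite -lee_fin; apply: le_trans he; exact: poweR_ge0.
split=> // s us.
have : ((\sum_(l <- s) (1 + freq a b l ^+ 2) ^+ m * cmodulus (fc phi l) ^+ 2)%:E <= e)%E.
  rewrite -sumEFin; apply: esum_ge; exists [set` s]; first by split=> //; exact: finite_seq.
  by rewrite -fsbig_seq.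
move: he; rewrite poweR12_sqrt//; move: e0; case: (e) => [r| |]//=.
rewrite !lee_fin => r0 rM h; apply: (le_trans h).
rewrite -(sqr_sqrtr r0); apply: lerXn2r => //; by rewrite nnegrE// sqrtr_ge0.
Qed.

Lemma weight_le m l : (1 + freq a b l ^+ 2) ^+ m <= (om mu1 l ^+ m) ^+ 2.
Proof.
rewrite -exprM mulnC exprM; apply: lerXn2r; rewrite ?nnegrE ?sqr_ge0 ?addr_ge0 ?sqr_ge0//.
rewrite [freq a b l]freqE /om -[(mu1 * _) ^+ 2]real_normK ?num_real// normrM (gtr0_norm m0).
set x := mu1 * _; have x0 : 0 <= x by rewrite mulr_ge0// ltW.
by rewrite (_ : (1 + x) ^+ 2 = 1 + x ^+ 2 + 2 * x); [rewrite lerDl mulr_ge0|ring].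
Qed.

Lemma weight_ge m l : (om mu1 l ^+ m) ^+ 2 <= 2 ^+ m * (1 + freq a b l ^+ 2) ^+ m.
Proof.
rewrite -exprM mulnC exprM -exprMn; apply: lerXn2r; rewrite ?nnegrE ?sqr_ge0 ?mulr_ge0 ?addr_ge0 ?sqr_ge0//.
rewrite [freq a b l]freqE /om -[(mu1 * _) ^+ 2]real_normK ?num_real// normrM (gtr0_norm m0).
set x := mu1 * _; rewrite -subr_ge0.
by rewrite (_ : _ - _ = (1 - x) ^+ 2) ?sqr_ge0//; ring.
Qed.

Lemma Hnorm_Hbound m (phi : R -> R[i]) (M : R) : (Hnorm a b m phi <= M%:E)%E ->
  Hbound mu1 m (fc phi) (2 ^+ m * M).
Proof.
move=> /Hnorm_ge[M0 h] s us; rewrite /nrm N2_leP ?mulr_ge0 ?exprn_ge0//.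
apply: (@le_trans _ _ (2 ^+ m * M ^+ 2)).
  apply: (@le_trans _ _ (2 ^+ m * \sum_(l <- s) (1 + freq a b l ^+ 2) ^+ m * cmodulus (fc phi l) ^+ 2)).
    rewrite mulr_sumr; apply: ler_sum => l _; rewrite exprMn mulrA ler_wpM2r ?sqr_ge0//.
    exact: weight_ge.
  by rewrite ler_wpM2l ?exprn_ge0//; exact: h.
rewrite exprMn ler_wpM2r ?sqr_ge0// -exprM ler_weXn2l ?leq_pmulr//.
by rewrite ler1n.
Qed.

Lemma Hbound_Hnorm m (phi : R -> R[i]) (C : R) : 0 <= C ->
  (forall s, uniq s -> nrm s (fun l => om mu1 l ^+ m) (fc phi) <= C) ->
  (Hnorm a b m phi <= C%:E)%E.
Proof.
move=> C0 h; apply: Hnorm_le => // s us; have := h s us; rewrite /nrm N2_leP//.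
apply: le_trans; apply: ler_sum => l _; rewrite [leRHS]exprMn ler_wpM2r ?sqr_ge0//.
exact: weight_le.
Qed.

End hnorm.

Section uniform_in_time.
Context {R : realType} (a b : R).

(** The tube lemma: compactness of [a, b] makes continuity in time uniform in space. It replaces
    dominated convergence for all integrals over x below. *)
Lemma tube (J : set R) (G : R -> R -> R) :
  {within [set p : R * R | a <= p.1 <= b /\ J p.2], continuous (fun p : R * R => G p.1 p.2)} ->
  forall t0 : R, J t0 -> forall e : R, 0 < e -> exists2 d : R, 0 < d &
    forall x t : R, a <= x <= b -> J t -> `|t - t0| < d -> `|G x t - G x t0| < e.
Proof.
move=> cG t0 Jt0 e e0.
have hG := (within_continuousP _ _).1 cG.
have cK : compact (`[a, b]%classic : set R) by exact: segment_compact.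
have := (compact_near_coveringP _).1 cK R (nbhs t0)
  (fun t x => a <= x <= b -> J t -> `|G x t - G x t0| < e).
case.
  move=> x; rewrite /= in_itv/= => xab; have e2 : 0 < e / 2 by rewrite divr_gt0.
  have [d d0 hd] := hG (x, t0) (conj xab Jt0) _ e2.
  exists (ball x d, ball t0 d); first by split; exact: nbhsx_ballx.
  move=> [y t] /= [yx tt] yab Jt.
  have h1 := hd (y, t) (conj yab Jt) (conj yx tt).
  have h2 := hd (y, t0) (conj yab Jt0) (conj yx (ballxx _ d0)).
  move: h1 h2; rewrite /= !ltr_norml => /andP[? ?] /andP[? ?]; apply/andP; split; lra.
move=> d d0 h; exists d => // x t xab Jt td.
by apply: (h t) => //=; rewrite ?in_itv//= /ball /= distrC.
Qed.

Lemma slice_cont (J : set R) (G : R -> R -> R) (t0 : R) :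
  {within [set p : R * R | a <= p.1 <= b /\ J p.2], continuous (fun p : R * R => G p.1 p.2)} ->
  J t0 -> {within `[a, b], continuous (fun x => G x t0)}.
Proof.
move=> cG Jt0; apply/within_continuousP => x; rewrite /= in_itv/= => xab e e0.
have [d d0 hd] := (within_continuousP _ _).1 cG (x, t0) (conj xab Jt0) _ e0.
exists d => // y; rewrite /= in_itv/= => yab yx.
exact: (hd (y, t0) (conj yab Jt0) (conj yx (ballxx _ d0))).
Qed.

Lemma ctube (J : set R) (G : R -> R -> R[i]) :
  cwithin_continuous [set p : R * R | a <= p.1 <= b /\ J p.2] (fun p : R * R => G p.1 p.2) ->
  forall t0 : R, J t0 -> forall e : R, 0 < e -> exists2 d : R, 0 < d &
    forall x t : R, a <= x <= b -> J t -> `|t - t0| < d -> cmodulus (G x t - G x t0) < e.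
Proof.
move=> [c1 c2] t0 Jt0 e e0; have e2 : 0 < e / 2 by rewrite divr_gt0.
have [d1 d10 h1] := tube (G := fun x t => complex.Re (G x t)) c1 Jt0 e2.
have [d2 d20 h2] := tube (G := fun x t => complex.Im (G x t)) c2 Jt0 e2.
exists (Num.min d1 d2); first by rewrite lt_min d10.
move=> x t xab Jt; rewrite lt_min => /andP[/(h1 _ _ xab Jt) {}h1 /(h2 _ _ xab Jt) {}h2].
by apply: (le_lt_trans (cmod_le_ReIm _)); rewrite cReB cImB; lra.
Qed.

Lemma cslice_cont (J : set R) (G : R -> R -> R[i]) (t0 : R) :
  cwithin_continuous [set p : R * R | a <= p.1 <= b /\ J p.2] (fun p : R * R => G p.1 p.2) ->
  J t0 -> ccont (fun x => G x t0) a b.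
Proof.
move=> [c1 c2] Jt0; split.
  exact: (slice_cont (G := fun x t => complex.Re (G x t)) c1 Jt0).
exact: (slice_cont (G := fun x t => complex.Im (G x t)) c2 Jt0).
Qed.

End uniform_in_time.

Section differentiation_under.
Context {R : realType} (a b : R) (ab : a < b).
Local Notation fc := (fourier_coef a b).

Lemma is_derive_small (f : R -> R) (x d : R) :
  (forall e : R, 0 < e -> exists2 r : R, 0 < r & forall h : R, `|h| < r ->
     `|f (x + h) - f x - d * h| <= e * `|h|) -> is_derive x (1 : R) f d.
Proof.
move=> hf.
have cv : (fun h : R => h^-1 *: (f (h *: (1 : R) + x) - f x)) @ 0^' --> d.
  apply/cvgrPdist_le => e e0; have [r r0 hr] := hf e e0.
  exists r => //= h; rewrite /= sub0r normrN => hlt h0.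
  have nh0 : 0 < `|h| by rewrite normr_gt0.
  have -> : d - h^-1 *: (f (h *: (1 : R) + x) - f x) = - (h^-1 * (f (x + h) - f x - d * h)).
    by rewrite /GRing.scale /= mulr1 [h + x]addrC; field.
  by rewrite normrN normrM normfV mulrC ler_pdivrMr//; exact: hr.
apply: DeriveDef; first by apply/cvg_ex; exists d.
by apply: cvg_lim.
Qed.

Lemma increment_le (g : R -> R) (t0 h d e r : R) : 0 < r -> `|h| < r ->
  (forall t : R, `|t - t0| < r -> derivable g t 1) ->
  (forall t : R, `|t - t0| < r -> `|derive1 g t - d| <= e) ->
  `|g (t0 + h) - g t0 - d * h| <= e * `|h|.
Proof.
move=> r0 hr dg hd.
have key (p q : R) : p <= q -> `|p - t0| < r -> `|q - t0| < r ->
   `|g q - g p - d * (q - p)| <= e * (q - p).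
  move=> pq pr qr; have btw (t : R) : p <= t <= q -> `|t - t0| < r.
    move: pr qr; rewrite !ltr_norml => /andP[? ?] /andP[? ?] /andP[? ?].
    by apply/andP; split; lra.
  have [c cpq ->] := @MVT_segment R g (derive1 g) p q pq
    (fun t ht => ltac:(move: ht; rewrite in_itv/= => /andP[h1 h2];
       apply: DeriveDef; [by apply: dg; apply: btw; rewrite !ltW|by rewrite derive1E]))
    (ltac:(apply: derivable_within_continuous => t; rewrite in_itv/= => ht; exact: dg (btw t ht))).
  rewrite -mulrBl normrM [`|q - p|]ger0_norm ?subr_ge0// ler_wpM2r ?subr_ge0//.
  by apply: hd; apply: btw; move: cpq; rewrite in_itv/=.
have tt : `|t0 - t0| < r by rewrite subrr normr0.
have ht : `|t0 + h - t0| < r by rewrite addrAC subrr add0r.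
have [h0|h0] := leP 0 h.
  have := key t0 (t0 + h) (ltac:(lra)) tt ht.
  by rewrite (_ : t0 + h - t0 = h) ?(ger0_norm h0)//; ring.
have := key (t0 + h) t0 (ltac:(lra)) ht tt.
rewrite (_ : t0 - (t0 + h) = - h) ?(ltr0_norm h0); last by ring.
rewrite -normrN => h1; apply: le_trans h1.
by rewrite le_eqVlt; apply/orP; left; apply/eqP; congr (`|_|); ring.
Qed.

(** Differentiation under the integral: by the mean value theorem the difference quotient differs
    from the derivative at t0 by the oscillation of psi_t, which is small uniformly in x. *)
Lemma fc_time_derivative (psi : R -> R -> R[i]) l (t0 : R) : 0 < t0 ->
  (forall t : R, 0 < t -> cintegrable a b (fun x => psi x t)) ->
  (forall x t, a <= x <= b -> 0 < t -> cderivable (psi x) t) ->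
  cwithin_continuous [set p : R * R | a <= p.1 <= b /\ 0 < p.2]
         (fun p : R * R => cderiv (psi p.1) p.2) ->
  is_cderive (fun t => fc (fun x => psi x t) l) t0 (fc (fun x => cderiv (psi x) t0) l).
Proof.
move=> t00 ipsi dpsi cpsi.
have icd : cintegrable a b (fun x => cderiv (psi x) t0).
  apply: cintegrable_cont.
  exact: (cslice_cont (J := [set t : R | 0 < t]) (G := fun x t => cderiv (psi x) t) cpsi t00).
pose F t := fc (fun x => psi x t) l; pose D := fc (fun x => cderiv (psi x) t0) l.
have main (e : R) : 0 < e -> exists2 r : R, 0 < r & forall h : R, `|h| < r ->
    cmodulus (F (t0 + h) - F t0 - D * h%:C) <= e * `|h|.
  move=> e0; have e4 : 0 < e / 4 by rewrite divr_gt0.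
  have [d d0 hd] := ctube (J := [set t : R | 0 < t]) (G := fun x t => cderiv (psi x) t) cpsi t00 e4.
  exists (Num.min d t0); first by rewrite lt_min d0.
  move=> h; rewrite lt_min => /andP[hd1 hd2].
  have pos (t : R) : `|t - t0| < Num.min d t0 -> 0 < t.
    by rewrite lt_min => /andP[_]; rewrite ltr_norml => /andP[h1 _]; lra.
  have th0 : 0 < t0 + h by apply: pos; rewrite addrAC subrr add0r lt_min hd1.
  have ii : cintegrable a b (fun x => psi x (t0 + h) - psi x t0).
    by apply: cintegrableB; exact: ipsi.
  have -> : F (t0 + h) - F t0 - D * h%:C =
     fc (fun x => psi x (t0 + h) - psi x t0 - h%:C * cderiv (psi x) t0) l.
    rewrite fcB//; last exact: cintegrableMl.
    by rewrite fcB ?fcMl//; [rewrite mulrC|exact: ipsi|exact: ipsi].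
  apply: le_trans (_ : _ <= 2 * (e / 4 * `|h| + e / 4 * `|h|)) _; last by lra.
  apply: fc_bound_cst => //.
    by apply: cintegrableB => //; exact: cintegrableMl.
  move=> x /andP[ax xb]; have xab : a <= x <= b by rewrite !ltW.
  have min0 : 0 < Num.min d t0 by rewrite lt_min d0.
  have hmin : `|h| < Num.min d t0 by rewrite lt_min hd1.
  apply: (le_trans (cmod_le_ReIm _)); rewrite !cReB !cImB cReM cImM /= !mul0r subr0 addr0.
  rewrite ![h * _]mulrC; apply: lerD.
    apply: (@increment_le (fun t => complex.Re (psi x t)) t0 h _ _ _ min0 hmin).
      by move=> t /pos tp; have [] := dpsi x t xab tp.
    move=> t ht; have tp := pos t ht; move: ht; rewrite lt_min => /andP[ht _].
    have := hd x t xab tp ht => /ltW; apply: le_trans.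
    by apply: le_trans (cmod_Re _); rewrite cReB.
  apply: (@increment_le (fun t => complex.Im (psi x t)) t0 h _ _ _ min0 hmin).
    by move=> t /pos tp; have [] := dpsi x t xab tp.
  move=> t ht; have tp := pos t ht; move: ht; rewrite lt_min => /andP[ht _].
  have := hd x t xab tp ht => /ltW; apply: le_trans.
  by apply: le_trans (cmod_Im _); rewrite cImB.
split; apply: is_derive_small => e e0; have [r r0 hr] := main e e0; exists r => // h /hr;
  apply: le_trans.
  by apply: le_trans (cmod_Re _); rewrite !cReB cReM /= mulr0 subr0.
by apply: le_trans (cmod_Im _); rewrite !cImB cImM /= mulr0 add0r.
Qed.

Lemma fc_derivative (F g : R -> R[i]) l : ccont F a b -> ccont g a b ->
  (forall x, a < x < b -> is_cderive F x (g x)) -> F a = F b ->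
  fc g l = (0 +i* freq a b l) * fc F l.
Proof.
move=> cF cg dF Fab; rewrite !fcE [RHS]mulrCA; congr (_ * _).
have ce := ccont_ech a b (- l).
pose z : R[i] := 0 +i* freq a b l.
have zN : 0 +i* freq a b (- l) = - z by rewrite freqN /z; apply: complex_eq; rewrite /= ?oppr0.
have := @cint_FTC R a b (fun x => g x * ech a b (- l) x - z * (F x * ech a b (- l) x))
  (fun x => F x * ech a b (- l) x) ab.
have c1 := ccontM cg ce; have c2 := ccontM cF ce; have c3 := ccontM (ccont_cst z a b) c2.
move=> /(_ (ccontB c1 c3) c2) h; apply/eqP; rewrite -subr_eq0; apply/eqP.
rewrite -cintMl -?cintB; [| exact: cintegrable_cont..].
rewrite h ?ech_a ?ech_b ?Fab ?subrr// => x xab.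
apply: (is_cderive_ext (is_cderiveM (dF x xab) (is_cderive_ech a b (- l) x))) => //.
by rewrite zN; ring.
Qed.

End differentiation_under.

Section solution_coefficients.
Context {R : realType} (a b : R) (ab : a < b).
Local Notation mu1 := (freq a b 1).
Local Notation fc := (fourier_coef a b).
Local Notation ci := ((0 +i* 1)%C : R[i]).
Context (V : R -> R) (cV : ccont (fun x => (V x)%:C) a b).
Context (eps : R) (psi0 : R -> R[i]) (psi : R -> R -> R[i]).
Context (sol : exact_solution a b eps V psi0 psi).

Definition sol_coef (l : int) (t : R) : R[i] := fc (fun x => psi x t) l.
Definition pot_coef (l : int) (t : R) : R[i] := fc (fun x => (V x)%:C * psi x t) l.

Lemma sol_slice t : 0 <= t -> ccont (fun x => psi x t) a b.
Proof.
move=> t0; have [cpsi _ _ _ _] := sol.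
exact: (cslice_cont (J := [set t : R | 0 <= t]) (G := psi) cpsi t0).
Qed.

Lemma sol_init l : sol_coef l 0 = fc psi0 l.
Proof.
have [_ _ _ _ h] := sol; apply: fc_eq => // x /andP[ax xb].
by rewrite h// !ltW.
Qed.

Lemma sol_Vslice t : 0 <= t -> ccont (fun x => (V x)%:C * psi x t) a b.
Proof. by move=> t0; apply: ccontM => //; exact: sol_slice. Qed.

Lemma ccont_of_modulus (g : R -> R[i]) (th : R) :
  (forall t : R, 0 <= t -> forall e : R, 0 < e -> exists2 d : R, 0 < d &
     forall s : R, 0 <= s -> `|s - t| < d -> cmodulus (g s - g t) < e) -> ccont g 0 th.
Proof.
move=> h; split; apply/within_continuousP => t; rewrite /= in_itv/= => /andP[t0 _] e e0;
  have [d d0 hd] := h t t0 e e0; exists d => // s; rewrite /= in_itv/= => /andP[s0 _] st.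
  apply: le_lt_trans (hd s s0 _); last by move: st; rewrite /ball /= distrC.
  by rewrite distrC -cReB; exact: cmod_Re.
apply: le_lt_trans (hd s s0 _); last by move: st; rewrite /ball /= distrC.
by rewrite distrC -cImB; exact: cmod_Im.
Qed.

Lemma sol_ccont l th : ccont (sol_coef l) 0 th.
Proof.
apply: ccont_of_modulus => t t0 e e0; have e4 : 0 < e / 4 by rewrite divr_gt0.
have [cpsi _ _ _ _] := sol.
have [d d0 hd] := ctube (J := [set t : R | 0 <= t]) (G := psi) cpsi t0 e4.
exists d => // s s0 st.
have i1 := cintegrable_cont (sol_slice s0); have i2 := cintegrable_cont (sol_slice t0).
rewrite /sol_coef -fcB//; apply: le_lt_trans (_ : _ <= 2 * (e / 4)) _; last by lra.
apply: fc_bound_cst => //; first exact: cintegrableB.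
by move=> x /andP[ax xb]; apply/ltW/hd => //; rewrite !ltW.
Qed.

(** The values of psi_x at the end points are not prescribed, only its one-sided limits. Replacing
    these values by the common limit gives a continuous function on [a, b] that is equal at both
    ends. *)
Let patch (u : R -> R) (l : R) (x : R) : R := if (a < x) && (x < b) then u x else l.

Let patch_near (u : R -> R) l x : a < x < b -> {near x, u =1 patch u l}.
Proof.
move=> /andP[ax xb]; near=> y; rewrite /patch.
have -> : a < y by near: y; exact: lt_nbhsr.
by have -> : y < b by near: y; exact: lt_nbhsl.
Unshelve. all: by end_near. Qed.

Let patch_cont (u : R -> R) (l : R) : (forall x, a < x < b -> derivable u x 1) ->
  u @ a^'+ --> l -> u @ b^'- --> l -> {within `[a, b], continuous (patch u l)}.
Proof.
move=> du ua ub; apply/(continuous_within_itvP _ ab).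
have pa : patch u l a = l by rewrite /patch ltxx.
have pb : patch u l b = l by rewrite /patch ltxx andbF.
split.
- move=> x; rewrite in_itv/= => xab.
  have dx : derivable (patch u l) x 1.
    exact: (near_eq_derivable (patch_near u l xab) (du x xab)).
  by apply: differentiable_continuous; apply/derivable1_diffP.
- rewrite pa; apply: cvg_trans ua; apply: near_eq_cvg.
  near=> y; rewrite /patch; have -> : a < y by [].
  by have -> : y < b by near: y; exact: nbhs_right_lt.
- rewrite pb; apply: cvg_trans ub; apply: near_eq_cvg.
  near=> y; rewrite /patch; have -> : y < b by [].
  by have -> : a < y by near: y; exact: nbhs_left_gt.
Unshelve. all: by end_near. Qed.

Lemma is_cderive_cderiv (F : R -> R[i]) x : cderivable F x -> is_cderive F x (cderiv F x).
Proof.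
by move=> [d1 d2]; split; [apply: (DeriveDef d1)|apply: (DeriveDef d2)]; rewrite -derive1E.
Qed.

Lemma sol_derive l t : 0 < t ->
  is_cderive (sol_coef l) t (- (ci * (freq a b l ^+ 2)%:C) * sol_coef l t - ci * eps%:C * pot_coef l t).
Proof.
move=> t0; have t0' := ltW t0; have [cpsi [dpsi cdpsi] eqn bc _] := sol.
have -> : - (ci * (freq a b l ^+ 2)%:C) * sol_coef l t - ci * eps%:C * pot_coef l t =
   fc (fun x => cderiv (psi x) t) l; last first.
  apply: fc_time_derivative => //.
  by move=> s s0; apply: cintegrable_cont; apply: sol_slice; exact: ltW.
have [pab [L [[La1 La2] [Lb1 Lb2]]]] := bc t t0.
pose P x : R[i] := patch (fun y => complex.Re (cderiv (fun y => psi y t) y)) (complex.Re L) x +i*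
                   patch (fun y => complex.Im (cderiv (fun y => psi y t) y)) (complex.Im L) x.
(* By the equation w is psi_xx in the interior; unlike psi_xx it is continuous up to the end points,
   so the second integration by parts is legitimate. *)
pose w x : R[i] := (eps * V x)%:C * psi x t - ci * cderiv (psi x) t.
have ct : ccont (fun x => cderiv (psi x) t) a b.
  exact: (cslice_cont (J := [set t : R | 0 < t]) (G := fun x t => cderiv (psi x) t) cdpsi t0).
have cw : ccont w a b.
  apply: ccontB; last by apply: ccontM => //; exact: ccont_cst.
  apply: ccont_ext (ccontM (ccont_cst eps%:C a b) (sol_Vslice t0')) _ => x /=.
  by rewrite mulrA -rmorphM.
have cP : ccont P a b.
  have c1 := patch_cont (fun x xab => let: And3 _ d _ := eqn x t xab t0 in d.1) La1 Lb1.
  have c2 := patch_cont (fun x xab => let: And3 _ d _ := eqn x t xab t0 in d.2) La2 Lb2.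
  by split; [exact: c1|exact: c2].
have PE x : a < x < b -> P x = cderiv (fun y => psi y t) x.
  by move=> xab; rewrite /P /patch xab; case: (cderiv _ x).
have dP1 x : a < x < b -> is_cderive (fun y => psi y t) x (P x).
  by move=> xab; rewrite PE//; apply: is_cderive_cderiv; have [] := eqn x t xab t0.
have dP2 x : a < x < b -> is_cderive P x (w x).
  move=> xab; have [_ d2 e] := eqn x t xab t0.
  have -> : w x = cderiv (cderiv (fun y => psi y t)) x by rewrite /w e; ring.
  have [h1 h2] := is_cderive_cderiv d2.
  by split; [apply: near_eq_is_derive h1|apply: near_eq_is_derive h2]; exact: patch_near.
have Pab : P a = P b by rewrite /P /patch !ltxx !andbF.
have e1 := fc_derivative ab l (sol_slice t0') cP dP1 pab.
have e2 := fc_derivative ab l cP cw dP2 Pab.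
have iV := cintegrable_cont (sol_Vslice t0'); have it := cintegrable_cont ct.
have e3 : fc w l = eps%:C * pot_coef l t - ci * fc (fun x => cderiv (psi x) t) l.
  rewrite /pot_coef -[eps%:C * _]fcMl// -[ci * _]fcMl// -fcB//; [|exact: cintegrableMl|exact: cintegrableMl].
  by apply: fc_eq => x _; rewrite /w rmorphM /= mulrA.
have hc : fc w l = - (freq a b l ^+ 2)%:C * sol_coef l t.
  rewrite e2 e1 mulrA; congr (_ * _).
  by apply: complex_eq; rewrite ?cReM ?cImM ?cReN ?cImN /=; ring.
have h4 : ci * fc (fun x => cderiv (psi x) t) l = eps%:C * pot_coef l t + (freq a b l ^+ 2)%:C * sol_coef l t.
  have -> : ci * fc (fun x => cderiv (psi x) t) l = eps%:C * pot_coef l t - fc w l by rewrite e3; ring.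
  by rewrite hc; ring.
have -> : fc (fun x => cderiv (psi x) t) l = - ci * (ci * fc (fun x => cderiv (psi x) t) l).
  by rewrite mulrA mulNr cisqr opprK mul1r.
by rewrite h4; ring.
Qed.

Lemma sol_conv (B : R) t : 0 <= t -> (forall l, om mu1 l ^+ 2 * cmodulus (sol_coef l t) <= B) ->
  fconv (fc (fun x => (V x)%:C)) (sol_coef^~ t) (pot_coef^~ t).
Proof.
move=> t0 hB l; have [K K0 hK] := ccont_bounded (ltW ab) cV.
have hK' : exists2 K : R, 0 <= K & forall x, a < x < b -> cmodulus ((V x)%:C) <= K.
  by exists K => // x /andP[h1 h2]; apply: hK; rewrite !ltW.
have := fc_product ab l (sol_slice t0) (cintegrable_cont cV) hK' hB.
rewrite (@fc_eq _ a b (fun x => psi x t * (V x)%:C) (fun x => (V x)%:C * psi x t)); last first.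
  by move=> x _; rewrite mulrC.
move=> h; apply: (clim_near (M1 := 0%N) h) => M _; apply: eq_bigr => k _.
by rewrite mulrC.
Qed.

Lemma ae_dense (P : R -> Prop) (p q : R) : p < q ->
  {ae @lebesgue_measure R, forall t, P t} -> exists2 t : R, p < t < q & P t.
Proof.
move=> pq [A [mA A0 sA]]; apply: contrapT => h.
have sub : `]p, q[%classic `<=` A.
  move=> t /=; rewrite in_itv/= => tpq; apply: sA => /= Pt; apply: h; by exists t.
have : (@lebesgue_measure R `]p, q[%classic <= @lebesgue_measure R A)%E.
  by apply: le_measure => //; rewrite inE.
rewrite A0 lebesgue_measure_itv/= lte_fin pq -EFinB lee_fin => h2.
by move: pq; rewrite -subr_gt0 ltNge h2.
Qed.

(** The hypothesis holds for almost every time. The coefficients are continuous in time, uniformly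
    in l, and a set of full measure meets every interval, so each finite section of the norm
    inherits the bound at every time. *)
Lemma sol_Hbound m (M T : R) : 0 < eps -> 0 < T ->
  {ae @lebesgue_measure R, forall t : R, 0 <= t <= T / eps ->
       Hper a b m (fun x => psi x t) /\ (Hnorm a b m (fun x => psi x t) <= M%:E)%E} ->
  forall t, 0 <= t <= T / eps -> Hbound mu1 m (sol_coef^~ t) (2 ^+ m * M).
Proof.
move=> eps0 T0 hae t /andP[t0 tT] s us.
rewrite leNgt; apply/negP => gt.
have Te : 0 < T / eps by rewrite divr_gt0.
have mu0 := mu_gt0 ab.
have w0 l : l \in s -> 0 <= om mu1 l ^+ m by move=> _; exact: omX_ge0.
pose W := N2 s (fun l => om mu1 l ^+ m) + 1.
have W0 : 0 < W by rewrite ltr_wpDl ?N2_ge0.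
have gap0 : 0 < (nrm s (fun l => om mu1 l ^+ m) (sol_coef^~ t) - 2 ^+ m * M) / W.
  by rewrite divr_gt0 ?subr_gt0.
have [d d0 hd] : exists2 d : R, 0 < d & forall r : R, 0 <= r -> `|r - t| < d ->
    forall l, cmodulus (sol_coef l r - sol_coef l t) <= (nrm s (fun l => om mu1 l ^+ m) (sol_coef^~ t) - 2 ^+ m * M) / W.
  have e4 := divr_gt0 gap0 (ltr0n R 4).
  have [cpsi _ _ _ _] := sol.
  have [d d0 hd] := ctube (J := [set t : R | 0 <= t]) (G := psi) cpsi t0 e4.
  exists d => // r r0 rt l.
  have i1 := cintegrable_cont (sol_slice r0); have i2 := cintegrable_cont (sol_slice t0).
  rewrite /sol_coef -fcB//; move: gap0 hd {e4}; move: (_ / W) => e e0 hd.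
  apply: le_trans (_ : _ <= 2 * (e / 4)) _; last by lra.
  apply: fc_bound_cst => //; first exact: cintegrableB.
  by move=> x /andP[ax xb]; apply/ltW/hd => //; rewrite !ltW.
(* An interval of admissible times close to t: to the right of t, or to its left when t is the final
   time. *)
have [p [q [p0 pq qT near]]] : exists p q : R, [/\ 0 <= p, p < q, q <= T / eps &
    forall r : R, p < r < q -> `|r - t| < d].
  have [lt|ge] := ltP t (T / eps).
    exists t, (Num.min (T / eps) (t + d)); split=> //.
    - by rewrite lt_min lt ltrDl.
    - by rewrite ge_min lexx.
    - move=> r /andP[r1]; rewrite lt_min => /andP[_ r2].
      by rewrite ger0_norm; lra.
  have tE : t = T / eps by apply/eqP; rewrite eq_le tT.
  exists (Num.max 0 (t - d)), t; split=> //.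
  - by rewrite le_max lexx.
  - by rewrite gt_max tE Te/= ltrBlDr ltrDl.
  - move=> r /andP[]; rewrite gt_max => /andP[_ r1] r2.
    by rewrite ler0_norm; lra.
have [r /andP[pr rq] hr] := ae_dense pq hae.
have [_ hM] := hr (ltac:(by apply/andP; split; [exact: le_trans p0 (ltW pr)|exact: le_trans (ltW rq) qT])).
have hB := Hnorm_Hbound ab hM us.
have r0 : 0 <= r by exact: le_trans p0 (ltW pr).
have := hd r r0 (near r (ltac:(by rewrite pr rq))).
move: gap0; set g := (_ / W) => g0 hg.
have : nrm s (fun l => om mu1 l ^+ m) (sol_coef^~ t) <= 2 ^+ m * M + g * N2 s (fun l => om mu1 l ^+ m).
  rewrite (@eq_nrm _ _ _ _ _ (fun l => sol_coef l r - (sol_coef l r - sol_coef l t))); last first.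
    by move=> l _; ring.
  apply: (nrmBle w0) => //; apply: (@le_trans _ _ (N2 s (fun l => g * om mu1 l ^+ m))).
    apply: N2_le => l ls; rewrite ger0_norm ?mulr_ge0 ?w0 ?cmod_ge0// mulrC ler_wpM2r ?w0//.
  by rewrite N2_scale ger0_norm// ltW.
rewrite leNgt => /negP; apply; rewrite -ltrBrDl.
have -> : nrm s (fun l => om mu1 l ^+ m) (sol_coef^~ t) - 2 ^+ m * M = g * W by rewrite /g divfK// gt_eqF.
by rewrite /W ltr_pM2l// ltrDl.
Qed.

End solution_coefficients.

(** * The scheme in Fourier coordinates *)

Section discrete_fourier.
Context {R : realType} (a b : R) (ab : a < b) (N : nat) (N0 : (0 < N)%N) (oN : ~~ odd N).
Local Notation mu1 := (freq a b 1).
Local Notation fc := (fourier_coef a b).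
Local Notation ech := (ech a b).
Local Notation T := (modes N).
Local Notation x_ j := (grid a b N j).

Let Np : 0 < (N%:R : R). Proof. by rewrite ltr0n. Qed.
Let m0 : 0 < mu1. Proof. exact: mu_gt0. Qed.
Let ba0 : 0 < b - a. Proof. by rewrite subr_gt0. Qed.

Lemma grid_in j : (j <= N)%N -> a <= x_ j <= b.
Proof.
move=> jN; rewrite /grid /mesh lerDl mulr_ge0 ?divr_ge0 ?(ltW ba0)//=.
rewrite -lerBrDl mulrCA ger_pMr// ler_pdivrMr// mul1r ler_nat//.
Qed.

Lemma ech_grid l j : ech l (x_ j) = expi (2 * pi * l%:~R * j%:R / N%:R).
Proof.
rewrite /ech /grid /mesh /freq; congr expi.
by field; rewrite !gt_eqF.
Qed.

Lemma ech_grid_period l p j : ech (l + p * N%:Z) (x_ j) = ech l (x_ j).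
Proof.
rewrite echD [X in _ * X](_ : _ = 1) ?mulr1// ech_grid.
have -> : 2 * pi * (p * N%:Z)%:~R * j%:R / N%:R = 2 * pi * (p * j%:Z)%:~R :> R.
  by rewrite !intrM -!pmulrn; field; rewrite gt_eqF.
exact: expi_2piz.
Qed.

Lemma ech_rep l j : ech (rep N l) (x_ j) = ech l (x_ j).
Proof. by have [p ->] := rep_eq N l; exact: ech_grid_period. Qed.

Lemma expi_neq1 (th : R) : 0 < `|th| < 2 * pi -> expi th != 1 :> R[i].
Proof.
move=> /andP[t0 t2]; apply/eqP => /(congr1 (@complex.Re R)) /= c1.
have : sin (`|th| / 2) = 0.
  have h : cos `|th| = 1 - 2 * sin (`|th| / 2) ^+ 2.
    rewrite [in LHS](_ : `|th| = `|th| / 2 + `|th| / 2); last by field.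
    by rewrite cosD -!expr2 cos2sin2; ring.
  rewrite cos_norm c1 in h; apply/eqP; rewrite -sqrf_eq0; apply/eqP; lra.
by apply/eqP; rewrite gt_eqF// sin_gt0_pi// divr_gt0//= ltr_pdivrMr// mulrC.
Qed.

Lemma sum_roots (l : int) : 0 < `|l| < N%:Z ->
  \sum_(j < N) expi (2 * pi * l%:~R * j%:R / N%:R) = 0 :> R[i].
Proof.
move=> /andP[l0 lN]; pose z : R[i] := expi (2 * pi * l%:~R / N%:R).
have p0 := pi_gt0 R.
have -> : \sum_(j < N) expi (2 * pi * l%:~R * j%:R / N%:R) = \sum_(j < N) z ^+ j.
  by apply: eq_bigr => j _; rewrite -expi_mulrn; congr expi; ring.
have z1 : z != 1.
  apply: expi_neq1; rewrite -!mulrA normrM [`|2|]ger0_norm// normrM [`|pi|]ger0_norm ?ltW//.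
  rewrite normrM [`|_^-1|]ger0_norm ?invr_ge0 ?(ltW Np)//.
  have lr : 0 < `|l%:~R : R| by rewrite -intr_norm ltr0z.
  have lrN : `|l%:~R : R| < N%:R by rewrite -intr_norm [N%:R]pmulrn ltr_int.
  rewrite !mulr_gt0 ?invr_gt0//= ltr_pM2l// gtr_pMr// ltr_pdivrMr// mul1r.
  exact: lrN.
have := subrX1 z N; have -> : z ^+ N = 1.
  rewrite -expi_mulrn (_ : N%:R * _ = 2 * pi * l%:~R) ?expi_2piz//.
  by field; rewrite gt_eqF.
by rewrite subrr => /esym/eqP; rewrite mulf_eq0 subr_eq0 (negbTE z1)/= => /eqP ->.
Qed.

(** The transform for functions of the grid index instead of column vectors; the value at j = N,
    which repeats that at 0, does not enter. *)
Definition dftn (g : nat -> R[i]) (l : int) : R[i] :=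
  ((N%:R : R)^-1)%:C * \sum_(j < N) g j * ech (- l) (x_ j).

Lemma eq_dftn g g' l : (forall j, (j < N)%N -> g j = g' j) -> dftn g l = dftn g' l.
Proof. by move=> h; congr (_ * _); apply: eq_bigr => j _; rewrite h. Qed.

Lemma dftn_rep g l : dftn g (rep N l) = dftn g l.
Proof.
congr (_ * _); apply: eq_bigr => j _; congr (_ * _).
have [p ->] := rep_eq N l; rewrite opprD -mulNr; exact: ech_grid_period.
Qed.

Lemma dist_modes l k : l \in T -> k \in T -> l != k -> 0 < `|l - k| < N%:Z.
Proof.
rewrite !mem_modes// => /andP[l1 l2] /andP[k1 k2] lk.
by rewrite normr_gt0 subr_eq0 lk/= ltr_norml; apply/andP; split; lia.
Qed.

Lemma NV1 : ((N%:R : R)^-1)%:C * N%:R = 1 :> R[i].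
Proof. by rewrite -[N%:R : R[i]](rmorph_nat (real_complex R)) -rmorphM /= mulVf ?gt_eqF. Qed.

Lemma dftn_ech k l : l \in T -> k \in T -> dftn (fun j => ech k (x_ j)) l = (k == l)%:R.
Proof.
move=> lT kT; rewrite /dftn; under eq_bigr do rewrite -echD.
have [->|kl] := eqVneq k l.
  under eq_bigr do rewrite subrr ech0.
  by rewrite sumr_const card_ord NV1.
under eq_bigr do rewrite ech_grid.
by rewrite sum_roots ?mulr0// dist_modes.
Qed.

Lemma dftnMl c g l : dftn (fun j => c * g j) l = c * dftn g l.
Proof. by rewrite /dftn mulrCA; congr (_ * _); rewrite mulr_sumr; apply: eq_bigr => j _; rewrite mulrA. Qed.

Lemma dftn_sum (s : seq int) (F : int -> nat -> R[i]) l :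
  dftn (fun j => \sum_(k <- s) F k j) l = \sum_(k <- s) dftn (F k) l.
Proof.
rewrite /dftn -mulr_sumr exchange_big; congr (_ * _).
by apply: eq_bigr => j _; rewrite mulr_suml.
Qed.

Lemma dftn_trig (d : int -> R[i]) l : l \in T ->
  dftn (fun j => \sum_(k <- T) d k * ech k (x_ j)) l = d l.
Proof.
move=> lT; rewrite dftn_sum (eq_big_seq (fun k => d k * (k == l)%:R)).
  rewrite (bigD1_seq l)//= ?uniq_modes// eqxx mulr1 big1 ?addr0// => k /negbTE ->.
  by rewrite mulr0.
by move=> k kT; rewrite dftnMl dftn_ech.
Qed.

Lemma dftn_inversion g j : (j < N)%N -> \sum_(k <- T) dftn g k * ech k (x_ j) = g j.
Proof.
move=> jN; rewrite -big_modesC.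
have -> : \sum_(k < N) dftn g (mode N k) * ech (mode N k) (x_ j) =
  ((N%:R : R)^-1)%:C * \sum_(i < N) g i * \sum_(k < N) ech (mode N k) (x_ j) * ech (- mode N k) (x_ i).
  rewrite /dftn; under eq_bigr do rewrite -mulrA mulr_suml.
  rewrite -mulr_sumr exchange_big; congr (_ * _); apply: eq_bigr => i _.
  by rewrite mulr_sumr; apply: eq_bigr => k _; ring.
rewrite (bigD1 (Ordinal jN))//= [X in _ + X]big1.
  under eq_bigr do rewrite -echD subrr ech0.
  by rewrite sumr_const card_ord addr0 mulrCA NV1 mulr1.
move=> i ij.
pose p : int := j%:Z - i%:Z.
have pN : 0 < `|p| < N%:Z.
  have : (i : nat) != j by apply: contra ij => /eqP e; apply/eqP/val_inj.
  have := ltn_ord i; rewrite /p {p}; move: (nat_of_ord i) => i' iN ij'.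
  rewrite normr_gt0 subr_eq0 eqz_nat eq_sym ij'/=.
  by rewrite ltr_norml; apply/andP; split; lia.
have -> : \sum_(k < N) ech (mode N k) (x_ j) * ech (- mode N k) (x_ i) =
   expi (- (2 * pi * (N./2)%:R * p%:~R / N%:R)) * \sum_(k < N) expi (2 * pi * p%:~R * k%:R / N%:R).
  rewrite mulr_sumr; apply: eq_bigr => k _; rewrite !ech_grid -!expiD; congr expi.
  by rewrite /p /mode !intrD !intrN intrD intrN -!pmulrn; ring.
by rewrite sum_roots// !mulr0.
Qed.

(** The convolution is cyclic although it is written with l - k: the transform has period N, so
    indices outside the window of modes stand for their representatives. *)
Lemma dftn_product g g' l :
  dftn (fun j => g j * g' j) l = \sum_(k <- T) dftn g (l - k) * dftn g' k.
Proof.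
have -> : dftn (fun j => g j * g' j) l = dftn (fun j => \sum_(k <- T) dftn g' k * (g j * ech k (x_ j))) l.
  apply: eq_dftn => j jN; rewrite -{1}(dftn_inversion g' jN) mulr_sumr.
  by apply: eq_bigr => k _; rewrite mulrCA.
rewrite dftn_sum; apply: eq_bigr => k _; rewrite dftnMl mulrC; congr (_ * _).
congr (_ * _); apply: eq_bigr => j _; rewrite -mulrA -echD; congr (_ * ech _ _).
by rewrite opprB.
Qed.

Lemma dftn_bound g l : (forall j, (j < N)%N -> cmodulus (g j) <= 1) -> cmodulus (dftn g l) <= 1.
Proof.
move=> h; rewrite cmodM cmodR ger0_norm ?invr_ge0 ?(ltW Np)// ler_pdivrMl// mulr1.
apply: (le_trans (cmod_sum _ _ _)); apply: (@le_trans _ _ (\sum_(j < N) 1)).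
  by apply: ler_sum => j _; rewrite cmodM cmod_ech mulr1 h.
by rewrite sumr_const card_ord.
Qed.

(** On the grid the character k coincides with that of its representative, so the discrete
    coefficient collects the Fourier coefficients of a whole residue class. *)
Lemma dftn_alias (phi : R -> R[i]) (B : R) l : ccont phi a b ->
  (forall k, om mu1 k ^+ 2 * cmodulus (fc phi k) <= B) -> l \in T ->
  clim (fun M => \sum_(k <- win M | rep N k == l) fc phi k) (dftn (fun j => phi (x_ j)) l).
Proof.
move=> cphi hB lT.
have B0 : 0 <= B by apply: le_trans (hB 0); rewrite mulr_ge0 ?cmod_ge0 ?omX_ge0.
have h : clim (fun M => dftn (fun j => \sum_(k <- win M) fc phi k * ech k (x_ j)) l)
    (dftn (fun j => phi (x_ j)) l).
  apply: climMl.
  have := @clim_sum R _ (index_enum 'I_N) (fun j M => (\sum_(k <- win M) fc phi k * ech k (x_ j)) * ech (- l) (x_ j))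
    (fun j => phi (x_ j) * ech (- l) (x_ j)).
  apply => j _; under [X in clim X _]funext do rewrite mulrC.
  rewrite mulrC; apply: climMl; apply: (clim_rate ab B0) => M.
  by apply: fourier_inversion => //; apply: grid_in; exact: ltnW.
apply: (clim_near (M1 := 0%N) h) => M _.
rewrite dftn_sum [RHS]big_mkcond; apply: eq_bigr => k _; rewrite dftnMl.
have -> : dftn (fun j => ech k (x_ j)) l = dftn (fun j => ech (rep N k) (x_ j)) l.
  by apply: eq_dftn => j _; rewrite ech_rep.
by rewrite dftn_ech ?rep_modes//; case: eqP => _; rewrite ?mulr1 ?mulr0.
Qed.

Lemma mesh_pow (m : nat) : (0 < m)%N ->
  (mu1 * N%:R / 2) ^+ 1 / (mu1 * N%:R / 2) ^+ m <= mesh a b N ^+ (m - 1).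
Proof.
case: m => // m _; rewrite subn1 /= expr1.
have x0 : 0 < mu1 * N%:R / 2 by exact: (divr_gt0 (mulr_gt0 m0 Np) (ltr0n R 2)).
have -> : mu1 * N%:R / 2 / (mu1 * N%:R / 2) ^+ m.+1 = (mu1 * N%:R / 2)^-1 ^+ m.
  by rewrite exprS invfM mulrA mulfV ?gt_eqF// mul1r exprVn.
apply: lerXn2r.
- by rewrite nnegrE invr_ge0 ltW.
- by rewrite nnegrE /mesh divr_ge0 ?(ltW ba0) ?(ltW Np).
(* The half bandwidth mu1 N / 2 is pi / h, which turns the aliasing gain into powers of the mesh
   size. *)
have -> : (mu1 * N%:R / 2)^-1 = mesh a b N / pi.
  have aux (P n d : R) : P != 0 -> n != 0 -> d != 0 -> (2 * P / d * n / 2)^-1 = d / n / P.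
    by move=> P0 n0 d0; field; rewrite P0 n0 d0.
  by rewrite /mesh /freq mulr1 aux// gt_eqF// pi_gt0.
rewrite ler_piMr ?divr_ge0 ?(ltW ba0) ?(ltW Np)// invf_le1 ?pi_gt0//.
by have := pihalf_ge1 R; lra.
Qed.

Lemma dftn_error (m : nat) (phi : R -> R[i]) (B : R) : (2 < m)%N -> ccont phi a b ->
  Hbound mu1 m (fc phi) B ->
  nrm T (om mu1) (fun l => dftn (fun j => phi (x_ j)) l - fc phi l) <=
  3 * (1 + mu1^-1) * B * mesh a b N ^+ (m - 1).
Proof.
move=> m2 cphi hB; have N1 : (1 < N)%N by case: (N) N0 oN => [|[|]].
have mp : (0 < m)%N by exact: ltn_trans m2.
have hB2 k : om mu1 k ^+ 2 * cmodulus (fc phi k) <= B.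
  by apply: (Hbound_point (m := 2)); apply: Hbound_mono hB => //; exact: ltnW.
have := @aliasing R mu1 m0 N m 1 (fc phi) (dftn (fun j => phi (x_ j))) B N1 oN mp hB
  (fun l lT => dftn_alias cphi hB2 lT).
rewrite (@eq_nrm_cmod _ _ _ (fun l => om mu1 l ^+ 1) _ _ (fun _ _ => erefl)).
move=> h; have B0 := Hbound_ge0 hB; have mi : 0 <= mu1^-1 by rewrite invr_ge0 ltW.
apply: (le_trans h); rewrite [leRHS]mulrAC ler_wpM2r// ler_wpM2l//.
  by rewrite mulr_ge0// addr_ge0.
exact: mesh_pow.
Qed.

Lemma dftn_Hbound (m : nat) (phi : R -> R[i]) (B : R) : (2 < m)%N -> ccont phi a b ->
  Hbound mu1 m (fc phi) B ->
  nrm T (fun l => om mu1 l ^+ m) (dftn (fun j => phi (x_ j))) <= (3 * (1 + mu1^-1) ^+ m + 1) * B.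
Proof.
move=> m2 cphi hB; have N1 : (1 < N)%N by case: (N) N0 oN => [|[|]].
have mp : (0 < m)%N by exact: ltn_trans m2.
have hB2 k : om mu1 k ^+ 2 * cmodulus (fc phi k) <= B.
  by apply: (Hbound_point (m := 2)); apply: Hbound_mono hB => //; exact: ltnW.
have := @aliasing R mu1 m0 N m m (fc phi) (dftn (fun j => phi (x_ j))) B N1 oN mp hB
  (fun l lT => dftn_alias cphi hB2 lT).
have x0 : 0 < mu1 * N%:R / 2 by exact: (divr_gt0 (mulr_gt0 m0 Np) (ltr0n R 2)).
rewrite divff ?mulr1; last by rewrite expf_neq0// gt_eqF.
move=> h; rewrite (@eq_nrm _ _ _ _ _ (fun l => (dftn (fun j => phi (x_ j)) l - fc phi l) + fc phi l)); last first.
  by move=> l _; rewrite subrK.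
rewrite mulrDl mul1r; apply: nrmDle => //; first by move=> l _; exact: omX_ge0.
by apply: hB; exact: uniq_modes.
Qed.

End discrete_fourier.

Section tsfp_in_fourier_space.
Context {R : realType} (a b : R) (ab : a < b) (N : nat) (N0 : (0 < N)%N) (oN : ~~ odd N).
Local Notation T := (modes N).
Local Notation x_ j := (grid a b N j).
Local Notation ci := ((0 +i* 1)%C : R[i]).
Local Notation dftn := (dftn a b N).
Context (V : R -> R).

(** Multiplication by e^(-i th V) on the grid, seen on Fourier coefficients; its entries depend on l
    - k modulo N only. *)
Definition pot_mx (th : R) (l k : int) : R[i] :=
  dftn (fun j => expi (- (th * V (x_ j)))) (l - k).

Definition pot_dft (l : int) : R[i] := dftn (fun j => (V (x_ j))%:C) l.

Lemma dft_col (F : nat -> R[i]) l : dft a b (\col_(j < N.+1) F j) l = dftn F l.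
Proof.
rewrite /dft; congr (_ * _); apply: eq_bigr => j _; rewrite mxE /=.
by rewrite /ech freqN mulNr.
Qed.

Lemma dftn_shift g l k : dftn (fun j => g j * ech a b k (x_ j)) l = dftn g (l - k).
Proof.
congr (_ * _); apply: eq_bigr => j _; rewrite -mulrA -echD; congr (_ * ech _ _ _ _).
by rewrite opprB.
Qed.

Lemma pot_mx0 u l : l \in T -> mv T (pot_mx 0) u l = u l.
Proof.
move=> lT; rewrite /mv (eq_big_seq (fun k => (k == l)%:R * u k)).
  rewrite (bigD1_seq l)//= ?uniq_modes// eqxx mul1r big1 ?addr0// => k /negbTE ->.
  by rewrite mul0r.
move=> k kT; congr (_ * _); rewrite -(dftn_ech ab N0 oN lT kT) /pot_mx -dftn_shift.
by apply: eq_dftn => j _; rewrite mul0r oppr0 expi0 mul1r.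
Qed.

Lemma pot_mx_le1 th l k : cmodulus (pot_mx th l k) <= 1.
Proof. by apply: dftn_bound => // j _; rewrite cmod_expi. Qed.

Lemma is_cderive_pot_mx th l k : l \in T -> k \in T ->
  is_cderive (fun th => pot_mx th l k) th (- ci * \sum_(j <- T) pot_dft (l - j) * pot_mx th j k).
Proof.
move=> lT kT.
have -> : \sum_(j <- T) pot_dft (l - j) * pot_mx th j k =
    dftn (fun j => (V (x_ j))%:C * expi (- (th * V (x_ j)))) (l - k).
  rewrite -dftn_shift (@eq_dftn _ _ _ _ _ (fun j => (V (x_ j))%:C * (expi (- (th * V (x_ j))) * ech a b k (x_ j)))).
    rewrite dftn_product//; apply: eq_bigr => j _; congr (_ * _).
    by rewrite dftn_shift.
  by move=> j _; rewrite mulrA.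
have h j : is_cderive (fun th => expi (- (th * V (x_ j))) * ech a b (- (l - k)) (x_ j)) th
    (- ci * ((V (x_ j))%:C * expi (- (th * V (x_ j)))) * ech a b (- (l - k)) (x_ j)).
  apply: is_cderiveMr.
  have d : is_derive th (1 : R) (fun y => - (y * V (x_ j))) (- V (x_ j)).
    apply: (is_derive_ext (is_derive_affine (- V (x_ j)) 0 th)) => // y.
    by rewrite addr0 mulNr mulrC.
  apply: (is_cderive_ext (is_cderive_expi d)) => //.
  rewrite mulrA; congr (_ * _); apply: complex_eq; rewrite ?cReM ?cImM /=; ring.
have hs := is_cderive_sum (s := index_enum 'I_N)
  (F := fun j th => expi (- (th * V (x_ j))) * ech a b (- (l - k)) (x_ j)) (fun j _ => h j).
apply: (is_cderive_ext (is_cderiveMl ((N%:R : R)^-1)%:C hs)) => //.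
rewrite mulrCA; congr (_ * _); rewrite mulr_sumr.
by apply: eq_bigr => j _; rewrite !mulrA.
Qed.

Lemma dft_free_half_step tau (u : 'cV[R[i]]_N.+1) l : l \in T ->
  dft a b (free_half_step a b tau u) l = expi ((0 - tau / 2) * freq a b l ^+ 2) * dft a b u l.
Proof.
move=> lT; transitivity (dftn (fun j => \sum_(k < N)
    expi (- (tau * freq a b (mode N k) ^+ 2 / 2)) * dft a b u (mode N k) *
    expi (freq a b (mode N k) * (x_ j - a))) l); first exact: dft_col.
rewrite (@eq_dftn _ _ _ _ _ (fun j => \sum_(k <- T) (expi ((0 - tau / 2) * freq a b k ^+ 2) * dft a b u k) * ech a b k (x_ j))).
  by rewrite dftn_trig.
move=> j _; rewrite -big_modesC; apply: eq_bigr => k _; congr (expi _ * _ * _); ring.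
Qed.

Lemma dft_potential_step eps tau (u : 'cV[R[i]]_N.+1) l :
  dft a b (potential_step a b eps tau V u) l = \sum_(k <- T) pot_mx (eps * tau) l k * dft a b u k.
Proof.
pose g (j : nat) : R[i] := u (inord j) ord0.
have e1 : dft a b (potential_step a b eps tau V u) l = dftn (fun j => expi (- (eps * tau * V (x_ j))) * g j) l.
  rewrite /dft; congr (_ * _); apply: eq_bigr => j _; rewrite mxE /=.
  congr (_ * u _ _ * _); last by rewrite /ech freqN mulNr.
  by apply/val_inj; rewrite /= inordK// ltnS ltnW.
have e2 k : dft a b u k = dftn g k.
  rewrite /dft; congr (_ * _); apply: eq_bigr => j _.
  congr (u _ _ * _); last by rewrite /ech freqN mulNr.
  by apply/val_inj; rewrite /= inordK// ltnS ltnW.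
by rewrite e1 dftn_product//; apply: eq_bigr => k _; rewrite e2.
Qed.

Lemma dft_tsfp_step eps tau psi0 n l : l \in T ->
  dft a b (tsfp a b N eps tau V psi0 n.+1) l =
  expi ((0 - tau / 2) * freq a b l ^+ 2) * mv T (pot_mx (eps * tau))
    (fun k => expi ((0 - tau / 2) * freq a b k ^+ 2) * dft a b (tsfp a b N eps tau V psi0 n) k) l.
Proof.
move=> lT; rewrite /tsfp iterS dft_free_half_step//; congr (_ * _).
rewrite dft_potential_step; apply: eq_big_seq => k kT.
by rewrite dft_free_half_step.
Qed.

Lemma dft_tsfp0 eps tau psi0 l :
  dft a b (tsfp a b N eps tau V psi0 0) l = dftn (fun j => psi0 (x_ j)) l.
Proof. exact: (dft_col (fun j => psi0 (x_ j))). Qed.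

Lemma fc_trig_interp (u : 'cV[R[i]]_N.+1) l :
  fourier_coef a b (trig_interp a b u) l = if l \in T then dft a b u l else 0.
Proof.
rewrite -(fc_trig ab (dft a b u) l (uniq_modes N)); apply: fc_eq => x _.
exact: (big_modesC N (fun k => dft a b u k * ech a b k x)).
Qed.

Lemma cintegrable_trig_interp (u : 'cV[R[i]]_N.+1) : cintegrable a b (trig_interp a b u).
Proof.
apply: cintegrable_cont.
apply: (@ccont_ext _ (fun x => \sum_(k <- T) dft a b u k * ech a b k x)).
  by apply: ccont_sum => k _; apply: ccontM; [exact: ccont_cst|exact: ccont_ech].
move=> x; symmetry; exact: (big_modesC N (fun k => dft a b u k * ech a b k x)).
Qed.

End tsfp_in_fourier_space.

Lemma norm_sub_le (x y z : int) : 0 <= x -> x <= z -> 0 <= y -> y <= z -> `|x - y| <= z.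
Proof. by move=> *; rewrite ler_norml; apply/andP; split; lia. Qed.

Lemma notin_modes N (l : int) : ~~ odd N -> l \notin modes N -> N%:Z <= 2 * `|l|.
Proof. by move=> oN; rewrite mem_modes// negb_and -leNgt -ltNge => /orP[]; lia. Qed.

Lemma tail_pow (R : realType) (x y : R) m : (0 < m)%N -> 0 < x -> x <= y ->
  y <= x ^+ 1 / x ^+ m * y ^+ m.
Proof.
case: m => // m _ x0 xy.
have -> : x ^+ 1 / x ^+ m.+1 = (x ^+ m)^-1.
  by rewrite expr1 exprS invfM mulrA mulfV ?gt_eqF// mul1r.
rewrite exprS.
have y0 : 0 <= y by exact: le_trans (ltW x0) xy.
rewrite mulrCA ler_peMr// mulrC ler_pdivlMr ?exprn_gt0// mul1r.
by apply: lerXn2r => //; rewrite nnegrE// ltW.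
Qed.

Lemma error_arith (R : realType) (E0 p q r ce bc h1 e2 rho : R) : 0 <= E0 -> 0 <= p -> 0 <= q ->
  0 <= r -> 0 <= ce -> 0 <= bc -> 0 <= h1 -> 0 <= e2 -> 0 <= rho ->
  E0 * (p * h1 + q * e2 + r * (ce * h1 + e2 + rho)) + q * e2 + bc * h1 <=
  (E0 * (p + q + r * (ce + 1 + 1)) + q + bc) * (h1 + e2 + rho).
Proof.
move=> E00 p0 q0 r0 ce0 bc0 h10 e20 rho0.
have X1 : h1 <= h1 + e2 + rho by lra.
have X2 : e2 <= h1 + e2 + rho by lra.
have X3 : e2 + rho <= h1 + e2 + rho by lra.
have X0 : 0 <= h1 + e2 + rho by lra.
rewrite !mulrDl -mulrA; apply: lerD; last by rewrite ler_wpM2l.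
apply: lerD; last by rewrite ler_wpM2l.
rewrite ler_wpM2l// !mulrDl; apply: lerD; first by apply: lerD; rewrite ler_wpM2l.
rewrite -mulrA ler_wpM2l// !mulrDl !mul1r.
have := ler_wpM2l ce0 X1; rewrite !mulrDr; lra.
Qed.

(** * The H^1 error of the scheme in terms of the untreated pairs of frequencies *)

Section scheme_error.
Context {R : realType} (a b : R) (ab : a < b) (m : nat) (m3 : (2 < m)%N) (T : R) (T0 : 0 < T).
Local Notation mu1 := (freq a b 1).
Local Notation fc := (fourier_coef a b).
Local Notation om := (om mu1).
Local Notation C0 := (C0 mu1).
Local Notation wm := (fun l => om l ^+ m).
Context (V : R -> R) (psi0 : R -> R[i]) (psi : R -> R -> R -> R[i]).
Context (cV : ccont (fun x => (V x)%:C) a b).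
Context (sol : forall eps : R, 0 < eps <= 1 -> exact_solution a b eps V psi0 (psi eps)).
Context (BV Bc : R) (hBV : Hbound mu1 m (fc (fun x => (V x)%:C)) BV).
Context (hBc : forall eps t : R, 0 < eps <= 1 -> 0 <= t <= T / eps ->
  Hbound mu1 m (fun l => sol_coef a b (psi eps) l t) Bc).

Let m0 : 0 < mu1. Proof. exact: mu_gt0. Qed.
Let m1 : (1 < m)%N. Proof. exact: ltnW. Qed.
Let mp : (0 < m)%N. Proof. exact: ltnW. Qed.

Definition high (tau0 : R) (l : int) : bool := Ncut tau0 < `|l|.

(* The pairs of frequencies that the normal form does not treat. *)
Definition high_remainder (N : nat) (tau0 : R) (c : int -> R[i]) : R :=
  N2 (modes N) (fun l => om l * \sum_(k <- modes N)
    (high tau0 l || high tau0 k)%:R * cmodulus (pot_dft a b N V (l - k)) * cmodulus (c k)).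

Let kp : R := 3 * (1 + mu1^-1).
Let Bv : R := (3 * (1 + mu1^-1) ^+ m + 1) * BV.
Let Bf : R := 2 ^+ m.+1 * C0 * BV * Bc.
Let Cv : R := C0 * Bv.
Let Cc : R := 2 * (Bv * C0).
Let Ceta : R := kp * Bf + Cv * (kp * Bc).

Let BV0 : 0 <= BV. Proof. exact: Hbound_ge0 hBV. Qed.
Let Bc0 : 0 <= Bc.
Proof.
have e : 0 < (1 : R) <= 1 by rewrite ltr01 lexx.
by apply: (Hbound_ge0 (hBc e (t := 0) _)); rewrite lexx divr_ge0// ltW.
Qed.
Let mi0 : 0 <= 1 + mu1^-1. Proof. by apply: addr_ge0 => //; rewrite invr_ge0 ltW. Qed.
Let kp0 : 0 <= kp. Proof. exact: mulr_ge0. Qed.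
Let C00 : 0 <= C0. Proof. exact: C0_ge0. Qed.
Let Bv0 : 0 <= Bv.
Proof. by apply: mulr_ge0 => //; apply: addr_ge0 => //; apply: mulr_ge0 => //; exact: exprn_ge0. Qed.
Let Bf0 : 0 <= Bf.
Proof. by apply: mulr_ge0 => //; apply: mulr_ge0 => //; apply: mulr_ge0 => //; exact: exprn_ge0. Qed.
Let Cv0 : 0 <= Cv. Proof. exact: mulr_ge0. Qed.
Let Cc0 : 0 <= Cc. Proof. by apply: mulr_ge0 => //; exact: mulr_ge0. Qed.
Let Ceta0 : 0 <= Ceta. Proof. by apply: addr_ge0; apply: mulr_ge0 => //; exact: mulr_ge0. Qed.

Lemma pot_coef_bound eps t : 0 < eps <= 1 -> 0 <= t <= T / eps ->
  Hbound mu1 m (fun l => pot_coef a b V (psi eps) l t) Bf.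
Proof.
move=> e01 tT; have /andP[t0 _] := tT; have hc := hBc e01 tT.
have hB2 l : om l ^+ 2 * cmodulus (sol_coef a b (psi eps) l t) <= Bc.
  by apply: (Hbound_point (m := 2)); apply: Hbound_mono hc.
exact: (fconv_bound m0 mp hBV hc (sol_conv ab cV (sol e01) t0 hB2)).
Qed.

Section constants.
Context (alpha nu3 : R) (alpha01 : 0 < alpha < 1) (nu0 : 0 < nu3).

Definition gam_const : R := Cgam a b alpha nu3 * (Bv * C0).

Lemma gam_const_ge0 : 0 <= gam_const.
Proof. by apply: mulr_ge0; [exact: Cgam_ge0|exact: mulr_ge0]. Qed.

Lemma C4_ge0 : 0 <= C4 Cv Cc Bc Bf T gam_const.
Proof.
have h3 := C3_ge0 Cv0 Cc0 Bc0 Bf0 (ltW T0); have hE := CE_ge0 T Cv0.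
have hg := gam_const_ge0.
exact: (addr_ge0 (addr_ge0 (addr_ge0 h3 (mulr_ge0 hg Bf0)) (mulr_ge0 (mulr_ge0 hE hg) Bc0)) (ler0n R 2)).
Qed.

Definition step_const : R := expR (CE Cv T * T) * (kp * Bc + gam_const * Bc +
  C4 Cv Cc Bc Bf T gam_const * T * (Ceta + 1 + 1)) + gam_const * Bc + Bc.

Lemma step_const_ge0 : 0 <= step_const.
Proof.
have x0 := mulr_ge0 kp0 Bc0; have x1 := mulr_ge0 gam_const_ge0 Bc0.
have x2 := mulr_ge0 (mulr_ge0 C4_ge0 (ltW T0)) (addr_ge0 (addr_ge0 Ceta0 ler01) ler01).
exact: (addr_ge0 (addr_ge0 (mulr_ge0 (expR_ge0 _) (addr_ge0 (addr_ge0 x0 x1) x2)) x1) Bc0).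
Qed.

End constants.

Section grid_size.
Context (N : nat) (N0 : (0 < N)%N) (oN : ~~ odd N).
Local Notation v := (pot_dft a b N V).
Local Notation S := (modes N).
Local Notation h1 := (mesh a b N ^+ (m - 1)).

Let h10 : 0 <= h1.
Proof. by apply: exprn_ge0; rewrite /mesh divr_ge0// subr_ge0 ltW. Qed.

Lemma pot_dft_rep l : v (rep N l) = v l. Proof. exact: dftn_rep. Qed.

Lemma pot_dft_bound : nrm S wm v <= Bv.
Proof. exact: (dftn_Hbound ab N0 oN m3 cV hBV). Qed.

Lemma delta_kernel l k : l \in S -> k \in S ->
  om l * `|freq a b l ^+ 2 - freq a b k ^+ 2| <= 2 * om (rep N (l - k)) ^+ m * om k ^+ m.-1.
Proof.
by move=> lS kS; rewrite [freq a b l]freqE [freq a b k]freqE; exact: (om_delta_leX m0 N0 oN pot_dft_bound m3).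
Qed.

(** On the grid the transform of V psi is exactly the cyclic convolution of the transforms of V and
    psi. Two aliasing errors remain, that of V psi and, after multiplication by V, that of psi. *)
Lemma conv_defect eps t : 0 < eps <= 1 -> 0 <= t <= T / eps ->
  nrm S om (fun l => pot_coef a b V (psi eps) l t -
    mv S (fun l k => v (l - k)) (fun k => sol_coef a b (psi eps) k t) l) <= Ceta * h1.
Proof.
move=> e01 tT; have t0 : 0 <= t by case/andP: tT.
have se := sol e01; have hc := hBc e01 tT.
have cpsi := sol_slice se t0; have cVpsi := sol_Vslice cV se t0.
have hB2 l : om l ^+ 2 * cmodulus (sol_coef a b (psi eps) l t) <= Bc.
  by apply: (Hbound_point (m := 2)); apply: Hbound_mono hc.
have hf := fconv_bound m0 mp hBV hc (sol_conv ab cV se t0 hB2).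
have d1 := dftn_error ab N0 oN m3 cVpsi hf.
have d2 := dftn_error ab N0 oN m3 cpsi hc.
have w0 l : l \in S -> 0 <= om l by move=> _; exact: om_ge0.
pose dp k := dftn a b N (fun j => psi eps (grid a b N j) t) k.
rewrite (@eq_nrm _ _ _ _ _ (fun l => - (dftn a b N (fun j => (V (grid a b N j))%:C * psi eps (grid a b N j) t) l - pot_coef a b V (psi eps) l t)
   + mv S (fun l k => v (l - k)) (fun k => dp k - sol_coef a b (psi eps) k t) l)); last first.
  move=> l _; rewrite mvB.
  have -> : dftn a b N (fun j => (V (grid a b N j))%:C * psi eps (grid a b N j) t) l = mv S (fun l k => v (l - k)) dp l.
    by rewrite dftn_product.
  by ring.
rewrite /Ceta mulrDl; apply: nrmDle => //; first by rewrite nrmN.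
apply: (@le_trans _ _ (Cv * nrm S om (fun k => dp k - sol_coef a b (psi eps) k t))).
  apply: le_trans (modes_H1_bound m0 N0 oN pot_dft_rep pot_dft_bound _ m1).
  exact: nrm_kernel.
by rewrite -mulrA ler_wpM2l.
Qed.

Section one_step_size.
Context (alpha nu3 tau0 tau : R) (alpha01 : 0 < alpha < 1) (nu0 : 0 < nu3) (tau001 : 0 < tau0 < 1).
Context (cond : step_condition_i a b alpha tau0 tau \/ step_condition_ii a b m alpha nu3 tau0 tau).
Local Notation A := (fun l => freq a b l ^+ 2).
Local Notation Cg := (gam_const alpha nu3).
Local Notation step_const := (step_const alpha nu3).
Let Cg0 : 0 <= Cg. Proof. exact: gam_const_ge0. Qed.
Let C40 : 0 <= C4 Cv Cc Bc Bf T Cg. Proof. exact: C4_ge0. Qed.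

(** Pairs with equal eigenvalues get 0 as well: there [phi_step] equals tau and there is nothing to
    cancel, while [gamma_step] would divide by 0. *)
Definition gam_mx (l k : int) : R :=
  if [|| high tau0 l, high tau0 k | A l - A k == 0] then 0 else gamma_step tau (A l - A k).

Let tau_gt0 : 0 < tau. Proof. by case: cond => [[]|[]]. Qed.

Let AE l k : A l - A k = mu1 ^+ 2 * (l ^+ 2 - k ^+ 2)%:~R.
Proof. by rewrite /= [freq a b l]freqE [freq a b k]freqE intrB !rmorphXn /=; ring. Qed.

Let lowE l k : ~~ high tau0 l -> ~~ high tau0 k -> A l - A k != 0 -> lowK tau0 (l ^+ 2 - k ^+ 2).
Proof.
rewrite /high -!leNgt => hl hk d0; split.
  rewrite normr_gt0; apply: contra d0 => /eqP e; by rewrite AE e mulr0.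
have c0 := Ncut_ge0 tau001.
have sq z : `|z| <= Ncut tau0 -> 0 <= z ^+ 2 <= Ncut tau0 ^+ 2.
  move=> hz; rewrite sqr_ge0/= -[z ^+ 2]real_normK ?num_real//.
  by apply: lerXn2r; rewrite ?nnegrE.
have /andP[l1 l2] := sq l hl; have /andP[k1 k2] := sq k hk.
exact: norm_sub_le.
Qed.

Lemma gam_mx_bound l k : l \in S -> k \in S ->
  om l * `|gam_mx l k| <= (Cgam a b alpha nu3 * tau) * om (rep N (l - k)) ^+ m * om k ^+ m.-1.
Proof.
move=> lS kS; rewrite /gam_mx; case: ifPn => [_|].
  rewrite normr0 mulr0 !mulr_ge0 ?omX_ge0 ?(ltW tau_gt0)//.
  exact: Cgam_ge0.
rewrite !negb_or => /and3P[hl hk d0]; have lk := lowE hl hk d0.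
have o1 := om_conv_le m0 N0 oN lS kS.
have o2 := delta_le m0 N0 oN pot_dft_bound lS kS.
rewrite -!freqE in o2.
rewrite AE in o2 d0 *.
by have [] := gamma_bound ab alpha01 nu0 tau001 m3 (erefl mu1) m0 cond lk
  (om_ge1 m0 _) (om_ge1 m0 _) (om_ge0 m0 _) o1 o2.
Qed.

Lemma gam_mx_cancel l k : l \in S -> k \in S -> ~~ (high tau0 l || high tau0 k) ->
  phi_step tau (A l - A k) - tau = 2 * tau * sin (tau * (A l - A k) / 2) * gam_mx l k.
Proof.
move=> lS kS; rewrite negb_or => /andP[hl hk]; rewrite /gam_mx (negbTE hl) (negbTE hk)/=.
have [d0|d0] := eqVneq (A l - A k) 0; first by rewrite /phi_step d0 eqxx subrr mulr0.
have lk := lowE hl hk d0.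
have o1 := om_conv_le m0 N0 oN lS kS.
have o2 := delta_le m0 N0 oN pot_dft_bound lS kS.
rewrite -!freqE in o2; rewrite AE in o2 d0 *.
have [s0 _] := gamma_bound ab alpha01 nu0 tau001 m3 (erefl mu1) m0 cond lk
  (om_ge1 m0 _) (om_ge1 m0 _) (om_ge0 m0 _) o1 o2.
exact: gamma_step_cancel.
Qed.

Lemma gam_mx_kernel x : N2 S (fun l => om l * \sum_(k <- S) `|gam_mx l k| * cmodulus (v (l - k)) * cmodulus (x k)) <=
  Cg * tau * nrm S wm x.
Proof.
have c0 : 0 <= Cgam a b alpha nu3 * tau by apply: mulr_ge0; [exact: Cgam_ge0|exact: ltW].
have := modes_kernel_bound m0 N0 oN pot_dft_rep pot_dft_bound x mp c0
  (fun l k _ _ => normr_ge0 (gam_mx l k)) gam_mx_bound.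
by rewrite (_ : Cg * tau = Cgam a b alpha nu3 * tau * (Bv * C0)) // /gam_const; ring.
Qed.

Lemma fourier_error (eps rho : R) (n : nat) : 0 < eps <= 1 -> 0 <= rho -> n%:R <= T / eps / tau ->
  (forall t : R, 0 <= t <= T / eps -> high_remainder N tau0 (fun k => sol_coef a b (psi eps) k t) <= rho) ->
  nrm S om (fun l => sol_coef a b (psi eps) l (n%:R * tau) - dft a b (tsfp a b N eps tau V psi0 n) l) <=
   expR (CE Cv T * T) * (kp * Bc * h1 + Cg * Bc * (eps * tau ^+ 2)
     + C4 Cv Cc Bc Bf T Cg * T * (Ceta * h1 + eps * tau ^+ 2 + rho)) + Cg * Bc * (eps * tau ^+ 2).
Proof.
move=> e01 rho0 nT hrho; have /andP[e0 e1] := e01; have se := sol e01.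
have ntT : n%:R * tau <= T / eps by rewrite -ler_pdivlMr.
have sub (t : R) : 0 <= t <= n%:R * tau -> 0 <= t <= T / eps.
  by move=> /andP[-> h2]/=; exact: le_trans ntT.
have := @nrm_splitting_error R int S om wm A (fun l k => v (l - k)) (pot_mx a b N V)
  Cv Cc Bc Bf T Cv0 Cc0 Bc0 Bf0 (ltW T0) _ _ _ _ _ _ _ eps tau (Ceta * h1) rho Cg
  (sol_coef a b (psi eps)) (pot_coef a b V (psi eps)) gam_mx (fun l k => high tau0 l || high tau0 k)
  n (fun n => dft a b (tsfp a b N eps tau V psi0 n)) e0 e1 tau_gt0 _ _ rho0 Cg0 _ _ _ _ _ gam_mx_kernel _ gam_mx_cancel _ _ n (leqnn n).
move=> H; have {}H := H (fun l _ => om_ge0 m0 l).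
have {}H := H (fun l _ => ltac:(by rewrite -[leLHS]expr1; apply: omX_mono => //)).
have {}H := H (fun u => modes_H1_bound m0 N0 oN pot_dft_rep pot_dft_bound u m1).
have {}H := H (fun u => modes_kernel_bound m0 N0 oN pot_dft_rep pot_dft_bound u mp (ler0n R 2)
  (fun l k _ _ => normr_ge0 _) delta_kernel).
have {}H := H (fun u l lS => pot_mx0 ab N0 oN V u lS).
have {}H := H (fun th l k lS kS => is_cderive_pot_mx ab N0 oN V th lS kS).
have {}H := H (pot_mx_le1 a b N0 V).
have {}H := H (ltac:(by rewrite mulrC -ler_pdivlMr)).
have {}H := H (mulr_ge0 Ceta0 h10).
have {}H := H (fun l _ => sol_ccont ab se l (n%:R * tau)).
have {}H := H (fun l t _ ht => ltac:(by have /andP[t0 _] := ht; have := sol_derive ab cV se l t0; rewrite -mulNr)).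
have {}H := H (fun t ht => hBc e01 (sub t ht) (uniq_modes N)).
have {}H := H (fun t ht => pot_coef_bound e01 (sub t ht) (uniq_modes N)).
have {}H := H (fun t ht => conv_defect e01 (sub t ht)).
have {}H := H (fun l k _ _ hl => ltac:(by rewrite /gam_mx orbA hl)).
have {}H := H (fun t ht => hrho t (sub t ht)).
have {}H := H (fun k l lS => dft_tsfp_step ab N0 oN V eps tau psi0 k lS).
apply: (le_trans H); rewrite lerD2r ler_wpM2l ?expR_ge0// lerD2r lerD2r.
have t00 : 0 <= (0 : R) <= T / eps by rewrite lexx divr_ge0 ?(ltW T0) ?(ltW e0).
have d2 := dftn_error ab N0 oN m3 (sol_slice se (lexx 0)) (hBc e01 t00).
rewrite (@eq_nrm_cmod _ _ _ _ _ (fun l => dftn a b N (fun j => psi eps (grid a b N j) 0) l - sol_coef a b (psi eps) l 0)); first exact: d2.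
move=> l _; rewrite cmodBC; congr (cmodulus (_ - _)).
rewrite dft_tsfp0; apply: eq_dftn => j jN.
have [_ _ _ _ hi] := se; rewrite hi//; apply: grid_in => //; exact: ltnW.
Qed.

Lemma fc_tsfp_error eps n l : 0 < eps <= 1 ->
  fc (tsfp_error a b V psi0 psi eps tau N n) l = sol_coef a b (psi eps) l (n%:R * tau) -
    (if l \in S then dft a b (tsfp a b N eps tau V psi0 n) l else 0).
Proof.
move=> e01; have nt0 : 0 <= n%:R * tau by apply: mulr_ge0 => //; exact: ltW.
rewrite -(fc_trig_interp ab (tsfp a b N eps tau V psi0 n)) -fcB//; last exact: cintegrable_trig_interp.
by apply: cintegrable_cont; exact: (sol_slice (sol e01)).
Qed.

Lemma om_tail l : l \notin S -> om l <= h1 * om l ^+ m.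
Proof.
move=> lS; have Np : 0 < (N%:R : R) by rewrite ltr0n.
have x0 : 0 < mu1 * N%:R / 2 by exact: (divr_gt0 (mulr_gt0 m0 Np) (ltr0n R 2)).
have xl : mu1 * N%:R / 2 <= om l.
  have := notin_modes oN lS.
  rewrite -(ler_int R) intrM intr_norm -!pmulrn => h.
  rewrite /om -mulrA; apply: (@le_trans _ _ (mu1 * `|l%:~R|)); last by rewrite lerDr.
  by rewrite ler_pM2l// ler_pdivrMr// mulrC.
apply: (@le_trans _ _ ((mu1 * N%:R / 2) ^+ 1 / (mu1 * N%:R / 2) ^+ m * om l ^+ m)); last first.
  by apply: ler_wpM2r; [exact: omX_ge0|exact: mesh_pow].
exact: tail_pow.
Qed.

Lemma tsfp_Hnorm (eps rho : R) (n : nat) : 0 < eps <= 1 -> 0 <= rho -> n%:R <= T / eps / tau ->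
  (forall t : R, 0 <= t <= T / eps -> high_remainder N tau0 (fun k => sol_coef a b (psi eps) k t) <= rho) ->
  (Hnorm a b 1 (tsfp_error a b V psi0 psi eps tau N n) <=
    (step_const * (h1 + eps * tau ^+ 2 + rho))%:E)%E.
Proof.
move=> e01 rho0 nT hrho; have /andP[e0 e1] := e01.
have H := fourier_error e01 rho0 nT hrho.
have x2 : 0 <= eps * tau ^+ 2 by apply: mulr_ge0; [exact: ltW|exact: sqr_ge0].
apply: Hbound_Hnorm => //.
  by apply: mulr_ge0; [exact: (step_const_ge0 alpha01 nu0)|exact: addr_ge0 (addr_ge0 h10 x2) rho0].
move=> s us; have w0 l : l \in s -> 0 <= om l ^+ 1 by move=> _; exact: omX_ge0.
have tT : 0 <= n%:R * tau <= T / eps.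
  by rewrite mulr_ge0 ?(ltW tau_gt0)//= -ler_pdivlMr.
pose c l := sol_coef a b (psi eps) l (n%:R * tau).
pose u l := dft a b (tsfp a b N eps tau V psi0 n) l.
(* On the modes this is the error in Fourier space; off the modes the interpolant has no coefficient
   and the tail of the exact solution is left. *)
rewrite (@eq_nrm _ _ _ _ _ (fun l => (if l \in S then c l - u l else 0) + (if l \in S then 0 else c l))); last first.
  by move=> l _; rewrite fc_tsfp_error//; case: ifP => _; rewrite ?addr0 ?subr0 ?add0r.
have nA : nrm s (fun l => om l ^+ 1) (fun l => if l \in S then c l - u l else 0) <= nrm S om (fun l => c l - u l).
  rewrite /nrm N2_leP ?N2_ge0// N2_sqr.
  rewrite (eq_bigr (fun l => if l \in S then (om l * cmodulus (c l - u l)) ^+ 2 else 0)); last first.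
    by move=> l _; rewrite expr1; case: ifP => // _; rewrite cmod0 mulr0 expr0n.
  rewrite -big_mkcond -big_filter; apply: ler_sum_subset.
  - by rewrite filter_uniq.
  - by move=> l; rewrite mem_filter => /andP[].
  - by move=> l _; exact: sqr_ge0.
have nB : nrm s (fun l => om l ^+ 1) (fun l => if l \in S then 0 else c l) <= Bc * h1.
  apply: (@le_trans _ _ (N2 s (fun l => h1 * (om l ^+ m * cmodulus (c l))))).
    apply: N2_le => l ls; rewrite ger0_norm ?mulr_ge0 ?w0 ?cmod_ge0// expr1.
    case: ifPn => lS; first by rewrite cmod0 mulr0 !mulr_ge0 ?omX_ge0 ?cmod_ge0.
    by rewrite mulrA ler_wpM2r ?cmod_ge0//; exact: om_tail.
  rewrite N2_scale ger0_norm// mulrC ler_wpM2r//.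
  exact: (hBc e01 tT us).
apply: (le_trans (nrmDle w0 (le_trans nA H) nB)).
have x0 := mulr_ge0 kp0 Bc0; have x1 := mulr_ge0 Cg0 Bc0.
have x4 := mulr_ge0 C40 (ltW T0).
have X0 : 0 <= h1 + eps * tau ^+ 2 + rho by exact: addr_ge0 (addr_ge0 h10 x2) rho0.
exact: error_arith.
Qed.

End one_step_size.

End grid_size.

(** The bound [rho] on the untreated pairs stays a parameter and C depends on neither [rho] nor
    [tau0]. Both claims of the theorem follow by inserting their own estimate of the remainder. *)
Theorem scheme_error (alpha nu3 : R) : 0 < alpha < 1 -> 0 < nu3 ->
  exists C : R, 0 < C /\ forall tau0 rho : R, 0 < tau0 < 1 -> 0 <= rho ->
    (forall (eps : R) (N : nat) (t : R), 0 < eps <= 1 -> (0 < N)%N -> ~~ odd N -> 0 <= t <= T / eps ->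
      high_remainder N tau0 (fun k => sol_coef a b (psi eps) k t) <= rho) ->
    tsfp_error_bound a b m T V psi0 psi alpha nu3 tau0 C rho.
Proof.
move=> al01 nu0.
exists (step_const alpha nu3 + 1); split.
  by rewrite ltr_wpDl// step_const_ge0.
move=> tau0 rho t01 rho0 hrho eps tau N n e01 N0 oN cond nT.
have H := tsfp_Hnorm N0 oN al01 nu0 t01 cond e01 rho0 nT (fun t tT => hrho eps N t e01 N0 oN tT).
apply: (le_trans H); rewrite lee_fin; apply: ler_wpM2r; last by rewrite lerDl.
have /andP[e0 _] := e01; have h0 : 0 <= mesh a b N ^+ (m - 1).
  by apply: exprn_ge0; rewrite /mesh divr_ge0// subr_ge0 ltW.
by rewrite !addr_ge0// mulr_ge0 ?sqr_ge0// ltW.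
Qed.

End scheme_error.

Section remainder.
Context {R : realType} (a b : R) (ab : a < b).
Local Notation mu1 := (freq a b 1).
Local Notation fc := (fourier_coef a b).
Context (V : R -> R) (cV : ccont (fun x => (V x)%:C) a b).

Let m0 : 0 < mu1. Proof. exact: mu_gt0. Qed.

(** The constant of [high_pairs_bound] with m = p + 1 and Y = mu1 / tau0, from which the power
    tau0^p has been taken out. *)
Definition remainder_const (p : nat) (BV Bc : R) : R :=
  2 ^+ p.+3 * C0 mu1 * ((3 * (1 + mu1^-1) ^+ p.+1 + 1) * BV) * Bc / mu1 ^+ p.

Lemma remainder_const_ge0 p (BV Bc : R) : 0 <= BV -> 0 <= Bc -> 0 <= remainder_const p BV Bc.
Proof.
move=> BV0 Bc0; have i0 : 0 <= 1 + mu1^-1 by apply: addr_ge0 => //; rewrite invr_ge0 ltW.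
apply: divr_ge0; last exact: exprn_ge0 (ltW m0).
have h2 : 0 <= 2 ^+ p.+3 :> R by exact: exprn_ge0.
have h3 : 0 <= 3 * (1 + mu1^-1) ^+ p.+1 + 1 by exact: (addr_ge0 (mulr_ge0 (ler0n R 3) (exprn_ge0 _ i0)) ler01).
exact: (mulr_ge0 (mulr_ge0 (mulr_ge0 h2 (C0_ge0 m0)) (mulr_ge0 h3 BV0)) Bc0).
Qed.

Lemma high_remainder_le p (BV Bc : R) N (tau0 : R) (c : int -> R[i]) : (1 < p)%N ->
  Hbound mu1 p.+1 (fc (fun x => (V x)%:C)) BV -> Hbound mu1 p.+1 c Bc ->
  (0 < N)%N -> ~~ odd N -> 0 < tau0 < 1 ->
  high_remainder a b V N tau0 c <= remainder_const p BV Bc * tau0 ^+ p.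
Proof.
move=> p1 hV hc N0 oN t01; have /andP[t0 t1] := t01.
have Y0 : 0 < mu1 / tau0 by exact: divr_gt0.
have hY l : high tau0 l -> mu1 / tau0 <= om mu1 l.
  rewrite /high => hl; apply: (@le_trans _ _ (mu1 * `|l%:~R|)); last by rewrite /om lerDr.
  rewrite ler_pM2l//; have := Ncut_ge tau0; rewrite div1r => h; apply: (le_trans h).
  by rewrite -intr_norm ler_int ltW.
have p3 : (2 < p.+1)%N by [].
apply: (le_trans (high_pairs_bound m0 N0 oN (pot_dft_rep ab V N0) (pot_dft_bound ab p3 cV hV N0 oN)
  (ltnW p3) Y0 hY (hc _ (uniq_modes N)))).
rewrite le_eqVlt; apply/orP; left; apply/eqP; rewrite /remainder_const /=.
by rewrite -[RHS]mulrA; congr (_ * _); rewrite expr_div_n invfM invrK.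
Qed.

End remainder.

Lemma error_bound_scale (R : realType) (a b : R) m (T : R) V psi0 psi (alpha nu3 tau0 C r K : R) :
  a < b -> 0 <= C -> 0 <= r -> 1 <= K -> 
  tsfp_error_bound a b m T V psi0 psi alpha nu3 tau0 C (K * r) ->
  tsfp_error_bound a b m T V psi0 psi alpha nu3 tau0 (C * K) r.
Proof.
move=> ab C0 r0 K1 h eps tau N n e01 N0 oN cond nT.
apply: (le_trans (h eps tau N n e01 N0 oN cond nT)); rewrite lee_fin -mulrA ler_wpM2l//.
have /andP[e0 _] := e01; have h0 : 0 <= mesh a b N ^+ (m - 1).
  by apply: exprn_ge0; rewrite /mesh divr_ge0// subr_ge0 ltW.
have e2 : 0 <= eps * tau ^+ 2 by rewrite mulr_ge0 ?sqr_ge0// ltW.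
rewrite !mulrDr lerD2r; apply: lerD; exact: ler_peMl.
Qed.

Section part_one.
Context {R : realType} (a b : R) (m : nat) (T : R) (V : R -> R)
    (psi0 : R -> R[i]) (psi : R -> R -> R -> R[i])
    (ab : a < b) (hm : (3 <= m)%N) (hT : 0 < T)
    (hV : Hper a b (maxn m 5) (fun x => (V x)%:C))
    (hpsi : forall eps : R, 0 < eps <= 1 ->
       exact_solution a b eps V psi0 (psi eps))
    (hbound : LinfH_uniformly_bounded a b T m psi).
Local Notation mu1 := (freq a b 1).
Local Notation fc := (fourier_coef a b).

Lemma potential_cont : ccont (fun x => (V x)%:C) a b.
Proof. by apply: (Hper_cont _ hV).1; rewrite leq_max orbT. Qed.

Lemma potential_Hbound : exists BV : R, Hbound mu1 m (fc (fun x => (V x)%:C)) BV.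
Proof.
have [B hB] := Hper_Hbound ab hV; exists B; apply: Hbound_mono hB; first exact: mu_gt0.
by rewrite leq_max leqnn.
Qed.

Lemma solution_Hbound : exists Bc : R, forall eps t : R, 0 < eps <= 1 -> 0 <= t <= T / eps ->
  Hbound mu1 m (fun l => sol_coef a b (psi eps) l t) Bc.
Proof.
have [M hM] := hbound; exists (2 ^+ m * M) => eps t e01 tT.
have /andP[e0 _] := e01.
exact: (sol_Hbound ab (hpsi e01) e0 hT (hM eps e01) tT).
Qed.

Lemma part_one (alpha nu3 : R) : 0 < alpha < 1 -> 0 < nu3 ->
     exists C : R, 0 < C /\
       forall tau0 : R, 0 < tau0 < 1 ->
         tsfp_error_bound a b m T V psi0 psi alpha nu3 tau0 C (tau0 ^+ (m - 1)).
Proof.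
move=> al01 nu0; have [BV hBV] := potential_Hbound; have [Bc hBc] := solution_Hbound.
have cV := potential_cont.
have [C [C0 hC]] := scheme_error ab hm hT cV hpsi hBV hBc al01 nu0.
have BV0 : 0 <= BV := Hbound_ge0 hBV.
have Bc0 : 0 <= Bc.
  have e : 0 < (1 : R) <= 1 by rewrite ltr01 lexx.
  by apply: (Hbound_ge0 (hBc 1 0 e _)); rewrite lexx divr_ge0// ltW.
pose K := remainder_const a b (m - 1) BV Bc + 1.
have K0 := remainder_const_ge0 ab (m - 1) BV0 Bc0.
exists (C * K); split; first by rewrite mulr_gt0// ltr_wpDl.
move=> tau0 t01; have /andP[t0 _] := t01.
have tp : 0 <= tau0 ^+ (m - 1) by rewrite exprn_ge0// ltW.
apply: error_bound_scale => //; [exact: ltW|by rewrite lerDr|].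
apply: hC => //; first by rewrite mulr_ge0// addr_ge0.
move=> eps N t e01 N0 oN tT.
have p1 : (1 < m - 1)%N by rewrite ltn_subRL.
have pm : (m - 1).+1 = m by rewrite subn1 prednK// (leq_trans _ hm).
apply: (le_trans (@high_remainder_le _ _ _ ab _ cV (m - 1) BV Bc N tau0 _ p1 _ _ N0 oN t01)).
- by rewrite pm.
- by rewrite pm; exact: hBc.
by rewrite ler_wpM2r// lerDl.
Qed.

End part_one.

(** * Observability of the free evolution *)

Section almost_periodic.
Context {R : realType}.
Local Notation ci := ((0 +i* 1)%C : R[i]).

Lemma mean_value_cmod (f df : R -> R[i]) (g dg : R -> R) (a b : R) : a <= b ->
  ccont f a b -> (forall t, a < t < b -> is_cderive f t (df t)) ->
  (forall t, is_derive t (1 : R) g (dg t)) ->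
  (forall t, a < t < b -> cmodulus (df t) <= dg t) ->
  cmodulus (f b - f a) <= g b - g a.
Proof.
move=> ab cf hf hg hd.
have N1 (z : R[i]) : N2 [:: 0%N] (fun=> 1 * cmodulus z) = cmodulus z.
  by rewrite /N2 big_seq1 mul1r sqrtr_sqr ger0_norm ?cmod_ge0.
have := @mean_value_N2 R nat [:: 0%N] (fun=> 1) (fun _ => f) (fun _ => df) g dg a b ab.
rewrite N1; apply => //.
- by move=> l t _; exact: hf.
- exact: is_derive_within_cont hg.
- by move=> t /hd; rewrite N1.
Qed.

Lemma second_difference (f f1 f2 : R -> R[i]) (t0 h eta : R) : 0 < h ->
  (forall t, is_cderive f t (f1 t)) -> (forall t, is_cderive f1 t (f2 t)) ->
  (forall t, `|t - t0| <= h -> cmodulus (f2 t) <= eta) ->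
  cmodulus (f (t0 + h) + f (t0 - h) - 2 * f t0) <= eta * h ^+ 2.
Proof.
move=> h0 d1 d2 hb; have hh := ltW h0.
pose g t := f (t0 + t) + f (t0 - t).
pose g1 t := f1 (t0 + t) - f1 (t0 - t).
have dm (F dF : R -> R[i]) t : (forall t, is_cderive F t (dF t)) -> is_cderive (fun t => F (t0 - t)) t (- dF (t0 - t)).
  move=> dFt; have h1 := is_cderive_shift (f := fun t => F (- t)) (r := - t0) (t := t) (d := - dF (t0 - t)).
  have : is_cderive (fun t => F (- (- t0 + t))) t (- dF (t0 - t)).
    apply: (is_cderive_shift (f := fun t => F (- t))).
    have h2 := is_cderive_scale (f := F) (r := -1) (t := - t0 + t).
    apply: (is_cderive_ext (h2 _ (dFt _))) => [y|]; first by rewrite mulN1r.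
    by rewrite mulN1r opprD opprK; apply: complex_eq; rewrite ?cReM ?cImM ?cReN ?cImN /=; ring.
  by move=> hm; apply: (is_cderive_ext hm) => // y; rewrite opprD opprK.
have dg t : is_cderive g t (g1 t).
  apply: is_cderiveD; first exact: is_cderive_shift.
  exact: dm.
have dg1 t : is_cderive g1 t (f2 (t0 + t) + f2 (t0 - t)).
  have := is_cderiveB (is_cderive_shift (d2 (t0 + t))) (dm _ _ t d2) => hm.
  by apply: (is_cderive_ext hm) => //; rewrite opprK.
have g1b t : 0 <= t <= h -> cmodulus (g1 t) <= 2 * eta * t.
  move=> /andP[t0' th].
  have := @mean_value_cmod g1 (fun t => f2 (t0 + t) + f2 (t0 - t)) (fun t => 2 * eta * t + 0) (fun=> 2 * eta) 0 t t0'.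
  have -> : g1 0 = 0 by rewrite /g1 addr0 subr0 subrr.
  rewrite subr0 !addr0 mulr0 subr0; apply.
  - exact: (@is_cderive_ccont R g1 _ 0 t dg1).
  - by move=> s _; exact: dg1.
  - by move=> s; exact: is_derive_affine.
  move=> s /andP[s0 st]; apply: (le_trans (cmodD _ _)).
  have b1 := hb (t0 + s) (ltac:(by rewrite addrAC subrr add0r ger0_norm ?(ltW s0)// (le_trans (ltW st)))).
  have b2 := hb (t0 - s) (ltac:(by rewrite addrAC subrr add0r normrN ger0_norm ?(ltW s0)// (le_trans (ltW st)))).
  lra.
have := @mean_value_cmod g g1 (fun t => eta * t ^+ 2) (fun t => 2 * eta * t) 0 h hh.
rewrite expr0n /= mulr0 subr0.
have -> : g h - g 0 = f (t0 + h) + f (t0 - h) - 2 * f t0 by rewrite /g addr0 subr0; ring.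
apply.
- exact: (@is_cderive_ccont R g _ 0 h dg).
- by move=> s _; exact: dg.
- move=> s; have id1 := is_derive_id s (1 : R).
  apply: (is_derive_ext (is_deriveZ eta (is_deriveM id1 id1))) => //.
  transitivity (eta * (s * 1 + s * 1)) => //; by ring.
- by move=> s /andP[s0 sh]; apply: g1b; rewrite !ltW.
Qed.

(** After division by the p-th exponential, a_p is the constant term. The sum is integrated twice in
    closed form, so a second difference with step h turns a_p into a_p h^2, while every other term
    is bounded with a gain (nu_n - nu_p)^-2. *)
Lemma coefficient_bound (s : seq nat) (nu : nat -> R) (a : nat -> R[i]) (t0 h eta : R) p :
  uniq s -> p \in s -> 0 < h -> (forall n, n \in s -> n != p -> nu n != nu p) ->
  (forall t : R, `|t - t0| <= h -> cmodulus (\sum_(n <- s) a n * expi (- (nu n * t))) <= eta) ->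
  cmodulus (a p) <= eta + 4 / h ^+ 2 * \sum_(n <- s | n != p) cmodulus (a n) / (nu n - nu p) ^+ 2.
Proof.
move=> us ps h0 hnu hS.
pose xi n := nu p - nu n.
pose s' := [seq n <- s | n != p].
have xi0 n : n \in s' -> xi n != 0.
  by rewrite mem_filter => /andP[np /hnu /(_ np)]; rewrite subr_eq0 eq_sym.
pose F t : R[i] := a p * ((t ^+ 2 / 2)%:C) - \sum_(n <- s') (a n * ((xi n ^+ 2)^-1)%:C) * expi (xi n * t).
pose F1 t : R[i] := a p * t%:C - \sum_(n <- s') (a n * ((xi n)^-1)%:C * ci) * expi (xi n * t).
pose F2 t : R[i] := a p + \sum_(n <- s') a n * expi (xi n * t).
have dE (x t : R) : is_cderive (fun t => expi (x * t)) t (ci * x%:C * expi (x * t)).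
  have h1 : is_derive t (1 : R) (fun t => x * t) x.
    by apply: (is_derive_ext (is_derive_affine x 0 t)) => // y; rewrite addr0.
  by apply: (is_cderive_ext (is_cderive_expi h1)) => //; rewrite imE.
have dF t : is_cderive F t (F1 t).
  apply: is_cderiveB.
    apply: is_cderiveMl; apply: (is_cderive_real (g := fun t => t ^+ 2 / 2)).
    have id1 := is_derive_id t (1 : R).
    apply: (is_derive_ext (is_deriveZ (2^-1) (is_deriveM id1 id1))) => [y|].
      by transitivity (2^-1 * (y * y)) => //; rewrite mulrC -expr2.
    transitivity (2^-1 * (t * 1 + t * 1)) => //; by field.
  have hs := is_cderive_sum (s := s') (F := fun n t => (a n * ((xi n ^+ 2)^-1)%:C) * expi (xi n * t))
    (fun n _ => is_cderiveMl _ (dE (xi n) t)).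
  apply: (is_cderive_ext hs) => //; apply: eq_big_seq => n ns.
  rewrite !mulrA; congr (_ * _); rewrite -[LHS]mulrA [ci * _]mulrC mulrA; congr (_ * _).
  rewrite -mulrA -rmorphM /=; congr (_ * _%:C); field; exact: xi0.
have dF1 t : is_cderive F1 t (F2 t).
  have -> : F2 t = a p * 1%:C - \sum_(n <- s') (a n * ((xi n)^-1)%:C * ci) * (ci * (xi n)%:C * expi (xi n * t)).
    rewrite mulr1 /F2; congr (_ + _); rewrite -sumrN; apply: eq_big_seq => n ns.
    rewrite !mulrA -mulNr; congr (_ * _).
    have -> : a n * ((xi n)^-1)%:C * ci * ci * (xi n)%:C = (ci * ci) * (a n * (((xi n)^-1)%:C * (xi n)%:C)) by ring.
    by rewrite cisqr -rmorphM /= mulVf ?xi0// mulr1 mulN1r opprK.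
  apply: is_cderiveB.
    by apply: is_cderiveMl; apply: is_cderive_real; exact: is_derive_id.
  exact: (is_cderive_sum (s := s') (fun n _ => is_cderiveMl _ (dE (xi n) t))).
have F2b t : `|t - t0| <= h -> cmodulus (F2 t) <= eta.
  move=> /hS; congr (_ <= _).
  have -> : F2 t = expi (nu p * t) * \sum_(n <- s) a n * expi (- (nu n * t)).
    rewrite mulr_sumr (bigD1_seq p)//= mulrCA -expiD subrr expi0 mulr1; congr (_ + _).
    rewrite big_filter; apply: eq_bigr => n _; rewrite mulrCA -expiD; congr (_ * expi _).
    by rewrite /xi; ring.
  by rewrite cmodM cmod_expi mul1r.
have := second_difference h0 dF dF1 F2b.
have -> : F (t0 + h) + F (t0 - h) - 2 * F t0 = a p * (h ^+ 2)%:C -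
   \sum_(n <- s') (a n * ((xi n ^+ 2)^-1)%:C) * (expi (xi n * (t0 + h)) + expi (xi n * (t0 - h)) - 2 * expi (xi n * t0)).
  rewrite /F.
  have -> : \sum_(n <- s') (a n * ((xi n ^+ 2)^-1)%:C) * (expi (xi n * (t0 + h)) + expi (xi n * (t0 - h)) - 2 * expi (xi n * t0)) =
    \sum_(n <- s') (a n * ((xi n ^+ 2)^-1)%:C) * expi (xi n * (t0 + h)) + \sum_(n <- s') (a n * ((xi n ^+ 2)^-1)%:C) * expi (xi n * (t0 - h))
    - 2 * \sum_(n <- s') (a n * ((xi n ^+ 2)^-1)%:C) * expi (xi n * t0).
    by rewrite mulr_sumr -big_split -sumrB; apply: eq_bigr => n _ /=; ring.
  have -> : (h ^+ 2)%:C = ((t0 + h) ^+ 2 / 2)%:C + ((t0 - h) ^+ 2 / 2)%:C - 2 * (t0 ^+ 2 / 2)%:C :> R[i].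
    by apply: complex_eq; rewrite ?cReD ?cImD ?cReN ?cImN ?cReM ?cImM /=; [field|ring].
  by ring.
move=> hk.
have h20 : 0 < h ^+ 2 by rewrite exprn_gt0.
have tail : cmodulus (\sum_(n <- s') (a n * ((xi n ^+ 2)^-1)%:C) * (expi (xi n * (t0 + h)) + expi (xi n * (t0 - h)) - 2 * expi (xi n * t0)))
   <= 4 * \sum_(n <- s | n != p) cmodulus (a n) / (nu n - nu p) ^+ 2.
  apply: (le_trans (cmod_sum _ _ _)); rewrite big_filter mulr_sumr; apply: ler_sum => n np.
  rewrite cmodM mulrC; apply: ler_pM; rewrite ?cmod_ge0//.
    apply: (le_trans (cmodB _ _)); rewrite cmodM !cmod_expi mulr1.
    have := cmodD (expi (xi n * (t0 + h))) (expi (xi n * (t0 - h))); rewrite !cmod_expi.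
    have -> : cmodulus (2 : R[i]) = 2.
      by rewrite (_ : 2 = (2 : R)%:C) ?cmodR ?ger0_norm// rmorph_nat.
    by move=> ?; lra.
  rewrite cmodM cmodR ger0_norm ?invr_ge0 ?sqr_ge0//.
  by rewrite (_ : xi n ^+ 2 = (nu n - nu p) ^+ 2)// /xi -sqrrN opprB.
have e1 : cmodulus (a p) * h ^+ 2 <= eta * h ^+ 2 + 4 * \sum_(n <- s | n != p) cmodulus (a n) / (nu n - nu p) ^+ 2.
  have -> : cmodulus (a p) * h ^+ 2 = cmodulus (a p * (h ^+ 2)%:C) by rewrite cmodM cmodR ger0_norm ?sqr_ge0.
  set X := a p * _ in hk *; set Y := \sum_(n <- s') _ in hk tail.
  have -> : X = (X - Y) + Y by rewrite subrK.
  by apply: (le_trans (cmodD _ _)); apply: lerD.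
move: e1; set S := \sum_(n <- s | n != p) _ => e1.
have -> : eta + 4 / h ^+ 2 * S = (eta * h ^+ 2 + 4 * S) / h ^+ 2 by field; rewrite gt_eqF.
by rewrite ler_pdivlMr.
Qed.

Lemma seq_max (s : seq nat) (F : nat -> R) : s != [::] -> exists2 p, p \in s & forall n, n \in s -> F n <= F p.
Proof.
elim: s => // x s ih _; have [->|sn] := eqVneq s [::].
  by exists x; rewrite ?mem_head// => n; rewrite inE => /eqP ->.
have [p ps hp] := ih sn; have [le|lt] := leP (F x) (F p).
  exists p; first by rewrite inE ps orbT.
  by move=> n; rewrite inE => /orP[/eqP ->//|/hp].
exists x; first by rewrite mem_head.
move=> n; rewrite inE => /orP[/eqP ->//|/hp h]; exact: le_trans h (ltW lt).
Qed.

(** [coefficient_bound] is applied to the coefficient of largest modulus: by the gap condition the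
    other terms amount to at most half of it and are absorbed. *)
Lemma ingham_gap (s : seq nat) (nu : nat -> R) (a : nat -> R[i]) (t0 h eta : R) :
  uniq s -> 0 < h -> (forall n p, n \in s -> p \in s -> n != p -> nu n != nu p) ->
  (forall p, p \in s -> 4 / h ^+ 2 * \sum_(n <- s | n != p) ((nu n - nu p) ^+ 2)^-1 <= 1 / 2) ->
  (forall t : R, `|t - t0| <= h -> cmodulus (\sum_(n <- s) a n * expi (- (nu n * t))) <= eta) ->
  forall p, p \in s -> cmodulus (a p) <= 2 * eta.
Proof.
move=> us h0 hnu gap hS p ps.
have sn : s != [::] by apply: contraTneq ps => ->.
have [q qs hq] := seq_max (fun n => cmodulus (a n)) sn.
apply: (le_trans (hq p ps)).
have h1 := coefficient_bound us qs h0 (fun n ns nq => hnu n q ns qs nq) hS.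
have h20 : 0 < h ^+ 2 by rewrite exprn_gt0.
have : 4 / h ^+ 2 * \sum_(n <- s | n != q) cmodulus (a n) / (nu n - nu q) ^+ 2 <= cmodulus (a q) * (1 / 2).
  apply: le_trans (ler_wpM2l (cmod_ge0 (a q)) (gap q qs)).
  rewrite mulrCA ler_wpM2l ?divr_ge0 ?(ltW h20)// mulr_sumr big_seq_cond [leRHS]big_seq_cond.
  by apply: ler_sum => n /andP[ns _]; rewrite ler_wpM2r ?invr_ge0 ?sqr_ge0// hq.
lra.
Qed.

(** The difference f(t + h) - e^(-i nu_q h) f(t) annihilates mode q and multiplies the others by
    known factors. Each costs a factor 2 in the bound and a time h. *)
Lemma kill_modes (s : seq nat) (nu : nat -> R) (a : nat -> R[i]) (Q : seq nat) (h t0 r eta : R) :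
  0 <= h -> (forall t : R, t0 <= t <= t0 + r -> cmodulus (\sum_(n <- s) a n * expi (- (nu n * t))) <= eta) ->
  forall t : R, t0 <= t <= t0 + r - (size Q)%:R * h ->
    cmodulus (\sum_(n <- s) (a n * \prod_(q <- Q) (expi (- (nu n * h)) - expi (- (nu q * h)))) * expi (- (nu n * t))) <= 2 ^+ size Q * eta.
Proof.
move=> h0 hS; elim: Q => [|q Q ih] t /andP[t1 t2].
  rewrite mul1r; have := hS t; rewrite t1 => /(_ _); rewrite (_ : t <= t0 + r); last by move: t2; rewrite /= mul0r subr0.
  move=> /(_ isT); congr (cmodulus _ <= _); apply: eq_bigr => n _; by rewrite big_nil mulr1.
pose P n := \prod_(q0 <- Q) (expi (- (nu n * h)) - expi (- (nu q0 * h))).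
have {}ih x : t0 <= x <= t0 + r - (size Q)%:R * h ->
    cmodulus (\sum_(n <- s) (a n * P n) * expi (- (nu n * x))) <= 2 ^+ size Q * eta by exact: ih.
have e1 := ih t; have e2 := ih (t + h).
have -> : \sum_(n <- s) (a n * \prod_(q0 <- q :: Q) (expi (- (nu n * h)) - expi (- (nu q0 * h)))) * expi (- (nu n * t)) =
  \sum_(n <- s) (a n * P n) * expi (- (nu n * (t + h))) - expi (- (nu q * h)) * \sum_(n <- s) (a n * P n) * expi (- (nu n * t)).
  rewrite mulr_sumr -sumrB; apply: eq_bigr => n _; rewrite big_cons -/(P n).
  have -> : expi (- (nu n * (t + h))) = expi (- (nu n * h)) * expi (- (nu n * t)) :> R[i].
    by rewrite -expiD; congr expi; ring.
  by ring.
move: t2; rewrite /= -natr1 mulrDl mul1r => t2.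
apply: (le_trans (cmodB _ _)); rewrite cmodM cmod_expi mul1r exprS.
have q0 : 0 <= (size Q)%:R * h by rewrite mulr_ge0.
have := e1 (ltac:(apply/andP; split; lra)); have := e2 (ltac:(apply/andP; split; lra)).
by move=> *; lra.
Qed.

Lemma sum_inv_sqr_gap (s : seq nat) p : uniq s ->
  \sum_(n <- s | n != p) ((n%:R - p%:R) ^+ 2 : R)^-1 <= 12.
Proof.
move=> us; rewrite -big_filter; set s' := [seq _ <- s | _].
have us' : uniq [seq n%:Z - p%:Z | n <- s'].
  by rewrite map_inj_uniq ?filter_uniq// => x y; lia.
have := @sum_om R 1 ltr01 _ us'; rewrite big_map divr1 => h3.
(* For d >= 1 one has 1 + d <= 2 d, which costs 4; the sum of (1 + |q|)^-2 is at most 3. *)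
apply: (@le_trans _ _ (\sum_(n <- s') 4 * om (1 : R) (n%:Z - p%:Z) ^- 2)); last first.
  by rewrite -mulr_sumr; lra.
rewrite big_seq [leRHS]big_seq; apply: ler_sum => n; rewrite mem_filter => /andP[np _].
have -> : (n%:R - p%:R : R) ^+ 2 = `|(n%:Z - p%:Z)%:~R| ^+ 2.
  by rewrite real_normK ?num_real// intrB.
rewrite /om mul1r; set d := `|_|.
have d1 : 1 <= d.
  rewrite /d -intr_norm -[1]/(1%:~R) ler_int; lia.
rewrite -[leLHS]mul1r -[4]/(4%:R) ler_pdivrMr; last by rewrite exprn_gt0// (lt_le_trans ltr01).
rewrite mulrAC ler_pdivlMr ?mul1r; last by rewrite exprn_gt0//; lra.
nra.
Qed.

Lemma square_modes_gap (c : R) (N1 n p : nat) : 0 < c -> (0 < N1)%N ->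
  (N1 <= n + p)%N -> n != p ->
  0 < (c * N1%:R) ^+ 2 * (n%:R - p%:R) ^+ 2 <= (c * n%:R ^+ 2 - c * p%:R ^+ 2) ^+ 2.
Proof.
move=> c0 N0 Nnp np; have N0' : 0 < N1%:R :> R by rewrite ltr0n.
have d0 : 0 < (n%:R - p%:R : R) ^+ 2.
  by rewrite lt_neqAle sqr_ge0 andbT eq_sym sqrf_eq0 subr_eq0 eqr_nat.
rewrite mulr_gt0//=; last by rewrite exprn_gt0// mulr_gt0.
have -> : c * n%:R ^+ 2 - c * p%:R ^+ 2 = c * (n%:R + p%:R) * (n%:R - p%:R) by ring.
rewrite [leRHS]exprMn ler_wpM2r ?(ltW d0)// !exprMn ler_wpM2l ?sqr_ge0//.
by rewrite -natrD -!natrX ler_nat leq_exp2r.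
Qed.

Lemma square_modes_gap_sum (c : R) (N1 : nat) (s : seq nat) p : 0 < c -> (0 < N1)%N -> uniq s ->
  (forall n, n \in s -> n != p -> (N1 <= n + p)%N) ->
  \sum_(n <- s | n != p) ((c * n%:R ^+ 2 - c * p%:R ^+ 2) ^+ 2)^-1 <= ((c * N1%:R) ^+ 2)^-1 * 12.
Proof.
move=> c0 N0 us hs.
have i0 : 0 <= ((c * N1%:R) ^+ 2)^-1 by rewrite invr_ge0 sqr_ge0.
apply: le_trans (ler_wpM2l i0 (sum_inv_sqr_gap p us)).
rewrite mulr_sumr big_seq_cond [leRHS]big_seq_cond; apply: ler_sum => n /andP[ns np].
have /andP[dn ge] := square_modes_gap c0 N0 (hs n ns np) np.
rewrite -invfM lef_pV2; [exact: ge|rewrite posrE; exact: (lt_le_trans dn ge)|rewrite posrE; exact: dn].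
Qed.

(* Ingham-type observability: only one coefficient is bounded, so the finitely
   many modes that violate the gap condition can be killed by differences. *)
Lemma ingham (mu r : R) (n0 : nat) : 0 < mu -> 0 < r ->
  exists2 C : R, 0 <= C & forall (M : nat) (a : nat -> R[i]) (t0 eta : R), (n0 <= M)%N ->
    (forall t : R, t0 <= t <= t0 + r ->
       cmodulus (\sum_(n <- iota 0 M.+1) a n * expi (- ((mu ^+ 2 * n%:R ^+ 2) * t))) <= eta) ->
    cmodulus (a n0) <= C * eta.
Proof.
move=> m0 r0; pose nu n : R := mu ^+ 2 * n%:R ^+ 2.
have r40 : 0 < r / 4 by rewrite divr_gt0.
have m20 : 0 < mu ^+ 2 by rewrite exprn_gt0.
pose G : R := 4 / (r / 4) ^+ 2 * (12 / (mu ^+ 2) ^+ 2).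
have G0 : 0 <= G by rewrite mulr_ge0 ?divr_ge0 ?sqr_ge0.
(* The modes below N1 other than n0 will be killed. Of two distinct remaining modes one is at least
   N1, so their time frequencies differ by at least mu^2 N1 |n - p|, and 2 G <= N1^2 makes the gap
   sum at most 1/2. *)
pose N1 := maxn n0.+1 (Num.bound (2 * G)).
have N1n : (n0 < N1)%N by rewrite leq_max leqnn.
have N1r : 1 <= N1%:R :> R by rewrite -[1]/(1%:R) ler_nat; exact: leq_trans N1n.
have N1G : 2 * G <= N1%:R ^+ 2.
  have := archi_boundP (normr_ge0 (2 * G)); rewrite (ger0_norm (mulr_ge0 (ler0n _ 2) G0)) => hb.
  apply: (@le_trans _ _ (N1%:R)); last by rewrite expr2 ler_peMl// (le_trans ler01).
  by apply: (le_trans (ltW hb)); rewrite ler_nat leq_maxr.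
pose Q := [seq q <- iota 0 N1 | q != n0].
have sQ : (size Q)%:R <= N1%:R :> R by rewrite ler_nat size_filter; apply: leq_trans (count_size _ _) _; rewrite size_iota.
(* At most N1 differences use at most half of the time r. Moreover all phases nu_q h with q < N1 lie
   in [0, 1], so differences of phases stay below 2 pi and the factor left on mode n0 is nonzero. *)
pose h := Num.min (r / 2 / N1%:R) (1 / (mu ^+ 2 * N1%:R ^+ 2)).
have h0 : 0 < h by rewrite lt_min !divr_gt0 ?mulr_gt0 ?exprn_gt0//; lra.
have hN : N1%:R * h <= r / 2.
  by rewrite mulrC -ler_pdivlMr ?ge_min ?lexx//; lra.
have hnu : mu ^+ 2 * N1%:R ^+ 2 * h <= 1.
  rewrite mulrC -ler_pdivlMr ?ge_min ?lexx ?orbT// mulr_gt0// exprn_gt0//; lra.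
pose P n := \prod_(q <- Q) (expi (- (nu n * h)) - expi (- (nu q * h))) : R[i].
have P0 : P n0 != 0.
  rewrite /P prodf_seq_neq0; apply/allP => q; rewrite mem_filter mem_iota add0n => /andP[qn /= qN].
  have -> : expi (- (nu n0 * h)) - expi (- (nu q * h)) =
     expi (- (nu q * h)) * (expi ((nu q - nu n0) * h) - 1) :> R[i].
    by rewrite mulrBr mulr1 -expiD; congr (expi _ - _); ring.
  rewrite mulf_neq0//.
    by apply: contraTneq (oner_neq0 R) => e; rewrite -(cmod_expi (- (nu q * h))) e cmod0 eqxx.
  rewrite subr_eq0; apply: expi_neq1; apply/andP; split.
    rewrite normr_gt0 mulf_neq0 ?(gt_eqF h0)// /nu -mulrBr mulf_neq0 ?(gt_eqF m20)//.
    by rewrite subr_eq0 -!natrX eqr_nat eqn_sqr.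
  have nb n : (n < N1)%N -> 0 <= nu n * h <= 1.
    move=> nN; apply/andP; split.
      by exact: (mulr_ge0 (mulr_ge0 (sqr_ge0 _) (sqr_ge0 _)) (ltW h0)).
    apply: le_trans hnu; rewrite /nu.
    by rewrite ler_wpM2r ?(ltW h0)// ler_wpM2l ?sqr_ge0// -!natrX ler_nat leq_exp2r// ltnW.
  have /andP[a1 a2] := nb q qN; have /andP[b1 b2] := nb n0 N1n.
  rewrite mulrBl; apply: (@le_lt_trans _ _ 1); first by rewrite ler_norml; apply/andP; split; lra.
  by have := pi_ge2 R; lra.
exists (2 * 2 ^+ size Q / cmodulus (P n0)).
  by rewrite divr_ge0 ?cmod_ge0// mulr_ge0// exprn_ge0.
move=> M a t0 eta nM hS.
pose s := iota 0 M.+1; pose s' := [seq n <- s | n \notin Q].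
have us' : uniq s' by rewrite filter_uniq ?iota_uniq.
have s'P n : n \in s' -> n = n0 \/ (N1 <= n)%N.
  rewrite mem_filter mem_filter mem_iota add0n /= negb_and negbK => /andP[+ _].
  by move=> /orP[/eqP ->|]; [left|rewrite -leqNgt; right].
have PQ n : n \in Q -> P n = 0.
  by move=> nQ; rewrite /P (big_rem n)//= subrr mul0r.
have Np : (0 < N1)%N by exact: leq_trans N1n.
have sumN n p : n \in s' -> p \in s' -> n != p -> (N1 <= n + p)%N.
  move=> /s'P hn /s'P hp np.
  case: hn hp np => [->|h1] [->|h2] => [|_|_|_]; first by rewrite eqxx.
  - exact: leq_trans h2 (leq_addl _ _).
  - exact: leq_trans h1 (leq_addr _ _).
  - exact: leq_trans h1 (leq_addr _ _).
have gapS : 4 / (r / 4) ^+ 2 * (((mu ^+ 2 * N1%:R) ^+ 2)^-1 * 12) <= 1 / 2.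
  have -> : 4 / (r / 4) ^+ 2 * (((mu ^+ 2 * N1%:R) ^+ 2)^-1 * 12) = G / N1%:R ^+ 2.
    by rewrite /G; field; rewrite !gt_eqF//=; lra.
  rewrite ler_pdivrMr ?exprn_gt0//; lra.
have fourr : 0 <= 4 / (r / 4) ^+ 2 by rewrite divr_ge0 ?sqr_ge0.
have key : cmodulus (a n0 * P n0) <= 2 * (2 ^+ size Q * eta).
  apply: (@ingham_gap s' nu (fun n => a n * P n) (t0 + r / 4) (r / 4) _ us' r40).
  - move=> n p ns ps np; have /andP[h1] := square_modes_gap m20 Np (sumN n p ns ps np) np.
    move=> /(lt_le_trans h1) h2; apply/eqP => e; move: h2.
    by rewrite -/(nu n) e subrr expr0n /= ltxx.
  - move=> p ps; apply: le_trans gapS; apply: (ler_wpM2l fourr).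
    by apply: square_modes_gap_sum => // n ns np; exact: sumN.
  - move=> t; rewrite ler_norml => /andP[t1 t2].
    have := @kill_modes s nu a Q h t0 r eta (ltW h0) hS t (ltac:(apply/andP; split; [lra|])).
    have qh : (size Q)%:R * h <= r / 2 by apply: le_trans hN; rewrite ler_wpM2r ?(ltW h0).
    move=> /(_ (ltac:(lra))); congr (cmodulus _ <= _).
    rewrite big_filter [RHS]big_mkcond; apply: eq_bigr => n _.
    by case: ifP => // /negbFE /PQ; rewrite /P => ->; rewrite mulr0 mul0r.
  - by rewrite mem_filter mem_iota add0n ltnS nM andbT mem_filter eqxx.
have Pp : 0 < cmodulus (P n0).
  by rewrite lt_neqAle cmod_ge0 andbT eq_sym; apply: contra P0 => /eqP /cmod_eq0 ->.
rewrite mulrAC ler_pdivlMr// -cmodM; apply: (le_trans key).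
by rewrite mulrA.
Qed.

End almost_periodic.

(** * Rapid decay forced by a two-term recurrence *)

Section recurrence.
Context {R : realType} (mu : R) (mu0 : 0 < mu).
Local Notation om := (om mu).

Definition rapid (v : int -> R[i]) : Prop :=
  forall p : nat, exists C : R, forall l, om l ^+ p * cmodulus (v l) <= C.

(** The recurrence is solved for v_j in terms of v_(j+2n), with a multiplier of modulus at most 1.
    Iterating towards infinity, where v tends to 0, leaves a sum of rapidly decaying terms. For j >=
    0 the weights grow along the iteration; negative j follow by the conjugation symmetry. *)
Let rapid_of_recurrence (v : int -> R[i]) (n : nat) (al be : R[i]) (B : R) : (0 < n)%N -> al != 0 ->
  cmodulus be <= cmodulus al -> (forall j, v (- j) = conjc (v j)) ->
  (forall l, om l * cmodulus (v l) <= B) ->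
  rapid (fun l => v (l - n%:Z) * al + v (l + n%:Z) * be) -> rapid v.
Proof.
move=> n0 al0 ba vc hB hr p; have [C hC] := hr p.+2.
have a0 : 0 < cmodulus al.
  by rewrite lt_neqAle cmod_ge0 andbT eq_sym; apply: contra al0 => /eqP /cmod_eq0 ->.
have C_ge0 : 0 <= C by apply: le_trans (hC 0); rewrite mulr_ge0 ?cmod_ge0 ?omX_ge0.
pose D := C / cmodulus al.
have D0 : 0 <= D by rewrite divr_ge0 ?cmod_ge0.
have step j : cmodulus (v j) <= cmodulus (v (j + (2 * n)%:Z)) + D * om (j + n%:Z) ^- p.+2.
  have := hC (j + n%:Z); rewrite addrK (_ : j + n%:Z + n%:Z = j + (2 * n)%:Z); last by lia.
  set z := v j * al + _ => hz; have o0 : 0 < om (j + n%:Z) ^+ p.+2 by rewrite exprn_gt0 ?om_gt0.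
  have : cmodulus (v j) * cmodulus al <= cmodulus z + cmodulus (v (j + (2 * n)%:Z)) * cmodulus al.
    rewrite -cmodM (_ : v j * al = z - v (j + (2 * n)%:Z) * be); last by rewrite /z addrK.
    apply: (le_trans (cmodB _ _)); rewrite lerD2l cmodM ler_wpM2l ?cmod_ge0//.
  move=> h; rewrite -(ler_pM2r a0) mulrDl; apply: (le_trans h); rewrite addrC lerD2l.
  rewrite /D mulrAC divfK ?gt_eqF// ler_pdivlMr// mulrC; exact: hz.
have chain j K : cmodulus (v j) <= cmodulus (v (j + (2 * n * K)%:Z)) +
    D * \sum_(i < K) om (j + (2 * n * i)%:Z + n%:Z) ^- p.+2.
  elim: K => [|K ih]; first by rewrite big_ord0 muln0 addr0 mulr0 addr0.
  rewrite big_ord_recr /= mulrDr addrA addrAC; apply: (le_trans ih); rewrite lerD2r.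
  apply: (le_trans (step _)); rewrite lerD2r.
  by rewrite (_ : j + _ + _ = j + (2 * n * K.+1)%:Z)//; lia.
have pos j : 0 <= j -> om j ^+ p * cmodulus (v j) <= D * C0 mu.
  move=> j0; apply/ler_addgt0Pr => e e0.
  (* So many iterations that the last term, of size B / om at distance at least K, weighs less than
     e. *)
  pose K := Num.bound (om j ^+ p * B / (e * mu)).
  have B0 : 0 <= B by apply: le_trans (hB 0); rewrite mulr_ge0 ?cmod_ge0 ?om_ge0.
  have oj := omX_ge0 mu0 j p.
  apply: (le_trans (ler_wpM2l oj (chain j K))); rewrite mulrDr addrC; apply: lerD.
    rewrite mulrCA ler_wpM2l// mulr_sumr.
    apply: (@le_trans _ _ (\sum_(l <- [seq j + (2 * n * i)%:Z + n%:Z | i <- iota 0 K]) om l ^- 2)); last first.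
      apply: (sum_om mu0); rewrite map_inj_uniq ?iota_uniq// => x y hxy.
      have : (2 * n * x = 2 * n * y)%N by lia.
      by move/eqP; rewrite eqn_pmul2l ?muln_gt0// => /eqP.
    rewrite big_map -(big_mkord xpredT (fun i => om j ^+ p * om (j + (2 * n * i)%:Z + n%:Z) ^- p.+2)).
    rewrite /index_iota subn0; apply: ler_sum => i _; set x := _ + n%:Z.
    have jx : om j <= om x by apply: om_le => //; rewrite /x; lia.
    have ox := om_gt0 mu0 x.
    rewrite -addn2 exprD invfM mulrA ler_piMl ?invr_ge0 ?omX_ge0//.
    by rewrite ler_pdivrMr ?exprn_gt0// mul1r lerXn2r ?nnegrE ?om_ge0.
  set x := j + _; have ox := om_gt0 mu0 x.
  have Kx : mu * K%:R <= om x.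
    apply: (@le_trans _ _ (mu * `|x%:~R|)); last by rewrite lerDr.
    rewrite ler_wpM2l ?(ltW mu0)// -intr_norm [K%:R]pmulrn ler_int /x.
    have : (K <= 2 * n * K)%N by rewrite leq_pmull// muln_gt0.
    by lia.
  have := archi_boundP (normr_ge0 (om j ^+ p * B / (e * mu))); rewrite ger0_norm; last first.
    by rewrite divr_ge0 ?mulr_ge0 ?(ltW e0) ?(ltW mu0).
  rewrite -/K ltr_pdivrMr ?mulr_gt0// => hK.
  have h1 : cmodulus (v x) <= B / om x by rewrite ler_pdivlMr// mulrC.
  apply: (le_trans (ler_wpM2l oj h1)); rewrite mulrA ler_pdivrMr//; apply: (le_trans (ltW hK)).
  by rewrite mulrCA ler_wpM2l ?(ltW e0)// mulrC.
exists (D * C0 mu) => j; have [j0|j0] := leP 0 j; first exact: pos.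
have := pos (- j); rewrite oppr_ge0 => /(_ (ltW j0)).
rewrite vc (om_absE mu (normrN j)) (_ : cmodulus (conjc (v j)) = cmodulus (v j))//.
by rewrite !cmodE /=; case: (v j) => x y /=; rewrite sqrrN.
Qed.

(** If the coefficient [be] dominates, the reflection l -> - l exchanges the two coefficients. For n
    = 0 there is only one term and one divides by it. *)
Lemma recurrence_rapid (v : int -> R[i]) (n : nat) (al be : R[i]) (B : R) :
  al != 0 \/ be != 0 -> (n = 0%N -> be = 0) -> (forall j, v (- j) = conjc (v j)) ->
  (forall l, om l * cmodulus (v l) <= B) ->
  rapid (fun l => v (l - n%:Z) * al + v (l + n%:Z) * be) -> rapid v.
Proof.
move=> hab hn vc hB hr.
have opp (u : int -> R[i]) : rapid u -> rapid (fun l => u (- l)).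
  by move=> hu p; have [C hC] := hu p; exists C => l; have := hC (- l); rewrite (om_absE mu (normrN l)).
have [n0|n0] := posnP n.
  move: hr; rewrite n0 (hn n0) => hr p; have [C hC] := hr p; case: hab => [al0|]; last by rewrite hn ?eqxx.
  have a0 : 0 < cmodulus al.
    by rewrite lt_neqAle cmod_ge0 andbT eq_sym; apply: contra al0 => /eqP /cmod_eq0 ->.
  exists (C / cmodulus al) => l; rewrite ler_pdivlMr// -mulrA -cmodM.
  by have := hC l; rewrite subr0 mulr0 addr0.
have [ba|/ltW ba] := leP (cmodulus be) (cmodulus al).
  apply: (rapid_of_recurrence n0 _ ba vc hB hr).
  case: hab => // be0; apply: contra be0 => /eqP a0; move: ba; rewrite a0 cmod0 => h.
  by apply/eqP; apply: cmod_eq0; apply/eqP; rewrite eq_le h cmod_ge0.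
have be0 : be != 0.
  case: hab => // al0; apply: contra al0 => /eqP a0; move: ba; rewrite a0 cmod0 => h.
  by apply/eqP; apply: cmod_eq0; apply/eqP; rewrite eq_le h cmod_ge0.
pose u l := v (- l).
have : rapid u; last by move/opp => h p; have [C hC] := h p; exists C => l; have := hC l; rewrite /u opprK.
apply: (rapid_of_recurrence (B := B) n0 be0 ba).
- by move=> j; rewrite /u vc.
- by move=> l; have := hB (- l); rewrite (om_absE mu (normrN l)).
- move=> p; have [C hC] := opp _ hr p; exists C => l; have := hC l; rewrite /u addrC.
  by rewrite opprB opprD [n%:Z - l]addrC.
Qed.

End recurrence.

(** * Extrapolation to vanishing coupling *)

HB.instance Definition _ (R : realType) :=
  Pointed.copy (R * R)%type ((R * R)%type : pointedType).

(** Componentwise completeness; it makes the plane a space to which Baire's theorem applies. *)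
Lemma complete_plane (R : realType) (F : set_system (R * R)) : ProperFilter F -> cauchy F -> cvg F.
Proof.
move=> FF /cauchyP cF.
have c1 : cauchy (fst @ F).
  apply/cauchyP => e /cF [x Fx]; exists x.1; rewrite /fmap /=; apply: (@filterS _ F _ (ball x e)) Fx => y [h _]; exact: h.
have c2 : cauchy (snd @ F).
  apply/cauchyP => e /cF [x Fx]; exists x.2; rewrite /fmap /=; apply: (@filterS _ F _ (ball x e)) Fx => y [_ h]; exact: h.
have /cvg_ex[/= l1 hl1] : cvg (fst @ F) by exact: R_complete.
have /cvg_ex[/= l2 hl2] : cvg (snd @ F) by exact: R_complete.
apply/cvg_ex; exists (l1, l2) => A [[/= P Q] [Pl1 Ql2] PQA].
have FP : F (fst @^-1` P) := hl1 _ Pl1; have FQ : F (snd @^-1` Q) := hl2 _ Ql2.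
have FI : F (fst @^-1` P `&` snd @^-1` Q) by exact: filterI.
by apply: (@filterS _ F _ _ A _ FI) => -[x y] [Px Qy]; apply: PQA; split.
Qed.

HB.instance Definition _ (R : realType) :=
  Uniform_isComplete.Build (R * R)%type (@complete_plane R).

Section baire.
Context {R : realType}.

(* The exceptional sets are completed by the complement of the rectangle so
   that Baire's theorem can be applied in the whole plane. *)
Lemma uniform_on_rectangle {I : Type} (F : I -> R -> R -> R) (x0 x1 y0 y1 : R) :
  x0 < x1 -> y0 < y1 ->
  (forall l x y, x0 <= x <= x1 -> y0 <= y <= y1 -> forall e : R, 0 < e -> exists2 d : R, 0 < d &
     forall x' y' : R, x0 <= x' <= x1 -> y0 <= y' <= y1 -> `|x' - x| < d -> `|y' - y| < d ->
     `|F l x' y' - F l x y| < e) ->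
  (forall x y, x0 <= x <= x1 -> y0 <= y <= y1 -> exists K, forall l, F l x y <= K) ->
  exists x2 x3 y2 y3 K : R, [/\ x0 <= x2, x2 < x3, x3 <= x1, y0 <= y2 & y2 < y3 /\ y3 <= y1 /\
     (forall x y l, x2 <= x <= x3 -> y2 <= y <= y3 -> F l x y <= K)].
Proof.
move=> x01 y01 cF pF.
pose rect (p : R * R) := (x0 <= p.1 <= x1) && (y0 <= p.2 <= y1).
pose D (n : nat) : set (R * R) := [set p | rect p -> exists l, n%:R < F l p.1 p.2].
have oD n : open (D n).
  rewrite openE => p Dp; have [rp|nrp] := boolP (rect p).
    have [l hl] := Dp rp; have /andP[p1 p2] := rp.
    have [d d0 hd] := cF l p.1 p.2 p1 p2 (F l p.1 p.2 - n%:R) (ltac:(by rewrite subr_gt0)).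
    exists (ball p.1 d, ball p.2 d); first by split; exact: nbhsx_ballx.
    move=> [x y] [/= bx by_] /andP[/= rx ry]; exists l.
    have := hd x y rx ry; rewrite distrC => /(_ bx); rewrite distrC => /(_ by_).
    by rewrite /= ltr_norml => /andP[h _]; lra.
  have : open (~` [set p | rect p]).
    apply: closed_openC.
    have -> : [set p | rect p] = (@fst R R) @^-1` `[x0, x1] `&` (@snd R R) @^-1` `[y0, y1].
      by apply/seteqP; split=> q /=; rewrite !in_itv/= /rect => /andP.
    apply: closedI; apply: closed_comp; try exact: itv_closed.
    - by move=> q _; exact: cvg_fst.
    - by move=> q _; exact: cvg_snd.
  rewrite openE => /(_ p (negP nrp)); apply: filterS => q /= nq rq; by case: nq.
have [n nD] : exists n, ~ dense (D n).
  apply: contrapT => /forallNP dD.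
  have := @Baire R ((R * R)%type : completeNormedModType R) D (fun n => conj (oD n) (contrapT (dD n))).
  pose U : set (R * R) := `]x0, x1[%classic `*` `]y0, y1[%classic.
  have U0 : U !=set0.
    exists ((x0 + x1) / 2, (y0 + y1) / 2); split; rewrite /= in_itv/=; apply/andP; split; lra.
  have oU : open U.
    have -> : U = (@fst R R) @^-1` `]x0, x1[ `&` (@snd R R) @^-1` `]y0, y1[ by [].
    apply: openI; apply: open_comp; try exact: itv_open.
    - by move=> q _; exact: cvg_fst.
    - by move=> q _; exact: cvg_snd.
  move=> /(_ U U0 oU) [[x y] [[/= hx hy]]] hD.
  move: hx hy; rewrite !in_itv/= => /andP[hx1 hx2] /andP[hy1 hy2].
  have rx : x0 <= x <= x1 by rewrite !ltW.
  have ry : y0 <= y <= y1 by rewrite !ltW.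
  have [K hK] := pF x y rx ry.
  have := archi_boundP (normr_ge0 K); set m := Num.bound _ => hm.
  have [|l] := hD m Logic.I; first by rewrite /rect /= rx ry.
  by have := hK l; have := ler_norm K; move: hm => /=; lra.
move: nD => /existsNP[U /not_implyP[[p Up] /not_implyP[oU /set0P/negP/negPn/eqP UD]]].
have UR q : U q -> rect q /\ forall l, F l q.1 q.2 <= n%:R.
  move=> Uq; have nD : ~ D n q by move=> Dq; have : (U `&` D n) q by []; rewrite UD.
  move: nD => /not_implyP[rq /forallNP hq]; split=> // l; rewrite leNgt; exact/negP.
have /nbhs_ballP[d /= d0 hd] : nbhs p U by exact: open_nbhs_nbhs.
have inU x y : p.1 - d / 2 <= x <= p.1 + d / 2 -> p.2 - d / 2 <= y <= p.2 + d / 2 -> U (x, y).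
  move=> /andP[h1 h2] /andP[h3 h4]; apply: hd; split; rewrite /ball /= ltr_norml; apply/andP; split; lra.
exists (p.1 - d / 2), (p.1 + d / 2), (p.2 - d / 2), (p.2 + d / 2), n%:R.
have [] := UR _ (inU (p.1 - d / 2) (p.2 - d / 2) (ltac:(apply/andP; split; lra)) (ltac:(apply/andP; split; lra))).
move=> /andP[/= /andP[a1 a2] /andP[a3 a4]] _.
have [] := UR _ (inU (p.1 + d / 2) (p.2 + d / 2) (ltac:(apply/andP; split; lra)) (ltac:(apply/andP; split; lra))).
move=> /andP[/= /andP[b1 b2] /andP[b3 b4]] _.
split => //; first lra; split; first lra; split => // x y l hx hy.
exact: (UR _ (inU x y hx hy)).2.
Qed.

End baire.

(** * Weights of divided differences *)

Section divided_differences.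
Context {R : realType}.

(** The n-th forward difference of step s. Going from n to n + 1, the weights are shifted and
    subtracted: their total mass at most doubles, and by the binomial formula the degree of the
    polynomial tested drops by one. *)
Lemma difference_weights (s : R) n : exists w : nat -> R, \sum_(i < n.+1) `|w i| <= 2 ^+ n /\
  forall j u, (j <= n)%N -> \sum_(i < n.+1) w i * (u + i%:R * s) ^+ j = (j == n)%:R * (n`!%:R * s ^+ n).
Proof.
elim: n => [|n [w [w1 w2]]].
  exists (fun=> 1); split; first by rewrite big_ord1 normr1 expr0.
  by move=> j u; rewrite leqn0 => /eqP ->; rewrite big_ord1 !expr0 fact0 eqxx !mulr1.
exists (fun i => (if i is k.+1 then w k else 0) - (if (i <= n)%N then w i else 0)).
have split (X : nat -> R) (N : R -> R) : N 0 = 0 ->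
    \sum_(i < n.+2) N (if (i : nat) is k.+1 then w k else 0) * X i = \sum_(k < n.+1) N (w k) * X k.+1
    /\ \sum_(i < n.+2) N (if (i <= n)%N then w i else 0) * X i = \sum_(k < n.+1) N (w k) * X k.
  move=> N0; split; first by rewrite big_ord_recl /= N0 mul0r add0r.
  rewrite big_ord_recr /= ltnn N0 mul0r addr0; apply: eq_bigr => i _; rewrite -ltnS ltn_ord //.
split.
  have [h1 h2] := split (fun=> 1) Num.norm (normr0 R).
  apply: (@le_trans _ _ (\sum_(i < n.+2) (`|if (i : nat) is k.+1 then w k else 0| * 1 + `|if (i <= n)%N then w i else 0| * 1))).
    by apply: ler_sum => i _; rewrite !mulr1; exact: ler_normB.
  rewrite big_split h1 h2 /= exprS; have -> : \sum_(k < n.+1) `|w k| * 1 = \sum_(k < n.+1) `|w k|.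
    by apply: eq_bigr => k _; rewrite mulr1.
  by move: w1; set S := \sum_(i < _) _; lra.
move=> j u jn.
have [h1 h2] := split (fun i => (u + i%:R * s) ^+ j) idfun erefl.
under eq_bigr do rewrite mulrBl.
rewrite sumrB h1 h2 -sumrB /= {split h1 h2}.
transitivity (\sum_(i < j) s ^+ i.+1 *+ 'C(j, i.+1) * \sum_(k < n.+1) w k * (u + k%:R * s) ^+ (j - i.+1)).
  under [RHS]eq_bigr do rewrite mulr_sumr.
  rewrite exchange_big /=; apply: eq_bigr => k _.
  have -> : u + k.+1%:R * s = (u + k%:R * s) + s by rewrite -natr1; ring.
  rewrite -mulrBr exprDn big_ord_recl subn0 expr0 mulr1 bin0 mulr1n addrAC subrr add0r mulr_sumr.
  apply: eq_bigr => i _; rewrite !lift0 -[in LHS]mulr_natr -[in RHS]mulr_natr; ring.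
transitivity (\sum_(i < j) s ^+ i.+1 *+ 'C(j, i.+1) * ((j - i.+1 == n)%N%:R * (n`!%:R * s ^+ n))).
  by apply: eq_bigr => i _; rewrite w2//; have := ltn_ord i; lia.
move: jn; rewrite leq_eqVlt => /predU1P[->|jn].
  rewrite big_ord_recl big1 ?addr0; last first.
    move=> i _; rewrite lift0 (_ : (n.+1 - i.+2 == n)%N = false) ?mul0r ?mulr0//; have := ltn_ord i; lia.
  rewrite subn1 /= !eqxx bin1 factS natrM !mul1r expr1 exprS -mulr_natr; ring.
rewrite (ltn_eqF jn) mul0r big1// => i _.
by rewrite (_ : (j - i.+1 == n)%N = false) ?mul0r ?mulr0//; have := ltn_ord i; lia.
Qed.

Lemma expn_fact_le (x : R) n : 0 <= x -> x ^+ n / n`!%:R <= expR x.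
Proof.
move=> x0; case: n => [|n]; first by rewrite fact0 divr1 expr0 -expR0 ler_expR.
by apply: le_trans (expR_ge1Dxn n x0); rewrite lerDr.
Qed.

(* These are divided differences at equidistant nodes. *)
Lemma interpolation_weights (u0 rho : R) n : 0 < rho -> (0 < n)%N ->
  exists la nd : nat -> R, [/\ forall i, (i < n.+1)%N -> u0 <= nd i <= u0 + rho,
    \sum_(i <- iota 0 n.+1) `|la i| <= (2 * expR 1 / rho) ^+ n &
    forall j, (j <= n)%N -> \sum_(i <- iota 0 n.+1) la i * nd i ^+ j = (j == n)%:R].
Proof.
move=> rho0 n0; have nR : 0 < n%:R :> R by rewrite ltr0n.
pose s := rho / n%:R; have s0 : 0 < s by rewrite divr_gt0.
have [w [w1 w2]] := difference_weights s n.
have f0 : 0 < n`!%:R :> R by rewrite ltr0n fact_gt0.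
have d0 : 0 < n`!%:R * s ^+ n by rewrite mulr_gt0// exprn_gt0.
have bs (F : nat -> R) : \sum_(i <- iota 0 n.+1) F i = \sum_(i < n.+1) F i.
  by rewrite -(big_mkord xpredT) /index_iota subn0.
exists (fun i => w i / (n`!%:R * s ^+ n)), (fun i => u0 + i%:R * s); split.
- move=> i; rewrite ltnS => iN; rewrite lerDl mulr_ge0 ?(ltW s0)//= lerD2l /s mulrCA ger_pMr//.
  by rewrite ler_pdivrMr// mul1r ler_nat.
- rewrite bs; under eq_bigr do rewrite normrM [`|_^-1|]ger0_norm ?invr_ge0 ?(ltW d0)//.
  rewrite -mulr_suml ler_pdivrMr//; apply: (le_trans w1).
  (* n^n <= e^n n! compensates the nodes being only rho / n apart, so the total weight grows
     geometrically in n and not factorially. *)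
  have h := expn_fact_le n (ler0n R n).
  have -> : (2 * expR 1 / rho) ^+ n * (n`!%:R * s ^+ n) = 2 ^+ n * (expR n%:R * n`!%:R / n%:R ^+ n).
    rewrite /s !exprMn !exprVn (_ : expR 1 ^+ n = expR n%:R); last by rewrite -expRM_natl mulr1.
    by field; rewrite !expf_neq0 ?gt_eqF.
  rewrite ler_peMr ?exprn_ge0// ler_pdivlMr ?exprn_gt0// mul1r.
  by move: h; rewrite ler_pdivrMr.
- move=> j jn; rewrite bs; under eq_bigr do rewrite mulrAC.
  by rewrite -mulr_suml w2// mulfK// gt_eqF.
Qed.

End divided_differences.

Lemma ccont_sub (R : realType) (f : R -> R[i]) (a b c d : R) : a <= c -> d <= b -> ccont f a b -> ccont f c d.
Proof.
move=> ac db [h1 h2]; have sub : `[c, d] `<=` `[a, b].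
  by move=> x /=; rewrite !in_itv/= => /andP[h3 h4]; rewrite (le_trans ac)// (le_trans h4).
by split; [move: h1|move: h2]; exact: continuous_subspaceW.
Qed.

Lemma is_derive_monomial (R : realType) (k r : R) n :
  is_derive r (1 : R) (fun r => k * r ^+ n.+1) (k * (n.+1%:R * r ^+ n)).
Proof.
apply: (is_derive_ext (is_deriveZ k (is_deriveX n.+1 (is_derive_id r (1 : R))))) => [y|].
  by transitivity (k * (id ^+ n.+1) y) => //; rewrite exprfctE.
by transitivity (k * ((n.+1%:R * r ^+ n) * 1)) => //; rewrite mulr1.
Qed.

(** * The hierarchy satisfied by divided differences of solutions in 1 / eps *)

Section extrapolation.
Context {R : realType} (mu : R) (mu0 : 0 < mu) (A : int -> R) (v c0 : int -> R[i]) (Bv M T U La : R)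
  (s : seq nat) (la nd : nat -> R) (n : nat) (c f : nat -> int -> R -> R[i]).
Hypotheses (n0 : (0 < n)%N) (T0 : 0 <= T) (us : uniq s) (hv : Hbound mu 3 v Bv)
  (hmom : forall j, (j <= n)%N -> \sum_(i <- s) la i * nd i ^+ j = (j == n)%:R)
  (hla : \sum_(i <- s) `|la i| <= La) (hnd : forall i, i \in s -> 1 <= nd i <= U) (U1 : 1 <= U) (M0 : 0 <= M)
  (hc : forall i (t : R), i \in s -> 0 <= t <= T -> Hbound mu 3 (c i ^~ t) M)
  (hf : forall i (t : R), i \in s -> 0 <= t <= T -> fconv v (c i ^~ t) (f i ^~ t))
  (ccont_c : forall i l, i \in s -> ccont (c i l) 0 T)
  (deriv_c : forall i l (t : R), i \in s -> 0 < t < T ->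
     is_cderive (c i l) t (- ((0 +i* 1)%C * (A l)%:C) * c i l t - (0 +i* 1)%C * ((nd i)^-1)%:C * f i l t))
  (hc0 : forall i l, i \in s -> c i l 0 = c0 l).
Local Notation ci := ((0 +i* 1)%C : R[i]).
Local Notation kap := (2 ^+ 4 * C0 mu * Bv).

(** [nd i] plays the role of 1 / eps_i. Multiplication by it cancels the coupling in the equation of
    the i-th solution, so up to the free flow the derivative of level j + 1 is driven by level j of
    the products. *)
Definition divdiff (g : nat -> int -> R -> R[i]) j l t : R[i] := \sum_(i <- s) (la i * nd i ^+ j)%:C * g i l t.
Definition free_flow l (t : R) : R[i] := expi (- (A l * t)) * c0 l.
Local Notation Z := (divdiff c).
Local Notation F := (divdiff f).
Let Y j l t := Z j l t - (j == n)%:R * free_flow l t.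

Let s0 : La >= 0. Proof. by apply: le_trans hla; apply: sumr_ge0. Qed.

Lemma expi_derive (x t : R) : is_cderive (fun t => expi (x * t)) t (ci * x%:C * expi (x * t)).
Proof.
have h1 : is_derive t (1 : R) (fun t => x * t) x.
  by apply: (is_derive_ext (is_derive_affine x 0 t)) => // y; rewrite addr0.
by apply: (is_cderive_ext (is_cderive_expi h1)) => //; rewrite imE.
Qed.

Lemma divdiff_ccont j l : ccont (fun t => expi (A l * t) * Z j l t) 0 T.
Proof.
apply: ccontM; first exact: (@is_cderive_ccont R _ _ 0 T (expi_derive (A l))).
by apply: ccont_sum => i si; apply: ccontM; [exact: ccont_cst|exact: ccont_c].
Qed.

Lemma divdiff_derive j l t : 0 < t < T ->
  is_cderive (fun t => expi (A l * t) * Z j.+1 l t) t (- (ci * expi (A l * t) * F j l t)).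
Proof.
move=> tT.
have hs := is_cderive_sum (s := s) (F := fun i t => (la i * nd i ^+ j.+1)%:C * c i l t)
  (fun i si => is_cderiveMl _ (deriv_c l si tT)).
apply: (is_cderive_ext (is_cderiveM (expi_derive (A l) t) hs)) => //.
rewrite /divdiff !mulr_sumr -big_split -sumrN; apply: eq_big_seq => i si /=.
have /andP[nd1 _] := hnd si; have nz : nd i != 0 by rewrite gt_eqF// (lt_le_trans ltr01).
have -> : (la i * nd i ^+ j)%:C = (la i * nd i ^+ j.+1)%:C * ((nd i)^-1)%:C :> R[i].
  by rewrite -rmorphM /= exprSr mulrA mulfK.
by ring.
Qed.

Lemma divdiff_conv j (t : R) : 0 <= t <= T -> fconv v (Z j ^~ t) (F j ^~ t).
Proof.
move=> tT l; have := clim_sum (s := s)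
  (F := fun i M => (la i * nd i ^+ j)%:C * \sum_(k <- win M) v (l - k) * c i k t)
  (z := fun i => (la i * nd i ^+ j)%:C * f i l t) (fun i si => climMl _ (hf si tT l)).
move=> h; apply: (clim_near (M1 := 0%N) h) => N _; rewrite /divdiff; under [RHS]eq_bigr do rewrite mulr_sumr.
rewrite exchange_big /=; apply: eq_bigr => i _; rewrite mulr_sumr; apply: eq_bigr => k _; by ring.
Qed.

Lemma divdiff_init j l : (j <= n)%N -> Z j l 0 = (j == n)%:R * c0 l.
Proof.
move=> jn; rewrite /divdiff (eq_big_seq (fun i => (la i * nd i ^+ j)%:C * c0 l)); last first.
  by move=> i si; rewrite hc0.
by rewrite -mulr_suml -rmorph_sum /= hmom// rmorph_nat.
Qed.

Lemma divdiff_point j l (t K : R) : 0 <= K -> (forall i, i \in s -> cmodulus (c i l t) <= K) ->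
  cmodulus (Z j l t) <= La * U ^+ j * K.
Proof.
move=> K0 hK; apply: (le_trans (cmod_sum _ _ _)).
apply: (@le_trans _ _ (\sum_(i <- s) `|la i| * (U ^+ j * K))).
  rewrite big_seq [leRHS]big_seq; apply: ler_sum => i si; have /andP[n1 nU] := hnd si.
  have ni : 0 <= nd i by apply: le_trans n1.
  rewrite cmodM cmodR normrM normrX (ger0_norm ni) -mulrA ler_wpM2l//.
  by apply: ler_pM; rewrite ?exprn_ge0 ?cmod_ge0 ?hK// lerXn2r ?nnegrE// (le_trans ni).
rewrite -mulr_suml -mulrA ler_wpM2r// mulr_ge0// exprn_ge0// (le_trans _ U1)//.
Qed.

Let Bv0 : 0 <= Bv. Proof. exact: Hbound_ge0 hv. Qed.
Let kap0 : 0 <= kap. Proof. by rewrite mulr_ge0// mulr_ge0 ?(C0_ge0 mu0)// exprn_ge0. Qed.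

Let Z0_bound (t : R) : 0 <= t <= T -> Hbound mu 3 (Z 0 ^~ t) (La * M).
Proof.
move=> tT q uq; rewrite /nrm.
apply: (@le_trans _ _ (N2 q (fun l => \sum_(i <- s) `|la i| * (om mu l ^+ 3 * cmodulus (c i l t))))).
  apply: N2_le => l _; rewrite (ger0_norm (mulr_ge0 (omX_ge0 mu0 l 3) (cmod_ge0 _))).
  apply: (le_trans (ler_wpM2l (omX_ge0 mu0 _ _) (cmod_sum _ _ _))); rewrite mulr_sumr.
  apply: ler_sum => i _; rewrite cmodM cmodR expr0 mulr1 le_eqVlt; apply/orP; left; apply/eqP; ring.
apply: (@le_trans _ _ (\sum_(i <- s) `|la i| * M)).
  apply: (@N2_sum _ _ _ q s (fun i l => `|la i| * (om mu l ^+ 3 * cmodulus (c i l t))) (fun i => `|la i| * M)) => i si.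
  by rewrite N2_scale normr_id ler_wpM2l//; exact: hc.
by rewrite -mulr_suml ler_wpM2r.
Qed.

(** For j < n the moments vanish and level j starts from 0; climbing the hierarchy by integration
    gains kap t / j at each level. Level n starts from c0, and subtracting the free flow keeps the
    same estimate. *)
Lemma divdiff_close j (t : R) : (j <= n)%N -> 0 <= t <= T ->
  Hbound mu 3 (Y j ^~ t) (La * M * (kap * t) ^+ j / j`!%:R).
Proof.
elim: j t => [|j ih] t jn tT.
  move=> q uq; rewrite expr0 fact0 divr1 mulr1.
  rewrite (@eq_nrm _ _ _ _ _ (Z 0 ^~ t)); first exact: Z0_bound.
  by move=> l _; rewrite /Y (ltn_eqF n0) mul0r subr0.
have /andP[t0 tT'] := tT.
have sub r : 0 < r < t -> 0 < r < T by move=> /andP[r0 rt]; rewrite r0 (lt_le_trans rt).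
have ZY r : 0 < r < t -> Hbound mu 3 (Z j ^~ r) (La * M * (kap * r) ^+ j / j`!%:R).
  move=> /sub /andP[r0 rT] q uq; rewrite (@eq_nrm _ _ _ _ _ (Y j ^~ r)); first by apply: ih; rewrite ?(ltnW jn)// !ltW.
  by move=> l _; rewrite /Y (ltn_eqF jn) mul0r subr0.
move=> q uq.
have dg r : is_derive r (1 : R) (fun r => (La * M * kap ^+ j.+1 / j.+1`!%:R) * r ^+ j.+1)
    (kap * (La * M * (kap * r) ^+ j / j`!%:R)).
  apply: (is_derive_ext (is_derive_monomial _ r j)) => //.
  move: (kap) => kp; rewrite exprMn factS natrM [kp ^+ j.+1]exprS; field.
  by rewrite !gt_eqF ?ltr0n ?fact_gt0.
have := @mean_value_N2 _ _ q (fun l => om mu l ^+ 3) (fun l r => expi (A l * r) * Z j.+1 l r)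
  (fun l r => - (ci * expi (A l * r) * F j l r)) _ _ 0 t t0 _ _ (is_derive_within_cont dg) (fun r _ => dg r) _.
rewrite expr0n /= mulr0 subr0.
have -> : La * M * kap ^+ j.+1 / j.+1`!%:R * t ^+ j.+1 = La * M * (kap * t) ^+ j.+1 / j.+1`!%:R.
  by rewrite [(_ * t) ^+ _]exprMn; set kj := _ ^+ j.+1; set tj := t ^+ _; set fj := _^-1; ring.
have -> : N2 q (fun l => om mu l ^+ 3 * cmodulus (expi (A l * t) * Z j.+1 l t - expi (A l * 0) * Z j.+1 l 0)) =
   nrm q (fun l => om mu l ^+ 3) (Y j.+1 ^~ t).
  rewrite /nrm; apply: eq_N2 => l _; congr (_ * _).
  rewrite mulr0 expi0 mul1r divdiff_init//.
  have -> : expi (A l * t) * Z j.+1 l t - (j.+1 == n)%:R * c0 l = expi (A l * t) * Y j.+1 l t.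
    rewrite /Y /free_flow mulrBr; congr (_ - _).
    by rewrite mulrCA [expi (A l * t) * _]mulrA expiNK mul1r.
  by rewrite cmodM cmod_expi mul1r.
apply.
- move=> l lq; exact: (ccont_sub (lexx 0) tT' (divdiff_ccont j.+1 l)).
- by move=> l r _ /sub; exact: divdiff_derive.
- move=> r rt; have /andP[r0 rT] := sub r rt; have rT' : 0 <= r <= T by rewrite !ltW.
  have := fconv_bound mu0 (isT : 0 < 3)%N hv (ZY r rt) (divdiff_conv j rT') uq.
  rewrite -mulrA mulrA; apply: le_trans; rewrite le_eqVlt; apply/orP; left; apply/eqP.
  by apply: eq_nrm_cmod => l _; rewrite cmodN !cmodM cmodi cmod_expi !mul1r.
Qed.

Lemma divdiff_conv_close (G : int -> R[i]) (t : R) l : 0 <= t <= T ->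
  fconv v (free_flow ^~ t) G ->
  cmodulus (F n l t - G l) <= kap * (La * M * (kap * T) ^+ n / n`!%:R).
Proof.
move=> tT hG; have /andP[t0 tT'] := tT.
have hY : fconv v (Y n ^~ t) (fun l => F n l t - G l).
  move=> k; apply: (clim_near (M1 := 0%N) (climB (divdiff_conv n tT k) (hG k))) => N _.
  by rewrite -sumrB; apply: eq_bigr => p _; rewrite /Y eqxx mul1r mulrBr.
have := Hbound_point l (fconv_bound mu0 (isT : 0 < 3)%N hv (divdiff_close (leqnn n) tT) hY).
rewrite -mulrA mulrA => h; apply: le_trans (_ : _ <= om mu l ^+ 3 * cmodulus (F n l t - G l)) _.
  by rewrite ler_peMl ?cmod_ge0// exprn_ege1// om_ge1.
apply: (le_trans h); apply: (ler_wpM2l kap0).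
have LM : 0 <= La * M := Hbound_ge0 (Z0_bound tT).
apply: ler_wpM2r; first by rewrite invr_ge0.
by apply: (ler_wpM2l LM); rewrite lerXn2r ?nnegrE ?(mulr_ge0 kap0) ?(ler_wpM2l kap0).
Qed.

End extrapolation.

(** * Extrapolated decay for the potential acting on the free flow *)

Section free_evolution.
Context {R : realType}.
Local Notation ci := ((0 +i* 1)%C : R[i]).

(** A Landau-type inequality: W is small at both ends of a short interval and its derivative is F up
    to a phase, so the mean of F is small; as F is close to G and G varies little, G is small too.
    No lower order than ze / h can be expected, hence the balance in h later. *)
Lemma landau_step (W F G : R -> R[i]) (t h de ze L : R) : 0 < h -> ccont W t (t + h) ->
  (forall r, t < r < t + h -> is_cderive W r (- (ci * F r))) ->
  cmodulus (W t) <= ze -> cmodulus (W (t + h)) <= ze ->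
  (forall r, t < r < t + h -> cmodulus (F r - G r) <= de) ->
  (forall r, t < r < t + h -> cmodulus (G r - G t) <= L * h) ->
  cmodulus (G t) <= 2 * ze / h + de + L * h.
Proof.
move=> h0 cW dW W1 W2 FG GG.
have th : t <= t + h by rewrite lerDl ltW.
have did (r : R) : is_cderive (fun r => r%:C : R[i]) r 1%:C.
  by apply: is_cderive_real; exact: is_derive_id.
have := @mean_value_cmod R (fun r => W r + (ci * G t) * r%:C) (fun r => - (ci * F r) + (ci * G t) * 1%:C)
  (fun r => (de + L * h) * r + 0) (fun=> de + L * h) t (t + h) th.
rewrite (_ : W (t + h) + _ - _ = W (t + h) - W t + ci * G t * h%:C); last by rewrite rmorphD /=; ring.
rewrite (_ : (de + L * h) * (t + h) + 0 - _ = (de + L * h) * h); last by ring.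
have hc : ccont (fun r => W r + (ci * G t) * r%:C) t (t + h).
  apply: ccontD => //; apply: ccontM; first exact: ccont_cst.
  exact: (@is_cderive_ccont R _ _ t (t + h) did).
move=> /(_ hc) h1.
have {}h1 : cmodulus (W (t + h) - W t + ci * G t * h%:C) <= (de + L * h) * h.
  apply: h1.
  - by move=> r rt; apply: is_cderiveD; [exact: dW|exact: is_cderiveMl].
  - by move=> r; exact: is_derive_affine.
  move=> r rt; rewrite mulr1.
  rewrite (_ : _ + _ = - ci * ((F r - G r) + (G r - G t))); last by ring.
  rewrite cmodM cmodN cmodi mul1r; apply: (le_trans (cmodD _ _)).
  exact: lerD (FG r rt) (GG r rt).
have : cmodulus (G t) * h <= (de + L * h) * h + (ze + ze).
  have -> : cmodulus (G t) * h = cmodulus (ci * G t * h%:C).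
    by rewrite !cmodM cmodi mul1r cmodR ger0_norm// ltW.
  rewrite (_ : ci * G t * h%:C = (W (t + h) - W t + ci * G t * h%:C) - (W (t + h) - W t)); last by ring.
  apply: (le_trans (cmodB _ _)); apply: lerD => //.
  by apply: (le_trans (cmodB _ _)); exact: lerD.
rewrite -ler_pdivlMr// => /le_trans; apply; rewrite le_eqVlt; apply/orP; left; apply/eqP.
by field; rewrite gt_eqF.
Qed.

Lemma geometric_bracket (x E : R) : 1 <= x -> 2 <= E -> exists n, E ^+ n <= x < E ^+ n.+1.
Proof.
move=> x1 E2; have E0' : 0 <= E by lra.
have ex : exists n, x < E ^+ n.
  exists (Num.bound x); apply: lt_le_trans (archi_boundP _) _; first lra.
  apply: le_trans (_ : (1 + (Num.bound x)%:R * 1) <= _).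
    by rewrite mulr1 lerDr.
  apply: (le_trans (bernoulli_ineq _ ler01)).
  by rewrite lerXn2r ?nnegrE//; lra.
case: (ex_minnP ex) => -[|n] h hmin; first by move: h; rewrite expr0 ltNge x1.
exists n; rewrite h andbT leNgt; apply/negP => /hmin; by rewrite ltnn.
Qed.

Context (a b : R) (ab : a < b) (v c0 : int -> R[i]) (Bv M : R).
Local Notation mu1 := (freq a b 1).
Local Notation om := (om mu1).
Local Notation A := (fun l => freq a b l ^+ 2).
Local Notation E0 := (free_flow A c0).
Local Notation kap := (2 ^+ 4 * C0 mu1 * Bv).
Hypotheses (hv : Hbound mu1 3 v Bv) (hc0 : Hbound mu1 3 c0 M).

Let m0 : 0 < mu1. Proof. exact: mu_gt0. Qed.
Let Bv0 : 0 <= Bv. Proof. exact: Hbound_ge0 hv. Qed.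
Let M0 : 0 <= M. Proof. exact: Hbound_ge0 hc0. Qed.

Lemma freq_le_om l : freq a b l ^+ 2 <= om l ^+ 2.
Proof.
rewrite [freq a b l]freqE -[leLHS]real_normK ?num_real// normrM (gtr0_norm m0).
have x0 : 0 <= mu1 * `|l%:~R| by exact: (mulr_ge0 (ltW m0) (normr_ge0 _)).
by apply: lerXn2r; rewrite ?nnegrE ?(om_ge0 m0)// /om lerDr.
Qed.

Lemma free_conv_exists : exists g : int -> R -> R[i], forall l t N,
  cmodulus (\sum_(k <- win N) v (l - k) * E0 k t - g l t) <= 2 * tail_bd a b (Bv * M) N.
Proof.
have h l t : exists S, forall N, cmodulus (\sum_(k <- win N) v (l - k) * E0 k t - S) <= 2 * tail_bd a b (Bv * M) N.
  have hb k : om k ^+ 2 * cmodulus (v (l - k) * c0 k) <= Bv * M.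
    rewrite cmodM mulrCA; apply: (ler_pM (cmod_ge0 _) (mulr_ge0 (omX_ge0 m0 k 2) (cmod_ge0 _))).
      have := Hbound_point (l - k) hv; apply: le_trans.
      by rewrite ler_peMl ?cmod_ge0// exprn_ege1// om_ge1.
    apply: le_trans (Hbound_point k hc0).
    by rewrite ler_wpM2r ?cmod_ge0// (omX_mono m0).
  have [S hS] := sum_exists ab hb (fun k => cmod_expi (- (A k * t))).
  exists S => N; have := hS N; congr (cmodulus (_ - _) <= _).
  by apply: eq_bigr => k _; rewrite /free_flow; ring.
by exists (fun l t => sval (cid (h l t))) => l t; exact: svalP (cid (h l t)).
Qed.

Context (g : int -> R -> R[i]) (hg : forall l t N,
  cmodulus (\sum_(k <- win N) v (l - k) * E0 k t - g l t) <= 2 * tail_bd a b (Bv * M) N).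

Lemma free_conv t : fconv v (E0^~ t) (g^~ t).
Proof. by move=> l; apply: (clim_rate ab (mulr_ge0 Bv0 M0)) => N; exact: hg. Qed.

Lemma free_conv_bound l t : cmodulus (g l t) <= kap * M.
Proof.
have hE : Hbound mu1 3 (E0^~ t) M by move=> s us; rewrite nrm_expi; exact: hc0.
have := Hbound_point l (fconv_bound m0 (isT : 0 < 3)%N hv hE (@free_conv t)).
by apply: le_trans; rewrite ler_peMl ?cmod_ge0// exprn_ege1// om_ge1.
Qed.

(** The phase and the free flow both move with speed of order the square of a frequency. For the
    flow this loss is taken from the H^3 bound of c0, so the weight of l occurs only as om^2. *)
Lemma free_conv_lip l t r :
  cmodulus (expi (A l * r) * g l r - expi (A l * t) * g l t) <=
  (kap * M + 2 ^+ 2 * C0 mu1 * Bv * M) * om l ^+ 2 * `|r - t|.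
Proof.
have rt : 0 <= `|r - t| by [].
have kM : 0 <= kap * M by apply: le_trans (free_conv_bound 0 0); exact: cmod_ge0.
rewrite (_ : _ - _ = (expi (A l * r) - expi (A l * t)) * g l r + expi (A l * t) * (g l r - g l t)); last by ring.
apply: (le_trans (cmodD _ _)); rewrite !cmodM cmod_expi mul1r !mulrDl; apply: lerD.
  have -> : kap * M * om l ^+ 2 * `|r - t| = om l ^+ 2 * `|r - t| * (kap * M) by ring.
  apply: ler_pM; rewrite ?cmod_ge0 ?free_conv_bound//.
  apply: (le_trans (cmod_expi_sub _ _)); rewrite -mulrBr normrM ger0_norm ?sqr_ge0//.
  by rewrite ler_wpM2r// freq_le_om.
have hd : Hbound mu1 1 (fun k => E0 k r - E0 k t) (`|r - t| * M).
  move=> s us; apply: le_trans (ler_wpM2l rt (hc0 us)).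
  rewrite /nrm -[X in X * _](normr_id (r - t)) -N2_scale; apply: N2_le => k _.
  rewrite (ger0_norm (mulr_ge0 (omX_ge0 m0 k 1) (cmod_ge0 _))) expr1.
  rewrite /free_flow -mulrBl cmodM.
  have e1 : cmodulus (expi (- (A k * r)) - expi (- (A k * t))) <= om k ^+ 2 * `|r - t|.
    apply: (le_trans (cmod_expi_sub _ _)).
    rewrite (_ : _ - _ = - (A k * (r - t))); last by ring.
    rewrite normrN normrM (ger0_norm (sqr_ge0 _)); apply: ler_wpM2r => //; exact: freq_le_om.
  have := ler_wpM2r (cmod_ge0 (c0 k)) e1 => /(ler_wpM2l (om_ge0 m0 k)) h2; apply: (le_trans h2).
  by rewrite le_eqVlt; apply/orP; left; apply/eqP; rewrite exprS; ring.
have hgd : fconv v (fun k => E0 k r - E0 k t) (fun k => g k r - g k t).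
  move=> k; apply: (clim_near (M1 := 0%N) (climB (@free_conv r k) (@free_conv t k))) => N _.
  by rewrite -sumrB; apply: eq_bigr => p _; rewrite mulrBr.
have := Hbound_point l (fconv_bound m0 (isT : 0 < 1)%N (Hbound_mono m0 (isT : 1 <= 3)%N hv) hd hgd).
have ox := om_ge1 m0 l; move=> h; apply: (@le_trans _ _ (om l ^+ 1 * cmodulus (g l r - g l t))).
  by rewrite expr1 ler_peMl ?cmod_ge0.
apply: (le_trans h).
have -> : 2 ^+ 2 * C0 mu1 * Bv * M * om l ^+ 2 * `|r - t| = om l ^+ 2 * (2 ^+ 2 * C0 mu1 * Bv * (`|r - t| * M)) by ring.
have X0 := le_trans (mulr_ge0 (omX_ge0 m0 l 1) (cmod_ge0 (g l r - g l t))) h.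
exact: (ler_peMl X0 (exprn_ege1 2 ox)).
Qed.

Let rate_nodes (x r W K U : R) q : 0 < x -> 0 < r -> 0 <= K -> W <= x * U ->
  x ^+ q * (2 * (W * (K / x ^+ (2 * q + 3))) / (r / 2 * x ^- (q + 2))) <= 4 / r * (U * K).
Proof.
move=> x0 r0 K0 WU.
have -> : x ^+ q * (2 * (W * (K / x ^+ (2 * q + 3))) / (r / 2 * x ^- (q + 2))) = 4 / r * (W * K / x).
  rewrite (_ : 2 * q + 3 = q + (q + 2) + 1)%N; last by lia.
  rewrite [x ^+ (_ + 1)]exprD [x ^+ (q + (q + 2))]exprD expr1; field.
  by rewrite !expf_neq0 ?gt_eqF.
rewrite ler_wpM2l ?divr_ge0 ?(ltW r0)// ler_pdivrMr//; apply: (le_trans (ler_wpM2r K0 WU)).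
by rewrite le_eqVlt; apply/orP; left; apply/eqP; ring.
Qed.

(** Powers of x are replaced by powers of E^(n+1), so the whole expression becomes the n-th term of
    an exponential series whose argument does not depend on x. *)
Let rate_factorial (x E La kT : R) q n : 0 <= x -> x <= E ^+ n.+1 -> 0 <= E -> 0 <= La -> La <= E ^+ n -> 0 <= kT ->
  x ^+ q * La * (kT ^+ n / n`!%:R) <= E ^+ q * expR (E ^+ q.+1 * kT).
Proof.
move=> x0 xE Ege0 La0 LaE kT0.
have kn0 : 0 <= kT ^+ n / n`!%:R by rewrite divr_ge0// exprn_ge0.
have X0 : 0 <= E ^+ q.+1 * kT by rewrite mulr_ge0// exprn_ge0.
apply: (@le_trans _ _ (E ^+ q * ((E ^+ q.+1 * kT) ^+ n / n`!%:R))); last first.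
  by apply: ler_wpM2l; [rewrite exprn_ge0|exact: expn_fact_le].
have -> : E ^+ q * ((E ^+ q.+1 * kT) ^+ n / n`!%:R) = (E ^+ n.+1) ^+ q * E ^+ n * (kT ^+ n / n`!%:R).
  by rewrite exprMn -!exprM !mulSn !exprD [(n * q)%N]mulnC; ring.
apply: (ler_wpM2r kn0); apply: ler_pM => //; first by rewrite exprn_ge0.
by rewrite lerXn2r ?nnegrE ?exprn_ge0.
Qed.

(* The number n of nodes is about log (om l) / log E with E large: the weights
   then cost only one power of om l, while 1 / n`! beats all of them. *)
Lemma extrapolated_decay (c f : R -> int -> R -> R[i]) (T e1 e2 t0 r K : R) (q : nat) :
  0 < e1 -> e1 < e2 -> e2 <= 1 -> 0 <= t0 -> 0 < r -> t0 + r <= T ->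
  (forall eps t : R, 0 < eps <= 1 -> 0 <= t <= T -> Hbound mu1 3 (c eps ^~ t) M) ->
  (forall eps t : R, 0 < eps <= 1 -> 0 <= t <= T -> fconv v (c eps ^~ t) (f eps ^~ t)) ->
  (forall eps l, 0 < eps <= 1 -> ccont (c eps l) 0 T) ->
  (forall eps l (t : R), 0 < eps <= 1 -> 0 < t < T ->
     is_cderive (c eps l) t (- (ci * (A l)%:C) * c eps l t - ci * eps%:C * f eps l t)) ->
  (forall eps l, 0 < eps <= 1 -> c eps l 0 = c0 l) ->
  (forall eps t l, e1 <= eps <= e2 -> t0 <= t <= t0 + r -> om l ^+ (2 * q + 3) * cmodulus (c eps l t) <= K) ->
  exists C : R, forall l t, t0 <= t <= t0 + r / 2 -> om l ^+ q * cmodulus (g l t) <= C.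
Proof.
move=> e10 e12 e21 t00 r0 tT hc hf cc dc ic hK.
have e20 := lt_trans e10 e12; have T0 : 0 <= T by lra.
pose rho := e1^-1 - e2^-1; have rho0 : 0 < rho by rewrite subr_gt0 ltf_pV2 ?posrE.
pose U := e1^-1; have U1 : 1 <= U by rewrite invf_ge1// (le_trans (ltW e12)).
have U0 : 0 < U by exact: lt_le_trans U1.
pose Cw : R := 2 * expR 1 / rho; have Cw0 : 0 < Cw by rewrite divr_gt0// mulr_gt0// expR_gt0.
have CU0 : 0 <= Cw * U by rewrite mulr_ge0// ltW.
pose E := 2 + Cw * U; have E2 : 2 <= E by rewrite lerDl.
have Ege0 : 0 <= E by lra.
have kp0 : 0 <= kap by rewrite mulr_ge0// mulr_ge0 ?(C0_ge0 m0)// exprn_ge0.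
have K0 : 0 <= K.
  apply: le_trans (hK e1 t0 0 _ _); rewrite ?mulr_ge0 ?cmod_ge0 ?(omX_ge0 m0)// ?lexx ?(ltW e12)//=.
  by rewrite lerDl ltW.
pose L := kap * M + 2 ^+ 2 * C0 mu1 * Bv * M.
pose kT := kap * T; have kT0 : 0 <= kT by exact: mulr_ge0.
have kM0 : 0 <= kap * M by exact: mulr_ge0.
pose X := E ^+ q.+1 * kT; have X0 : 0 <= X by rewrite mulr_ge0// exprn_ge0.
have L0 : 0 <= L by rewrite addr_ge0// mulr_ge0// mulr_ge0// mulr_ge0 ?(C0_ge0 m0)// exprn_ge0.
exists (E ^+ q * (kap * M) + (4 / r * (U * K) + kap * M * (E ^+ q * expR X) + L * (r / 2))).
move=> l t /andP[t1 t2]; set x := om l; have x1 : 1 <= x by exact: om_ge1.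
have x0 : 0 < x := lt_le_trans ltr01 x1; have xq0 : 0 <= x ^+ q by rewrite exprn_ge0// ltW.
have r40 : 0 <= 4 / r by rewrite divr_ge0// ltW.
have P1 : 0 <= 4 / r * (U * K) by rewrite mulr_ge0// mulr_ge0// ltW.
have P2 : 0 <= kap * M * (E ^+ q * expR X) by rewrite mulr_ge0// mulr_ge0 ?expR_ge0// exprn_ge0.
have P3 : 0 <= L * (r / 2) by rewrite mulr_ge0// divr_ge0// ltW.
have P4 : 0 <= E ^+ q * (kap * M) by rewrite mulr_ge0// exprn_ge0.
(* For n = 0 the weight is below E and the trivial bound of g suffices; otherwise E^n <= om l <
   E^(n+1) determines the number of nodes. *)
have [[|n] /andP[En xE]] := geometric_bracket x1 E2.
  apply: (@le_trans _ _ (E ^+ q * (kap * M))); last by rewrite lerDl addr_ge0 ?addr_ge0.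
  apply: ler_pM; rewrite ?cmod_ge0 ?free_conv_bound// lerXn2r ?nnegrE ?(ltW x0)//.
  by move: xE; rewrite expr1 => /ltW.
move: n En xE => n'; set n := n'.+1 => En xE; have n0 : (0 < n)%N by [].
have [la [nd [hnd hla hmom]]] := interpolation_weights e2^-1 rho0 n0.
pose s := iota 0 n.+1.
have ndE i : i \in s -> e2^-1 <= nd i <= U.
  rewrite mem_iota add0n => /andP[_ /hnd]; by rewrite /rho addrC subrK.
have nd1 i : i \in s -> 1 <= nd i <= U.
  move=> /ndE /andP[h1 h2]; rewrite h2 andbT (le_trans _ h1)// invf_ge1//.
have ep i : i \in s -> e1 <= (nd i)^-1 <= e2.
  move=> si; have /andP[h1 h2] := ndE i si; have ip : 0 < e2^-1 by rewrite invr_gt0.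
  have np := lt_le_trans ip h1; apply/andP; split.
    by rewrite -[e1]invrK lef_pV2 ?posrE ?invr_gt0.
  by rewrite -[X in _ <= X]invrK lef_pV2 ?posrE.
have ep1 i : i \in s -> 0 < (nd i)^-1 <= 1.
  by move=> /ep /andP[h1 h2]; rewrite (lt_le_trans e10 h1) (le_trans h2).
pose La := Cw ^+ n.
pose cn i := c (nd i)^-1; pose fn i := f (nd i)^-1.
have hc' i (t' : R) : i \in s -> 0 <= t' <= T -> Hbound mu1 3 (cn i ^~ t') M by move=> si; apply: hc; exact: ep1.
have hf' i (t' : R) : i \in s -> 0 <= t' <= T -> fconv v (cn i ^~ t') (fn i ^~ t') by move=> si; apply: hf; exact: ep1.
have cc' i l' : i \in s -> ccont (cn i l') 0 T by move=> si; apply: cc; exact: ep1.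
have dc' i l' (t' : R) : i \in s -> 0 < t' < T ->
    is_cderive (cn i l') t' (- (ci * (A l')%:C) * cn i l' t' - ci * ((nd i)^-1)%:C * fn i l' t').
  by move=> si; apply: dc; exact: ep1.
have ic' i l' : i \in s -> cn i l' 0 = c0 l' by move=> si; apply: ic; exact: ep1.
have close t' : 0 <= t' <= T -> cmodulus (divdiff s la nd fn n l t' - g l t') <= kap * (La * M * kT ^+ n / n`!%:R).
  move=> tT'; have gc := @free_conv t'.
  exact: (divdiff_conv_close m0 n0 T0 hv hmom hla nd1 M0 hc' hf' cc' dc' ic' l tT' gc).
(* This h makes the Lipschitz term of size x^-q. Division by h then costs x^(q+2) and the weights
   cost one x, which together with x^q is the exponent 2q + 3 required of the solutions. *)
pose h := r / 2 * x ^- (q + 2).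
have xp p : 1 <= x ^+ p by exact: exprn_ege1.
have xp0 p : 0 < x ^+ p by exact: lt_le_trans (xp p).
have h0 : 0 < h by rewrite mulr_gt0 ?invr_gt0// divr_gt0.
have hr : h <= r / 2 by rewrite ger_pMr ?divr_gt0// invf_le1.
pose ze := La * U ^+ n.+1 * (K / x ^+ (2 * q + 3)).
have zb t' : t0 <= t' <= t0 + r -> cmodulus (expi (A l * t') * divdiff s la nd cn n.+1 l t') <= ze.
  move=> ht; rewrite cmodM cmod_expi mul1r; apply: (divdiff_point hla nd1 U1).
    by rewrite divr_ge0// ltW.
  by move=> i si; rewrite ler_pdivlMr// mulrC; apply: hK => //; exact: ep.
have := @landau_step (fun t => expi (A l * t) * divdiff s la nd cn n.+1 l t)
  (fun t => expi (A l * t) * divdiff s la nd fn n l t) (fun t => expi (A l * t) * g l t) t h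
  (kap * (La * M * kT ^+ n / n`!%:R)) ze (L * x ^+ 2) h0.
have gE : cmodulus (expi (A l * t) * g l t) = cmodulus (g l t) by rewrite cmodM cmod_expi mul1r.
rewrite gE => main.
have {}main : cmodulus (g l t) <= 2 * ze / h + kap * (La * M * kT ^+ n / n`!%:R) + L * x ^+ 2 * h.
  apply: main.
  - apply: (@ccont_sub _ _ 0 T); [lra|lra|]; exact: (divdiff_ccont A la nd cc').
  - move=> t' ht; rewrite mulrA; apply: (divdiff_derive la nd1 dc').
    case/andP: ht => *; apply/andP; split; lra.
  - by apply: zb; apply/andP; split; lra.
  - by apply: zb; apply/andP; split; lra.
  - move=> t' /andP[h1 h2]; rewrite -mulrBr cmodM cmod_expi mul1r; apply: close; apply/andP; split; lra.
  - move=> t' /andP[h1 h2]; apply: (le_trans (free_conv_lip _ _ _)).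
    rewrite ler_wpM2l//; first by rewrite mulr_ge0// sqr_ge0.
    by rewrite ger0_norm; lra.
have CUn : (Cw * U) ^+ n <= x.
  apply: le_trans En; apply: lerXn2r; rewrite ?nnegrE//; by rewrite lerDr.
have LaU : La * U ^+ n.+1 <= x * U.
  by rewrite exprSr mulrA -exprMn ler_wpM2r// ltW.
have LaE : La <= E ^+ n.
  apply: lerXn2r; rewrite ?nnegrE ?(ltW Cw0)//; apply: le_trans (_ : Cw * U <= _); last by rewrite lerDr.
  by rewrite ler_peMr// ltW.
have T1 : x ^+ q * (2 * ze / h) <= 4 / r * (U * K).
  exact: rate_nodes.
have T2 : x ^+ q * (kap * (La * M * kT ^+ n / n`!%:R)) <= kap * M * (E ^+ q * expR X).
  have -> : x ^+ q * (kap * (La * M * kT ^+ n / n`!%:R)) = kap * M * (x ^+ q * La * (kT ^+ n / n`!%:R)) by ring.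
  apply: (ler_wpM2l kM0); apply: rate_factorial => //; [exact: ltW|exact: ltW|exact: exprn_ge0 (ltW Cw0)].
have T3 : x ^+ q * (L * x ^+ 2 * h) = L * (r / 2).
  by rewrite /h exprD; field; rewrite !gt_eqF.
apply: (le_trans (ler_wpM2l xq0 main)); move: T2; set D := kap * (La * _ * _ / _) => T2.
rewrite [x ^+ q * (2 * ze / h + D + _)]mulrDr [x ^+ q * (2 * ze / h + D)]mulrDr T3.
exact: (ler_wpDl P4 (lerD (lerD T1 T2) (lexx _))).
Qed.

End free_evolution.

(** * Smooth solutions *)

Lemma ccont_modulus (R : realType) (f : R -> R[i]) (a b t e : R) : ccont f a b -> a <= t <= b -> 0 < e ->
  exists2 d : R, 0 < d & forall s : R, a <= s <= b -> `|s - t| < d -> cmodulus (f s - f t) < e.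
Proof.
move=> [/within_continuousP h1 /within_continuousP h2] tab e0; have e2 : 0 < e / 2 by rewrite divr_gt0.
have [d1 d10 hd1] := h1 t tab (e / 2) e2; have [d2 d20 hd2] := h2 t tab (e / 2) e2.
exists (Num.min d1 d2); first by rewrite lt_min d10.
move=> s sab; rewrite lt_min => /andP[l1 l2]; apply: (le_lt_trans (cmod_le_ReIm _)).
rewrite cReB cImB; have := hd1 s sab; rewrite /ball /= distrC => /(_ l1); rewrite distrC => {}l1.
have := hd2 s sab; rewrite /ball /= distrC => /(_ l2); rewrite distrC => {}l2; lra.
Qed.

Lemma cmod_dist (R : realType) (z u : R[i]) : `|cmodulus z - cmodulus u| <= cmodulus (z - u).
Proof.
have h1 := cmodD (z - u) u; have h2 := cmodD (u - z) z.
move: h1 h2; rewrite !subrK (cmodBC u z) => h1 h2; rewrite ler_norml; apply/andP; split; lra.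
Qed.

Section smooth_case.
Context {R : realType} (a b : R) (T : R) (V : R -> R)
    (psi0 : R -> R[i]) (psi : R -> R -> R -> R[i])
    (ab : a < b) (hT : 0 < T) (cV : ccont (fun x => (V x)%:C) a b)
    (hpsi : forall eps : R, 0 < eps <= 1 ->
       exact_solution a b eps V psi0 (psi eps))
    (hsmooth : forall eps t : R, 0 < eps <= 1 -> 0 <= t <= T / eps ->
      forall k : nat, Hper a b k (fun x => psi eps x t)).
Local Notation mu1 := (freq a b 1).
Local Notation om := (om mu1).
Local Notation fc := (fourier_coef a b).
Local Notation ci := ((0 +i* 1)%C : R[i]).
Local Notation v := (fc (fun x => (V x)%:C)).
Local Notation c0 := (fc psi0).
Local Notation A := (fun l => freq a b l ^+ 2).
Local Notation c eps := (sol_coef a b (psi eps)).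
Local Notation f eps := (pot_coef a b V (psi eps)).

Let m0 : 0 < mu1. Proof. exact: mu_gt0. Qed.

Lemma fc_real_conj j : v (- j) = conjc (v j).
Proof.
pose phi x := (V x)%:C * expi (- (freq a b j * (x - a))).
have iV : cintegrable a b phi.
  apply: cintegrable_cont; apply: ccontM => //.
  by apply: (ccont_ext (ccont_ech a b (- j))) => x; rewrite /ech freqN mulNr.
have conj_phi x : (V x)%:C * expi (- (freq a b (- j) * (x - a))) = conjc (phi x).
  rewrite /phi freqN mulNr opprK rmorphM; congr (_ * _); first by rewrite /= oppr0.
  by have := conj_expi (- (freq a b j * (x - a))); rewrite opprK => <-.
have cphi : cintegral `]a, b[%classic (fun x => conjc (phi x)) = conjc (cintegral `]a, b[%classic phi).
  have := congr1 (@complex.Im R) (cintN iV); rewrite /cintegral cImN /= => hI.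
  by rewrite hI.
rewrite /fourier_coef (_ : (fun x => (V x)%:C * _) = (fun x => conjc (phi x))); last exact/funext.
by rewrite cphi rmorphM /= oppr0.
Qed.

Lemma sum_win_fold (F : int -> R[i]) M :
  \sum_(k <- win M) F k = \sum_(n <- iota 0 M.+1) (F n%:Z + (if n == 0%N then 0 else F (- n%:Z))).
Proof.
elim: M => [|M ih]; first by rewrite /win /= !big_seq1 /= subrr addr0.
rewrite (perm_big [:: M.+1%:Z, - M.+1%:Z & win M]); last first.
  apply: uniq_perm; rewrite ?uniq_win//.
    by apply/and3P; split; [rewrite inE mem_win; lia|rewrite mem_win; lia|exact: uniq_win].
  by move=> k; rewrite mem_win 2!in_cons mem_win; apply/idP/idP; lia.
rewrite 2!big_cons ih -[M.+2]addn1 iotaD big_cat big_seq1 add0n.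
by set S := \big[_/_]_(n <- _) _; rewrite /= [RHS]addrC -addrA.
Qed.

Let unit_le (eps : R) : 0 < eps <= 1 -> T <= T / eps.
Proof. by move=> /andP[e0 e1]; rewrite ler_peMr ?(ltW hT)// invf_ge1. Qed.

Let time_ok (eps t : R) : 0 < eps <= 1 -> 0 <= t <= T -> 0 <= t <= T / eps.
Proof. by move=> e01 /andP[t0 tT]; rewrite t0 (le_trans tT)// unit_le. Qed.

Context (BV Bc : R) (hBV : Hbound mu1 3 v BV) (hBc : forall eps t : R, 0 < eps <= 1 -> 0 <= t <= T / eps ->
  Hbound mu1 3 (fun l => c eps l t) Bc).

Let kap : R := 2 ^+ 4 * C0 mu1 * BV.
Let BV0 : 0 <= BV. Proof. exact: Hbound_ge0 hBV. Qed.
Let one01 : 0 < (1 : R) <= 1. Proof. by rewrite ltr01 lexx. Qed.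
Let Bc0 : 0 <= Bc.
Proof. by apply: (Hbound_ge0 (hBc one01 (t := 0) _)); rewrite lexx divr_ge0// ltW. Qed.
Let kap0 : 0 <= kap.
Proof. by rewrite mulr_ge0// mulr_ge0 ?(C0_ge0 m0)// exprn_ge0. Qed.

Let sconv (eps t : R) : 0 < eps <= 1 -> 0 <= t <= T / eps -> fconv v (c eps ^~ t) (f eps ^~ t).
Proof.
move=> e01 tT; have /andP[t0 _] := tT.
apply: (sol_conv ab cV (hpsi e01) t0 (B := Bc)) => l.
by apply: (Hbound_point l); apply: Hbound_mono (hBc e01 tT).
Qed.

(** Gronwall's inequality for the difference of two solutions in the rotating frame. Continuity in
    eps is what Baire's argument needs besides continuity in t; only the fixed time T is
    involved. *)
Lemma sol_lipschitz : exists2 L : R, 0 <= L & forall (e1 e2 t : R) l, 0 < e1 <= 1 -> 0 < e2 <= 1 ->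
  0 <= t <= T -> cmodulus (c e1 l t - c e2 l t) <= L * `|e1 - e2|.
Proof.
exists (2 * (kap * Bc * T) * expR (2 * kap * T)).
  exact: (mulr_ge0 (mulr_ge0 (ler0n _ 2) (mulr_ge0 (mulr_ge0 kap0 Bc0) (ltW hT))) (expR_ge0 _)).
move=> e1 e2 t l h1 h2 tT; set de := `|e1 - e2|; have de0 : 0 <= de by exact: normr_ge0.
pose z l t := expi (A l * t) * (c e1 l t - c e2 l t).
pose dz l t := - (ci * expi (A l * t) * (e1%:C * f e1 l t - e2%:C * f e2 l t)).
have nz s t' : nrm s (fun l => om l ^+ 3) (z ^~ t') = nrm s (fun l => om l ^+ 3) (fun l => c e1 l t' - c e2 l t').
  exact: nrm_expi.
have key := @gronwall_nrm R int (fun s => uniq s) (fun l => om l ^+ 3) z dz kap (kap * Bc * de) (2 * Bc) 0 T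
  kap0 (mulr_ge0 (mulr_ge0 kap0 Bc0) de0) (mulr_ge0 (ler0n _ 2) Bc0) (lexx 0).
have : nrm [:: l] (fun l => om l ^+ 3) (z ^~ t) <= 2 * (0 + kap * Bc * de * T) * expR (2 * kap * t).
  apply: (key _ _ _ _ _ _ [:: l] t isT tT).
  - by move=> s l' _ _; exact: (omX_ge0 m0).
  - move=> s l' _ _; apply: ccontM; first exact: (@is_cderive_ccont R _ _ 0 T (expi_derive (A l'))).
    by apply: ccontB; [exact: (sol_ccont ab (hpsi h1) l' T)|exact: (sol_ccont ab (hpsi h2) l' T)].
  - move=> s l' t' _ _ /andP[t0 tT'].
    have := is_cderiveM (expi_derive (A l') t') (is_cderiveB (sol_derive ab cV (hpsi h1) l' t0) (sol_derive ab cV (hpsi h2) l' t0)).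
    by move=> h; apply: (is_cderive_ext h) => //; rewrite /dz; ring.
  - move=> s t' us tT'; rewrite nz; have -> : 2 * Bc = Bc + Bc by ring.
    apply: nrmBle; [by move=> l' _; exact: (omX_ge0 m0)| |]; exact: (hBc _ (time_ok _ tT')).
  - move=> s t' B us /andP[t0 tT'] hB; have tT2 : 0 <= t' <= T by rewrite !ltW.
    have hd : Hbound mu1 3 (fun l => c e1 l t' - c e2 l t') B by move=> s' us'; rewrite -nz; exact: hB.
    have cd : fconv v (fun l => c e1 l t' - c e2 l t') (fun l => f e1 l t' - f e2 l t').
      move=> k; apply: (clim_near (M1 := 0%N) (climB (sconv h1 (time_ok h1 tT2) k) (sconv h2 (time_ok h2 tT2) k))) => N _.
      by rewrite -sumrB; apply: eq_bigr => p _; rewrite mulrBr.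
    have b1 := fconv_bound m0 (isT : 0 < 3)%N hBV hd cd us.
    have b2 := fconv_bound m0 (isT : 0 < 3)%N hBV (hBc h2 (time_ok h2 tT2)) (sconv h2 (time_ok h2 tT2)) us.
    have -> : nrm s (fun l => om l ^+ 3) (dz ^~ t') = nrm s (fun l => om l ^+ 3)
        (fun l => e1%:C * (f e1 l t' - f e2 l t') + (e1 - e2)%:C * f e2 l t').
      apply: eq_nrm_cmod => k _; rewrite /dz cmodN !cmodM cmodi cmod_expi !mul1r; congr cmodulus.
      by rewrite rmorphB /=; ring.
    apply: nrmDle; [by move=> l' _; exact: (omX_ge0 m0)| |].
      rewrite nrmZ cmodR; have /andP[p1 p2] := h1; rewrite (gtr0_norm p1).
      apply: le_trans b1; exact: (ler_piMl (nrm_ge0 _ _ _) p2).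
    by rewrite nrmZ cmodR mulrC ler_wpM2r.
  - move=> s us; rewrite (@eq_nrm _ _ _ _ _ (fun=> 0)) ?nrm0// => k _.
    by rewrite /z (sol_init (hpsi h1)) (sol_init (hpsi h2)) subrr mulr0.
rewrite add0r => h.
have : cmodulus (c e1 l t - c e2 l t) <= 2 * (kap * Bc * de * T) * expR (2 * kap * t).
  apply: le_trans h; rewrite nz /nrm /N2 big_seq1 sqrtr_sqr.
  have o1 := om_ge1 m0 l; rewrite (ger0_norm (mulr_ge0 (omX_ge0 m0 l 3) (cmod_ge0 _))).
  by rewrite ler_peMl ?cmod_ge0// exprn_ege1.
have P0 : 0 <= 2 * (kap * Bc * de * T).
  exact: (mulr_ge0 (ler0n _ 2) (mulr_ge0 (mulr_ge0 (mulr_ge0 kap0 Bc0) de0) (ltW hT))).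
have eT : expR (2 * kap * t) <= expR (2 * kap * T).
  by case/andP: tT => _ tT; rewrite ler_expR; apply: (ler_wpM2l (mulr_ge0 (ler0n _ 2) kap0)).
move=> /le_trans; apply; apply: (le_trans (ler_wpM2l P0 eT)).
by rewrite le_eqVlt; apply/orP; left; apply/eqP; move: kap => kp; ring.
Qed.

(** The couplings stay in [1/2, 1], away from 0, because the extrapolation uses the nodes 1 / eps
    and needs them in an interval where the decay is already uniform. *)
Lemma rectangle_decay (q : nat) : exists e1 e2 t0 t1 K : R, [/\ 0 < e1, e1 < e2, e2 <= 1, 0 <= t0 & t0 < t1 /\
  t1 <= T /\ (forall eps t l, e1 <= eps <= e2 -> t0 <= t <= t1 -> om l ^+ q * cmodulus (c eps l t) <= K)].
Proof.
have [L L0 hL] := sol_lipschitz.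
have half : 1 / 2 < 1 :> R by lra.
have e01 (eps : R) : 1 / 2 <= eps <= 1 -> 0 < eps <= 1 by move=> /andP[h1 ->]; rewrite andbT; lra.
have [||e1 [e2 [t0 [t1 [K [h1 h2 h3 h4 [h5 [h6 h7]]]]]]]] :=
    @uniform_on_rectangle R int (fun l eps t => om l ^+ q * cmodulus (c eps l t)) (1 / 2) 1 0 T half hT; last first.
- by exists e1, e2, t0, t1, K; split=> //; lra.
- move=> eps t /e01 ep tT; have [B hB] := Hper_Hbound ab (hsmooth ep (time_ok ep tT) q).
  by exists B => l; exact: (Hbound_point l hB).
move=> l eps t ep tT e e0; have W0 := exprn_gt0 q (om_gt0 m0 l); set W := om l ^+ q in W0 *.
have e20 : 0 < e / (2 * W) by rewrite divr_gt0// mulr_gt0.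
have [d1 d10 hd1] := ccont_modulus (sol_ccont ab (hpsi (e01 _ ep)) l T) tT e20.
have L10 : 0 < L + 1 by lra.
exists (Num.min d1 (e / (2 * W) / (L + 1))); first by rewrite lt_min d10 divr_gt0.
move=> eps' t' ep' tT'; rewrite !lt_min => /andP[_ he] /andP[ht _].
rewrite -mulrBr normrM (gtr0_norm W0) mulrC -ltr_pdivlMr//; apply: (le_lt_trans (cmod_dist _ _)).
rewrite (_ : _ - _ = (c eps' l t' - c eps l t') + (c eps l t' - c eps l t)); last by rewrite addrA subrK.
apply: (le_lt_trans (cmodD _ _)).
have a1 := hd1 t' tT' ht; have a2 := hL eps' eps t' l (e01 _ ep') (e01 _ ep) tT'.
have a3 : L * `|eps' - eps| <= e / (2 * W).
  move: he; rewrite ltr_pdivlMr// => /ltW; apply: le_trans; rewrite mulrC ler_wpM2l//; lra.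
have -> : e / W = e / (2 * W) + e / (2 * W) by field; rewrite gt_eqF.
lra.
Qed.

Let hc0 : Hbound mu1 3 c0 Bc.
Proof.
have t00 : 0 <= (0 : R) <= T / 1 by rewrite lexx divr1 ltW.
move=> s us; rewrite (@eq_nrm R int s _ c0 (fun l => c 1 l 0)); first exact: (hBc one01 t00 us).
by move=> l _; rewrite (sol_init (hpsi one01)).
Qed.

(** The frequencies n and - n share the time frequency mu1^2 n^2, so observation in time can
    separate only their sum. For n = 0 the second term is suppressed. *)
Lemma free_resonances l t M : \sum_(k <- win M) v (l - k) * free_flow A c0 k t =
  \sum_(n <- iota 0 M.+1) (v (l - n%:Z) * c0 n%:Z + v (l + n%:Z) * (if n == 0%N then 0 else c0 (- n%:Z))) *
    expi (- ((mu1 ^+ 2 * n%:R ^+ 2) * t)).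
Proof.
rewrite sum_win_fold; apply: eq_bigr => n _; rewrite /free_flow.
have -> : freq a b n%:Z ^+ 2 = mu1 ^+ 2 * n%:R ^+ 2 by rewrite [freq a b n%:Z]freqE exprMn.
have -> : freq a b (- n%:Z) ^+ 2 = mu1 ^+ 2 * n%:R ^+ 2.
  by rewrite freqN [freq a b n%:Z]freqE sqrrN exprMn.
by case: eqP => _; rewrite ?opprK; ring.
Qed.

(** The decay of the free evolution of order q holds on a whole time interval. Ingham's inequality
    passes it to the single time frequency with a constant that depends on n but not on l. *)
Lemma resonance_rapid (n : nat) :
  rapid mu1 (fun l => v (l - n%:Z) * c0 n%:Z + v (l + n%:Z) * (if n == 0%N then 0 else c0 (- n%:Z))).
Proof.
move=> q; have [e1 [e2 [t0 [t1 [K [e10 e12 e21 t00 [t01 [t1T hK]]]]]]]] := rectangle_decay (2 * q + 3).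
have [g hg] := free_conv_exists ab hBV hc0.
have r0 : 0 < t1 - t0 by rewrite subr_gt0.
have [|||||||C hC] := @extrapolated_decay R a b ab v c0 BV Bc hBV hc0 g hg (fun eps => c eps) (fun eps => f eps)
  T e1 e2 t0 (t1 - t0) K q e10 e12 e21 t00 r0 _.
- by rewrite addrC subrK.
- by move=> eps t ep tT; apply: hBc => //; exact: time_ok.
- by move=> eps t ep tT; apply: sconv => //; exact: time_ok.
- by move=> eps l ep; exact: (sol_ccont ab (hpsi ep) l T).
- by move=> eps l t ep /andP[tp _]; exact: (sol_derive ab cV (hpsi ep) l tp).
- by move=> eps l ep; rewrite (sol_init (hpsi ep)).
- by move=> eps t l ep tt; apply: hK => //; move: tt; rewrite addrC subrK.
have r20 : 0 < (t1 - t0) / 2 by rewrite divr_gt0.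
have [CI CI0 hI] := ingham n m0 r20.
have BB : 0 <= BV * Bc by exact: mulr_ge0.
exists (CI * C) => l; set W := om l ^+ q; have W0 : 0 < W by rewrite exprn_gt0// om_gt0.
set z := _ + _; apply/ler_addgt0Pr => e e0.
have D0 : 0 < W * CI * 2 + 1 by rewrite ltr_wpDl// mulr_ge0// mulr_ge0// ltW.
have [M0 hM] := tail_bd_small ab BB (divr_gt0 e0 D0).
(* Ingham's inequality is stated for finite sums. The truncation M depends on l and e, which is
   harmless because the constant is uniform in M; the tail then contributes at most e. *)
pose M := maxn M0 n; have tM := hM M (leq_maxl _ _).
have tM0 := tail_bd_ge0 ab M BB.
have hz : cmodulus z <= CI * (C / W + 2 * tail_bd a b (BV * Bc) M).
  apply: (hI M (fun n => v (l - n%:Z) * c0 n%:Z + v (l + n%:Z) * (if n == 0%N then 0 else c0 (- n%:Z))) t0).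
    exact: leq_maxr.
  move=> t tt; rewrite -free_resonances -[X in cmodulus X](subrK (g l t)) addrC.
  apply: (le_trans (cmodD _ _)); apply: lerD; last exact: hg.
  by rewrite ler_pdivlMr// mulrC; exact: hC.
apply: (le_trans (ler_wpM2l (ltW W0) hz)).
have -> : W * (CI * (C / W + 2 * tail_bd a b (BV * Bc) M)) = CI * C + W * CI * 2 * tail_bd a b (BV * Bc) M.
  by move: (tail_bd _ _ _ _) => tb; field; rewrite gt_eqF.
rewrite lerD2l; apply: (@le_trans _ _ ((W * CI * 2 + 1) * tail_bd a b (BV * Bc) M)).
  by rewrite ler_wpM2r// lerDl.
by move: tM; rewrite ltr_pdivlMr// mulrC => /ltW.
Qed.

(** Any frequency l at which psi0 has a nonzero coefficient provides a recurrence with n = |l| that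
    is not trivial. *)
Lemma potential_rapid : (forall l, c0 l = 0) \/ rapid mu1 v.
Proof.
have [h|/existsNP[l hl]] := pselect (forall l, c0 l = 0); [by left|right].
have hv l' : om l' * cmodulus (v l') <= BV.
  by have := Hbound_point l' (Hbound_mono m0 (isT : 1 <= 3)%N hBV); rewrite expr1.
apply: (recurrence_rapid m0 (n := `|l|%N) (al := c0 `|l|%N%:Z)
  (be := if `|l|%N == 0%N then 0 else c0 (- `|l|%N%:Z)) (B := BV)) => //.
- have [l0|l0] := leP 0 l; first by left; rewrite gez0_abs//; exact/eqP.
  have a0 : (`|l|%N == 0%N) = false by rewrite absz_eq0 lt_eqF.
  by right; rewrite a0 (_ : - `|l|%N%:Z = l); [exact/eqP|rewrite ltz0_abs// opprK].
- by move=> ->.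
- exact: fc_real_conj.
- exact: resonance_rapid.
Qed.

End smooth_case.

(** * Truncated weights and regularity uniform in eps *)

Section truncated_weights.
Context {R : realType} (mu : R) (mu0 : 0 < mu).
Local Notation om := (om mu).

Lemma rapid_Hbound (u : int -> R[i]) p : rapid mu u -> exists B, Hbound mu p u B.
Proof.
move=> /(_ p.+1)[C hC]; exists (C * C0 mu) => s us.
have C_ge0 : 0 <= C by apply: le_trans (hC 0); exact: (mulr_ge0 (omX_ge0 mu0 0 p.+1) (cmod_ge0 _)).
have CC0 : 0 <= C * C0 mu := mulr_ge0 C_ge0 (C0_ge0 mu0).
rewrite /nrm (N2_leP _ _ CC0).
apply: (@le_trans _ _ (\sum_(l <- s) C ^+ 2 * om l ^- 2)).
  apply: ler_sum => l _; have o0 := om_gt0 mu0 l.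
  rewrite -expr_div_n; apply: lerXn2r; rewrite ?nnegrE ?divr_ge0 ?(om_ge0 mu0)//.
    exact: (mulr_ge0 (omX_ge0 mu0 l p) (cmod_ge0 _)).
  rewrite ler_pdivlMr//; apply: le_trans (hC l).
  by rewrite exprSr mulrAC.
rewrite -mulr_sumr exprMn ler_wpM2l ?sqr_ge0//.
apply: (le_trans (sum_om mu0 us)); rewrite -/(C0 mu) expr2.
by rewrite ler_peMl ?(C0_ge0 mu0) ?(C0_ge1 mu0).
Qed.

Context (Y : R) (Y1 : 1 <= Y) (p : nat).
(** The weight om^p is capped because a uniform H^p bound of the solution, which Gronwall's
    inequality wants a priori, is what has to be proved. A capped weight is bounded, and it still
    satisfies w_l <= om_(l-k)^p w_k, with constants free of Y. *)
Let w l : R := Num.min (om l) Y ^+ p.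

Let w0 l : 0 <= w l.
Proof. by rewrite exprn_ge0// le_min (om_ge0 mu0) (le_trans ler01). Qed.

Lemma min_weight_le l k : w l <= om (l - k) ^+ p * w k.
Proof.
have Y0 : 0 <= Y by exact: le_trans Y1.
rewrite /w -exprMn; apply: lerXn2r.
- by rewrite nnegrE le_min (om_ge0 mu0).
- by rewrite nnegrE mulr_ge0 ?(om_ge0 mu0)// le_min (om_ge0 mu0).
have [h|h] := leP (om k) Y.
  by rewrite ge_min -{1}(subrK k l) omD.
by rewrite ge_min ler_peMl ?orbT// om_ge1.
Qed.

(** All derivatives are put on v, whose weighted coefficients are summable, so Schur's test bounds
    the convolution in the norm of c itself. *)
Lemma fconv_min_bound (v c f : int -> R[i]) (Bv B : R) : Hbound mu p.+1 v Bv -> fconv v c f ->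
  (forall s, uniq s -> nrm s w c <= B) -> forall s, uniq s -> nrm s w f <= C0 mu * Bv * B.
Proof.
move=> hv hf hc s us; have CB : 0 <= C0 mu * Bv := mulr_ge0 (C0_ge0 mu0) (Hbound_ge0 hv).
apply: (N2_clim (F := fun l M => \sum_(k <- win M) v (l - k) * c k)).
- by move=> l _; exact: w0.
- by move=> l _; exact: hf.
move=> M; apply: (@le_trans _ _ (N2 s (fun l => \sum_(k <- win M)
    (om (l - k) ^+ p * cmodulus (v (l - k))) * (w k * cmodulus (c k))))).
  apply: N2_le => l _; rewrite (ger0_norm (mulr_ge0 (w0 l) (cmod_ge0 _))).
  apply: (le_trans (ler_wpM2l (w0 l) (cmod_sum _ _ _))); rewrite mulr_sumr; apply: ler_sum => k _.
  have vc : 0 <= cmodulus (v (l - k)) * cmodulus (c k) := mulr_ge0 (cmod_ge0 _) (cmod_ge0 _).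
  rewrite cmodM; apply: (le_trans (ler_wpM2r vc (min_weight_le l k))).
  by rewrite le_eqVlt; apply/orP; left; apply/eqP; ring.
apply: (le_trans (@N2_schur _ _ _ s (win M) (fun l k => om (l - k) ^+ p * cmodulus (v (l - k)))
    (fun k => w k * cmodulus (c k)) (C0 mu * Bv) _ CB _ _)).
- by move=> l k; exact: (mulr_ge0 (omX_ge0 mu0 _ _) (cmod_ge0 _)).
- move=> l _; have := @Hbound_l1 _ _ mu0 p.+1 p v Bv [seq l - k | k <- win M] (ltnSn p) hv; rewrite big_map.
  by apply; rewrite map_inj_uniq ?uniq_win// => x y h; lia.
- move=> k _; have := @Hbound_l1 _ _ mu0 p.+1 p v Bv [seq l - k | l <- s] (ltnSn p) hv; rewrite big_map.
  by apply; rewrite map_inj_uniq// => x y h; lia.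
by apply: (ler_wpM2l CB); apply: hc; exact: uniq_win.
Qed.

End truncated_weights.

Section uniform_regularity.
Context {R : realType} (a b : R) (T : R) (V : R -> R)
    (psi0 : R -> R[i]) (psi : R -> R -> R -> R[i])
    (ab : a < b) (hT : 0 < T) (cV : ccont (fun x => (V x)%:C) a b)
    (hpsi : forall eps : R, 0 < eps <= 1 ->
       exact_solution a b eps V psi0 (psi eps)).
Local Notation mu1 := (freq a b 1).
Local Notation om := (om mu1).
Local Notation fc := (fourier_coef a b).
Local Notation ci := ((0 +i* 1)%C : R[i]).
Local Notation v := (fc (fun x => (V x)%:C)).
Local Notation c0 := (fc psi0).
Local Notation A := (fun l => freq a b l ^+ 2).
Local Notation c eps := (sol_coef a b (psi eps)).
Local Notation f eps := (pot_coef a b V (psi eps)).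
Let m0 : 0 < mu1. Proof. exact: mu_gt0. Qed.
Context (Bc : R) (hBc : forall eps t : R, 0 < eps <= 1 -> 0 <= t <= T / eps ->
  Hbound mu1 3 (fun l => c eps l t) Bc).

(** The growth rate of the norm is proportional to eps, and over the time T / eps it accumulates to
    a constant. *)
Lemma sol_Hbound_uniform p (BV B0 : R) : Hbound mu1 p.+1 v BV -> Hbound mu1 p c0 B0 ->
  forall eps t : R, 0 < eps <= 1 -> 0 <= t <= T / eps ->
  Hbound mu1 p (c eps ^~ t) (2 * B0 * expR (2 * (C0 mu1 * BV) * T)).
Proof.
move=> hv h0 eps t e01 tT s us; have /andP[e0 e1] := e01.
have B00 := Hbound_ge0 h0; have CB : 0 <= C0 mu1 * BV := mulr_ge0 (C0_ge0 m0) (Hbound_ge0 hv).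
have T0 : 0 <= T / eps by rewrite divr_ge0 ?ltW.
have Bc0 : 0 <= Bc by apply: (Hbound_ge0 (hBc e01 (t := 0) _)); rewrite lexx.
(* The cap exceeds every weight on the list s, so on s the capped norm is the full one; it enters
   only the a priori bound. *)
pose Y := 1 + \sum_(l <- s) om l.
have Y1 : 1 <= Y by rewrite lerDl sumr_ge0// => l _; exact: om_ge0.
have Y0 : 0 <= Y := le_trans ler01 Y1.
pose w l := Num.min (om l) Y ^+ p.
have w0 l : 0 <= w l by rewrite exprn_ge0// le_min (om_ge0 m0).
pose z l t := expi (A l * t) * c eps l t.
pose dz l t := - (ci * expi (A l * t) * (eps%:C * f eps l t)).
have sc (r : R) : 0 <= r <= T / eps -> fconv v (c eps ^~ r) (f eps ^~ r).
  move=> rT; have /andP[r0 _] := rT; apply: (sol_conv ab cV (hpsi e01) r0 (B := Bc)) => l.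
  by apply: (Hbound_point l); apply: Hbound_mono (hBc e01 rT).
have L0 : 0 <= eps * (C0 mu1 * BV) := mulr_ge0 (ltW e0) CB.
have K0 : 0 <= Y ^+ p * Bc := mulr_ge0 (exprn_ge0 _ Y0) Bc0.
have key := @gronwall_nrm R int (fun s => uniq s) w z dz (eps * (C0 mu1 * BV)) 0 (Y ^+ p * Bc) B0 (T / eps)
  L0 (lexx 0) K0 B00.
have : nrm s w (z ^~ t) <= 2 * (B0 + 0 * (T / eps)) * expR (2 * (eps * (C0 mu1 * BV)) * t).
  apply: (key _ _ _ _ _ _ s t us tT).
  - by move=> s' l' _ _; exact: w0.
  - move=> s' l' _ _; apply: ccontM; first exact: (@is_cderive_ccont R _ _ 0 (T / eps) (expi_derive (A l'))).
    exact: (sol_ccont ab (hpsi e01) l' (T / eps)).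
  - move=> s' l' t' _ _ /andP[t0 tT'].
    have h := is_cderiveM (expi_derive (A l') t') (sol_derive ab cV (hpsi e01) l' t0).
    by apply: (is_cderive_ext h) => //; rewrite /dz; ring.
  - move=> s' t' us' tT'; rewrite /z nrm_expi; have hb := hBc e01 tT' us'.
    apply: le_trans (ler_wpM2l (exprn_ge0 p Y0) hb).
    rewrite /nrm -[X in X * _](ger0_norm (exprn_ge0 p Y0)) -N2_scale; apply: N2_le => l _.
    rewrite (ger0_norm (mulr_ge0 (w0 l) (cmod_ge0 _))); apply: ler_pM => //; first exact: cmod_ge0.
      by apply: lerXn2r; rewrite ?nnegrE ?le_min ?(om_ge0 m0)// ge_min lexx orbT.
    by rewrite ler_peMl ?cmod_ge0// exprn_ege1// om_ge1.
  - move=> s' t' B us' /andP[t0 tT'] hB; have tT2 : 0 <= t' <= T / eps by rewrite !ltW.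
    have hB' s2 : uniq s2 -> nrm s2 w (c eps ^~ t') <= B by move=> /hB; rewrite /z nrm_expi.
    have := fconv_min_bound m0 Y1 hv (sc t' tT2) hB' us'.
    have -> : nrm s' w (dz ^~ t') = eps * nrm s' w (f eps ^~ t').
      rewrite -[X in X * _](gtr0_norm e0) -cmodR -nrmZ; apply: eq_nrm_cmod => k _.
      by rewrite /dz cmodN !cmodM cmodi cmod_expi !mul1r.
    by move=> /(ler_wpM2l (ltW e0)); rewrite addr0 !mulrA.
  - move=> s' us'; apply: le_trans (h0 s' us'); rewrite /z nrm_expi; apply: N2_le => l _.
    rewrite (ger0_norm (mulr_ge0 (w0 l) (cmod_ge0 _))) (sol_init (hpsi e01)) ler_wpM2r ?cmod_ge0//.
    by apply: lerXn2r; rewrite ?nnegrE ?le_min ?(om_ge0 m0)// ge_min lexx.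
rewrite mul0r addr0 /z nrm_expi => h.
have -> : nrm s (fun l => om l ^+ p) (c eps ^~ t) = nrm s w (c eps ^~ t).
  rewrite /nrm; apply: eq_N2 => l ls; congr (_ * _); rewrite /w; congr (_ ^+ p); symmetry; apply/min_idPl.
  rewrite /Y (big_rem l)//= addrCA lerDl addr_ge0// sumr_ge0// => k _; exact: om_ge0.
apply: (le_trans h); rewrite ler_wpM2l ?mulr_ge0// ler_expR -!mulrA ler_wpM2l//.
rewrite mulrC -!mulrA ler_wpM2l ?(C0_ge0 m0)// ler_wpM2l ?(Hbound_ge0 hv)//.
by case/andP: tT => _; rewrite ler_pdivlMr.
Qed.

End uniform_regularity.

Lemma error_bound_mono (R : realType) (a b : R) m (T : R) V psi0 psi (alpha nu3 tau0 C r r' : R) :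
  0 <= C -> r <= r' ->
  tsfp_error_bound a b m T V psi0 psi alpha nu3 tau0 C r ->
  tsfp_error_bound a b m T V psi0 psi alpha nu3 tau0 C r'.
Proof.
move=> C0 rr h eps tau N n e01 N0 oN cond nT.
apply: (le_trans (h eps tau N n e01 N0 oN cond nT)).
by rewrite lee_fin ler_wpM2l// lerD2l.
Qed.

(** * The remainder and the critical parameter in the smooth case *)

Section part_two.
Context {R : realType} (a b : R) (m : nat) (T : R) (V : R -> R)
    (psi0 : R -> R[i]) (psi : R -> R -> R -> R[i])
    (ab : a < b) (hm : (3 <= m)%N) (hT : 0 < T)
    (hV : Hper a b (maxn m 5) (fun x => (V x)%:C))
    (hpsi : forall eps : R, 0 < eps <= 1 ->
       exact_solution a b eps V psi0 (psi eps))
    (hbound : LinfH_uniformly_bounded a b T m psi)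
    (hsmooth : forall eps t : R, 0 < eps <= 1 -> 0 <= t <= T / eps ->
      forall k : nat, Hper a b k (fun x => psi eps x t)).
Local Notation mu1 := (freq a b 1).
Local Notation om := (om mu1).
Local Notation fc := (fourier_coef a b).
Local Notation c eps := (sol_coef a b (psi eps)).

Let m0 : 0 < mu1. Proof. exact: mu_gt0. Qed.

(** If psi0 has no Fourier coefficients the solution vanishes and nothing is known of V; otherwise V
    decays rapidly and all norms are uniformly bounded. The normalisation 1 <= C allows division by
    C. *)
Lemma high_remainder_rapid (p : nat) : exists2 C : R, 1 <= C & forall (tau0 eps t : R) (N : nat),
  (1 < p)%N -> 0 < tau0 < 1 -> 0 < eps <= 1 -> (0 < N)%N -> ~~ odd N -> 0 <= t <= T / eps ->
  high_remainder a b V N tau0 (fun l => c eps l t) <= C * tau0 ^+ p.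
Proof.
have [BV /(Hbound_mono m0 hm) hBV] := potential_Hbound ab hV.
have [Bc hBc'] := solution_Hbound ab hT hpsi hbound.
have hBc (eps t : R) : 0 < eps <= 1 -> 0 <= t <= T / eps -> Hbound mu1 3 (fun l => c eps l t) Bc.
  by move=> e01 tT; exact: (Hbound_mono m0 hm (hBc' eps t e01 tT)).
have cV := potential_cont hV.
have [c00|rv] := potential_rapid ab hT cV hpsi hsmooth hBV hBc.
  exists 1 => // tau0 eps t N _ t01 e01 _ _ tT; have /andP[t0 _] := t01.
  have h0 : Hbound mu1 0 (fc psi0) 0.
    by move=> s us; rewrite (@eq_nrm _ _ _ _ _ (fun=> 0)) ?nrm0.
  have h1 := sol_Hbound_uniform ab hT cV hpsi hBc (Hbound_mono m0 (isT : 1 <= 3)%N hBV) h0 e01 tT.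
  have cz l : cmodulus (c eps l t) = 0.
    have := Hbound_point l h1; rewrite expr0 mul1r mulr0 mul0r => h; apply/eqP.
    by rewrite eq_le h cmod_ge0.
  rewrite /high_remainder (@eq_N2 _ _ _ _ (fun=> 0)); last first.
    by move=> l _; rewrite big1 ?mulr0// => k _; rewrite cz mulr0.
  by rewrite N2_0 mul1r exprn_ge0// ltW.
have [BV1 hBV1] := rapid_Hbound m0 p.+1 rv.
have [BV2 hBV2] := rapid_Hbound m0 p.+2 rv.
have one01 : 0 < (1 : R) <= 1 by rewrite ltr01 lexx.
have t00 : 0 <= (0 : R) <= T / 1 by rewrite lexx divr1 ltW.
have [B0 hB0] := Hper_Hbound ab (hsmooth one01 t00 p.+1).
have h0 : Hbound mu1 p.+1 (fc psi0) B0.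
  move=> s us; rewrite (@eq_nrm R int s _ _ (fun l => c 1 l 0)); first exact: hB0.
  by move=> l _; rewrite (sol_init (hpsi one01)).
pose B1 := 2 * B0 * expR (2 * (C0 mu1 * BV2) * T).
have hc (eps t : R) : 0 < eps <= 1 -> 0 <= t <= T / eps -> Hbound mu1 p.+1 (fun l => c eps l t) B1.
  by move=> e01 tT; exact: (sol_Hbound_uniform ab hT cV hpsi hBc hBV2 h0 e01 tT).
have K0 : 0 <= remainder_const a b p BV1 B1.
  exact: (remainder_const_ge0 ab p (Hbound_ge0 hBV1) (Hbound_ge0 (hc 1 0 one01 t00))).
exists (remainder_const a b p BV1 B1 + 1); first by rewrite lerDr.
move=> tau0 eps t N p1 t01 e01 N0 oN tT; have /andP[t0 _] := t01.
apply: (le_trans (high_remainder_le ab cV p1 hBV1 (hc eps t e01 tT) N0 oN t01)).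
by rewrite ler_wpM2r ?lerDl// exprn_ge0// ltW.
Qed.

Lemma part_two : exists rho tau0cr : R -> R,
     [/\ forall tau0 : R, 0 < tau0 < 1 -> 0 <= rho tau0 <= tau0 ^+ (m - 1),
         forall p : nat, exists Cp : R,
           forall tau0 : R, 0 < tau0 < 1 -> rho tau0 <= Cp * tau0 ^+ p,
         forall delta : R, 0 < delta < 1 ->
           0 < tau0cr (ln delta) < 1 /\ rho (tau0cr (ln delta)) <= delta &
         forall alpha nu3 : R, 0 < alpha < 1 -> 0 < nu3 ->
           exists C : R, 0 < C /\
             (forall tau0 : R, 0 < tau0 < 1 ->
                tsfp_error_bound a b m T V psi0 psi alpha nu3 tau0 C
                  (rho tau0)) /\
             (forall delta : R, 0 < delta < 1 ->
                tsfp_error_bound a b m T V psi0 psi alpha nu3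
                  (tau0cr (ln delta)) C delta)].
Proof.
have p1 : (1 < m - 1)%N by rewrite ltn_subRL.
pose Rc p := s2val (cid2 (high_remainder_rapid p)).
have Rc1 p : 1 <= Rc p by exact: (s2valP (cid2 (high_remainder_rapid p))).
have Rc0 p : 0 < Rc p := lt_le_trans ltr01 (Rc1 p).
pose K := Rc (m - 1)%N; have K0 : 0 < K by exact: Rc0.
(* The best of all available powers. Dividing by K, the constant of the power m - 1, makes rho at
   most tau0^(m-1); K is later moved into the constant of the error bound. *)
pose S (tau0 : R) : set R := [set Rc p / K * tau0 ^+ p | p in [set p | (m - 1 <= p)%N]].
pose rho (tau0 : R) : R := inf (S tau0).
have lbS tau0 : 0 < tau0 -> lbound (S tau0) 0.
  by move=> t0 _ [p _ <-]; rewrite mulr_ge0 ?exprn_ge0 ?divr_ge0// ltW.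
have neS tau0 : S tau0 !=set0 by exists (Rc (m - 1)%N / K * tau0 ^+ (m - 1)); exists (m - 1)%N => /=.
have rho_le p tau0 : 0 < tau0 -> (m - 1 <= p)%N -> rho tau0 <= Rc p / K * tau0 ^+ p.
  by move=> t0 mp; apply: ge_inf; [exists 0; exact: lbS|exists p].
have rho_m tau0 : 0 < tau0 -> rho tau0 <= tau0 ^+ (m - 1).
  by move=> t0; have := rho_le (m - 1)%N tau0 t0 (leqnn _); rewrite divff ?mul1r ?gt_eqF.
have rho_ge tau0 : 0 < tau0 -> 0 <= rho tau0.
  by move=> t0; apply: lb_le_inf => //; exact: lbS.
(* At the logarithm of delta this is delta / 2. Since rho(tau0) <= tau0^(m-1) <= tau0, this choice
   already brings the remainder below delta. *)
pose cr (y : R) : R := expR y / 2.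
have crE delta : 0 < delta -> cr (ln delta) = delta / 2 by move=> d0; rewrite /cr lnK.
have cr01 delta : 0 < delta < 1 -> 0 < cr (ln delta) < 1.
  by move=> /andP[d0 d1]; rewrite crE//; apply/andP; split; lra.
have crD delta : 0 < delta < 1 -> rho (cr (ln delta)) <= delta.
  move=> d01; have /andP[c0 c1] := cr01 _ d01; have /andP[d0 d1] := d01.
  apply: (le_trans (rho_m _ c0)); apply: (@le_trans _ _ (cr (ln delta) ^+ 1)).
    by apply: ler_wiXn2l; rewrite ?(ltW c0) ?(ltW c1)// ltnW.
  by rewrite expr1 crE//; lra.
exists rho, cr; split.
- by move=> tau0 /andP[t0 _]; rewrite rho_ge ?rho_m.
- move=> p; have [mp|/ltnW pm] := leqP (m - 1) p.
    by exists (Rc p / K) => tau0 /andP[t0 _]; exact: rho_le.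
  exists 1 => tau0 /andP[t0 t1]; rewrite mul1r; apply: (le_trans (rho_m _ t0)).
  by apply: ler_wiXn2l; rewrite ?(ltW t0) ?(ltW t1).
- by move=> delta d01; split; [exact: cr01|exact: crD].
move=> alpha nu3 al01 nu0.
have [BV hBV] := potential_Hbound ab hV; have [Bc hBc] := solution_Hbound ab hT hpsi hbound.
have cV := potential_cont hV.
have [C [C0 hC]] := scheme_error ab hm hT cV hpsi hBV hBc al01 nu0.
have bound tau0 : 0 < tau0 < 1 ->
    tsfp_error_bound a b m T V psi0 psi alpha nu3 tau0 (C * K) (rho tau0).
  move=> t01; have /andP[t0 _] := t01.
  apply: error_bound_scale => //; [exact: ltW|exact: rho_ge|exact: Rc1|].
  apply: hC => //; first by apply: mulr_ge0; [exact: ltW|exact: rho_ge].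
  move=> eps N t e01 N0 oN tT; rewrite mulrC -ler_pdivrMr//.
  apply: lb_le_inf => // _ [p mp <-]; rewrite ler_pdivrMr// mulrAC divfK ?gt_eqF//.
  have := s2valP' (cid2 (high_remainder_rapid p)); apply => //; exact: leq_trans mp.
exists (C * K); split; first exact: mulr_gt0.
split=> // delta d01; apply: (error_bound_mono _ (crD _ d01)); first by rewrite ltW// mulr_gt0.
by apply: bound; exact: cr01.
Qed.

End part_two.

Theorem theorem2p2 (R : realType) (a b : R) (m : nat) (T : R) (V : R -> R)
    (psi0 : R -> R[i]) (psi : R -> R -> R -> R[i])
    (hab : a < b) (hm : (3 <= m)%N) (hT : 0 < T)
    (hV : Hper a b (maxn m 5) (fun x => (V x)%:C))
    (hpsi : forall eps : R, 0 < eps <= 1 ->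
       exact_solution a b eps V psi0 (psi eps))
    (hbound : LinfH_uniformly_bounded a b T m psi)
    (hbound_t : LinfH_uniformly_bounded a b T (m - 2)
       (fun eps x t => cderiv (psi eps x) t)) :
  (forall alpha nu3 : R, 0 < alpha < 1 -> 0 < nu3 ->
     exists C : R, 0 < C /\
       forall tau0 : R, 0 < tau0 < 1 ->
         tsfp_error_bound a b m T V psi0 psi alpha nu3 tau0 C
           (tau0 ^+ (m - 1)))
  /\
  ((forall eps t : R, 0 < eps <= 1 -> 0 <= t <= T / eps ->
      forall k : nat, Hper a b k (fun x => psi eps x t)) ->
   exists rho tau0cr : R -> R,
     [/\ forall tau0 : R, 0 < tau0 < 1 -> 0 <= rho tau0 <= tau0 ^+ (m - 1),
         forall p : nat, exists Cp : R,
           forall tau0 : R, 0 < tau0 < 1 -> rho tau0 <= Cp * tau0 ^+ p,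
         forall delta : R, 0 < delta < 1 ->
           0 < tau0cr (ln delta) < 1 /\ rho (tau0cr (ln delta)) <= delta &
         forall alpha nu3 : R, 0 < alpha < 1 -> 0 < nu3 ->
           exists C : R, 0 < C /\
             (forall tau0 : R, 0 < tau0 < 1 ->
                tsfp_error_bound a b m T V psi0 psi alpha nu3 tau0 C
                  (rho tau0)) /\
             (forall delta : R, 0 < delta < 1 ->
                tsfp_error_bound a b m T V psi0 psi alpha nu3
                  (tau0cr (ln delta)) C delta)]).
Proof.
split=> [alpha nu3 al01 nu0|hsmooth].
  exact: (part_one hab hm hT hV hpsi hbound al01 nu0).
exact: (part_two hab hm hT hV hpsi hbound hsmooth).
Qed.
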